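(* Let $M\in[1,\infty[$ and $\Delta\in[1,M]$ with $M^{2/3}\ll\Delta\ll M^{3/4}$, and let $\alpha\in\mathbb R$. Then \[\sum_{M\leqslant n\leqslant M+\Delta}t(n)\,e(n\alpha)\ll M^{3/8+(3+12\vartheta)/(32+48\vartheta)+\varepsilon}+\Delta\,M^{-1/4+3\vartheta/(32+48\vartheta)+\varepsilon}.\] In particular, for $\vartheta=7/64$ this gives $\ll M^{585/1192+\varepsilon}+\Delta\,M^{-575/2384+\varepsilon}$, and for $\vartheta=0$ it gives $\ll M^{15/32+\varepsilon}+\Delta\,M^{\varepsilon-1/4}$.
   Context: Let $\psi$ be a fixed Maass cusp form for the full modular group $\mathrm{SL}_2(\mathbb Z)$, with eigenvalue $1/4+\kappa^2$ of the hyperbolic Laplacian and Fourier expansion $\psi(x+yi)=y^{1/2}\sum_{n\neq0}t(n)K_{i\kappa}(2\pi|n|y)e(nx)$; $\psi$ is assumed even or odd. Here $e(x)=e^{2\pi ix}$. The number $\vartheta\in[0,\infty[$ is a fixed exponent such that $t(n)\ll n^{\vartheta+\varepsilon}$ for every $\varepsilon>0$ (the specializations assume that $\vartheta=7/64$, resp. $\vartheta=0$, is admissible). $\varepsilon$ is an arbitrarily small fixed positive number; implicit constants may depend on $\psi$, $\vartheta$ and $\varepsilon$. *)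

(* Defs.v *)
From Stdlib Require Import Reals ZArith.
From Coquelicot Require Import Coquelicot.

Open Scope R_scope.

(* A function on the upper half-plane is a function [C -> C] whose values off
   [upper_half] are irrelevant; as [C] is [R * R], [x + y i] is [(x, y)]. *)
Definition upper_half (z : C) : Prop := 0 < Im z.

Definition e (x : R) : C := (cos (2 * PI * x), sin (2 * PI * x)).

Definition partial_x (f : C -> C) (z : C) : C :=
  (Derive (fun s => Re (f (s, Im z))) (Re z),
   Derive (fun s => Im (f (s, Im z))) (Re z)).

Definition partial_y (f : C -> C) (z : C) : C :=
  (Derive (fun s => Re (f (Re z, s))) (Im z),
   Derive (fun s => Im (f (Re z, s))) (Im z)).

(* [k] times continuously differentiable in the real sense, in (x, y). *)
Fixpoint Ck_upper_half (k : nat) (f : C -> C) : Prop :=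
  (forall z : C, upper_half z -> continuous f z) /\
  match k with
  | O => True
  | S k' =>
      (forall z : C, upper_half z ->
         ex_derive (V := C_R_NormedModule) (fun s : R => f (s, Im z)) (Re z) /\
         ex_derive (V := C_R_NormedModule) (fun s : R => f (Re z, s)) (Im z)) /\
      Ck_upper_half k' (partial_x f) /\ Ck_upper_half k' (partial_y f)
  end.

Definition smooth_upper_half (f : C -> C) : Prop :=
  forall k : nat, Ck_upper_half k f.

(* The sign is the one making the operator positive. *)
Definition hyp_laplacian (f : C -> C) (z : C) : C :=
  (- RtoC (Im z ^ 2)
   * (partial_x (partial_x f) z + partial_y (partial_y f) z))%C.

Definition SL2Z_invariant (f : C -> C) : Prop :=
  forall a b c d : Z, (a * d - b * c = 1)%Z ->
  forall z : C, upper_half z ->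
    f ((RtoC (IZR a) * z + RtoC (IZR b)) / (RtoC (IZR c) * z + RtoC (IZR d)))%C
    = f z.

(* Growth at the only cusp, infinity. *)
Definition moderate_growth (f : C -> C) : Prop :=
  exists A N : R, forall x y : R, 1 <= y -> Cmod (f (x, y)) <= A * Rpower y N.

Definition cuspidal (f : C -> C) : Prop :=
  forall y : R, 0 < y ->
    is_RInt (V := C_R_NormedModule) (fun x : R => f (x, y)) 0 1 (RtoC 0).

(* The spectral parameter [kappa] is real since the full modular group has no
   exceptional eigenvalue (no cuspidal eigenvalue below 1/4). *)
Record maass_cusp_form (psi : C -> C) (kappa : R) : Prop := {
  mcf_smooth : smooth_upper_half psi;
  mcf_invariant : SL2Z_invariant psi;
  mcf_eigen : forall z : C, upper_half z ->
    hyp_laplacian psi z = (RtoC (1 / 4 + kappa ^ 2) * psi z)%C;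
  mcf_growth : moderate_growth psi;
  mcf_cuspidal : cuspidal psi;
  mcf_nonzero : exists z : C, upper_half z /\ psi z <> RtoC 0
}.

Definition even_form (psi : C -> C) : Prop :=
  forall x y : R, 0 < y -> psi (- x, y) = psi (x, y).

Definition odd_form (psi : C -> C) : Prop :=
  forall x y : R, 0 < y -> psi (- x, y) = (- psi (x, y))%C.

(* K_{i kappa}(u) for real [kappa] and [u > 0], from
   K_nu(u) = \int_0^oo exp (- u cosh v) cosh (nu v) dv
   and cosh (i kappa v) = cos (kappa v). *)
Definition bessel_K (kappa u : R) : R :=
  RInt_gen (V := R_CompleteNormedModule)
    (fun v : R => exp (- u * cosh v) * cos (kappa * v))
    (at_point 0) (Rbar_locally p_infty).

Definition fourier_term (t : Z -> C) (kappa : R) (z : C) (n : Z) : C :=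
  (t n * RtoC (bessel_K kappa (2 * PI * Rabs (IZR n) * Im z))
   * e (IZR n * Re z))%C.

(* The sum over n <> 0 converges as the sum of its two halves. *)
Definition has_fourier_expansion (psi : C -> C) (kappa : R) (t : Z -> C) : Prop :=
  forall z : C, upper_half z -> exists s_pos s_neg : C,
    is_series (V := C_R_NormedModule)
      (fun k : nat => fourier_term t kappa z (Z.of_nat (S k))) s_pos /\
    is_series (V := C_R_NormedModule)
      (fun k : nat => fourier_term t kappa z (- Z.of_nat (S k))%Z) s_neg /\
    psi z = (RtoC (sqrt (Im z)) * (s_pos + s_neg))%C.

(* t(n) << n^(theta + eps) for every eps > 0. *)
Definition admissible_exponent (t : Z -> C) (theta : R) : Prop :=
  forall eps : R, 0 < eps -> exists A : R, forall n : Z, (1 <= n)%Z ->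
    Cmod (t n) <= A * Rpower (IZR n) (theta + eps).

(* The sum over integers a <= n <= b of f n, for real a >= 0. *)
Definition sum_between (a b : R) (f : Z -> C) : C :=
  sum_n_m (G := C_AbelianMonoid) (fun n : nat => f (Z.of_nat n))
    (Z.to_nat (Zceil a)) (Z.to_nat (Zfloor b)).

(* Main.v *)
Require Import Defs.
From Stdlib Require Import Reals ZArith Lra Lia Psatz List Permutation.
From Coquelicot Require Import Coquelicot.
Open Scope R_scope.

(** The proof uses only the invariance of [psi], its continuity and its Fourier expansion.
  Averaging [psi (x + i y)] over heights [y] of size [1 / M] against a smooth weight gives a
  function [Phi] whose Fourier coefficients are [t n] times positive factors of bounded
  variation.  A sum over an interval of [n] is therefore the integral of [Phi] against a
  Dirichlet kernel, and averaging the sum over [H] shifts costs the trivial bound on [H] terms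
  but replaces the kernel by one that decays like [1 / (H x^2)].  Splitting according to
  [|x| ~ 1 / U], everything reduces to saving a factor [sqrt R] in the integral of [Phi] over
  an interval [[c, d]] of length [1 / U] (lemma [key_prop]).

  If [c] is close to a fraction [h/k] with small [k], a modular substitution at [h/k] and a
  second Fourier expansion produce dual oscillatory integrals, treated by the first and second
  derivative tests; only dual frequencies near the stationary one cost a bound on [t n].
  Otherwise [[c, d]] is cut into Farey arcs whose denominators are all large and pairwise far
  apart.  With [x = h/k + 1 / (k p)] every arc of a dyadic class becomes an integral of one and
  the same bounded function over translates of the period; by Cauchy-Schwarz only the
  correlations of the phases of two arcs matter, and these phases differ substantially
  because the denominators do.  The parameters [H] and [R] are then optimised. *)

(** The average over heights is more than a smoothing device. After the substitution at [h/k] an arc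
    sees [psi] at height [Y = y / (k u)^2], which changes along the arc and from arc to arc.
    Integrating over [y] allows [Y] to be taken as the variable, and then all dependence on the arc
    moves into the weight [wY]: for fixed [Y] every arc tests the same function of [X], and only
    this makes Cauchy-Schwarz over the arcs possible. The denominators are far apart because the
    difference of two good approximations to [c] is again a good approximation: when no small
    denominator approximates [c], no small difference of denominators can occur either. Everything
    is done with real integrals. Values of [psi] enter through their components [cp phi], the real
    parts after rotation by [- phi], with bounds uniform in [phi]; the twist by [e (- m x)] and the
    passage between real and imaginary parts are both changes of [phi]. The Bessel function enters
    the dual integrals through truncations [KV], with estimates uniform in the truncation. *)

Notation RV := R_CompleteNormedModule.

(** * Positivity and monotonicity tactics *)

Lemma le_mul_r a b : 0 <= a -> 1 <= b -> a <= a * b.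
Proof. intros Ha Hb. rewrite <- (Rmult_1_r a) at 1. apply Rmult_le_compat_l; lra. Qed.

Lemma le_mul_l a b : 0 <= a -> 1 <= b -> a <= b * a.
Proof. intros Ha Hb. rewrite Rmult_comm. apply le_mul_r; auto. Qed.

Lemma mul_le_r a b : 0 <= a -> b <= 1 -> a * b <= a.
Proof. intros Ha Hb. rewrite <- (Rmult_1_r a) at 2. apply Rmult_le_compat_l; lra. Qed.

Lemma mul_le_l a b : 0 <= a -> b <= 1 -> b * a <= a.
Proof. intros Ha Hb. rewrite Rmult_comm. apply mul_le_r; auto. Qed.

Lemma one_le_mul a b : 1 <= a -> 1 <= b -> 1 <= a * b.
Proof. intros Ha Hb. apply Rle_trans with (1 := Ha). apply le_mul_r; lra. Qed.

Lemma le_div a b c : 0 < c -> a * c <= b -> a <= b / c.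
Proof. intros Hc H. apply Rle_div_r; auto. Qed.

Lemma div_le a b c : 0 < c -> a <= b * c -> a / c <= b.
Proof. intros Hc H. apply Rle_div_l; auto. Qed.

Lemma lt_div a b c : 0 < c -> a * c < b -> a < b / c.
Proof. intros Hc H. apply Rlt_div_r; auto. Qed.

Lemma div_lt a b c : 0 < c -> a < b * c -> a / c < b.
Proof. intros Hc H. apply Rlt_div_l; auto. Qed.

Lemma le_inv a c : 0 < c -> a * c <= 1 -> a <= / c.
Proof. intros Hc H. rewrite <- (Rmult_1_l (/ c)). apply le_div; auto. Qed.

Lemma inv_le b c : 0 < c -> 1 <= b * c -> / c <= b.
Proof. intros Hc H. rewrite <- (Rmult_1_l (/ c)). apply div_le; auto. Qed.

Lemma one_le_pow a n : 1 <= a -> 1 <= a ^ n.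
Proof. apply pow_R1_Rle. Qed.

Ltac no_evar := match goal with |- ?G => tryif has_evar G then fail else idtac end.

Ltac pos := first [assumption | lra |
  lazymatch goal with
  | |- _ /\ _ => split; pos
  | |- _ <> 0 => apply Rgt_not_eq; pos
  | |- _ > _ => apply Rlt_gt; pos
  | |- _ >= _ => apply Rle_ge; pos
  | |- 0 < _ * _ => apply Rmult_lt_0_compat; pos
  | |- 0 <= _ * _ => apply Rmult_le_pos; pos
  | |- 0 < _ / _ => apply Rdiv_lt_0_compat; pos
  | |- 0 <= _ / _ => apply Rdiv_le_0_compat; pos
  | |- 0 < / _ => apply Rinv_0_lt_compat; pos
  | |- 0 <= / _ => left; apply Rinv_0_lt_compat; pos
  | |- 0 <= _ ^ 2 => apply pow2_ge_0
  | |- 0 < _ ^ _ => apply pow_lt; pos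
  | |- 0 <= _ ^ _ => apply pow_le; pos
  | |- 0 < sqrt _ => apply sqrt_lt_R0; pos
  | |- 0 <= sqrt _ => apply sqrt_pos
  | |- 0 <= Rabs _ => apply Rabs_pos
  | |- 0 <= INR _ => apply pos_INR
  | |- 0 < exp _ => apply exp_pos
  | |- 0 <= exp _ => left; apply exp_pos
  | |- 0 < Rpower _ _ => apply exp_pos
  | |- 0 <= Rpower _ _ => left; apply exp_pos
  | |- 0 < PI => apply PI_RGT_0
  | |- 0 <= PI => left; apply PI_RGT_0
  | |- 0 <= Cmod _ => apply Cmod_ge_0
  | |- 0 <= ln _ => rewrite <- ln_1; apply ln_le; pos
  | |- 0 < _ + _ => first [solve [apply Rplus_lt_le_0_compat; pos] | apply Rplus_le_lt_0_compat; pos]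
  | |- 0 <= _ + _ => apply Rplus_le_le_0_compat; pos
  | |- 0 < Rmin _ _ => apply Rmin_glb_lt; pos
  | |- 0 <= Rmin _ _ => apply Rmin_glb; pos
  | |- 0 <= Rmax _ _ => eapply Rle_trans; [|apply Rmax_l]; pos
  | |- 0 < ?x => let b := eval unfold x in x in change (0 < b); pos
  | |- 0 <= ?x => let b := eval unfold x in x in change (0 <= b); pos
  end].

Ltac mono := first [assumption | lra |
  lazymatch goal with
  | |- _ /\ _ => split; mono
  | |- ?a <= ?a * _ => apply le_mul_r; [pos | mono]
  | |- ?a <= _ * ?a => apply le_mul_l; [pos | mono]
  | |- ?a * _ <= ?a => apply mul_le_r; [pos | mono]
  | |- _ * ?a <= ?a => apply mul_le_l; [pos | mono]
  | |- ?a * ?b <= ?a * ?c => apply Rmult_le_compat_l; [pos | mono]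
  | |- ?b * ?a <= ?c * ?a => apply Rmult_le_compat_r; [pos | mono]
  | |- ?a * ?b < ?a * ?c => apply Rmult_lt_compat_l; [pos | mono]
  | |- ?b * ?a < ?c * ?a => apply Rmult_lt_compat_r; [pos | mono]
  | |- _ * _ <= _ * _ => apply Rmult_le_compat; [pos | pos | mono | mono]
  | |- _ / _ <= _ / _ => unfold Rdiv; mono
  | |- / _ <= / _ => apply Rinv_le_contravar; [pos | mono]
  | |- sqrt _ <= sqrt _ => apply sqrt_le_1_alt; mono
  | |- _ ^ _ <= _ ^ _ => apply pow_incr; split; [pos | mono]
  | |- ln _ <= ln _ => apply ln_le; [pos | mono]
  | |- 1 <= sqrt _ => rewrite <- sqrt_1; apply sqrt_le_1_alt; mono
  | |- 1 <= INR _ => apply (le_INR 1); lia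
  | |- INR _ <= INR _ => apply le_INR; lia
  | |- 1 <= IZR _ => apply IZR_le; lia
  | |- IZR _ <= IZR _ => apply IZR_le; lia
  | |- 1 <= _ * _ => apply one_le_mul; mono
  | |- 1 <= _ ^ _ => apply one_le_pow; mono
  | |- _ + _ <= _ + _ => apply Rplus_le_compat; mono
  | |- _ - _ <= _ - _ => apply Rplus_le_compat; [| apply Ropp_le_contravar]; mono
  | |- Rabs (?a * ?b) <= ?c * ?d => rewrite (Rabs_mult a b); apply Rmult_le_compat; [pos | pos | mono | mono]
  | |- _ <= Rmin _ _ => apply Rmin_glb; mono
  | |- Rmax _ _ <= _ => apply Rmax_lub; mono
  | |- _ => first [pos |
    lazymatch goal with
    | |- _ <= _ / _ => apply le_div; [pos | mono]
    | |- _ / _ <= _ => apply div_le; [pos | mono]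
    | |- _ < _ / _ => apply lt_div; [pos | mono]
    | |- _ / _ < _ => apply div_lt; [pos | mono]
    | |- _ <= / _ => apply le_inv; [pos | mono]
    | |- / _ <= _ => apply inv_le; [pos | mono]
    end]
  end].

Ltac fld := first [ring | solve [field; pos] | apply sqrt_sqrt; pos | apply sqrt_square; pos | symmetry; apply sqrt_sqrt; pos | symmetry; apply sqrt_square; pos].

Ltac bound1 := first [lra | lia |
  lazymatch goal with
  | |- @eq R _ _ => fld
  | |- ?a <= ?b => first [solve [mono] | right; fld]
  | |- ?a < ?b => mono
  | |- (_ <= _ <= _)  => mono
  | |- (_ <= _ < _)  => split; mono
  | |- (_ < _ <= _)  => split; mono
  | |- (_ < _ < _)  => split; mono
  | |- _ => pos
  end | assumption].

Ltac bound := no_evar; intros; first [bound1 |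
  match goal with
  | x := _ |- context [?y] => constr_eq x y; unfold x; bound1
  end].

Ltac lhs b := lazymatch goal with
  | |- ?a <= _ => replace a with b by bound
  | |- ?a < _ => replace a with b by bound
  | |- ?a = _ => replace a with b by bound
  end.
Ltac rhs b := lazymatch goal with
  | |- _ <= ?a => replace a with b by bound
  | |- _ < ?a => replace a with b by bound
  | |- _ = ?a => replace a with b by bound
  end.
Ltac mul_l := apply Rmult_le_compat_l; [bound |].
Ltac mul_r := apply Rmult_le_compat_r; [bound |].
Ltac le_by lem := eapply Rle_trans; [apply lem |].
Ltac trans_l b := apply Rle_trans with b; [bound |].
Ltac trans_r b := apply Rle_trans with b; [| bound].

(** * Continuity and elementary rules for real integrals *)

Lemma ex_RInt_cont (f : R -> R) (a b : R) : a <= b ->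
  (forall x, a <= x <= b -> continuous f x) -> ex_RInt f a b.
Proof.
 intros Hab Hf. apply (ex_RInt_continuous (V := RV)).
 intros z Hz. apply Hf. rewrite Rmin_left, Rmax_right in Hz by lra. bound.
Qed.

Lemma continuous_abs (f : R -> R) x : continuous f x -> continuous (fun t => Rabs (f t)) x.
Proof. intros H. apply (continuous_comp f Rabs); auto. apply continuous_Rabs. Qed.

Lemma continuous_mulR (f g : R -> R) x : continuous f x -> continuous g x -> continuous (fun t => f t * g t) x.
Proof. intros. apply (continuous_mult (K := R_AbsRing) f g); auto. Qed.

Lemma continuous_addR (f g : R -> R) x : continuous f x -> continuous g x -> continuous (fun t => f t + g t) x.
Proof. intros. apply (continuous_plus f g); auto. Qed.

Lemma continuous_subR (f g : R -> R) x : continuous f x -> continuous g x -> continuous (fun t => f t - g t) x.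
Proof. intros. apply (continuous_minus f g); auto. Qed.

Lemma continuous_oppR (f : R -> R) x : continuous f x -> continuous (fun t => - f t) x.
Proof. intros. apply (continuous_opp f); auto. Qed.

Lemma continuous_invR (f : R -> R) x : continuous f x -> f x <> 0 -> continuous (fun t => / f t) x.
Proof. intros. apply continuous_comp; auto. apply continuous_Rinv; auto. Qed.

Lemma continuous_divR (f g : R -> R) x : continuous f x -> continuous g x -> g x <> 0 -> continuous (fun t => f t / g t) x.
Proof. intros. apply continuous_mulR; auto. apply continuous_invR; auto. Qed.

Lemma continuous_cosR (f : R -> R) x : continuous f x -> continuous (fun t => cos (f t)) x.
Proof. intros. apply continuous_comp; auto. apply continuous_cos. Qed.

Lemma continuous_sinR (f : R -> R) x : continuous f x -> continuous (fun t => sin (f t)) x.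
Proof. intros. apply continuous_comp; auto. apply continuous_sin. Qed.

Lemma continuous_expR (f : R -> R) x : continuous f x -> continuous (fun t => exp (f t)) x.
Proof. intros. apply continuous_comp; auto. apply continuous_exp. Qed.

Lemma is_derive_continuous (f : R -> R) x l : is_derive f x l -> continuous f x.
Proof. intros H. apply (ex_derive_continuous f). exists l; exact H. Qed.

Lemma continuous_pt (f : R -> R) x : continuous f x -> continuity_pt f x.
Proof. intros H. apply continuity_pt_filterlim. bound. Qed.

Lemma continuous_powR (f : R -> R) n x : continuous f x -> continuous (fun t => f t ^ n) x.
Proof.
 intros H. induction n as [|n IH]; simpl.
 - apply continuous_const.
 - apply continuous_mulR; auto.
Qed.

Ltac cont1 := match goal with
  | |- continuous ?f ?x =>
    match f with
    | (fun t => ?c) => apply continuous_const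
    | (fun t => t) => apply continuous_id
    | (fun t => _ / _) => apply continuous_divR
    | (fun t => / _) => apply continuous_invR
    | (fun t => _ * _) => apply continuous_mulR
    | (fun t => _ + _) => apply continuous_addR
    | (fun t => _ - _) => apply continuous_subR
    | (fun t => - _) => apply continuous_oppR
    | (fun t => cos _) => apply continuous_cosR
    | (fun t => sin _) => apply continuous_sinR
    | (fun t => exp _) => apply continuous_expR
    | (fun t => _ ^ _) => apply continuous_powR
    | (fun t => Rabs _) => apply continuous_abs
    | Ropp => change (continuous (fun t => - t) x)
    | cos => apply continuous_cos
    | sin => apply continuous_sin
    | exp => apply continuous_exp
    | Rplus ?c => change (continuous (fun t => c + t) x)
    | Rminus ?c => change (continuous (fun t => c - t) x)
    | Rmult ?c => change (continuous (fun t => c * t) x)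
    | Rdiv ?c => change (continuous (fun t => c / t) x)
    end
  end.
Ltac cont := repeat (first [assumption | cont1]); try lra; try (apply Rgt_not_eq; lra).

Lemma RInt_addR (f g : R -> R) a b : ex_RInt f a b -> ex_RInt g a b ->
  RInt (fun x => f x + g x) a b = RInt f a b + RInt g a b.
Proof. intros. apply (RInt_plus (V := RV) f g); auto. Qed.

Lemma RInt_subR (f g : R -> R) a b : ex_RInt f a b -> ex_RInt g a b ->
  RInt (fun x => f x - g x) a b = RInt f a b - RInt g a b.
Proof. intros. apply (RInt_minus (V := RV) f g); auto. Qed.

Lemma RInt_mulR (c : R) (f : R -> R) a b : ex_RInt f a b ->
  RInt (fun x => c * f x) a b = c * RInt f a b.
Proof. intros. apply (RInt_scal (V := RV) f); auto. Qed.

Lemma ex_RInt_mulR (c : R) (f : R -> R) a b : ex_RInt f a b -> ex_RInt (fun x => c * f x) a b.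
Proof. intros. apply (ex_RInt_scal (V := RV) f); auto. Qed.

Lemma ex_RInt_addR (f g : R -> R) a b : ex_RInt f a b -> ex_RInt g a b -> ex_RInt (fun x => f x + g x) a b.
Proof. intros. apply (ex_RInt_plus (V := RV) f g); auto. Qed.

Lemma ex_RInt_subR (f g : R -> R) a b : ex_RInt f a b -> ex_RInt g a b -> ex_RInt (fun x => f x - g x) a b.
Proof. intros. apply (ex_RInt_minus (V := RV) f g); auto. Qed.

Lemma RInt_le_const (f : R -> R) a b M : a <= b -> ex_RInt f a b ->
  (forall t, a <= t <= b -> f t <= M) -> RInt f a b <= (b - a) * M.
Proof.
 intros Hab Hf HM.
 assert (E : RInt (fun _ : R => M) a b = (b - a) * M) by (rewrite RInt_const; reflexivity).
 rewrite <- E. apply RInt_le; auto.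
 - apply ex_RInt_const.
 - intros; apply HM; lra.
Qed.

Lemma RInt_ge0 (f : R -> R) a b : a <= b -> ex_RInt f a b ->
  (forall t, a <= t <= b -> 0 <= f t) -> 0 <= RInt f a b.
Proof.
 intros Hab Hf H. apply RInt_ge_0; auto. intros; apply H; lra.
Qed.

(** * Oscillatory integrals *)

(** Since [cos f] is the derivative of [sin f] divided by [f1], one integrates by parts with
    [G = A sin f / f1]. The integral of [|f2| / f1^2] stays in the bound; it becomes explicit as
    soon as [f2] has a sign. *)
Lemma osc_ibp (A A' f f1 f2 : R -> R) (a b lam A0 V : R) :
  a <= b -> 0 < lam ->
  (forall x, a <= x <= b -> is_derive A x (A' x)) ->
  (forall x, a <= x <= b -> continuous A' x) ->
  (forall x, a <= x <= b -> is_derive f x (f1 x)) ->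
  (forall x, a <= x <= b -> is_derive f1 x (f2 x)) ->
  (forall x, a <= x <= b -> continuous f2 x) ->
  (forall x, a <= x <= b -> lam <= Rabs (f1 x)) ->
  (forall x, a <= x <= b -> Rabs (A x) <= A0) ->
  RInt (fun x => Rabs (A' x)) a b <= V ->
  Rabs (RInt (fun x => A x * cos (f x)) a b) <=
   (2 * A0 + V) / lam + A0 * RInt (fun x => Rabs (f2 x) / (f1 x) ^ 2) a b.
Proof.
 intros Hab Hlam HA HA' Hf Hf1 Hf2 Hl HA0 HV.
 assert (forall x, a <= x <= b -> f1 x <> 0).
 { intros x Hx E. specialize (Hl x Hx). rewrite E, Rabs_R0 in Hl. lra. }
 assert (Hpos : forall x, a <= x <= b -> 0 < f1 x ^ 2).
 { intros x Hx. apply pow2_gt_0. auto. }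
 assert (forall x, a <= x <= b -> continuous A x) by (intros; eapply is_derive_continuous; eauto).
 assert (forall x, a <= x <= b -> continuous f x) by (intros; eapply is_derive_continuous; eauto).
 assert (forall x, a <= x <= b -> continuous f1 x) by (intros; eapply is_derive_continuous; eauto).
 set (G := fun x => A x * sin (f x) / f1 x).
 set (r := fun x => A' x * sin (f x) / f1 x - A x * sin (f x) * f2 x / (f1 x)^2).
 assert (forall x, a <= x <= b -> is_derive G x (A x * cos (f x) + r x)).
 { intros x Hx. unfold G, r.
  pose proof (HA x Hx) as D1. pose proof (Hf x Hx) as D2. pose proof (Hf1 x Hx) as D3.
  auto_derive.
  - repeat split; auto; eexists; eassumption.
  - apply is_derive_unique in D1. apply is_derive_unique in D2. apply is_derive_unique in D3. change (fun x0 : R => A x0) with A; change (fun x0 : R => f x0) with f; change (fun x0 : R => f1 x0) with f1. rewrite D1, D2, D3.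
   field. auto. }
 assert (forall x, a <= x <= b -> continuous r x).
 { intros x Hx. unfold r. cont; auto. apply Rgt_not_eq; apply Hpos; auto. }
 assert (I1 : is_RInt (fun x => A x * cos (f x) + r x) a b (minus (G b) (G a))).
 { apply (is_RInt_derive (V := RV)); rewrite Rmin_left, Rmax_right by lra; auto.
  intros x Hx. cont; auto. }
 assert (e1 : ex_RInt (fun x => A x * cos (f x)) a b) by (apply ex_RInt_cont; auto; intros; cont; auto).
 assert (e2 : ex_RInt r a b) by (apply ex_RInt_cont; auto).
 assert (E : RInt (fun x => A x * cos (f x)) a b = G b - G a - RInt r a b).
 { apply (is_RInt_unique (V := RV)) in I1.
  rewrite (RInt_addR (fun x => A x * cos (f x)) r a b e1 e2) in I1.
  unfold plus, minus, opp in I1; simpl in I1. unfold plus in I1; simpl in I1. lra. }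
 assert (HGb : forall x, a <= x <= b -> Rabs (G x) <= A0 / lam).
 { intros x Hx. unfold G. unfold Rdiv. rewrite !Rabs_mult.
  apply Rmult_le_compat; try (apply Rabs_pos).
  - apply Rmult_le_pos; apply Rabs_pos.
  - rewrite <- (Rmult_1_r A0). apply Rmult_le_compat; try apply Rabs_pos; auto.
   apply Rabs_le. apply SIN_bound.
  - rewrite Rabs_inv. apply Rinv_le_contravar; auto. }
 assert (ex_RInt (fun x => Rabs (A' x)) a b) by (apply ex_RInt_cont; auto; intros; cont; auto).
 assert (ex_RInt (fun x => Rabs (f2 x) / f1 x ^ 2) a b).
 { apply ex_RInt_cont; auto; intros; cont; auto. apply Rgt_not_eq; apply Hpos; auto. }
 assert (Rabs (RInt r a b) <= V / lam + A0 * RInt (fun x => Rabs (f2 x) / f1 x ^ 2) a b).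
 { eapply Rle_trans. apply abs_RInt_le; auto.
  assert (E2 : RInt (fun x => / lam * Rabs (A' x) + A0 * (Rabs (f2 x) / f1 x ^ 2)) a b
   = / lam * RInt (fun x => Rabs (A' x)) a b + A0 * RInt (fun x => Rabs (f2 x) / f1 x ^ 2) a b).
  { rewrite RInt_addR, !RInt_mulR; auto; apply ex_RInt_mulR; auto. }
  apply Rle_trans with (RInt (fun x => / lam * Rabs (A' x) + A0 * (Rabs (f2 x) / f1 x ^ 2)) a b).
  - apply RInt_le; auto.
   + apply ex_RInt_cont; auto. intros; cont; auto.
   + apply ex_RInt_cont; auto. intros x Hx; cont; auto. apply Rgt_not_eq; apply Hpos; auto.
   + intros x Hx. assert (Hx' : a <= x <= b) by lra. unfold r.
    assert (Rabs (sin (f x)) <= 1) by (apply Rabs_le; apply SIN_bound).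
    le_by Rabs_triang. rewrite Rabs_Ropp.
    apply Rplus_le_compat.
    * unfold Rdiv. rewrite !Rabs_mult, Rabs_inv.
     rewrite (Rmult_comm (/ lam)).
     apply Rmult_le_compat; try apply Rabs_pos.
     -- apply Rmult_le_pos; apply Rabs_pos.
     -- left; apply Rinv_0_lt_compat. apply Rabs_pos_lt; auto.
     -- rewrite <- (Rmult_1_r (Rabs (A' x))) at 2. apply Rmult_le_compat_l; auto. apply Rabs_pos.
     -- apply Rinv_le_contravar; auto.
    * unfold Rdiv. rewrite !Rabs_mult, Rabs_inv.
     rewrite (Rabs_right (f1 x ^ 2)) by (specialize (Hpos x Hx'); lra).
     rewrite <- Rmult_assoc.
     apply Rmult_le_compat_r. left; apply Rinv_0_lt_compat; auto.
     mul_r.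
     rewrite <- (Rmult_1_r A0). apply Rmult_le_compat; try apply Rabs_pos; auto.
  - rewrite E2. apply Rplus_le_compat_r. unfold Rdiv. rewrite Rmult_comm.
   bound. }
 rewrite E. le_by Rabs_triang. rewrite Rabs_Ropp.
 assert (Rabs (G b - G a) <= 2 * (A0 / lam)).
 { le_by Rabs_triang. rewrite Rabs_Ropp.
  pose proof (HGb a). pose proof (HGb b). lra. }
 bound.
Qed.

(** For [f2 >= 0] the integrand left by [osc_ibp] is the derivative of [- / f1], so its integral is
    an increment bounded by [/ lam], whatever the length of the interval. *)
Lemma osc_first (A A' f f1 f2 : R -> R) (a b lam A0 V : R) :
  a <= b -> 0 < lam ->
  (forall x, a <= x <= b -> is_derive A x (A' x)) ->
  (forall x, a <= x <= b -> continuous A' x) ->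
  (forall x, a <= x <= b -> is_derive f x (f1 x)) ->
  (forall x, a <= x <= b -> is_derive f1 x (f2 x)) ->
  (forall x, a <= x <= b -> continuous f2 x) ->
  (forall x, a <= x <= b -> 0 <= f2 x) ->
  (forall x, a <= x <= b -> lam <= f1 x) \/ (forall x, a <= x <= b -> f1 x <= - lam) ->
  (forall x, a <= x <= b -> Rabs (A x) <= A0) ->
  RInt (fun x => Rabs (A' x)) a b <= V ->
  Rabs (RInt (fun x => A x * cos (f x)) a b) <= (3 * A0 + V) / lam.
Proof.
 intros Hab Hlam HA HA' Hf Hf1 Hf2 Hf2p Hl HA0 HV.
 assert (Hl' : forall x, a <= x <= b -> lam <= Rabs (f1 x)).
 { intros x Hx. destruct Hl as [Hl|Hl]; specialize (Hl x Hx).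
  - rewrite Rabs_right; lra.
  - rewrite Rabs_left; lra. }
 assert (forall x, a <= x <= b -> f1 x <> 0).
 { intros x Hx E. specialize (Hl' x Hx). rewrite E, Rabs_R0 in Hl'. lra. }
 assert (0 <= A0). { apply Rle_trans with (Rabs (A a)); [apply Rabs_pos | apply HA0; lra]. }
 assert (I : is_RInt (fun x => Rabs (f2 x) / f1 x ^ 2) a b (minus (- / f1 b) (- / f1 a))).
 { apply (is_RInt_derive (V := RV) (fun x => - / f1 x)); rewrite Rmin_left, Rmax_right by lra.
  - intros x Hx. pose proof (Hf1 x Hx) as D3. auto_derive.
   + split; auto. eexists; eassumption.
   + apply is_derive_unique in D3. change (fun x0 : R => f1 x0) with f1. rewrite D3. rewrite Rabs_right by (apply Rle_ge; auto).
    field. auto.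
  - intros x Hx. cont; auto. eapply is_derive_continuous; eauto. apply pow_nonzero; auto. }
 eapply Rle_trans.
 { eapply (osc_ibp A A' f f1 f2 a b lam A0 V); eauto. }
 rewrite (is_RInt_unique _ _ _ _ I).
 (* [f1] keeps its sign, so one of the two terms is negative and is dropped. *)
 assert (- / f1 b + - - / f1 a <= / lam).
 { destruct Hl as [Hl|Hl].
  - pose proof (Hl a ltac:(lra)). pose proof (Hl b ltac:(lra)).
   assert (0 < / f1 b) by bound.
   assert (/ f1 a <= / lam) by bound. lra.
  - pose proof (Hl a ltac:(lra)). pose proof (Hl b ltac:(lra)).
   assert (0 < / - f1 a) by bound.
   assert (/ - f1 b <= / lam) by bound.
   rewrite Rinv_opp in *. lra. }
 apply Rle_trans with ((2 * A0 + V) / lam + A0 * / lam).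
 - apply Rplus_le_compat_l. apply Rmult_le_compat_l; auto.
 - bound.
Qed.

Lemma RInt_split (f : R -> R) a c b : a <= c <= b ->
  (forall x, a <= x <= b -> continuous f x) ->
  RInt f a b = RInt f a c + RInt f c b.
Proof.
 intros H Hf. symmetry. apply (RInt_Chasles (V := RV) f a c b);
 apply ex_RInt_cont; try lra; intros; apply Hf; lra.
Qed.

Lemma RInt_abs_sub (f : R -> R) a b c d : a <= c -> c <= d -> d <= b ->
  (forall x, a <= x <= b -> continuous f x) ->
  RInt (fun x => Rabs (f x)) c d <= RInt (fun x => Rabs (f x)) a b.
Proof.
 intros H1 H2 H3 Hf.
 assert (cf : forall x, a <= x <= b -> continuous (fun x => Rabs (f x)) x) by (intros; cont; auto).
 rewrite (RInt_split _ a c b) by (auto; lra).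
 rewrite (RInt_split _ c d b); try lra; [| intros; apply cf; lra].
 assert (0 <= RInt (fun x => Rabs (f x)) a c).
 { apply RInt_ge0; try lra. apply ex_RInt_cont; try lra; intros; apply cf; lra. bound. }
 assert (0 <= RInt (fun x => Rabs (f x)) d b).
 { apply RInt_ge0; try lra. apply ex_RInt_cont; try lra; intros; apply cf; lra. bound. }
 lra.
Qed.

(** [f1] increases at rate at least [mu], so beyond distance [d = / sqrt mu] from its zero it
    exceeds [sqrt mu] in size and [osc_first] applies; the window around the zero costs [2 A0 d]. *)
Lemma osc_second (A A' f f1 f2 : R -> R) (a b mu A0 V : R) :
  a <= b -> 0 < mu ->
  (forall x, a <= x <= b -> is_derive A x (A' x)) ->
  (forall x, a <= x <= b -> continuous A' x) ->
  (forall x, a <= x <= b -> is_derive f x (f1 x)) ->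
  (forall x, a <= x <= b -> is_derive f1 x (f2 x)) ->
  (forall x, a <= x <= b -> continuous f2 x) ->
  (forall x, a <= x <= b -> mu <= f2 x) ->
  (forall x, a <= x <= b -> Rabs (A x) <= A0) ->
  RInt (fun x => Rabs (A' x)) a b <= V ->
  Rabs (RInt (fun x => A x * cos (f x)) a b) <= (8 * A0 + 2 * V) / sqrt mu.
Proof.
 intros Hab Hmu HA HA' Hf Hf1 Hf2 Hf2p HA0 HV.
 assert (A0pos : 0 <= A0). { apply Rle_trans with (Rabs (A a)); [apply Rabs_pos | apply HA0; lra]. }
 assert (Vpos : 0 <= V).
 { eapply Rle_trans; [|apply HV]. apply RInt_ge0; auto. apply ex_RInt_cont; auto; intros; cont; auto.
  bound. }
 set (s := sqrt mu). assert (Hs : 0 < s) by bound.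
 assert (Hss : s * s = mu) by bound.
 set (d := / s). assert (Hd : 0 < d) by bound.
 assert (cA : forall x, a <= x <= b -> continuous A x) by (intros; eapply is_derive_continuous; eauto).
 assert (cf : forall x, a <= x <= b -> continuous f x) by (intros; eapply is_derive_continuous; eauto).
 assert (cI : forall x, a <= x <= b -> continuous (fun x => A x * cos (f x)) x) by (intros; cont; auto).
 assert (MVT : forall x y, a <= x -> x <= y -> y <= b -> f1 x + mu * (y - x) <= f1 y).
 { intros x y H1 H2 H3. destruct (MVT_gen f1 x y f2) as [c [Hc E]].
  - rewrite Rmin_left, Rmax_right by lra. intros; apply Hf1; lra.
  - rewrite Rmin_left, Rmax_right by lra. intros z Hz. apply continuity_pt_filterlim.
   eapply is_derive_continuous. apply Hf1; lra.
  - rewrite Rmin_left, Rmax_right in Hc by lra.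
   assert (mu * (y - x) <= f2 c * (y - x)) by (apply Rmult_le_compat_r; [lra| apply Hf2p; lra]). lra. }
 (* If [f1] has no zero, the endpoint where it is smallest in size plays the role of [x0]; there is
    then nothing to treat beyond that endpoint. *)
 assert (X0 : exists x0, a <= x0 <= b /\ (x0 = a \/ f1 x0 <= 0) /\ (x0 = b \/ 0 <= f1 x0)).
 { destruct (Rle_dec 0 (f1 a)) as [H|H]; [exists a; repeat split; auto; lra|].
  destruct (Rle_dec (f1 b) 0) as [H'|H']; [exists b; repeat split; auto; lra|].
  (* The intermediate value theorem is applied to a function continuous on the whole line, obtained
     from [f1] by composing with the projection on [[a, b]]. *)
  set (cl := fun x => Rmax a (Rmin b x)).
  assert (Hcl : forall x, a <= cl x <= b).
  { intros x. split. apply Rmax_l. apply Rmax_lub; auto. apply Rmin_l. }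
  assert (ccl : continuity (fun x => f1 (cl x))).
  { intros x. apply continuity_pt_filterlim. apply (continuous_comp cl f1).
   - unfold cl. apply continuity_pt_filterlim.
    apply (continuity_pt_ext (fun x => ((a + (b + x - Rabs (b - x)) / 2) + Rabs (a - (b + x - Rabs (b - x)) / 2)) / 2)).
    + intros t. unfold Rmax, Rmin. destruct (Rle_dec b t); destruct (Rle_dec a _); unfold Rabs; repeat destruct Rcase_abs; lra.
    + apply continuity_pt_filterlim. change (continuous (fun x => ((a + (b + x - Rabs (b - x)) / 2) + Rabs (a - (b + x - Rabs (b - x)) / 2)) / 2) x).
     cont; try lra.
   - eapply is_derive_continuous; apply Hf1; apply Hcl. }
  assert (Ea : cl a = a) by (unfold cl; rewrite Rmin_right, Rmax_left; lra).
  assert (Eb : cl b = b) by (unfold cl; rewrite Rmin_left, Rmax_right; lra).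
  destruct (IVT_gen (fun x => f1 (cl x)) a b 0 ccl) as [x [Hx E]].
  - rewrite Ea, Eb. rewrite Rmin_left, Rmax_right by lra. lra.
  - exists (cl x). split; [apply Hcl|]. bound. }
 destruct X0 as [x0 [Hx0 [Hl Hr]]].
 set (l := Rmax a (x0 - d)). set (r := Rmin b (x0 + d)).
 assert (a <= l <= x0). { unfold l; split; [apply Rmax_l|]. bound. }
 assert (x0 <= r <= b). { unfold r; split; [|apply Rmin_l]. bound. }
 rewrite (RInt_split _ a l b) by (auto; lra).
 rewrite (RInt_split _ l r b); [|lra| intros; apply cI; lra].
 assert (Rabs (RInt (fun x => A x * cos (f x)) l r) <= 2 * A0 / s).
 { eapply Rle_trans. apply abs_RInt_le_const with (M := A0); try lra.
  - apply ex_RInt_cont; try lra. intros; apply cI; lra.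
  - intros t Ht. rewrite Rabs_mult. rewrite <- (Rmult_1_r A0).
   apply Rmult_le_compat; try apply Rabs_pos. apply HA0; lra. apply Rabs_le, COS_bound.
  - rhs ((2 * d) * A0).
   mul_r. unfold l, r.
   pose proof (Rmax_r a (x0 - d)). pose proof (Rmin_r b (x0 + d)). lra. }
 assert (Rabs (RInt (fun x => A x * cos (f x)) a l) <= (3 * A0 + V) / s).
 { destruct (Req_dec l a) as [E|E].
  - rewrite E, RInt_point. unfold zero; simpl. rewrite Rabs_R0. apply Rdiv_le_0_compat; lra.
  - assert (l = x0 - d). { unfold l, Rmax in *. destruct (Rle_dec a (x0 - d)); auto. lra. }
   apply (osc_first A A' f f1 f2 a l s A0 V); auto; try lra; try (intros x Hx; first [apply HA|apply HA'|apply Hf|apply Hf1|apply Hf2|apply HA0]; lra).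
   + intros x Hx. specialize (Hf2p x ltac:(lra)). lra.
   + right. intros x Hx. pose proof (MVT x x0 ltac:(lra) ltac:(lra) ltac:(lra)).
    assert (mu * d <= mu * (x0 - x)) by bound.
    assert (mu * d = s) by (unfold d; rewrite <- Hss; field; lra). lra.
   + eapply Rle_trans; [|apply HV]. apply RInt_abs_sub; auto; lra. }
 assert (Rabs (RInt (fun x => A x * cos (f x)) r b) <= (3 * A0 + V) / s).
 { destruct (Req_dec r b) as [E|E].
  - rewrite E, RInt_point. unfold zero; simpl. rewrite Rabs_R0. apply Rdiv_le_0_compat; lra.
  - assert (r = x0 + d). { unfold r, Rmin in *. destruct (Rle_dec b (x0 + d)); auto. lra. }
   apply (osc_first A A' f f1 f2 r b s A0 V); auto; try lra; try (intros x Hx; first [apply HA|apply HA'|apply Hf|apply Hf1|apply Hf2|apply HA0]; lra).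
   + intros x Hx. specialize (Hf2p x ltac:(lra)). lra.
   + left. intros x Hx. pose proof (MVT x0 x ltac:(lra) ltac:(lra) ltac:(lra)).
    assert (mu * d <= mu * (x - x0)) by bound.
    assert (mu * d = s) by (unfold d; rewrite <- Hss; field; lra). lra.
   + eapply Rle_trans; [|apply HV]. apply RInt_abs_sub; auto; lra. }
 le_by Rabs_triang.
 le_by Rplus_le_compat_l. apply Rabs_triang.
 bound.
Qed.

(** * Projection on an interval, parameter integrals and Fubini *)

Definition clamp (a b x : R) : R := Rmax a (Rmin b x).

Lemma clamp_in a b x : a <= b -> a <= clamp a b x <= b.
Proof. intros H. split. apply Rmax_l. apply Rmax_lub; auto. apply Rmin_l. Qed.

Lemma clamp_id a b x : a <= x <= b -> clamp a b x = x.
Proof. intros H. unfold clamp. rewrite Rmin_right by lra. apply Rmax_right. lra. Qed.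

Lemma clamp_lip a b x y : Rabs (clamp a b x - clamp a b y) <= Rabs (x - y).
Proof.
 unfold clamp, Rmax, Rmin. repeat destruct Rle_dec; unfold Rabs; repeat destruct Rcase_abs; lra.
Qed.

Lemma clamp_mono a b x y : x <= y -> clamp a b x <= clamp a b y.
Proof. intros H. unfold clamp, Rmax, Rmin. repeat destruct Rle_dec; lra. Qed.

(** Composing with projections extends a function from a rectangle to the plane, so that Fubini need
    only be proved for functions continuous everywhere. *)
Lemma continuity_2d_clamp (f : R -> R -> R) a b c d : a <= b -> c <= d ->
  (forall x y, a <= x <= b -> c <= y <= d -> continuity_2d_pt f x y) ->
  forall x y, continuity_2d_pt (fun x y => f (clamp a b x) (clamp c d y)) x y.
Proof.
 intros Hab Hcd H x y eps.
 destruct (H (clamp a b x) (clamp c d y) (clamp_in _ _ _ Hab) (clamp_in _ _ _ Hcd) eps) as [de Hd].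
 exists de. intros u v Hu Hv. apply Hd; eapply Rle_lt_trans; try apply clamp_lip; auto.
Qed.

Lemma continuity_2d_pt_l (f : R -> R -> R) x y : continuity_2d_pt f x y -> continuous (fun x => f x y) x.
Proof.
 intros H. apply continuity_pt_filterlim. intros eps Heps.
 destruct (H (mkposreal eps Heps)) as [de Hd]. exists de. split. apply cond_pos.
 intros u [_ Hu]. apply Hd; auto.
 rewrite Rminus_diag, Rabs_R0. apply cond_pos.
Qed.

Lemma continuity_2d_pt_r (f : R -> R -> R) x y : continuity_2d_pt f x y -> continuous (fun y => f x y) y.
Proof.
 intros H. apply continuity_pt_filterlim. intros eps Heps.
 destruct (H (mkposreal eps Heps)) as [de Hd]. exists de. split. apply cond_pos.
 intros u [_ Hu]. apply Hd; auto.
 rewrite Rminus_diag, Rabs_R0. apply cond_pos.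
Qed.

Lemma continuity_2d_swap (f : R -> R -> R) x y : continuity_2d_pt f x y -> continuity_2d_pt (fun u v => f v u) y x.
Proof. intros H eps. destruct (H eps) as [de Hd]. exists de. intros u v Hu Hv. apply Hd; auto. Qed.

Lemma RInt_param_cont (f : R -> R -> R) a b y0 : a <= b ->
  (forall x y, a <= x <= b -> continuity_2d_pt f x y) ->
  continuous (fun y => RInt (fun x => f x y) a b) y0.
Proof.
 intros Hab Hf. apply continuity_pt_filterlim. intros eps Heps.
 assert (Hb : 0 < eps / (2 * (b - a + 1))) by bound.
 destruct (uniform_continuity_2d_1d f a b y0 (fun x Hx => Hf x y0 Hx) (mkposreal _ Hb)) as [de Hd].
 exists de. split. apply cond_pos. intros y [_ Hy]. simpl in *. unfold R_dist in *.
 apply Rabs_def2 in Hy.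
 assert (forall z, ex_RInt (fun x => f x z) a b).
 { intros z. apply ex_RInt_cont; auto. intros x Hx. apply (continuity_2d_pt_l f x z). auto. }
 rewrite <- (RInt_subR (fun x => f x y) (fun x => f x y0)) by auto.
 apply Rle_lt_trans with ((b - a) * (eps / (2 * (b - a + 1)))).
 - apply abs_RInt_le_const; auto.
  + apply ex_RInt_subR; auto.
  + intros x Hx. left. apply Hd; try lra.
   rewrite Rminus_diag, Rabs_R0. apply cond_pos.
 - apply Rlt_le_trans with ((b - a + 1) * (eps / (2 * (b - a + 1))) + eps / 4).
  bound.
  replace ((b - a + 1) * (eps / (2 * (b - a + 1)))) with (eps / 2) by bound. lra.
Qed.

(** As functions of the upper limit [b], both sides vanish at [b = a] and have the same derivative,
    by differentiation under the integral sign. *)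
Lemma fubini_global (f : R -> R -> R) a b c d : a <= b -> c <= d ->
  (forall x y, continuity_2d_pt f x y) ->
  RInt (fun x => RInt (fun y => f x y) c d) a b = RInt (fun y => RInt (fun x => f x y) a b) c d.
Proof.
 intros Hab Hcd Hf.
 set (g := fun t => RInt (fun y => RInt (fun x => f x y) a t) c d).
 assert (fx : forall x y, continuous (fun x => f x y) x) by (intros; apply continuity_2d_pt_l; auto).
 assert (ex : forall y s t, ex_RInt (fun x => f x y) s t).
 { intros. apply (ex_RInt_continuous (V := RV)). intros; apply fx. }
 assert (D1 : forall y t, is_derive (fun t => RInt (fun x => f x y) a t) t (f t y)).
 { intros y t. apply (is_derive_RInt (V := R_NormedModule) (fun x => f x y) _ a t); auto.
  exists (mkposreal 1 Rlt_0_1). intros z _. apply (RInt_correct (V := RV)). apply ex. }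
 assert (cy : forall t y, continuous (fun y => RInt (fun x => f x y) a t) y).
 { intros t y. destruct (Rle_dec a t).
  - apply RInt_param_cont; auto.
  - apply (continuous_ext (fun y => - RInt (fun x => f x y) t a)).
   + intros z. apply (opp_RInt_swap (V := RV)). apply ex.
   + apply continuous_oppR. apply RInt_param_cont; auto; lra. }
 assert (D : forall t, is_derive g t (RInt (fun y => f t y) c d)).
 { intros t. unfold g.
  replace (RInt (fun y => f t y) c d) with (RInt (fun y => Derive (fun u => RInt (fun x => f x y) a u) t) c d).
  - apply (is_derive_RInt_param (fun u y => RInt (fun x => f x y) a u)).
   + exists (mkposreal 1 Rlt_0_1). intros z _ y Hy. eexists. apply D1.
   + intros y Hy. apply (continuity_2d_pt_ext (fun u v => f u v)); auto.
    intros u v. symmetry. apply is_derive_unique. apply D1.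
   + exists (mkposreal 1 Rlt_0_1). intros z _. apply (ex_RInt_continuous (V := RV)).
    intros; apply cy.
  - apply RInt_ext. intros y _. apply is_derive_unique, D1. }
 assert (I : is_RInt (fun t => RInt (fun y => f t y) c d) a b (minus (g b) (g a))).
 { apply (is_RInt_derive (V := RV)); intros x _; [apply D|].
  apply (RInt_param_cont (fun y x => f x y)); auto. intros; apply continuity_2d_swap; auto. }
 rewrite (is_RInt_unique (V := RV) _ _ _ _ I).
 unfold minus, plus, opp; simpl.
 assert (Z : g a = 0).
 { unfold g. rewrite (RInt_ext _ (fun _ => 0)). rewrite RInt_const. unfold scal; simpl; unfold mult; simpl; ring.
  intros y _. rewrite RInt_point. reflexivity. }
 rewrite Z. bound.
Qed.

Lemma fubini (f : R -> R -> R) a b c d : a <= b -> c <= d ->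
  (forall x y, a <= x <= b -> c <= y <= d -> continuity_2d_pt f x y) ->
  RInt (fun x => RInt (fun y => f x y) c d) a b = RInt (fun y => RInt (fun x => f x y) a b) c d.
Proof.
 intros Hab Hcd Hf.
 pose proof (fubini_global _ a b c d Hab Hcd (continuity_2d_clamp f a b c d Hab Hcd Hf)) as E.
 etransitivity; [|etransitivity; [apply E|]].
 - apply RInt_ext. intros x Hx. rewrite Rmin_left, Rmax_right in Hx by lra.
  apply RInt_ext. intros y Hy. rewrite Rmin_left, Rmax_right in Hy by lra.
  rewrite !clamp_id; lra.
 - apply RInt_ext. intros x Hx. rewrite Rmin_left, Rmax_right in Hx by lra.
  apply RInt_ext. intros y Hy. rewrite Rmin_left, Rmax_right in Hy by lra.
  rewrite !clamp_id; lra.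
Qed.

Lemma ex_RInt_param (f : R -> R -> R) a b c d : a <= b -> c <= d ->
  (forall x y, a <= x <= b -> c <= y <= d -> continuity_2d_pt f x y) ->
  ex_RInt (fun y => RInt (fun x => f x y) a b) c d.
Proof.
 intros Hab Hcd Hf.
 apply (ex_RInt_ext (V := R_NormedModule) (fun y => RInt (fun x => f (clamp a b x) (clamp c d y)) a b)).
 - intros y Hy. rewrite Rmin_left, Rmax_right in Hy by lra.
  apply RInt_ext. intros x Hx. rewrite Rmin_left, Rmax_right in Hx by lra.
  rewrite !clamp_id; auto; lra.
 - apply ex_RInt_cont; auto. intros y Hy.
  apply (RInt_param_cont (fun x y => f (clamp a b x) (clamp c d y))); auto.
  intros; apply continuity_2d_clamp; auto.
Qed.

(** Integration by parts against the primitive of [w]: a bound for all initial integrals of [w]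
    survives multiplication by an amplitude of bounded variation. This is how the kernels [1 / sin]
    and [1 / sin^2] are attached to the key bound. *)
Lemma RInt_amplitude (A A' w : R -> R) a b E A0 V : a <= b ->
  (forall x, continuous w x) ->
  (forall x, a <= x <= b -> is_derive A x (A' x)) ->
  (forall x, a <= x <= b -> continuous A' x) ->
  (forall x, a <= x <= b -> Rabs (RInt w a x) <= E) ->
  (forall x, a <= x <= b -> Rabs (A x) <= A0) ->
  RInt (fun x => Rabs (A' x)) a b <= V ->
  Rabs (RInt (fun x => A x * w x) a b) <= E * (A0 + V).
Proof.
 intros Hab Hw HA HA' HE HA0 HV.
 set (G := fun x => RInt w a x).
 assert (forall s t, ex_RInt w s t) by (intros; apply (ex_RInt_continuous (V := RV)); auto).
 assert (DG : forall x, is_derive G x (w x)).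
 { intros x. apply (is_derive_RInt (V := R_NormedModule) w G a x); auto.
  exists (mkposreal 1 Rlt_0_1). intros z _. apply (RInt_correct (V := RV)); auto. }
 assert (forall x, continuous G x) by (intros; eapply is_derive_continuous; apply DG).
 assert (forall x, a <= x <= b -> continuous A x) by (intros; eapply is_derive_continuous; eauto).
 assert (I : is_RInt (fun x => A' x * G x + A x * w x) a b (minus (A b * G b) (A a * G a))).
 { apply (is_RInt_derive (V := RV) (fun x => A x * G x)); rewrite Rmin_left, Rmax_right by lra.
  - intros x Hx. apply (is_derive_mult A G x (A' x) (w x)); auto. intros; apply Rmult_comm.
  - intros x Hx. cont; auto. }
 assert (ex_RInt (fun x => A' x * G x) a b) by (apply ex_RInt_cont; auto; intros; cont; auto).
 assert (ex_RInt (fun x => A x * w x) a b) by (apply ex_RInt_cont; auto; intros; cont; auto).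
 apply (is_RInt_unique (V := RV)) in I.
 rewrite RInt_addR in I by auto. unfold minus, plus, opp in I; simpl in I.
 assert (Ga : G a = 0) by (unfold G; rewrite RInt_point; reflexivity).
 rewrite Ga in I.
 assert (0 <= E) by (eapply Rle_trans; [apply Rabs_pos | apply (HE a); lra]).
 assert (Rabs (RInt (fun x => A' x * G x) a b) <= E * V).
 { eapply Rle_trans. apply abs_RInt_le; auto.
  apply Rle_trans with (RInt (fun x => E * Rabs (A' x)) a b).
  - apply RInt_le; auto.
   + apply ex_RInt_cont; auto; intros; cont; auto.
   + apply ex_RInt_cont; auto; intros; cont; auto.
   + intros x Hx. rewrite Rabs_mult, Rmult_comm. mul_r. apply HE; lra.
  - rewrite RInt_mulR. bound. apply ex_RInt_cont; auto; intros; cont; auto. }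
 replace (RInt (fun x => A x * w x) a b) with (A b * G b - RInt (fun x => A' x * G x) a b) by lra.
 le_by Rabs_triang. rewrite Rabs_Ropp.
 assert (Rabs (A b * G b) <= E * A0).
 { rewrite Rabs_mult, Rmult_comm. apply Rmult_le_compat; try apply Rabs_pos. apply HE; lra. apply HA0; lra. }
 lra.
Qed.

(** * Finite sums over ranges and lists *)

Fixpoint rsum (f : nat -> R) (N : nat) : R :=
  match N with O => 0 | S n => rsum f n + f n end.

Lemma rsum_ext f g N : (forall k, (k < N)%nat -> f k = g k) -> rsum f N = rsum g N.
Proof. induction N; simpl; intros H; auto. rewrite IHN, H; auto. Qed.

Lemma rsum_le f g N : (forall k, (k < N)%nat -> f k <= g k) -> rsum f N <= rsum g N.
Proof. induction N; simpl; intros H. lra. apply Rplus_le_compat; auto. Qed.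

Lemma rsum_add f g N : rsum (fun k => f k + g k) N = rsum f N + rsum g N.
Proof. induction N; simpl; lra. Qed.

Lemma rsum_mul c f N : rsum (fun k => c * f k) N = c * rsum f N.
Proof. induction N; simpl; [ring|]. bound. Qed.

Lemma rsum_pos f N : (forall k, (k < N)%nat -> 0 <= f k) -> 0 <= rsum f N.
Proof. induction N; simpl; intros H. lra. pose proof (H N ltac:(lia)). assert (0 <= rsum f N) by auto. lra. Qed.

Lemma rsum_abs f N : Rabs (rsum f N) <= rsum (fun k => Rabs (f k)) N.
Proof.
 induction N; simpl. rewrite Rabs_R0; lra.
 le_by Rabs_triang. lra.
Qed.

Lemma rsum_const c N : rsum (fun _ => c) N = INR N * c.
Proof. induction N. simpl; ring. simpl rsum. rewrite IHN, S_INR. ring. Qed.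

Lemma rsum_cont (f : nat -> R -> R) N x : (forall k, (k < N)%nat -> continuous (f k) x) ->
  continuous (fun x => rsum (fun k => f k x) N) x.
Proof.
 induction N; simpl; intros H. apply continuous_const. apply continuous_addR; auto.
Qed.

Lemma rsum_RInt (f : nat -> R -> R) N a b : (forall k, (k < N)%nat -> ex_RInt (f k) a b) ->
  RInt (fun x => rsum (fun k => f k x) N) a b = rsum (fun k => RInt (f k) a b) N /\
  ex_RInt (fun x => rsum (fun k => f k x) N) a b.
Proof.
 induction N; simpl; intros H.
 - split. rewrite RInt_const. unfold scal; simpl; unfold mult; simpl; ring. apply ex_RInt_const.
 - destruct IHN as [E1 E2]. intros; apply H; lia. split.
  + rewrite RInt_addR; auto. rewrite E1. f_equal.
  + apply ex_RInt_addR; auto.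
Qed.

(** Abel summation: under weights that do not increase, terms of mean at most [C] count as if each
    were [C]. *)
Lemma rsum_abel (a c : nat -> R) C N :
  (forall n, rsum a n <= C * INR n) ->
  (forall k, (k < N)%nat -> 0 <= c k) -> (forall k, (S k < N)%nat -> c (S k) <= c k) ->
  rsum (fun k => a k * c k) N <= C * rsum c N.
Proof.
 intros Ha Hc Hd.
 (* The slack [C n - rsum a n] is carried along with the last weight; it is nonnegative, so passing
    to a smaller weight only helps. *)
 assert (forall n, (n < N)%nat -> rsum (fun k => a k * c k) (S n) + (C * INR (S n) - rsum a (S n)) * c n <= C * rsum c (S n)).
 { induction n; intros Hn.
  - simpl. lra.
  - specialize (IHn ltac:(lia)).
   change (rsum (fun k => a k * c k) (S (S n))) with (rsum (fun k => a k * c k) (S n) + a (S n) * c (S n)).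
   change (rsum a (S (S n))) with (rsum a (S n) + a (S n)).
   change (rsum c (S (S n))) with (rsum c (S n) + c (S n)).
   rewrite (S_INR (S n)).
   pose proof (Ha (S n)). pose proof (Hd n Hn).
   nra. }
 destruct N as [|n]. simpl; lra.
 specialize (H n ltac:(lia)). pose proof (Ha (S n)). pose proof (Hc n ltac:(lia)).
 nra.
Qed.

Section Lists.
Context {T : Type}.

Fixpoint lsum (f : T -> R) (l : list T) : R :=
  match l with nil => 0 | x :: l' => f x + lsum f l' end.

Lemma lsum_app f l l' : lsum f (l ++ l') = lsum f l + lsum f l'.
Proof. induction l; simpl; lra. Qed.

Lemma lsum_ext f g l : (forall x, In x l -> f x = g x) -> lsum f l = lsum g l.
Proof. induction l; simpl; intros H; auto. rewrite H, IHl; auto. Qed.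

Lemma lsum_le f g l : (forall x, In x l -> f x <= g x) -> lsum f l <= lsum g l.
Proof. induction l; simpl; intros H. lra. apply Rplus_le_compat; auto. Qed.

Lemma lsum_add f g l : lsum (fun x => f x + g x) l = lsum f l + lsum g l.
Proof. induction l; simpl; lra. Qed.

Lemma lsum_mul c f l : lsum (fun x => c * f x) l = c * lsum f l.
Proof. induction l; simpl; [ring|]. bound. Qed.

Lemma lsum_pos f l : (forall x, In x l -> 0 <= f x) -> 0 <= lsum f l.
Proof. induction l; simpl; intros H. lra. pose proof (H a (or_introl eq_refl)). assert (0 <= lsum f l) by auto. lra. Qed.

Lemma lsum_abs f l : Rabs (lsum f l) <= lsum (fun x => Rabs (f x)) l.
Proof. induction l; simpl. rewrite Rabs_R0; lra. le_by Rabs_triang. lra. Qed.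

Lemma lsum_const c l : lsum (fun _ => c) l = INR (length l) * c.
Proof. induction l. simpl; ring. simpl lsum. rewrite IHl. simpl length. rewrite S_INR. ring. Qed.

Lemma lsum_perm f l l' : Permutation l l' -> lsum f l = lsum f l'.
Proof. induction 1; simpl; lra. Qed.

Lemma lsum_filter f p l : lsum f (filter p l) = lsum (fun x => if p x then f x else 0) l.
Proof. induction l; simpl; auto. destruct (p a); simpl; lra. Qed.

Lemma lsum_cont (f : T -> R -> R) l x : (forall k, In k l -> continuous (f k) x) ->
  continuous (fun x => lsum (fun k => f k x) l) x.
Proof. induction l; simpl; intros H. apply continuous_const. apply continuous_addR; auto. Qed.

Lemma lsum_RInt (f : T -> R -> R) l a b : (forall k, In k l -> ex_RInt (f k) a b) ->
  RInt (fun x => lsum (fun k => f k x) l) a b = lsum (fun k => RInt (f k) a b) l /\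
  ex_RInt (fun x => lsum (fun k => f k x) l) a b.
Proof.
 induction l; simpl; intros H.
 - split. rewrite RInt_const. unfold scal; simpl; unfold mult; simpl; ring. apply ex_RInt_const.
 - destruct IHl as [E1 E2]. intros; apply H; auto. split.
  + rewrite RInt_addR; auto. rewrite E1. f_equal.
  + apply ex_RInt_addR; auto.
Qed.

End Lists.

Lemma lsum_map {T S : Type} (g : S -> T) (f : T -> R) l : lsum f (map g l) = lsum (fun x => f (g x)) l.
Proof. induction l; simpl; auto. bound. Qed.

Lemma lsum_flat_map {T S : Type} (g : S -> list T) (f : T -> R) l : lsum f (flat_map g l) = lsum (fun x => lsum f (g x)) l.
Proof. induction l; simpl; auto. rewrite lsum_app, IHl; auto. Qed.

Lemma lsum_swap {T S : Type} (f : T -> S -> R) l l' :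
  lsum (fun x => lsum (fun y => f x y) l') l = lsum (fun y => lsum (fun x => f x y) l) l'.
Proof.
 induction l; simpl. symmetry. rewrite (lsum_const 0). ring. rewrite IHl. rewrite <- lsum_add. bound.
Qed.

(** * Well-spaced sets of real numbers *)

Lemma ForallOrdPairs_perm {T} (P : T -> T -> Prop) l l' : (forall x y, P x y -> P y x) ->
  Permutation l l' -> ForallOrdPairs P l -> ForallOrdPairs P l'.
Proof.
 intros Hs. induction 1; intros F; auto.
 - inversion F; subst. constructor; auto. eapply Permutation_Forall; eauto.
 - inversion F as [|? ? F1 F2]; subst. inversion F2; subst. inversion F1; subst.
  constructor; [constructor; auto|]. constructor; auto.
Qed.

Lemma list_max_R (l : list R) : l <> nil -> exists x l', Permutation l (x :: l') /\ forall y, In y l' -> y <= x.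
Proof.
 induction l as [|a l IH]; intros H. congruence.
 destruct l as [|b l].
 - exists a, nil. split; auto. intros y [].
 - destruct IH as [x [l' [P Hx]]]. congruence.
  destruct (Rle_dec a x).
  + exists x, (a :: l'). split. rewrite P. apply perm_swap. intros y [<-|Hy]; auto.
  + exists a, (x :: l'). split. rewrite P; auto. intros y [<-|Hy]; [lra|]. specialize (Hx y Hy); lra.
Qed.

Definition spaced (g : R) (l : list R) := ForallOrdPairs (fun x y => g <= Rabs (x - y)) l.

(** Removing the largest element leaves a spaced set below [B - g]. *)
Lemma spaced_count n : forall (l : list R) g A B, length l = n -> spaced g l -> (0 < n)%nat ->
  (forall x, In x l -> A <= x <= B) -> (INR n - 1) * g <= B - A.
Proof.
 induction n as [|n IH]; intros l g A B Hl Hs Hn HAB. lia.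
 destruct (list_max_R l) as [x [l' [P Hx]]]. { intros E. rewrite E in Hl. discriminate. }
 assert (length l' = n). { apply Permutation_length in P. simpl in P. lia. }
 assert (Hs' : spaced g (x :: l')). { eapply ForallOrdPairs_perm; eauto. intros u v. rewrite Rabs_minus_sym; auto. }
 assert (A <= x <= B). { apply HAB. eapply Permutation_in. symmetry; apply P. left; auto. }
 destruct (Nat.eq_dec n 0) as [E|E].
 - subst n. rewrite E. simpl. lra.
 - inversion Hs' as [|? ? F1 F2]; subst.
  assert ((INR (length l') - 1) * g <= (x - g) - A).
  { apply (IH l' g A (x - g)); auto; try lia. intros y Hy. split.
   - apply HAB. eapply Permutation_in. symmetry; apply P. right; auto.
   - rewrite Forall_forall in F1. specialize (F1 y Hy). specialize (Hx y Hy).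
    rewrite Rabs_right in F1 by lra. lra. }
  rewrite S_INR. lra.
Qed.

(** The [j]-th smallest element is at least [j q], and the sum of [/ sqrt j] up to [n] is at most
    [2 sqrt n]. In this form the correlations of one arc with all the others are summed. *)
Lemma spaced_sum_sqrt n : forall (l : list R) q, length l = n -> 0 < q -> spaced q l ->
  (forall x, In x l -> q <= x) -> lsum (fun x => / sqrt x) l <= 2 * (sqrt (INR n) / sqrt q).
Proof.
 induction n as [|n IH]; intros l q Hl Hq Hs Hb.
 - destruct l; [|discriminate]. simpl. rewrite sqrt_0. lra.
 - destruct (list_max_R l) as [x [l' [P Hx]]]. { intros E. rewrite E in Hl. discriminate. }
  assert (Hl' : length l' = n). { apply Permutation_length in P. simpl in P. lia. }
  assert (Hs' : spaced q (x :: l')). { eapply ForallOrdPairs_perm; eauto. intros u v. rewrite Rabs_minus_sym; auto. }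
  assert (Hin : forall y, In y (x :: l') -> q <= y). { intros y Hy; apply Hb. eapply Permutation_in. symmetry; apply P. auto. }
  rewrite (lsum_perm _ _ _ P). simpl lsum.
  assert (H : lsum (fun x => / sqrt x) l' <= 2 * (sqrt (INR n) / sqrt q)).
  { inversion Hs'; subst. apply IH; auto. intros; apply Hin; right; auto. }
  assert (Hxn : INR (S n) * q <= x).
  { assert (length (x :: l') = S n) by (simpl; lia).
   pose proof (spaced_count (S n) (x :: l') q q x H0 Hs' ltac:(lia)).
   assert ((INR (S n) - 1) * q <= x - q).
   { apply H1. intros y Hy. split. auto. destruct Hy as [<-|Hy]; [lra|auto]. } lra. }
  pose proof (pos_INR n) as Hn0.
  assert (0 < INR (S n)) by (apply lt_0_INR; lia).
  assert (/ sqrt x <= / (sqrt (INR (S n)) * sqrt q)).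
  { rewrite <- sqrt_mult by lra. bound. }
  set (s := sqrt (INR (S n))) in *. set (r := sqrt (INR n)) in *. set (w := sqrt q) in *.
  assert (s * s = r * r + 1). { unfold s, r. rewrite !sqrt_sqrt by lra. rewrite S_INR. lra. }
  assert (/ (s * w) + 2 * (r / w) <= 2 * (s / w)).
  { apply Rmult_le_reg_r with (s * w). bound.
   lhs (1 + 2 * r * s).
   rhs (2 * (s * s)).
   nra. }
  lra.
Qed.

Lemma harmonic_log N : rsum (fun k => / (INR k + 1)) N <= 1 + ln (INR N + 1).
Proof.
 assert (H : forall n, rsum (fun k => / (INR k + 1)) (S n) <= 1 + ln (INR n + 1)).
 { induction n.
  - simpl. rewrite !Rplus_0_l, ln_1. lra.
  - change (rsum (fun k => / (INR k + 1)) (S (S n))) with (rsum (fun k => / (INR k + 1)) (S n) + / (INR (S n) + 1)).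
   assert (Hp : 0 < INR n + 1) by bound.
   assert (E : / (INR (S n) + 1) <= ln (INR (S n) + 1) - ln (INR n + 1)).
   { rewrite <- ln_div; try (rewrite ?S_INR; lra).
    rewrite S_INR. set (u := INR n + 1) in *.
    assert (ln (u / (u + 1)) <= u / (u + 1) - 1).
    { pose proof (exp_ineq1_le (ln (u / (u + 1)))). rewrite exp_ln in H. lra. bound. }
    replace ((u + 1) / u) with (/ (u / (u + 1))) by bound.
    rewrite ln_Rinv by (apply Rdiv_lt_0_compat; lra).
    replace (u / (u + 1) - 1) with (- / (u + 1)) in H by bound. lra. }
   lra. }
 destruct N. simpl. rewrite !Rplus_0_l, ln_1. lra.
 le_by H.
 bound.
Qed.

(** * The Bessel function *)

Lemma cosh_ge1 v : 1 <= cosh v.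
Proof.
 unfold cosh. pose proof (exp_pos (-v)).
 assert (exp v * exp (- v) = 1) by (rewrite <- exp_plus, Rplus_opp_r; apply exp_0).
 assert (0 <= exp (- v) * ((exp v - 1) * (exp v - 1))) by (apply Rmult_le_pos; [lra|apply Rle_0_sqr]).
 nra.
Qed.

Lemma cosh_ge_exp v : exp v / 2 <= cosh v.
Proof. unfold cosh. pose proof (exp_pos (-v)). lra. Qed.

Lemma is_derive_cosh v : is_derive cosh v (sinh v).
Proof. apply is_derive_Reals. apply derivable_pt_lim_cosh. Qed.

Lemma continuous_coshR (f : R -> R) x : continuous f x -> continuous (fun t => cosh (f t)) x.
Proof.
 intros. apply continuous_comp; auto. eapply is_derive_continuous. apply is_derive_cosh.
Qed.

Lemma cosh_incr u v : 0 <= u -> u <= v -> cosh u <= cosh v.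
Proof.
 intros H1 H2. destruct (Req_dec u v) as [->|Hn]; [lra|].
 assert (cosh v - cosh u = (exp v - exp u) * (1 - exp (- u) * exp (- v)) / 2).
 { unfold cosh. pose proof (exp_plus u (-u)). pose proof (exp_plus v (-v)). rewrite Rplus_opp_r, exp_0 in *.
  replace ((exp v - exp u) * (1 - exp (-u) * exp (-v)) / 2) with
   ((exp v - exp u - exp (-u) * (exp v * exp (-v)) + (exp u * exp (-u)) * exp (-v)) / 2) by field.
  rewrite <- H, <- H0. field. }
 assert (exp u < exp v) by (apply exp_increasing; lra).
 assert (exp (- u) * exp (-v) <= 1). { rewrite <- exp_plus, <- exp_0. destruct (Req_dec (-u + - v) 0) as [->|]. lra. left; apply exp_increasing; lra. }
 nra.
Qed.

(** Decay of order [3/2] is what the dual sums ask of the Bessel function, and a cubic minorant of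
    [exp] supplies it. *)
Lemma exp_cubic t : 0 <= t -> (1 + t / 3) ^ 3 <= exp t.
Proof.
 intros H. replace (exp t) with (exp (t / 3) ^ 3).
 - apply pow_incr. pose proof (exp_ineq1_le (t / 3)). lra.
 - simpl. rewrite Rmult_1_r, <- !exp_plus. f_equal. field.
Qed.

Lemma sqrt_le_half t : 0 <= t -> sqrt t <= (1 + t) / 2.
Proof.
 intros H. pose proof (sqrt_sqrt t H). pose proof (Rle_0_sqr (sqrt t - 1)). unfold Rsqr in *. lra.
Qed.

Lemma exp_dec1 t : 0 < t -> (1 + t) * exp (- t) <= 14 / sqrt t.
Proof.
 intros H. pose proof (exp_cubic t ltac:(lra)) as E. pose proof (sqrt_le_half t ltac:(lra)) as S.
 apply Rmult_le_reg_r with (sqrt t * exp t). bound.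
 rewrite exp_Ropp. lhs ((1 + t) * sqrt t).
 rhs (14 * exp t).
 nra.
Qed.

(** With [sqrt t <= (1 + t) / 2] the leading terms to compare are [t^3 / 2] and [14 t^3 / 27],
    whence the constant. *)
Lemma exp_dec2 t : 0 < t -> (1 + t) * exp (- t) <= 14 / (t * sqrt t).
Proof.
 intros H. pose proof (exp_cubic t ltac:(lra)) as E. pose proof (sqrt_le_half t ltac:(lra)) as S.
 apply Rmult_le_reg_r with (t * sqrt t * exp t). bound.
 rewrite exp_Ropp. lhs ((1 + t) * t * sqrt t).
 rhs (14 * exp t).
 nra.
Qed.

(** The truncated Bessel integrands are all compared with [/ sqrt (cosh v)], whose integral is at
    most [2 sqrt 2]. *)
Lemma int_sqrt_cosh V : 0 <= V -> RInt (fun v => / sqrt (cosh v)) 0 V <= 3.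
Proof.
 intros HV.
 assert (I : is_RInt (fun v => sqrt 2 * exp (- v / 2)) 0 V (minus (- 2 * sqrt 2 * exp (- V / 2)) (- 2 * sqrt 2 * exp (- 0 / 2)))).
 { apply (is_RInt_derive (V := RV) (fun v => - 2 * sqrt 2 * exp (- v / 2))).
  - intros x _. auto_derive; auto. unfold Rdiv. field.
  - intros x _. cont; try lra. }
 assert (forall v, continuous (fun v => / sqrt (cosh v)) v).
 { intros v. apply continuous_invR. apply continuous_comp. apply continuous_coshR; apply continuous_id.
  apply continuous_sqrt. apply Rgt_not_eq, sqrt_lt_R0. pose proof (cosh_ge1 v); lra. }
 apply Rle_trans with (RInt (fun v => sqrt 2 * exp (- v / 2)) 0 V).
 - apply RInt_le; auto. apply ex_RInt_cont; auto. eexists; apply I.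
  intros x Hx.
  assert (E : sqrt 2 * exp (- x / 2) = / sqrt (exp x / 2)).
  { assert (0 < exp (x / 2)) by bound.
   replace (exp x / 2) with ((exp (x / 2) * / sqrt 2) * (exp (x/2) * / sqrt 2)).
   - rewrite sqrt_square. replace (- x / 2) with (- (x / 2)) by field. rewrite exp_Ropp. bound.
    apply Rmult_le_pos. lra. left. apply Rinv_0_lt_compat. apply sqrt_lt_R0; lra.
   - lhs ((exp (x/2) * exp (x/2)) * / (sqrt 2 * sqrt 2)).
    rewrite <- exp_plus, sqrt_sqrt by lra. replace (x / 2 + x / 2) with x by field. bound. }
  rewrite E. apply Rinv_le_contravar. bound.
  apply sqrt_le_1_alt. apply cosh_ge_exp.
 - rewrite (is_RInt_unique (V := RV) _ _ _ _ I). unfold minus, plus, opp; simpl.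
  replace (- 0 / 2) with 0 by field. rewrite exp_0. pose proof (exp_pos (- V / 2)).
  assert (sqrt 2 <= 1.5). { replace 1.5 with (sqrt (1.5 * 1.5)). bound. bound. }
  pose proof (sqrt_pos 2). nra.
Qed.

Section MaassForm.
Variable kappa : R.

(** The integral of [bessel_K] cut at [V]; [KV1] is its derivative in [w]. Over a bounded range
    differentiation under the integral sign is immediate, and every estimate is uniform in [V], so
    the limit function itself never has to be differentiated. *)
Definition KV (V w : R) : R := RInt (fun v => exp (- w * cosh v) * cos (kappa * v)) 0 V.
Definition KV1 (V w : R) : R := RInt (fun v => - cosh v * exp (- w * cosh v) * cos (kappa * v)) 0 V.

Lemma KV_integrand_cont w v : continuous (fun v => exp (- w * cosh v) * cos (kappa * v)) v.
Proof. cont. apply continuous_coshR, continuous_id. Qed.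

Lemma KV1_integrand_cont w v : continuous (fun v => - cosh v * exp (- w * cosh v) * cos (kappa * v)) v.
Proof. cont; apply continuous_coshR, continuous_id. Qed.

Lemma c2d_continuous_l (f : R -> R) x y : continuous f x -> continuity_2d_pt (fun u v => f u) x y.
Proof.
 intros H. apply (continuity_1d_2d_pt_comp f (fun u v => u)). apply continuity_pt_filterlim; auto. apply continuity_2d_pt_id1.
Qed.

Lemma c2d_continuous_r (f : R -> R) x y : continuous f y -> continuity_2d_pt (fun u v => f v) x y.
Proof.
 intros H. apply (continuity_1d_2d_pt_comp f (fun u v => v)). apply continuity_pt_filterlim; auto. apply continuity_2d_pt_id2.
Qed.

Lemma c2d_comp (f : R -> R) (g : R -> R -> R) x y : continuous f (g x y) -> continuity_2d_pt g x y -> continuity_2d_pt (fun u v => f (g u v)) x y.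
Proof. intros. apply continuity_1d_2d_pt_comp; auto. apply continuity_pt_filterlim; auto. Qed.

Lemma KV_derive V w : 0 <= V -> is_derive (KV V) w (KV1 V w).
Proof.
 intros HV. unfold KV, KV1.
 assert (D : forall w v, is_derive (fun w => exp (- w * cosh v) * cos (kappa * v)) w (- cosh v * exp (- w * cosh v) * cos (kappa * v))).
 { intros. auto_derive; auto. ring. }
 replace (RInt (fun v => - cosh v * exp (- w * cosh v) * cos (kappa * v)) 0 V)
  with (RInt (fun v => Derive (fun w => exp (- w * cosh v) * cos (kappa * v)) w) 0 V).
 - apply (is_derive_RInt_param (fun w v => exp (- w * cosh v) * cos (kappa * v))).
  + exists (mkposreal 1 Rlt_0_1). intros. eexists; apply D.
  + intros t _. apply (continuity_2d_pt_ext (fun w v => - cosh v * exp (- w * cosh v) * cos (kappa * v))).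
   * intros. symmetry. apply is_derive_unique, D.
   * repeat apply continuity_2d_pt_mult.
    -- apply (c2d_continuous_r (fun v => - cosh v)). cont. apply continuous_coshR, continuous_id.
    -- apply c2d_comp. apply continuous_exp. apply continuity_2d_pt_mult.
      apply (c2d_continuous_l (fun w => - w)). cont. apply (c2d_continuous_r (fun v => cosh v)).
      apply continuous_coshR, continuous_id.
    -- apply (c2d_continuous_r (fun v => cos (kappa * v))). cont.
  + exists (mkposreal 1 Rlt_0_1). intros. apply (ex_RInt_continuous (V := RV)). intros; apply KV_integrand_cont.
 - apply RInt_ext. intros; apply is_derive_unique, D.
Qed.

Lemma KV1_cont V w : 0 <= V -> continuous (KV1 V) w.
Proof.
 intros HV. apply (RInt_param_cont (fun v w => - cosh v * exp (- w * cosh v) * cos (kappa * v))); auto.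
 intros. repeat apply continuity_2d_pt_mult.
 - apply (c2d_continuous_l (fun v => - cosh v)). cont. apply continuous_coshR, continuous_id.
 - apply c2d_comp. apply continuous_exp. apply continuity_2d_pt_mult.
  apply (c2d_continuous_r (fun w => - w)). cont. apply (c2d_continuous_l (fun v => cosh v)).
  apply continuous_coshR, continuous_id.
 - apply (c2d_continuous_l (fun v => cos (kappa * v))). cont.
Qed.

Lemma KV_gen_bound (h : R -> R) V B : 0 <= V ->
  (forall v, continuous h v) -> (forall v, 0 <= v -> Rabs (h v) <= B * / sqrt (cosh v)) ->
  0 <= B -> Rabs (RInt h 0 V) <= 3 * B.
Proof.
 intros HV Hc Hb HB.
 assert (forall v, continuous (fun v => / sqrt (cosh v)) v).
 { intros v. apply continuous_invR. apply continuous_comp. apply continuous_coshR; apply continuous_id.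
  apply continuous_sqrt. apply Rgt_not_eq, sqrt_lt_R0. pose proof (cosh_ge1 v); lra. }
 assert (ex_RInt h 0 V) by (apply ex_RInt_cont; auto).
 assert (ex_RInt (fun v => / sqrt (cosh v)) 0 V) by (apply ex_RInt_cont; auto).
 eapply Rle_trans. apply abs_RInt_le; auto.
 apply Rle_trans with (RInt (fun v => B * / sqrt (cosh v)) 0 V).
 - apply RInt_le; auto. apply ex_RInt_cont; auto. intros; cont; auto. apply ex_RInt_mulR; auto.
  intros; apply Hb; lra.
 - rewrite RInt_mulR by auto. pose proof (int_sqrt_cosh V HV). nra.
Qed.

(** With [t = w cosh v] the two decay estimates separate into a power of [w] times the integrable
    [/ sqrt (cosh v)]; the second uses [cosh v >= 1] to drop a surplus factor. *)
Lemma cosh_term_bound w v : 0 < w -> (1 + w * cosh v) * exp (- w * cosh v) <= (14 / sqrt w) * / sqrt (cosh v)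
  /\ (1 + w * cosh v) * exp (- w * cosh v) <= (14 / (w * sqrt w)) * / sqrt (cosh v).
Proof.
 intros Hw. pose proof (cosh_ge1 v) as Hc. set (c := cosh v) in *.
 assert (0 < w * c) by nra.
 assert (0 < sqrt w) by bound. assert (0 < sqrt c) by bound.
 replace (- w * c) with (- (w * c)) by ring. split.
 - eapply Rle_trans. apply exp_dec1; auto. right. rewrite sqrt_mult by lra. field; lra.
 - eapply Rle_trans. apply exp_dec2; auto. rewrite sqrt_mult by lra.
  rhs (14 * / (w * sqrt w * sqrt c)).
  mul_l. apply Rinv_le_contravar.
  + repeat apply Rmult_lt_0_compat; auto.
  + rhs (c * (w * sqrt w * sqrt c)).
   bound.
Qed.

Lemma abs_cos_mul a x : Rabs (a * cos x) <= Rabs a.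
Proof.
 rewrite Rabs_mult. rewrite <- (Rmult_1_r (Rabs a)) at 2. mul_l. apply Rabs_le, COS_bound.
Qed.

Lemma KV_bound V w : 0 <= V -> 0 < w -> Rabs (KV V w) <= 42 / sqrt w /\ Rabs (KV V w) <= 42 / (w * sqrt w).
Proof.
 intros HV Hw. assert (0 < sqrt w) by bound.
 assert (Hb : forall v, Rabs (exp (- w * cosh v) * cos (kappa * v)) <= (1 + w * cosh v) * exp (- w * cosh v)).
 { intros v. le_by abs_cos_mul. rewrite Rabs_right by (left; apply exp_pos).
  pose proof (cosh_ge1 v).
  assert (0 < w * cosh v) by bound.
  bound. }
 split.
 - rhs (3 * (14 / sqrt w)).
  apply KV_gen_bound; auto. intros; apply KV_integrand_cont.
  intros v _. le_by Hb. apply cosh_term_bound; auto.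
  apply Rdiv_le_0_compat; lra.
 - rhs (3 * (14 / (w * sqrt w))).
  apply KV_gen_bound; auto. intros; apply KV_integrand_cont.
  intros v _. le_by Hb. apply cosh_term_bound; auto.
  bound.
Qed.

(** The factor [w] turns the [cosh v] brought down by differentiation into the [w cosh v] that
    [cosh_term_bound] controls. *)
Lemma KV1_bound V w : 0 <= V -> 0 < w -> w * Rabs (KV1 V w) <= 42 / sqrt w /\ w * Rabs (KV1 V w) <= 42 / (w * sqrt w).
Proof.
 intros HV Hw. assert (0 < sqrt w) by bound.
 assert (E : w * Rabs (KV1 V w) = Rabs (RInt (fun v => w * (- cosh v * exp (- w * cosh v) * cos (kappa * v))) 0 V)).
 { rewrite RInt_mulR. rewrite Rabs_mult, (Rabs_right w) by lra. reflexivity.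
  apply ex_RInt_cont; auto. intros; apply KV1_integrand_cont. }
 rewrite E.
 assert (Hb : forall v, Rabs (w * (- cosh v * exp (- w * cosh v) * cos (kappa * v))) <= (1 + w * cosh v) * exp (- w * cosh v)).
 { intros v. replace (w * (- cosh v * exp (- w * cosh v) * cos (kappa * v))) with ((- (w * cosh v) * exp (- w * cosh v)) * cos (kappa * v)) by ring.
  le_by abs_cos_mul. rewrite Rabs_mult, Rabs_Ropp.
  pose proof (exp_pos (- w * cosh v)). pose proof (cosh_ge1 v).
  assert (0 < w * cosh v) by bound. rewrite !Rabs_right by lra. lra. }
 assert (forall v, continuous (fun v => w * (- cosh v * exp (- w * cosh v) * cos (kappa * v))) v).
 { intros v. apply continuous_mulR. apply continuous_const. apply KV1_integrand_cont. }
 split.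
 - rhs (3 * (14 / sqrt w)).
  apply KV_gen_bound; auto.
  intros v _. le_by Hb. apply cosh_term_bound; auto.
  apply Rdiv_le_0_compat; lra.
 - rhs (3 * (14 / (w * sqrt w))).
  apply KV_gen_bound; auto.
  intros v _. le_by Hb. apply cosh_term_bound; auto.
  bound.
Qed.

(** From [(w - 1) (cosh v - 1) >= 0] one gets [w cosh v >= (w - 1) + cosh v], which splits off
    [exp (- w)] and leaves the integrand at [w = 1]; a factor [3] bounds [exp 1]. *)
Lemma cosh_exp_bound w v : 1 <= w -> (1 + cosh v) * exp (- w * cosh v) <= 42 * exp (- w) * / sqrt (cosh v).
Proof.
 intros Hw. pose proof (cosh_ge1 v) as Hc.
 destruct (cosh_term_bound 1 v ltac:(lra)) as [H _]. rewrite sqrt_1 in H.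
 assert (exp (- w * cosh v) <= exp (- w) * (3 * exp (- 1 * cosh v))).
 { apply Rle_trans with (exp (- w) * exp 1 * exp (-1 * cosh v)).
  - rewrite <- !exp_plus. destruct (Req_dec (- w * cosh v) (- w + 1 + -1 * cosh v)) as [->|Hn]; [lra|].
   left. apply exp_increasing. assert (0 <= (w - 1) * (cosh v - 1)) by bound. lra.
  - rewrite Rmult_assoc. mul_l. mul_r. apply exp_le_3. }
 apply Rle_trans with ((1 + cosh v) * (exp (- w) * (3 * exp (- 1 * cosh v)))).
 - apply Rmult_le_compat_l; lra.
 - lhs (3 * exp (- w) * ((1 + 1 * cosh v) * exp (-1 * cosh v))).
  rhs (3 * exp (- w) * (14 / 1 * / sqrt (cosh v))).
  bound.
Qed.

Lemma KV_exp_bound V w : 0 <= V -> 1 <= w -> Rabs (KV V w) <= 126 * exp (- w) /\ Rabs (KV1 V w) <= 126 * exp (- w).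
Proof.
 intros HV Hw. replace (126 * exp (- w)) with (3 * (42 * exp (- w))) by ring. pose proof (exp_pos (- w)).
 split.
 - apply KV_gen_bound; auto; try lra. intros; apply KV_integrand_cont.
  intros v _. eapply Rle_trans; [|apply cosh_exp_bound; auto].
  le_by abs_cos_mul. rewrite Rabs_right by (left; apply exp_pos).
  pose proof (exp_pos (- w * cosh v)). pose proof (cosh_ge1 v). nra.
 - apply KV_gen_bound; auto; try lra. intros; apply KV1_integrand_cont.
  intros v _. eapply Rle_trans; [|apply cosh_exp_bound; auto].
  le_by abs_cos_mul.
  pose proof (exp_pos (- w * cosh v)). pose proof (cosh_ge1 v).
  rewrite Rabs_mult, Rabs_Ropp, !Rabs_right by lra. nra.
Qed.

(** Even the crude [exp (- t) <= 14 / t] at [t = w cosh v >= w exp v / 2] gives an exponentially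
    small tail. *)
Lemma KV_tail V V' w : 0 <= V -> V <= V' -> 0 < w -> Rabs (KV V' w - KV V w) <= 84 / w * exp (- V).
Proof.
 intros HV HV' Hw. unfold KV.
 assert (ex : forall a b, ex_RInt (fun v => exp (- w * cosh v) * cos (kappa * v)) a b).
 { intros. apply (ex_RInt_continuous (V := RV)). intros; apply KV_integrand_cont. }
 rewrite (RInt_split _ 0 V V'); try lra. 2: { intros; apply KV_integrand_cont. }
 match goal with |- Rabs (?a + ?b - ?a) <= _ => replace (a + b - a) with b by (apply Rminus_diag_uniq; generalize (a : R) (b : R); intros; ring) end.
 assert (I : is_RInt (fun v => 28 / w * exp (- v)) V V' (minus (- (28 / w) * exp (- V')) (- (28 / w) * exp (- V)))).
 { apply (is_RInt_derive (V := RV) (fun v => - (28 / w) * exp (- v))).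
  - intros x _. auto_derive; auto. ring.
  - intros x _. cont. }
 eapply Rle_trans. apply abs_RInt_le; auto.
 apply Rle_trans with (RInt (fun v => 28 / w * exp (- v)) V V').
 - apply RInt_le; auto. apply ex_RInt_cont; auto. intros; apply continuous_abs, KV_integrand_cont.
  eexists; apply I. intros v Hv. le_by abs_cos_mul.
  rewrite Rabs_right by (left; apply exp_pos).
  pose proof (cosh_ge_exp v). pose proof (exp_pos v). set (t := w * cosh v).
  replace (- w * cosh v) with (- t) by bound.
  assert (exp (- t) <= 14 / t).
  { rewrite exp_Ropp. pose proof (exp_ineq1_le t). trans_l (/ t).
   unfold Rdiv. bound. }
  le_by H1. rewrite exp_Ropp.
  rhs (14 / (w * (exp v / 2))).
  mul_l. apply Rinv_le_contravar. nra. unfold t. nra.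
 - rewrite (is_RInt_unique (V := RV) _ _ _ _ I). unfold minus, plus, opp; simpl.
  assert (0 < / w * exp (- V')) by bound.
  assert (0 < / w * exp (- V)) by bound.
  bound.
Qed.

(** The truncations are Cauchy by [KV_tail]; their limit along the integers is then the limit along
    all [V], hence the value of the improper integral. *)
Lemma bessel_lim V w : 0 <= V -> 0 < w -> Rabs (bessel_K kappa w - KV V w) <= 84 / w * exp (- V).
Proof.
 intros HV Hw.
 assert (small : forall eps, 0 < eps -> exists V0, 0 <= V0 /\ forall V, V0 <= V -> 84 / w * exp (- V) < eps).
 { intros eps He. exists (Rmax 0 (84 / w / eps)). split. bound. intros V0 HV0.
  assert (84 / w / eps <= V0) by (eapply Rle_trans; [apply Rmax_r|eauto]).
  pose proof (exp_ineq1_le V0). rewrite exp_Ropp.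
  apply Rmult_lt_reg_r with (exp V0). bound.
  rewrite Rmult_assoc, Rinv_l by (apply Rgt_not_eq, exp_pos). rewrite Rmult_1_r.
  apply Rle_lt_trans with (eps * V0). apply Rmult_le_reg_r with (/ eps). bound.
  rhs V0. auto.
  bound. }
 assert (L : exists l, forall V, 0 <= V -> Rabs (l - KV V w) <= 84 / w * exp (- V)).
 { assert (C : ex_finite_lim_seq (fun n => KV (INR n) w)).
  { apply ex_lim_seq_cauchy_corr. intros eps. destruct (small eps (cond_pos eps)) as [V0 [HV0 Hs]].
   destruct (nfloor_ex V0 HV0) as [N HN]. exists (S N). intros n m Hn Hm.
   assert (Q : forall a b, (S N <= a)%nat -> (a <= b)%nat -> Rabs (KV (INR b) w - KV (INR a) w) < eps).
   { intros a b Ha Hb. eapply Rle_lt_trans. apply KV_tail; auto. bound. bound.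
    apply Hs. apply le_INR in Ha. rewrite S_INR in Ha. lra. }
   destruct (Nat.le_ge_cases n m). rewrite Rabs_minus_sym. apply Q; auto. apply Q; auto. }
  destruct C as [l Hl]. exists l. intros W HW.
  apply Rnot_lt_le. intros Hc.
  apply is_lim_seq_spec in Hl.
  assert (He : 0 < Rabs (l - KV W w) - 84 / w * exp (- W)) by lra.
  destruct (Hl (mkposreal _ He)) as [N HN]. simpl in HN.
  destruct (nfloor_ex W HW) as [n0 Hn0].
  set (n := (N + S n0)%nat). specialize (HN n ltac:(unfold n; lia)).
  assert (W <= INR n). { unfold n. rewrite plus_INR, S_INR. pose proof (pos_INR N). lra. }
  pose proof (KV_tail W (INR n) w HW H Hw).
  assert (Rabs (l - KV W w) <= Rabs (KV (INR n) w - l) + Rabs (KV (INR n) w - KV W w)).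
  { rewrite (Rabs_minus_sym (KV (INR n) w) l). replace (l - KV W w) with ((l - KV (INR n) w) + (KV (INR n) w - KV W w)) by ring. apply Rabs_triang. }
  lra. }
 destruct L as [l Hl].
 assert (E : bessel_K kappa w = l).
 { unfold bessel_K. apply is_RInt_gen_unique. intros P [eps HP].
  destruct (small eps (cond_pos eps)) as [V0 [HV0 Hs]].
  apply Filter_prod with (fun x => x = 0) (fun x => V0 < x).
  - reflexivity.
  - exists V0. auto.
  - intros x y -> Hy. exists (KV y w). split.
   + apply (RInt_correct (V := RV)). apply (ex_RInt_continuous (V := RV)). intros; apply KV_integrand_cont.
   + apply HP. change (Rabs (KV y w - l) < eps). rewrite Rabs_minus_sym.
    eapply Rle_lt_trans. apply Hl. lra. apply Hs. lra. }
 rewrite E. apply Hl; auto.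
Qed.

Lemma bessel_approx w eps : 0 < w -> 0 < eps -> exists V, 0 <= V /\ Rabs (bessel_K kappa w - KV V w) <= eps.
Proof.
 intros Hw He. exists (84 / w / eps).
 assert (0 <= 84 / w / eps) by bound.
 split; auto. eapply Rle_trans. apply bessel_lim; auto.
 set (V := 84 / w / eps) in *. rewrite exp_Ropp. pose proof (exp_ineq1_le V).
 apply Rmult_le_reg_r with (exp V). bound.
 lhs (eps * V). bound.
Qed.

Lemma bessel_exp_bound w : 1 <= w -> Rabs (bessel_K kappa w) <= 126 * exp (- w).
Proof.
 intros Hw. apply le_epsilon. intros eps He. destruct (bessel_approx w eps ltac:(lra) He) as [V [HV H]].
 destruct (KV_exp_bound V w HV Hw) as [B _].
 replace (bessel_K kappa w) with ((bessel_K kappa w - KV V w) + KV V w) by ring.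
 le_by Rabs_triang. lra.
Qed.

Lemma bessel_bound w : 0 < w -> Rabs (bessel_K kappa w) <= 42 / sqrt w.
Proof.
 intros Hw. apply le_epsilon. intros eps He. destruct (bessel_approx w eps Hw He) as [V [HV H]].
 destruct (KV_bound V w HV Hw) as [B _].
 replace (bessel_K kappa w) with ((bessel_K kappa w - KV V w) + KV V w) by ring.
 le_by Rabs_triang. lra.
Qed.

(** The mean value theorem is applied to a truncation so long that its error is at most [eps / 2] at
    both points. *)
Lemma bessel_lip w0 w w' : 1 <= w0 -> w0 <= w -> w0 <= w' ->
  Rabs (bessel_K kappa w - bessel_K kappa w') <= 126 * exp (- w0) * Rabs (w - w').
Proof.
 intros H0 Hw Hw'. apply le_epsilon. intros eps He.
 set (V := Rmax (84 / w / (eps / 2)) (84 / w' / (eps / 2))).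
 assert (P : forall u, 0 < u -> 84 / u / (eps / 2) <= V -> 0 <= V -> Rabs (bessel_K kappa u - KV V u) <= eps / 2).
 { intros u Hu HuV HV. eapply Rle_trans. apply bessel_lim; auto. rewrite exp_Ropp. pose proof (exp_ineq1_le V).
  apply Rmult_le_reg_r with (exp V). bound.
  rewrite Rmult_assoc, Rinv_l by (apply Rgt_not_eq, exp_pos).
  apply Rle_trans with (eps / 2 * V); [|apply Rmult_le_compat_l; lra].
  apply Rmult_le_reg_r with (/ (eps / 2)). bound.
  rhs V. lra. }
 assert (HV : 0 <= V) by bound.
 pose proof (P w ltac:(lra) (Rmax_l _ _) HV). pose proof (P w' ltac:(lra) (Rmax_r _ _) HV).
 assert (Rabs (KV V w - KV V w') <= 126 * exp (- w0) * Rabs (w - w')).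
 { destruct (MVT_gen (KV V) w' w (KV1 V)) as [c [Hc E]].
  - intros; apply KV_derive; auto.
  - intros. apply continuity_pt_filterlim. eapply is_derive_continuous. apply KV_derive; auto.
  - rewrite E, Rabs_mult. mul_r.
   assert (w0 <= c). { destruct Hc as [Hc _]. eapply Rle_trans; [|apply Hc]. bound. }
   destruct (KV_exp_bound V c HV ltac:(lra)) as [_ B]. le_by B.
   mul_l. destruct (Req_dec c w0) as [->|]. lra. left. apply exp_increasing. lra. }
 replace (bessel_K kappa w - bessel_K kappa w') with ((bessel_K kappa w - KV V w) + (KV V w - KV V w') + - (bessel_K kappa w' - KV V w')) by ring.
 le_by Rabs_triang. rewrite Rabs_Ropp.
 le_by Rplus_le_compat_r. apply Rabs_triang. lra.
Qed.

(* Laplace's method: the part of the integral near v = 0 dominates. *)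
Lemma bessel_lower : exists c w0, 0 < c /\ 1 <= w0 /\ forall w, w0 <= w -> c * exp (- (3 / 2) * w) <= bessel_K kappa w.
Proof.
 (* On [[0, v0]] one has [|kappa v| <= 1 <= PI / 3], hence a cosine of at least [1/2]. *)
 set (v0 := / (Rabs kappa + 1)).
 assert (Hk : 0 < Rabs kappa + 1) by bound.
 assert (Hv0 : 0 < v0) by bound.
 assert (Hv1 : v0 <= 1). { rewrite <- Rinv_1. apply Rinv_le_contravar; pose proof (Rabs_pos kappa); lra. }
 set (v1 := v0 / 2). set (c0 := cosh v0). set (c1 := cosh v1).
 assert (Hc01 : c1 < c0).
 { unfold c0, c1. assert (H : c1 <= c0) by (apply cosh_incr; unfold v1; lra).
  destruct (Req_dec (cosh v1) (cosh v0)) as [E|E].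
  - exfalso. unfold cosh in E. set (a := exp v1). assert (Ha : exp v0 = a * a). { unfold a, v1. rewrite <- exp_plus. f_equal. field. }
   assert (a > 1). { unfold a. rewrite <- exp_0. apply exp_increasing. bound. }
   rewrite !exp_Ropp in E. fold a in E. rewrite Ha in E.
   assert (E' : (a + / a) * (a * a) = (a * a + / (a * a)) * (a * a)) by nra.
   replace ((a + / a) * (a * a)) with (a * a * a + a) in E' by bound.
   replace ((a * a + / (a * a)) * (a * a)) with (a * a * (a * a) + 1) in E' by bound.
   assert (1 < a * a * a) by nra. assert (0 < (a - 1) * (a * a * a - 1)) by bound. lra.
  - unfold c0, c1 in H. lra. }
 (* Origin of the exponent [3/2] in the statement: [v1 <= 1/2] and [cosh (1/2) <= 3/2]. *)
 assert (Hc1 : c1 <= 3 / 2).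
 { apply Rle_trans with (cosh (1 / 2)). apply cosh_incr; unfold v1; lra.
  unfold cosh. assert (exp (- (1/2)) <= 1). { apply Rle_trans with (exp 0); [left; apply exp_increasing; lra | rewrite exp_0; lra]. }
  assert (exp (1/2) * exp (1/2) <= 3). { rewrite <- exp_plus. replace (1/2+1/2) with 1 by field. apply exp_le_3. }
  nra. }
 set (d := c0 - c1).
 (* The range [[0, v1]] gives the main term, [[v1, v0]] contributes a nonnegative amount and is
    dropped, and beyond [v0] the integrand is smaller by a factor [exp (- w (c0 - c1))] up to a
    constant. *)
 assert (LB : forall w, 1 <= w -> v1 / 2 * exp (- w * c1) - 42 * exp (- (w - 1) * c0) <= bessel_K kappa w).
 { intros w Hw. apply Rnot_lt_le. intros Hc.
  set (gap := v1 / 2 * exp (- w * c1) - 42 * exp (- (w - 1) * c0) - bessel_K kappa w).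
  assert (Hg : 0 < gap) by bound.
  set (V := Rmax 1 (84 / w / (gap / 2))).
  assert (HV : 1 <= V) by apply Rmax_l.
  assert (Happ : Rabs (bessel_K kappa w - KV V w) <= gap / 2).
  { eapply Rle_trans. apply bessel_lim; lra. rewrite exp_Ropp. pose proof (exp_ineq1_le V).
   apply Rmult_le_reg_r with (exp V). bound.
   rewrite Rmult_assoc, Rinv_l by (apply Rgt_not_eq, exp_pos).
   apply Rle_trans with (gap / 2 * V); [|apply Rmult_le_compat_l; lra].
   apply Rmult_le_reg_r with (/ (gap / 2)). bound.
   rhs V. unfold V. rewrite Rmult_1_r. apply Rmax_r. }
  assert (KVb : v1 / 2 * exp (- w * c1) - 42 * exp (- (w - 1) * c0) <= KV V w).
  { unfold KV.
   assert (cc : forall v, continuous (fun v => exp (- w * cosh v) * cos (kappa * v)) v) by (apply KV_integrand_cont).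
   assert (cz : forall v, 0 <= v <= v0 -> 1 / 2 <= cos (kappa * v)).
   { intros v Hv. assert (B : -1 <= kappa * v <= 1).
    { assert (Rabs (kappa * v) <= 1). rewrite Rabs_mult, (Rabs_right v) by lra.
     trans_l (Rabs kappa * v0).
     unfold v0. apply Rmult_le_reg_r with (Rabs kappa + 1); auto. rewrite Rmult_assoc, Rinv_l by lra. lra.
     split; [|]. pose proof (Rle_abs (- (kappa * v))). rewrite Rabs_Ropp in H0. lra. pose proof (Rle_abs (kappa * v)). lra. }
    rewrite <- cos_PI3.
    assert (P3 : 1 <= PI / 3). { pose proof PI2_3_2. lra. }
    destruct (Rle_dec 0 (kappa * v)).
    - apply cos_decr_1; lra.
    - rewrite <- (cos_neg (kappa * v)). apply cos_decr_1; lra. }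
   rewrite (RInt_split _ 0 v1 V) by (auto; unfold v1; lra).
   rewrite (RInt_split _ v1 v0 V) by (auto; unfold v1; lra).
   assert (I1 : v1 / 2 * exp (- w * c1) <= RInt (fun v => exp (- w * cosh v) * cos (kappa * v)) 0 v1).
   { replace (v1 / 2 * exp (- w * c1)) with (RInt (fun _ => / 2 * exp (- w * c1)) 0 v1).
    2: { rewrite RInt_const. unfold scal; simpl; unfold mult; simpl. field. }
    apply RInt_le. bound. apply ex_RInt_const. apply ex_RInt_cont; auto. bound.
    intros v Hv. rewrite Rmult_comm. apply Rmult_le_compat. bound. lra.
    - assert (cosh v <= c1) by (apply cosh_incr; lra).
     destruct (Req_dec (- w * c1) (- w * cosh v)) as [->|]. lra. left; apply exp_increasing. nra.
    - pose proof (cz v). unfold v1 in Hv. lra. }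
   assert (I2 : 0 <= RInt (fun v => exp (- w * cosh v) * cos (kappa * v)) v1 v0).
   { apply RInt_ge0. bound. apply ex_RInt_cont; auto. bound.
    intros v Hv. apply Rmult_le_pos. bound. pose proof (cz v). unfold v1 in Hv. lra. }
   assert (I3 : Rabs (RInt (fun v => exp (- w * cosh v) * cos (kappa * v)) v0 V) <= 42 * exp (- (w - 1) * c0)).
   { assert (csq : forall v, continuous (fun v => / sqrt (cosh v)) v).
    { intros v. apply continuous_invR. apply continuous_comp. apply continuous_coshR; apply continuous_id.
     apply continuous_sqrt. apply Rgt_not_eq, sqrt_lt_R0. pose proof (cosh_ge1 v); lra. }
    le_by abs_RInt_le. lra. apply ex_RInt_cont; auto; lra.
    apply Rle_trans with (RInt (fun v => 14 * exp (- (w - 1) * c0) * / sqrt (cosh v)) v0 V).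
    - apply RInt_le. lra. apply ex_RInt_cont; auto; try lra. intros; apply continuous_abs; auto.
     apply ex_RInt_cont; auto; try lra. intros; apply continuous_mulR; [apply continuous_const | auto].
     intros v Hv. le_by abs_cos_mul. rewrite Rabs_right by (left; apply exp_pos).
     assert (c0 <= cosh v) by (apply cosh_incr; lra).
     destruct (cosh_term_bound 1 v ltac:(lra)) as [B _]. rewrite sqrt_1 in B.
     pose proof (exp_pos (-1 * cosh v)).
     apply Rle_trans with (exp (- (w - 1) * c0) * exp (-1 * cosh v)).
     + rewrite <- exp_plus. destruct (Req_dec (- w * cosh v) (- (w - 1) * c0 + -1 * cosh v)) as [->|]. lra.
      left; apply exp_increasing. nra.
     + rhs (exp (- (w - 1) * c0) * (14 / 1 * / sqrt (cosh v))).
      mul_l. pose proof (cosh_ge1 v).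
      eapply Rle_trans; [|exact B]. change (- (1)) with (-1). rewrite <- (Rmult_1_l (exp (-1 * cosh v))) at 1. apply Rmult_le_compat_r; lra.
    - rewrite RInt_mulR by (apply ex_RInt_cont; auto; lra).
     rhs (14 * exp (- (w - 1) * c0) * 3).
     mul_l.
     pose proof (int_sqrt_cosh V ltac:(lra)) as HI.
     rewrite (RInt_split _ 0 v0 V) in HI by (auto; lra).
     assert (0 <= RInt (fun v => / sqrt (cosh v)) 0 v0).
     { apply RInt_ge0. lra. apply ex_RInt_cont; auto; lra. intros. left. apply Rinv_0_lt_compat, sqrt_lt_R0. pose proof (cosh_ge1 t); lra. }
     lra. }
   pose proof (Rle_abs (- RInt (fun v => exp (- w * cosh v) * cos (kappa * v)) v0 V)). rewrite Rabs_Ropp in H. lra. }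
  pose proof (Rle_abs (KV V w - bessel_K kappa w)). rewrite Rabs_minus_sym in H. unfold gap in *. lra. }
 (* choose w0 with 42 exp(c0) exp(-w d) <= v1/4 *)
 assert (0 < v1) by bound.
 set (w0 := Rmax 1 (168 * exp c0 / v1 / d)).
 exists (v1 / 4), w0. split; [lra|]. split; [apply Rmax_l|].
 intros w Hw. assert (1 <= w) by (eapply Rle_trans; [apply Rmax_l|exact Hw]).
 assert (168 * exp c0 / v1 / d <= w) by (eapply Rle_trans; [apply Rmax_r|exact Hw]).
 eapply Rle_trans; [|apply LB; auto].
 assert (42 * exp (- (w - 1) * c0) <= v1 / 4 * exp (- w * c1)).
 { replace (- (w - 1) * c0) with (c0 + (- (w * d)) + - w * c1) by bound.
  rewrite !exp_plus. rewrite <- !Rmult_assoc. mul_r.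
  rewrite exp_Ropp. apply Rmult_le_reg_r with (exp (w * d)). bound.
  apply Rle_trans with (v1 / 4 * (w * d)).
  - apply Rmult_le_reg_r with (4 / v1 / d). bound.
   rhs w.
   lhs (168 * exp c0 / v1 / d). auto.
  - mul_l. pose proof (exp_ineq1_le (w * d)). lra. }
 assert (exp (- (3/2) * w) <= exp (- w * c1)).
 { destruct (Req_dec (- (3/2) * w) (- w * c1)) as [->|]. lra. left; apply exp_increasing. nra. }
 nra.
Qed.

(** * The Fourier expansion *)

(* Dirichlet's approximation theorem by a mediant search, which also produces the complementary row of a unimodular matrix. *)
Lemma mediant_search (K : Z) (x : R) (fuel : nat) : forall h k h' k' : Z,
  (1 <= k <= K)%Z -> (1 <= k' <= K)%Z -> (h' * k - h * k' = 1)%Z ->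
  (Z.to_nat (K + 1 - (k + k')) <= fuel)%nat ->
  IZR h <= x * IZR k -> x * IZR k' <= IZR h' ->
  exists c r a b : Z, (1 <= c <= K)%Z /\ (- a * r - b * c = 1)%Z /\ Rabs (IZR c * x - IZR r) * (IZR K + 1) <= 1.
Proof.
 induction fuel as [|fuel IH]; intros h k h' k' Hk Hk' Hd Hf Hx Hx'.
 - assert (HKR : IZR K + 1 <= IZR k + IZR k') by (rewrite <- plus_IZR; change 1 with (IZR 1); rewrite <- plus_IZR; apply IZR_le; lia).
  assert (HdR : IZR h' * IZR k - IZR h * IZR k' = 1) by (rewrite <- !mult_IZR, <- minus_IZR; apply IZR_eq; auto).
  assert (Hk0 : 1 <= IZR k) by bound. assert (Hk0' : 1 <= IZR k') by bound.
  (* Without fuel the mediant has denominator above [K]. The endpoint on the same side of the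
     mediant as [x] is the approximation, and the other endpoint completes the matrix. *)
  destruct (Rle_dec (x * (IZR k + IZR k')) (IZR h + IZR h')) as [H|H].
  + exists k, h, k', (- h')%Z. split; [lia|]. split; [lia|].
   rewrite Rabs_right by lra.
   trans_l ((IZR k * x - IZR h) * (IZR k + IZR k')).
   assert (IZR k * (x * (IZR k + IZR k')) <= IZR k * (IZR h + IZR h')) by bound. lra.
  + exists k', h', (- k)%Z, h. split; [lia|]. split; [lia|].
   rewrite Rabs_left1 by lra.
   trans_l (- (IZR k' * x - IZR h') * (IZR k + IZR k')).
   assert (IZR k' * (IZR h + IZR h') <= IZR k' * (x * (IZR k + IZR k'))) by bound. lra.
 - destruct (Z_lt_dec K (k + k')) as [HK|HK].
  + apply (IH h k h' k'); auto. lia.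
  + destruct (Rle_dec (x * (IZR k + IZR k')) (IZR h + IZR h')) as [H|H].
   * apply (IH h k (h + h')%Z (k + k')%Z); auto; try lia. rewrite !plus_IZR; auto.
   * apply (IH (h + h')%Z (k + k')%Z h' k'); auto; try lia. rewrite !plus_IZR; lra.
Qed.

Lemma dirichlet (K : Z) (x : R) : (1 <= K)%Z ->
  exists c r a b : Z, (1 <= c <= K)%Z /\ (- a * r - b * c = 1)%Z /\ Rabs (IZR c * x - IZR r) * (IZR K + 1) <= 1.
Proof.
 intros HK. apply (mediant_search K x (Z.to_nat K) (Int_part x) 1 (Int_part x + 1) 1); try lia.
 - pose proof (base_Int_part x). lra.
 - pose proof (base_Int_part x). rewrite plus_IZR. lra.
Qed.

Fixpoint zl (N : nat) : list Z :=
  match N with O => nil | S n => Z.of_nat (S n) :: (- Z.of_nat (S n))%Z :: zl n end.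

Lemma in_zl N n : In n (zl N) -> (1 <= Z.abs n <= Z.of_nat N)%Z.
Proof. induction N; simpl; intros H. bound. destruct H as [<-|[<-|H]]; try lia. specialize (IHN H). lia. Qed.

Lemma lsum_zl f N : lsum f (zl N) = rsum (fun k => f (Z.of_nat (S k)) + f (- Z.of_nat (S k))%Z) N.
Proof. induction N. reflexivity. simpl lsum. rewrite IHN. simpl rsum. ring. Qed.

Lemma NoDup_zl N : NoDup (zl N).
Proof.
 induction N; [constructor|].
 constructor; [|constructor]; auto.
 - intros [H|H]. lia. apply in_zl in H. lia.
 - intros H. apply in_zl in H. lia.
Qed.

(** The real part of [exp (- i phi) z]. Bounds uniform in [phi] bound the modulus up to a factor
    [2], and a twist by [e (- m x)] only adds [2 PI m x] to [phi]. *)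
Definition cp (phi : R) (z : C) : R := Re z * cos phi + Im z * sin phi.

Lemma cp_le phi z : Rabs (cp phi z) <= Cmod z.
Proof.
 unfold cp, Cmod. destruct z as [a b]. simpl Re. simpl Im. simpl fst. simpl snd.
 apply Rsqr_incr_0_var; [|apply sqrt_pos]. rewrite <- Rsqr_abs. rewrite Rsqr_sqrt by nra.
 pose proof (sin2_cos2 phi). unfold Rsqr in *.
 pose proof (Rle_0_sqr (a * sin phi - b * cos phi)). unfold Rsqr in H0. nra.
Qed.

Lemma cp_Cmod z B : (forall phi, Rabs (cp phi z) <= B) -> Cmod z <= 2 * B.
Proof.
 intros H. pose proof (H 0) as H0. pose proof (H (PI / 2)) as H1. unfold cp in *.
 rewrite cos_0, sin_0 in H0. rewrite cos_PI2, sin_PI2 in H1.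
 rewrite Rmult_0_r, Rmult_1_r, Rplus_0_r in H0. rewrite Rmult_0_r, Rmult_1_r, Rplus_0_l in H1.
 destruct z as [a b]. simpl in H0, H1. unfold Cmod. simpl fst. simpl snd.
 pose proof (Rabs_pos a). pose proof (Rabs_pos b).
 apply Rsqr_incr_0_var; [|lra]. rewrite Rsqr_sqrt by nra. unfold Rsqr.
 rewrite <- (pow2_abs a), <- (pow2_abs b). nra.
Qed.

Variable psi : C -> C.
Variable t : Z -> C.
Hypothesis psi_inv : SL2Z_invariant psi.
Hypothesis t_exp : has_fourier_expansion psi kappa t.

Definition gn (n : Z) (y : R) : R := sqrt y * bessel_K kappa (2 * PI * Rabs (IZR n) * y).
(** The real part of [t n * exp (i phi)]: the component [cp phi] of the [n]-th term of the expansion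
    at [x + i y] is [gn n y * T n (2 PI n x - phi)]. *)
Definition T (n : Z) (phi : R) : R := Re (t n) * cos phi - Im (t n) * sin phi.
Definition PS (N : nat) (phi x y : R) : R := lsum (fun n => gn n y * T n (2 * PI * (IZR n * x) - phi)) (zl N).

Lemma T_le n phi : Rabs (T n phi) <= Cmod (t n).
Proof.
 replace (T n phi) with (cp (- phi) (t n)). apply cp_le.
 unfold cp, T. rewrite cos_neg, sin_neg. ring.
Qed.

Lemma T_lip n u v : Rabs (T n u - T n v) <= 2 * Cmod (t n) * Rabs (u - v).
Proof.
 destruct (MVT_gen (T n) v u (fun x => - Re (t n) * sin x - Im (t n) * cos x)) as [c [Hc E]].
 - intros x _. unfold T. auto_derive; auto. ring.
 - intros x _. apply continuous_pt. unfold T. cont.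
 - rewrite E, Rabs_mult. mul_r.
  replace (- Re (t n) * sin c - Im (t n) * cos c) with (T n (c + PI / 2)).
  + pose proof (T_le n (c + PI / 2)). pose proof (Cmod_ge_0 (t n)). lra.
  + unfold T. rewrite cos_plus, sin_plus, cos_PI2, sin_PI2. ring.
Qed.

Lemma cp_term phi x y n : sqrt y * cp phi (fourier_term t kappa (x, y) n) = gn n y * T n (2 * PI * (IZR n * x) - phi).
Proof.
 unfold cp, fourier_term, gn, T, e. destruct (t n) as [a b].
 unfold Re, Im, RtoC, Cmult. simpl fst. simpl snd.
 rewrite cos_minus, sin_minus. ring.
Qed.

Lemma Re_sum_n (a : nat -> C) N : Re (sum_n (G := C_AbelianMonoid) a N) = rsum (fun k => Re (a k)) (S N) /\
  Im (sum_n (G := C_AbelianMonoid) a N) = rsum (fun k => Im (a k)) (S N).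
Proof.
 induction N.
 - rewrite sum_O. simpl. split; ring.
 - rewrite sum_Sn. destruct IHN as [E1 E2].
  change (rsum (fun k => Re (a k)) (S (S N))) with (rsum (fun k => Re (a k)) (S N) + Re (a (S N))).
  change (rsum (fun k => Im (a k)) (S (S N))) with (rsum (fun k => Im (a k)) (S N) + Im (a (S N))).
  rewrite <- E1, <- E2. split; reflexivity.
Qed.

Lemma series_lim (a : nat -> C) l : is_series (V := C_R_NormedModule) a l ->
  forall eps, 0 < eps -> exists N0, forall N, (N0 <= N)%nat ->
    Rabs (rsum (fun k => Re (a k)) N - Re l) < eps /\ Rabs (rsum (fun k => Im (a k)) N - Im l) < eps.
Proof.
 intros H eps He. destruct (H (ball l (mkposreal eps He))) as [N0 HN].
 - exists (mkposreal eps He). auto.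
 - exists (S N0). intros N HNN. destruct N as [|N]; [lia|]. specialize (HN N ltac:(lia)).
  destruct HN as [B1 B2].
  destruct (Re_sum_n a N) as [E1 E2].
  rewrite <- E1, <- E2. bound.
Qed.

Lemma pointwise phi x y : 0 < y -> forall eps, 0 < eps -> exists N0, forall N, (N0 <= N)%nat ->
  Rabs (cp phi (psi (x, y)) - PS N phi x y) <= eps.
Proof.
 intros Hy eps He.
 destruct (t_exp (x, y) Hy) as [sp [sm [Hp [Hm E]]]].
 set (d := eps / (4 * (sqrt y + 1))).
 pose proof (sqrt_pos y) as Hs.
 assert (Hd : 0 < d) by bound.
 destruct (series_lim _ _ Hp d Hd) as [N1 H1]. destruct (series_lim _ _ Hm d Hd) as [N2 H2].
 exists (N1 + N2)%nat. intros N HN. destruct (H1 N ltac:(lia)) as [A1 A2]. destruct (H2 N ltac:(lia)) as [B1 B2].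
 assert (P : PS N phi x y = sqrt y * (cos phi * (rsum (fun k => Re (fourier_term t kappa (x, y) (Z.of_nat (S k)))) N + rsum (fun k => Re (fourier_term t kappa (x, y) (- Z.of_nat (S k)))) N)
   + sin phi * (rsum (fun k => Im (fourier_term t kappa (x, y) (Z.of_nat (S k)))) N + rsum (fun k => Im (fourier_term t kappa (x, y) (- Z.of_nat (S k)))) N))).
 { unfold PS. rewrite lsum_zl. rewrite <- !rsum_add. rewrite <- !rsum_mul, <- rsum_add, <- rsum_mul.
  apply rsum_ext. intros k _. rewrite <- !cp_term. unfold cp. ring. }
 rewrite P, E.
 set (a1 := rsum (fun k => Re (fourier_term t kappa (x, y) (Z.of_nat (S k)))) N) in *.
 set (a2 := rsum (fun k => Im (fourier_term t kappa (x, y) (Z.of_nat (S k)))) N) in *.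
 set (b1 := rsum (fun k => Re (fourier_term t kappa (x, y) (- Z.of_nat (S k)))) N) in *.
 set (b2 := rsum (fun k => Im (fourier_term t kappa (x, y) (- Z.of_nat (S k)))) N) in *.
 clearbody a1 a2 b1 b2.
 destruct sp as [p1 p2]. destruct sm as [m1 m2]. unfold cp, RtoC, Cmult, Cplus, Re, Im in *. simpl fst in *. simpl snd in *.
 replace ((sqrt y * (p1 + m1) - 0 * (p2 + m2)) * cos phi + (sqrt y * (p2 + m2) + 0 * (p1 + m1)) * sin phi -
   sqrt y * (cos phi * (a1 + b1) + sin phi * (a2 + b2))) with
  (sqrt y * (- ((a1 - p1) * cos phi + (b1 - m1) * cos phi) - ((a2 - p2) * sin phi + (b2 - m2) * sin phi))) by ring.
 rewrite Rabs_mult, (Rabs_right (sqrt y)) by lra.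
 assert (forall u v, Rabs u < d -> Rabs v <= 1 -> Rabs (u * v) <= d).
 { intros u v Hu Hv. rewrite <- (Rmult_1_r d). bound. }
 assert (C1 : Rabs (cos phi) <= 1) by (apply Rabs_le, COS_bound).
 assert (C2 : Rabs (sin phi) <= 1) by (apply Rabs_le, SIN_bound).
 pose proof (H _ _ A1 C1) as Q1. pose proof (H _ _ B1 C1) as Q2. pose proof (H _ _ A2 C2) as Q3. pose proof (H _ _ B2 C2) as Q4.
 apply Rabs_le_between in Q1. apply Rabs_le_between in Q2. apply Rabs_le_between in Q3. apply Rabs_le_between in Q4.
 apply Rle_trans with (sqrt y * (4 * d)).
 - mul_l. apply Rabs_le. lra.
 - unfold d. lhs (eps * (sqrt y / (sqrt y + 1))).
  bound.
Qed.

Lemma finite_max (f : nat -> R) N : exists D, 0 <= D /\ forall k, (k < N)%nat -> f k <= D.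
Proof.
 induction N as [|N [D [HD H]]]. exists 0. split; bound.
 exists (Rmax D (f N)). split. bound.
 intros k Hk. destruct (Nat.eq_dec k N) as [->|]. apply Rmax_r. eapply Rle_trans; [apply H; lia|apply Rmax_l].
Qed.

Lemma series_bounded (a : nat -> C) l : is_series (V := C_R_NormedModule) a l -> exists D, 0 <= D /\ forall k, Cmod (a k) <= D.
Proof.
 intros H. destruct (series_lim a l H 1 Rlt_0_1) as [N0 HN].
 destruct (finite_max (fun k => Cmod (a k)) N0) as [D [HD HD']].
 exists (D + 4). split. lra. intros k. destruct (lt_dec k N0) as [Hk|Hk].
 - specialize (HD' k Hk). lra.
 - destruct (HN k ltac:(lia)) as [A1 A2]. destruct (HN (S k) ltac:(lia)) as [B1 B2].
  simpl in B1, B2. apply Rabs_lt_between in A1. apply Rabs_lt_between in A2. apply Rabs_lt_between in B1. apply Rabs_lt_between in B2.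
  assert (Cmod (a k) <= 2 * 2).
  { destruct (a k) as [u v]. simpl in *. unfold Cmod. simpl fst. simpl snd.
   apply Rsqr_incr_0_var; [|lra]. rewrite Rsqr_sqrt by nra. unfold Rsqr.
   nra. }
  lra.
Qed.

(* The Fourier expansion converges at every height. *)
Lemma t_subexp delta : 0 < delta -> exists D, 0 < D /\ forall n, n <> 0%Z -> Cmod (t n) <= D * exp (delta * Rabs (IZR n)).
Proof.
 intros Hde. destruct (bessel_lower) as [c [w0 [Hc [Hw0 Hlow]]]].
 (* At this height the exponent [(3/2) (2 PI n y)] of [bessel_lower] equals [delta n]. *)
 set (y := delta / (3 * PI)).
 assert (Hy : 0 < y) by bound.
 destruct (t_exp (0, y) Hy) as [sp [sm [Hp [Hm _]]]].
 destruct (series_bounded _ _ Hp) as [D1 [HD1 B1]]. destruct (series_bounded _ _ Hm) as [D2 [HD2 B2]].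
 destruct (nfloor_ex (w0 / (2 * PI * y))) as [n1 Hn1]. { bound. }
 (* The frequencies too small for [bessel_lower] are finite in number and are covered by a
    maximum. *)
 destruct (finite_max (fun k => Cmod (t (Z.of_nat k)) + Cmod (t (- Z.of_nat k)%Z)) (S n1)) as [D3 [HD3 B3]].
 exists (D1 / c + D2 / c + D3 + 1).
 assert (0 <= D1 / c) by bound. assert (0 <= D2 / c) by bound.
 split. lra.
 intros n Hn. set (k := Z.abs_nat n).
 assert (HR : Rabs (IZR n) = INR k). { unfold k. rewrite INR_IZR_INZ, Zabs2Nat.id_abs, abs_IZR. auto. }
 assert (He1 : 1 <= exp (delta * Rabs (IZR n))).
 { rewrite HR. pose proof (exp_ineq1_le (delta * INR k)). assert (0 <= delta * INR k) by bound. lra. }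
 assert (Hnk : n = Z.of_nat k \/ n = (- Z.of_nat k)%Z) by bound.
 clearbody k.
 assert (Hfin : Cmod (t n) <= D1 / c * exp (delta * Rabs (IZR n)) \/ Cmod (t n) <= D2 / c * exp (delta * Rabs (IZR n)) \/ Cmod (t n) <= D3).
 { destruct (le_dec k n1) as [Hle|Hgt].
  - right; right. specialize (B3 k ltac:(lia)). cbv beta in B3. pose proof (Cmod_ge_0 (t (Z.of_nat k))). pose proof (Cmod_ge_0 (t (- Z.of_nat k)%Z)).
   destruct Hnk as [->| ->]; lra.
  - assert (Hbig : w0 <= 2 * PI * INR k * y).
   { assert (INR n1 + 1 <= INR k) by (rewrite <- S_INR; apply le_INR; lia).
    assert (w0 / (2 * PI * y) <= INR k) by lra.
    apply Rmult_le_reg_r with (/ (2 * PI * y)). bound.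
    rhs (INR k). auto. }
   pose proof (Hlow _ Hbig) as HL.
   assert (Ey : - (3 / 2) * (2 * PI * INR k * y) = - (delta * INR k)) by bound.
   rewrite Ey in HL.
   assert (Hmod : forall m : Z, Rabs (IZR m) = INR k -> Cmod (fourier_term t kappa (0, y) m) = Cmod (t m) * bessel_K kappa (2 * PI * INR k * y)).
   { intros m Hm'. unfold fourier_term. rewrite !Cmod_mult. rewrite Cmod_R.
    unfold Im, Re. simpl fst. rewrite Hm'.
    assert (Cmod (e (IZR m * 0)) = 1). { unfold e. rewrite Rmult_0_r, Rmult_0_r, cos_0, sin_0. unfold Cmod. simpl fst. simpl snd. replace (1 ^ 2 + 0 ^ 2) with 1 by ring. apply sqrt_1. }
    rewrite H1, Rmult_1_r. f_equal. apply Rabs_right. apply Rle_ge. eapply Rle_trans; [|apply HL].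
    bound. }
   assert (conv : forall D, Cmod (t n) * bessel_K kappa (2 * PI * INR k * y) <= D -> Cmod (t n) <= D / c * exp (delta * Rabs (IZR n))).
   { intros D HD. rewrite HR. rewrite exp_Ropp in HL.
    assert (Cmod (t n) * (c * / exp (delta * INR k)) <= D). { eapply Rle_trans; [|apply HD]. bound. }
    apply Rmult_le_reg_r with (c * / exp (delta * INR k)). bound.
    rhs D. auto. }
   destruct k as [|k']; [lia|].
   destruct Hnk as [E|E].
   + left. apply conv. rewrite <- Hmod by auto. rewrite E. apply B1.
   + right; left. apply conv. rewrite <- Hmod by auto. rewrite E. apply B2. }
 nra.
Qed.

Lemma exp_le a b : a <= b -> exp a <= exp b.
Proof. intros [H| ->]; [left; apply exp_increasing; auto | right; reflexivity]. Qed.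

Lemma exp_lt1 a : a < 0 -> exp a < 1.
Proof. intros H. rewrite <- exp_0. apply exp_increasing; auto. Qed.

Lemma sqrt_le_exp y : 0 <= y -> sqrt y <= exp y.
Proof. intros H. pose proof (sqrt_le_half y H). pose proof (exp_ineq1_le y). lra. Qed.

Lemma exp_pow_nat a n : exp (INR n * a) = exp a ^ n.
Proof.
 induction n. simpl. rewrite Rmult_0_l. apply exp_0.
 rewrite S_INR. replace ((INR n + 1) * a) with (a + INR n * a) by ring. rewrite exp_plus, IHn. reflexivity.
Qed.

Lemma geom_tail (f : nat -> R) C q N N' : 0 <= C -> 0 < q < 1 -> (N <= N')%nat ->
  (forall k, (N <= k)%nat -> Rabs (f k) <= C * q ^ k) ->
  Rabs (rsum f N' - rsum f N) <= C * q ^ N / (1 - q).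
Proof.
 intros HC Hq HN Hf.
 assert (H : forall j, Rabs (rsum f (N + j) - rsum f N) <= C * (q ^ N - q ^ (N + j)) / (1 - q)).
 { induction j.
  - rewrite Nat.add_0_r, Rminus_diag, Rabs_R0, Rminus_diag. right. field. lra.
  - rewrite Nat.add_succ_r. simpl rsum.
   replace (rsum f (N + j) + f (N + j)%nat - rsum f N) with ((rsum f (N + j) - rsum f N) + f (N + j)%nat) by ring.
   le_by Rabs_triang. specialize (Hf (N + j)%nat ltac:(lia)).
   replace (C * (q ^ N - q ^ S (N + j)) / (1 - q)) with (C * (q ^ N - q ^ (N + j)) / (1 - q) + C * q ^ (N + j)) by (simpl; field; lra).
   lra. }
 specialize (H (N' - N)%nat). replace (N + (N' - N))%nat with N' in H by lia.
 le_by H. mul_r.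
 mul_l. assert (0 < q ^ N') by bound. lra.
Qed.

Lemma mobius_eq (a b c d x y : R) : a * d - b * c = 1 -> 0 < y ->
  0 < (c * x + d) ^ 2 + (c * y) ^ 2 /\
  ((RtoC a * (x, y) + RtoC b) / (RtoC c * (x, y) + RtoC d))%C =
  (((a * x + b) * (c * x + d) + a * c * y ^ 2) / ((c * x + d) ^ 2 + (c * y) ^ 2), y / ((c * x + d) ^ 2 + (c * y) ^ 2)).
Proof.
 intros H Hy.
 assert (0 < (c * x + d) ^ 2 + (c * y) ^ 2).
 { destruct (Req_dec c 0) as [->|Hc].
  - nra.
  - assert (c * y <> 0) by nra.
   assert (0 < (c * y) * (c * y)) by nra. bound. }
 split; auto.
 apply injective_projections; simpl fst; simpl snd.
 - field. lra.
 - transitivity ((a * d - b * c) * y / ((c * x + d) ^ 2 + (c * y) ^ 2)).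
  + field. lra.
  + rewrite H. bound.
Qed.

Lemma gn_exp n y : 0 < y -> 1 <= 6 * Rabs (IZR n) * y -> Rabs (gn n y) <= 126 * sqrt y * exp (- (6 * Rabs (IZR n) * y)).
Proof.
 intros Hy H. unfold gn. rewrite Rabs_mult, (Rabs_right (sqrt y)) by (apply Rle_ge, sqrt_pos).
 pose proof PI2_3_2 as HP.
 assert (6 * Rabs (IZR n) * y <= 2 * PI * Rabs (IZR n) * y) by bound.
 rhs (sqrt y * (126 * exp (- (6 * Rabs (IZR n) * y)))).
 mul_l.
 le_by bessel_exp_bound. lra. mul_l. apply exp_le. lra.
Qed.

Lemma PS_diff N N' phi x y : PS N' phi x y - PS N phi x y =
  rsum (fun k => gn (Z.of_nat (S k)) y * T (Z.of_nat (S k)) (2 * PI * (IZR (Z.of_nat (S k)) * x) - phi) +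
     gn (- Z.of_nat (S k)) y * T (- Z.of_nat (S k)) (2 * PI * (IZR (- Z.of_nat (S k)) * x) - phi)) N' -
  rsum (fun k => gn (Z.of_nat (S k)) y * T (Z.of_nat (S k)) (2 * PI * (IZR (Z.of_nat (S k)) * x) - phi) +
     gn (- Z.of_nat (S k)) y * T (- Z.of_nat (S k)) (2 * PI * (IZR (- Z.of_nat (S k)) * x) - phi)) N.
Proof. unfold PS. rewrite !lsum_zl. bound. Qed.

Lemma abs_pm k : Rabs (IZR (Z.of_nat (S k))) = INR k + 1 /\ Rabs (IZR (- Z.of_nat (S k))) = INR k + 1.
Proof.
 rewrite opp_IZR, Rabs_Ropp, <- INR_IZR_INZ, S_INR. rewrite Rabs_right. auto. bound.
Qed.

(** The Bessel factor decays like [exp (- 6 |n| y)], against [exp (y1 |n|)] from the coefficients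
    and [exp y] from [sqrt y]. There remains a geometric tail of ratio [exp (- 4 y1)], whatever
    [phi], [x] and [y >= y1]. *)
Lemma uniform_approx y1 eps : 0 < y1 -> 0 < eps -> exists N0, forall N, (N0 <= N)%nat -> forall phi x y, y1 <= y ->
  Rabs (cp phi (psi (x, y)) - PS N phi x y) <= eps.
Proof.
 intros Hy1 He. destruct (t_subexp y1 Hy1) as [D [HD HDt]].
 set (q := exp (- (4 * y1))).
 assert (0 < q < 1). { split. bound. unfold q. apply exp_lt1. lra. }
 destruct (nfloor_ex (/ (6 * y1))) as [n1 Hn1]. { bound. }
 assert (Hc : 0 < eps / 2 * (1 - q) / (252 * D)) by bound.
 destruct (pow_lt_1_zero q ltac:(rewrite Rabs_right; lra) _ Hc) as [n2 Hn2].
 exists (n1 + n2)%nat. intros N HN phi x y Hy.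
 assert (Hterm : forall k n, (n1 <= k)%nat -> Rabs (IZR n) = INR k + 1 -> forall th, Rabs (gn n y * T n th) <= 126 * D * q ^ k).
 { intros k n Hk Hn th. apply le_INR in Hk.
  assert (Hk1 : 1 <= 6 * Rabs (IZR n) * y).
  { apply Rle_trans with (6 * (INR k + 1) * y1). 2: { bound. }
   apply Rmult_le_reg_r with (/ (6 * y1)). bound.
   rhs (INR k + 1). lra. }
  rewrite Rabs_mult.
  assert (Hn0 : n <> 0%Z). { intros ->. rewrite Rabs_R0 in Hn. pose proof (pos_INR k); lra. }
  pose proof (gn_exp n y ltac:(lra) Hk1) as G. pose proof (T_le n th) as G2. pose proof (HDt n Hn0) as G3.
  pose proof (sqrt_le_exp y ltac:(lra)) as G4.
  apply Rle_trans with (126 * exp y * exp (- (6 * Rabs (IZR n) * y)) * (D * exp (y1 * Rabs (IZR n)))).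
  - apply Rmult_le_compat; try apply Rabs_pos. le_by G.
   bound. lra.
  - replace (126 * exp y * exp (- (6 * Rabs (IZR n) * y)) * (D * exp (y1 * Rabs (IZR n)))) with
    (126 * D * (exp y * exp (- (6 * Rabs (IZR n) * y)) * exp (y1 * Rabs (IZR n)))) by ring.
   mul_l. unfold q. rewrite <- exp_pow_nat, <- !exp_plus. apply exp_le.
   assert (0 <= INR k * (y - y1)) by bound. nra. }
 apply le_epsilon. intros e' He'.
 destruct (pointwise phi x y ltac:(lra) e' He') as [N1 HN1].
 set (N' := (N + N1)%nat). specialize (HN1 N' ltac:(unfold N'; lia)).
 assert (Rabs (PS N' phi x y - PS N phi x y) <= eps / 2).
 { rewrite PS_diff. eapply Rle_trans.
  { apply (geom_tail _ (252 * D) q N N'); auto; try lra; try (unfold N'; lia).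
   intros k Hk. destruct (abs_pm k) as [E1 E2]. le_by Rabs_triang.
   pose proof (Hterm k _ ltac:(lia) E1 (2 * PI * (IZR (Z.of_nat (S k)) * x) - phi)).
   pose proof (Hterm k _ ltac:(lia) E2 (2 * PI * (IZR (- Z.of_nat (S k)) * x) - phi)). lra. }
  specialize (Hn2 N ltac:(lia)). rewrite Rabs_right in Hn2 by (left; apply pow_lt; lra).
  apply Rle_trans with (252 * D * (eps / 2 * (1 - q) / (252 * D)) / (1 - q)).
  - mul_r. apply Rmult_le_compat_l; lra.
  - bound. }
 replace (cp phi (psi (x, y)) - PS N phi x y) with ((cp phi (psi (x, y)) - PS N' phi x y) + (PS N' phi x y - PS N phi x y)) by ring.
 le_by Rabs_triang. lra.
Qed.

(** The expansion has no term [n = 0], so the whole sum is dominated by a geometric series that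
    starts at a multiple of [exp (- y)]. *)
Lemma cusp_decay : exists C, 0 < C /\ forall phi x y, 1 / 4 <= y -> Rabs (cp phi (psi (x, y))) <= C * exp (- y).
Proof.
 destruct (t_subexp (1 / 8) ltac:(lra)) as [D [HD HDt]].
 set (q := exp (- (1 / 2))).
 assert (0 < q < 1). { split. bound. unfold q. apply exp_lt1. lra. }
 exists (252 * D / (1 - q)). split. bound.
 intros phi x y Hy.
 assert (Hterm : forall k n, Rabs (IZR n) = INR k + 1 -> forall th, Rabs (gn n y * T n th) <= 126 * D * exp (- y) * q ^ k).
 { intros k n Hn th. pose proof (pos_INR k) as Hk.
  assert (Hn0 : n <> 0%Z). { intros ->. rewrite Rabs_R0 in Hn. lra. }
  assert (Hk1 : 1 <= 6 * Rabs (IZR n) * y) by nra.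
  rewrite Rabs_mult.
  pose proof (gn_exp n y ltac:(lra) Hk1) as G. pose proof (T_le n th) as G2. pose proof (HDt n Hn0) as G3.
  pose proof (sqrt_le_exp y ltac:(lra)) as G4.
  apply Rle_trans with (126 * exp y * exp (- (6 * Rabs (IZR n) * y)) * (D * exp (1 / 8 * Rabs (IZR n)))).
  - apply Rmult_le_compat; try apply Rabs_pos. le_by G.
   bound. lra.
  - replace (126 * exp y * exp (- (6 * Rabs (IZR n) * y)) * (D * exp (1 / 8 * Rabs (IZR n)))) with
    (126 * D * (exp y * exp (- (6 * Rabs (IZR n) * y)) * exp (1 / 8 * Rabs (IZR n)))) by ring.
   rewrite (Rmult_assoc (126 * D) (exp (- y))). mul_l. unfold q. rewrite <- exp_pow_nat, <- !exp_plus. apply exp_le.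
   nra. }
 apply le_epsilon. intros eps He.
 destruct (pointwise phi x y ltac:(lra) eps He) as [N HN]. specialize (HN N ltac:(lia)).
 assert (Rabs (PS N phi x y) <= 252 * D * exp (- y) * q ^ 0 / (1 - q)).
 { pose proof (PS_diff 0 N phi x y) as E. rewrite Rminus_0_r in E. rewrite E.
  apply (geom_tail _ (252 * D * exp (- y)) q 0 N); auto; try lia.
  - pose proof (exp_pos (- y)). nra.
  - intros k _. destruct (abs_pm k) as [E1 E2]. le_by Rabs_triang.
   pose proof (Hterm k _ E1 (2 * PI * (IZR (Z.of_nat (S k)) * x) - phi)).
   pose proof (Hterm k _ E2 (2 * PI * (IZR (- Z.of_nat (S k)) * x) - phi)). lra. }
 replace (cp phi (psi (x, y))) with ((cp phi (psi (x, y)) - PS N phi x y) + PS N phi x y) by ring.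
 le_by Rabs_triang. lra.
Qed.

Lemma gn_lip n y y' ym : (1 <= Rabs (IZR n)) -> 1 / 4 <= ym -> ym <= y -> ym <= y' -> y' <= 2 * ym ->
  Rabs (gn n y - gn n y') <= 1134 * Rabs (IZR n) * exp (- (5 * Rabs (IZR n) * ym)) * Rabs (y - y').
Proof.
 intros Hn Hym H1 H2 H3. pose proof PI2_3_2 as HP. pose proof PI_4 as HP4. set (N := Rabs (IZR n)) in *.
 assert (1 <= 6 * N * ym) by nra.
 assert (W : forall u, ym <= u -> 6 * N * ym <= 2 * PI * N * u) by bound.
 unfold gn. fold N.
 assert (Rabs (bessel_K kappa (2 * PI * N * y)) <= 126 * exp (- (6 * N * ym))).
 { le_by bessel_exp_bound. pose proof (W y H1); lra. mul_l. apply exp_le. pose proof (W y H1); lra. }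
 assert (Rabs (bessel_K kappa (2 * PI * N * y) - bessel_K kappa (2 * PI * N * y')) <= 126 * exp (- (6 * N * ym)) * (8 * N * Rabs (y - y'))).
 { eapply Rle_trans. apply (bessel_lip (6 * N * ym)); auto.
  mul_l. rewrite <- Rmult_minus_distr_l, Rabs_mult. mul_r.
  rewrite Rabs_right. bound. bound. }
 assert (Rabs (sqrt y - sqrt y') <= Rabs (y - y')).
 { assert (1 / 2 <= sqrt y). { replace (1/2) with (sqrt (1/4)). bound. replace (1/4) with ((1/2)*(1/2)) by field. bound. }
  assert (1 / 2 <= sqrt y'). { replace (1/2) with (sqrt (1/4)). bound. replace (1/4) with ((1/2)*(1/2)) by field. bound. }
  replace (y - y') with ((sqrt y - sqrt y') * (sqrt y + sqrt y')).
  - rewrite Rabs_mult. rewrite (Rabs_right (sqrt y + sqrt y')) by lra. rewrite <- (Rmult_1_r (Rabs (sqrt y - sqrt y'))) at 1.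
   mul_l. lra.
  - rewrite <- (sqrt_sqrt y) at 3 by lra. rewrite <- (sqrt_sqrt y') at 3 by lra. ring. }
 assert (sqrt y' <= exp (N * ym)).
 { pose proof (sqrt_le_half y' ltac:(lra)). pose proof (exp_ineq1_le (N * ym)). nra. }
 assert (E5 : exp (N * ym) * exp (- (6 * N * ym)) = exp (- (5 * N * ym))) by (rewrite <- exp_plus; f_equal; ring).
 assert (exp (- (6 * N * ym)) <= exp (- (5 * N * ym))) by (apply exp_le; nra).
 replace (sqrt y * bessel_K kappa (2 * PI * N * y) - sqrt y' * bessel_K kappa (2 * PI * N * y')) with
  ((sqrt y - sqrt y') * bessel_K kappa (2 * PI * N * y) + sqrt y' * (bessel_K kappa (2 * PI * N * y) - bessel_K kappa (2 * PI * N * y'))) by ring.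
 le_by Rabs_triang. rewrite !Rabs_mult. rewrite (Rabs_right (sqrt y')) by (apply Rle_ge, sqrt_pos).
 apply Rle_trans with (Rabs (y - y') * (126 * exp (- (6 * N * ym))) + exp (N * ym) * (126 * exp (- (6 * N * ym)) * (8 * N * Rabs (y - y')))).
 - apply Rplus_le_compat; apply Rmult_le_compat; auto; try apply Rabs_pos. apply sqrt_pos.
 - replace (exp (N * ym) * (126 * exp (- (6 * N * ym)) * (8 * N * Rabs (y - y')))) with (1008 * N * (exp (N * ym) * exp (- (6 * N * ym))) * Rabs (y - y')) by ring.
  rewrite E5.
  assert (Rabs (y - y') * (126 * exp (- (6 * N * ym))) <= 126 * N * exp (- (5 * N * ym)) * Rabs (y - y')).
  { lhs (126 * exp (- (6 * N * ym)) * Rabs (y - y')).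
   bound. }
  bound.
Qed.

(** Estimated term by term with a constant independent of [N], so that the bound passes to [psi] by
    [uniform_approx]. *)
Lemma PS_lip_cusp : exists C, 0 < C /\ forall N phi x y x' y' ym, 1 / 4 <= ym -> ym <= y -> ym <= y' -> y' <= 2 * ym ->
  Rabs (PS N phi x y - PS N phi x' y') <= C * exp (- ym) * (Rabs (x - x') + Rabs (y - y')).
Proof.
 destruct (t_subexp (1 / 8) ltac:(lra)) as [D [HD HDt]].
 set (q := exp (- (1 / 2))).
 assert (0 < q < 1). { split. bound. unfold q. apply exp_lt1. lra. }
 exists (32400 * D / (1 - q)). split. bound.
 intros N phi x y x' y' ym Hym H1 H2 H3.
 set (dd := Rabs (x - x') + Rabs (y - y')).
 pose proof (Rabs_pos (x - x')) as Hdx. pose proof (Rabs_pos (y - y')) as Hdy.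
 assert (Hterm : forall k n, Rabs (IZR n) = INR k + 1 ->
  Rabs (gn n y * T n (2 * PI * (IZR n * x) - phi) - gn n y' * T n (2 * PI * (IZR n * x') - phi)) <= 16200 * D * exp (- ym) * dd * q ^ k).
 { intros k n Hn. pose proof (pos_INR k) as Hk. pose proof PI_4 as HP4. pose proof PI_RGT_0 as HP0.
  assert (Hn0 : n <> 0%Z). { intros ->. rewrite Rabs_R0 in Hn. lra. }
  pose proof (HDt n Hn0) as G3. pose proof (T_le n (2 * PI * (IZR n * x) - phi)) as G2.
  pose proof (gn_lip n y y' ym ltac:(lra) Hym H1 H2 H3) as G.
  pose proof (gn_exp n y' ltac:(lra) ltac:(rewrite Hn; nra)) as G4.
  pose proof (T_lip n (2 * PI * (IZR n * x) - phi) (2 * PI * (IZR n * x') - phi)) as G5.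
  replace (2 * PI * (IZR n * x) - phi - (2 * PI * (IZR n * x') - phi)) with (2 * PI * (IZR n * (x - x'))) in G5 by ring.
  rewrite !Rabs_mult, (Rabs_right 2), (Rabs_right PI) in G5 by lra.
  set (M := Rabs (IZR n)) in *. set (E8 := exp (1 / 8 * M)) in *.
  assert (M <= 8 * E8). { unfold E8. pose proof (exp_ineq1_le (1 / 8 * M)). lra. }
  pose proof (sqrt_le_half y' ltac:(lra)) as G6.
  assert (sqrt y' <= exp (M * ym)). { pose proof (exp_ineq1_le (M * ym)). nra. }
  assert (Rabs (gn n y') <= 126 * exp (- (5 * M * ym))).
  { le_by G4. lhs (126 * (sqrt y' * exp (- (6 * M * y')))). mul_l.
   apply Rle_trans with (exp (M * ym) * exp (- (6 * (M * ym)))).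
   - apply Rmult_le_compat; auto. bound. bound. apply exp_le. nra.
   - rewrite <- exp_plus. apply exp_le. lra. }
  replace (gn n y * T n (2 * PI * (IZR n * x) - phi) - gn n y' * T n (2 * PI * (IZR n * x') - phi)) with
   ((gn n y - gn n y') * T n (2 * PI * (IZR n * x) - phi) + gn n y' * (T n (2 * PI * (IZR n * x) - phi) - T n (2 * PI * (IZR n * x') - phi))) by ring.
  le_by Rabs_triang. rewrite !Rabs_mult.
  set (E5 := exp (- (5 * M * ym))) in *. assert (0 < E5) by bound.
  assert (Rabs (gn n y - gn n y') * Rabs (T n (2 * PI * (IZR n * x) - phi)) <= (1134 * (8 * E8) * E5 * Rabs (y - y')) * (D * E8)).
  { apply Rmult_le_compat; try apply Rabs_pos; [|lra]. le_by G.
   bound. }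
  assert (Rabs (gn n y') * Rabs (T n (2 * PI * (IZR n * x) - phi) - T n (2 * PI * (IZR n * x') - phi)) <= 126 * E5 * (2 * (D * E8) * (2 * 4 * ((8 * E8) * Rabs (x - x'))))).
  { apply Rmult_le_compat; try apply Rabs_pos; auto. le_by G5.
   bound. }
  assert ((1134 * (8 * E8) * E5 * Rabs (y - y')) * (D * E8) + 126 * E5 * (2 * (D * E8) * (2 * 4 * ((8 * E8) * Rabs (x - x')))) <= 16200 * D * dd * (E8 * E8 * E5)).
  { replace ((1134 * (8 * E8) * E5 * Rabs (y - y')) * (D * E8) + 126 * E5 * (2 * (D * E8) * (2 * 4 * ((8 * E8) * Rabs (x - x'))))) with
    ((9072 * D * Rabs (y - y') + 16128 * D * Rabs (x - x') - 0) * (E8 * E8 * E5)) by ring.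
   mul_r. unfold dd. nra. }
  assert (E8 * E8 * E5 <= exp (- ym) * q ^ k).
  { unfold E8, E5, q. rewrite <- exp_pow_nat, <- !exp_plus. apply exp_le. nra. }
  assert (16200 * D * dd * (E8 * E8 * E5) <= 16200 * D * dd * (exp (- ym) * q ^ k)) by bound.
  lra. }
 unfold PS. rewrite !lsum_zl.
 set (F := fun k => (gn (Z.of_nat (S k)) y * T (Z.of_nat (S k)) (2 * PI * (IZR (Z.of_nat (S k)) * x) - phi) -
   gn (Z.of_nat (S k)) y' * T (Z.of_nat (S k)) (2 * PI * (IZR (Z.of_nat (S k)) * x') - phi)) +
   (gn (- Z.of_nat (S k)) y * T (- Z.of_nat (S k)) (2 * PI * (IZR (- Z.of_nat (S k)) * x) - phi) -
   gn (- Z.of_nat (S k)) y' * T (- Z.of_nat (S k)) (2 * PI * (IZR (- Z.of_nat (S k)) * x') - phi))).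
 match goal with |- Rabs (?a - ?b) <= _ => replace (a - b) with (rsum F N - rsum F 0) end.
 - rhs (32400 * D * exp (- ym) * dd * q ^ 0 / (1 - q)).
  apply geom_tail; auto; try lia.
  + repeat apply Rmult_le_pos; try lra. bound. unfold dd; lra.
  + intros k _. destruct (abs_pm k) as [E1 E2]. unfold F. le_by Rabs_triang.
   pose proof (Hterm k _ E1). pose proof (Hterm k _ E2). lra.
 - rewrite Rminus_0_r. clear. unfold F. induction N; [simpl; ring|]. cbn [rsum]. bound.
Qed.

Lemma psi_lip_cusp : exists C, 0 < C /\ forall phi x y x' y' ym, 1 / 4 <= ym -> ym <= y -> ym <= y' -> y' <= 2 * ym ->
  Rabs (cp phi (psi (x, y)) - cp phi (psi (x', y'))) <= C * exp (- ym) * (Rabs (x - x') + Rabs (y - y')).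
Proof.
 destruct PS_lip_cusp as [C [HC H]]. exists C. split; auto.
 intros phi x y x' y' ym H0 H1 H2 H3. apply le_epsilon. intros eps He.
 destruct (uniform_approx ym (eps / 2) ltac:(lra) ltac:(lra)) as [N HN].
 pose proof (HN N (le_n _) phi x y H1) as A. pose proof (HN N (le_n _) phi x' y' H2) as A'.
 pose proof (H N phi x y x' y' ym H0 H1 H2 H3) as B.
 replace (cp phi (psi (x, y)) - cp phi (psi (x', y'))) with
  ((cp phi (psi (x, y)) - PS N phi x y) + (PS N phi x y - PS N phi x' y') + - (cp phi (psi (x', y')) - PS N phi x' y')) by ring.
 le_by Rabs_triang. rewrite Rabs_Ropp.
 le_by Rplus_le_compat_r. apply Rabs_triang. lra.
Qed.

(** Height [1/2] replaces the fundamental domain. Dirichlet's theorem with denominators up to about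
    [/ sqrt y] gives [|c x + d| <= sqrt y] and [c y <= sqrt y], so that [|c z + d|^2 <= 2 y]. *)
Lemma reduction x y : 0 < y -> exists a b c d : Z, (a * d - b * c = 1)%Z /\
   1 / 2 <= y / ((IZR c * x + IZR d) ^ 2 + (IZR c * y) ^ 2).
Proof.
 intros Hy. destruct (Rle_dec (1 / 2) y) as [H|H].
 - exists 1%Z, 0%Z, 0%Z, 1%Z. split. lia. replace ((0 * x + 1) ^ 2 + (0 * y) ^ 2) with 1 by ring. lra.
 - set (s := sqrt y). assert (Hs : 0 < s) by bound.
  assert (Hss : s * s = y) by bound.
  assert (Hs1 : s < 1) by nra.
  pose proof (archimed (/ s)) as [Ha1 Ha2].
  set (K := (up (/ s) - 1)%Z).
  assert (HKR : IZR K = IZR (up (/ s)) - 1) by (unfold K; rewrite minus_IZR; auto).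
  assert (Hinvs : 1 < / s) by (rewrite <- Rinv_1; apply Rinv_lt_contravar; lra).
  assert (HK1 : (1 <= K)%Z). { assert (0 < IZR K) by lra. apply lt_IZR in H0. lia. }
  destruct (dirichlet K x HK1) as [c [r [a [b [Hc [Hd Hap]]]]]].
  exists a, b, c, (- r)%Z. split. lia.
  rewrite opp_IZR. set (p := IZR c * x + - IZR r).
  assert (Rabs p * (/ s) <= 1).
  { eapply Rle_trans; [|apply Hap]. mul_l. lra. }
  assert (Rabs p <= s). { apply Rmult_le_reg_r with (/ s). lra. rewrite Rinv_r by lra. auto. }
  assert (p ^ 2 <= y). { rewrite <- pow2_abs. pose proof (Rabs_pos p). nra. }
  assert (1 <= IZR c <= / s). { split. bound. trans_l (IZR K). lra. }
  assert (IZR c * s <= 1). { trans_l (/ s * s). bound. }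
  assert ((IZR c * y) ^ 2 <= y). { assert (0 <= IZR c * s) by nra. assert ((IZR c * s) ^ 2 <= 1) by nra. nra. }
  assert (0 < p ^ 2 + (IZR c * y) ^ 2) by bound.
  apply Rmult_le_reg_r with (p ^ 2 + (IZR c * y) ^ 2); auto. unfold Rdiv at 2. rewrite Rmult_assoc, Rinv_l by lra. lra.
Qed.

Lemma psi_bounded : exists B, 0 < B /\ forall phi x y, 0 < y -> Rabs (cp phi (psi (x, y))) <= B.
Proof.
 destruct cusp_decay as [C [HC H]]. exists C. split; auto. intros phi x y Hy.
 destruct (reduction x y Hy) as [a [b [c [d [Hd Him]]]]].
 assert (HdR : IZR a * IZR d - IZR b * IZR c = 1) by (rewrite <- !mult_IZR, <- minus_IZR; apply IZR_eq; auto).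
 destruct (mobius_eq (IZR a) (IZR b) (IZR c) (IZR d) x y HdR Hy) as [_ E].
 rewrite <- (psi_inv a b c d Hd (x, y) Hy). rewrite E.
 le_by H. lra. rewrite <- (Rmult_1_r C) at 2. mul_l.
 match goal with |- exp (- ?u) <= 1 => assert (0 < u) by lra; left; apply exp_lt1; lra end.
Qed.

(* The invariance of the hyperbolic distance carries the Lipschitz bound near the cusp to the whole half-plane. *)
Lemma psi_lip : exists C, 0 < C /\ forall phi x y x' y', 0 < y -> Rabs (x - x') + Rabs (y - y') <= y / 8 ->
  Rabs (cp phi (psi (x, y)) - cp phi (psi (x', y'))) <= C * ((Rabs (x - x') + Rabs (y - y')) / y).
Proof.
 destruct psi_lip_cusp as [C [HC H]]. exists (4 * C). split. lra.
 intros phi x y x' y' Hy Hdd. set (dd := Rabs (x - x') + Rabs (y - y')) in *.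
 pose proof (Rabs_pos (x - x')) as Hdx. pose proof (Rabs_pos (y - y')) as Hdy.
 assert (7 / 8 * y <= y' <= 9 / 8 * y).
 { assert (Rabs (y - y') <= y / 8) by (unfold dd in Hdd; lra). apply Rabs_le_between in H0. lra. }
 destruct (reduction x y Hy) as [a [b [c [d [Hd Him]]]]].
 assert (HdR : IZR a * IZR d - IZR b * IZR c = 1) by (rewrite <- !mult_IZR, <- minus_IZR; apply IZR_eq; auto).
 destruct (mobius_eq (IZR a) (IZR b) (IZR c) (IZR d) x y HdR Hy) as [P E].
 destruct (mobius_eq (IZR a) (IZR b) (IZR c) (IZR d) x' y' HdR ltac:(lra)) as [P' E'].
 set (z := (x, y) : Complex.C). set (z' := (x', y') : Complex.C).
 set (w := (RtoC (IZR c) * z + RtoC (IZR d))%C). set (w' := (RtoC (IZR c) * z' + RtoC (IZR d))%C).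
 set (j2 := (IZR c * x + IZR d) ^ 2 + (IZR c * y) ^ 2) in *. set (j2' := (IZR c * x' + IZR d) ^ 2 + (IZR c * y') ^ 2) in *.
 set (j := Cmod w). set (j' := Cmod w').
 assert (Hj2 : j * j = j2).
 { unfold j, Cmod, w, z, j2. unfold Cplus, Cmult, RtoC; simpl fst; simpl snd. rewrite sqrt_sqrt by (apply Rplus_le_le_0_compat; apply pow2_ge_0). ring. }
 assert (j' * j' = j2').
 { unfold j', Cmod, w', z', j2'. unfold Cplus, Cmult, RtoC; simpl fst; simpl snd. rewrite sqrt_sqrt by (apply Rplus_le_le_0_compat; apply pow2_ge_0). ring. }
 assert (Hj : 0 < j). { assert (0 <= j) by bound. nra. }
 assert (Hj' : 0 < j'). { assert (0 <= j') by bound. nra. }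
 assert (Cmod (z - z')%C <= dd).
 { unfold dd, z, z', Cmod, Cminus, Cplus, Copp. simpl fst; simpl snd.
  apply Rsqr_incr_0_var; [|lra]. rewrite Rsqr_sqrt by (apply Rplus_le_le_0_compat; apply pow2_ge_0). unfold Rsqr. fold (x - x') (y - y').
  rewrite <- (pow2_abs (x - x')), <- (pow2_abs (y - y')). nra. }
 assert (Rabs (IZR c) * y <= j).
 { rewrite <- (Rabs_right y) at 1 by lra. rewrite <- Rabs_mult. apply Rsqr_incr_0_var; [|lra]. unfold Rsqr. rewrite Hj2. unfold j2.
  assert (Rabs (IZR c * y) * Rabs (IZR c * y) = (IZR c * y) ^ 2). { rewrite <- pow2_abs. ring. }
  pose proof (pow2_ge_0 (IZR c * x + IZR d)). lra. }
 (* A displacement of at most [y / 8] changes [c z + d] by at most an eighth of its modulus, so the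
    two points are carried to comparable heights. *)
 assert (Cmod (w - w')%C <= j / 8).
 { replace (w - w')%C with (RtoC (IZR c) * (z - z'))%C by (unfold w, w'; ring). rewrite Cmod_mult, Cmod_R.
  trans_l (Rabs (IZR c) * (y / 8)). lra. }
 assert (7 / 8 * j <= j' <= 9 / 8 * j).
 { pose proof (Cmod_triangle w (w' - w)%C) as T1. pose proof (Cmod_triangle w' (w - w')%C) as T2.
  replace (w + (w' - w))%C with w' in T1 by ring. replace (w' + (w - w'))%C with w in T2 by ring.
  assert (Cmod (w' - w)%C = Cmod (w - w')%C). { replace (w' - w)%C with (- (w - w'))%C by ring. apply Cmod_opp. }
  fold j in T1, T2. bound. }
 assert (w <> 0%C). { intros E0. unfold j in Hj. rewrite E0, Cmod_0 in Hj. lra. }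
 assert (w' <> 0%C). { intros E0. unfold j' in Hj'. rewrite E0, Cmod_0 in Hj'. lra. }
 assert (Hyy' : 0 < y') by lra.
 rewrite <- (psi_inv a b c d Hd z Hy). rewrite <- (psi_inv a b c d Hd z' Hyy').
 set (g := ((RtoC (IZR a) * z + RtoC (IZR b)) / (RtoC (IZR c) * z + RtoC (IZR d)))%C) in *.
 set (g' := ((RtoC (IZR a) * z' + RtoC (IZR b)) / (RtoC (IZR c) * z' + RtoC (IZR d)))%C) in *.
 assert (Hgg : Cmod (g - g')%C <= 8 / 7 * (dd / (j * j))).
 { assert (Eg : (g - g' = (z - z') / (w * w'))%C).
  { transitivity (((RtoC (IZR a) * RtoC (IZR d) - RtoC (IZR b) * RtoC (IZR c)) * (z - z')) / (w * w'))%C.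
   - unfold g, g'. unfold w, w' in *. field. split; auto.
   - rewrite <- !RtoC_mult, <- RtoC_minus, HdR. field. bound. }
  rewrite Eg, Cmod_div by (apply Cmult_neq_0; auto). rewrite Cmod_mult. fold j j'.
  apply Rle_trans with (dd / (j * (7 / 8 * j))).
  - apply Rmult_le_compat. bound. bound. auto.
   apply Rinv_le_contravar. nra. apply Rmult_le_compat_l; lra.
  - bound. }
 pose proof (E : g = _) as E2. pose proof (E' : g' = _) as E2'. rewrite E2, E2' in Hgg. rewrite E2, E2'.
 match type of E2 with g = (?u, ?v) => set (X := u) in *; set (Y := v) in * end.
 match type of E2' with g' = (?u, ?v) => set (X' := u) in *; set (Y' := v) in * end.
 assert (Rabs (X - X') <= 8 / 7 * (dd / (j * j))).
 { eapply Rle_trans; [|apply Hgg]. apply (Rle_trans _ (Rmax (Rabs (fst ((X, Y) - (X', Y'))%C)) (Rabs (snd ((X, Y) - (X', Y'))%C)))). apply Rmax_l. apply Rmax_Cmod. }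
 assert (Rabs (Y - Y') <= 8 / 7 * (dd / (j * j))).
 { eapply Rle_trans; [|apply Hgg]. apply (Rle_trans _ (Rmax (Rabs (fst ((X, Y) - (X', Y'))%C)) (Rabs (snd ((X, Y) - (X', Y'))%C)))). apply Rmax_r. apply Rmax_Cmod. }
 assert (8 / 7 * (dd / (j * j)) = 8 / 7 * (dd / y) * Y).
 { unfold Y. rewrite <- Hj2. bound. }
 assert (dd / y <= 1 / 8). { apply Rmult_le_reg_r with y; auto. unfold Rdiv at 1. rewrite Rmult_assoc, Rinv_l by lra. lra. }
 assert (HY2 : Rabs (Y - Y') <= Y / 7) by nra.
 apply Rabs_le_between in HY2.
 (* [Y'] lies between [6/7 Y] and [8/7 Y], so [6/7 Y] is a common lower height. The decay
    [exp (- 6/7 Y) <= / (6/7 Y)] then cancels the factor [Y] in the distance of the images. *)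
 eapply Rle_trans. apply (H phi X Y X' Y' (6 / 7 * Y)); lra.
 pose proof (exp_ineq1_le (6 / 7 * Y)) as He. rewrite exp_Ropp.
 apply Rle_trans with (C * / (6 / 7 * Y) * (8 / 7 * (dd / y) * Y + 8 / 7 * (dd / y) * Y)).
 - apply Rmult_le_compat. bound.
  bound. bound. lra.
 - lhs (8 / 3 * C * (dd / y)).
  bound.
Qed.

Lemma int_cos_period j phi : j <> 0%Z -> RInt (fun x => cos (2 * PI * (IZR j * x) + phi)) 0 1 = 0.
Proof.
 intros Hj. assert (IZR j <> 0) by (apply not_0_IZR; auto). pose proof PI_RGT_0.
 assert (I : is_RInt (fun x => cos (2 * PI * (IZR j * x) + phi)) 0 1
  (minus (/ (2 * PI * IZR j) * sin (2 * PI * (IZR j * 1) + phi)) (/ (2 * PI * IZR j) * sin (2 * PI * (IZR j * 0) + phi)))).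
 { apply (is_RInt_derive (V := RV) (fun x => / (2 * PI * IZR j) * sin (2 * PI * (IZR j * x) + phi))).
  - intros x _. auto_derive; auto. field. lra.
  - intros x _. cont. }
 rewrite (is_RInt_unique (V := RV) _ _ _ _ I). unfold minus, plus, opp; simpl.
 replace (sin (2 * PI * (IZR j * 1) + phi)) with (sin (2 * PI * (IZR j * 0) + phi)). ring.
 rewrite Rmult_0_r, Rmult_0_r, Rplus_0_l, Rmult_1_r, Rplus_comm.
 destruct j as [|p|p]; [congruence| |].
 - rewrite <- (sin_period phi (Pos.to_nat p)). f_equal. rewrite INR_IZR_INZ, positive_nat_Z. ring.
 - rewrite <- (sin_period (phi + 2 * PI * IZR (Z.neg p)) (Pos.to_nat p)). f_equal. rewrite INR_IZR_INZ, positive_nat_Z.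
  change (Z.neg p) with (- Z.pos p)%Z. rewrite opp_IZR. ring.
Qed.

(** The real form of [t n] times the conjugate of [t m]: adding the product of the companions
    shifted by [PI / 2] leaves only the difference of the phases. *)
Lemma T_prod n m a b : T n a * T m b + T n (a - PI / 2) * T m (b - PI / 2) =
  (Re (t n) * Re (t m) + Im (t n) * Im (t m)) * cos (a - b + 0) + (Re (t n) * Im (t m) - Im (t n) * Re (t m)) * cos (a - b - PI / 2).
Proof.
 unfold T. rewrite Rplus_0_r, !cos_minus, !sin_minus, cos_PI2, sin_PI2. ring.
Qed.

Definition Tl (y phi : R) (l : list Z) (x : R) : R := lsum (fun n => gn n y * T n (2 * PI * (IZR n * x) - phi)) l.

Lemma T_cont n (f : R -> R) x : continuous f x -> continuous (fun x => T n (f x)) x.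
Proof. intros. unfold T. cont. Qed.

Lemma Tl_cont y phi l x : continuous (Tl y phi l) x.
Proof. apply lsum_cont. intros n _. apply continuous_mulR. apply continuous_const. apply T_cont. cont. Qed.

(** The components at [0] and [PI / 2] are the real and imaginary parts, so the integrand is a
    squared modulus. Frequencies are added one at a time, and each new cross term integrates to
    zero. *)
Lemma parseval y l : NoDup l -> RInt (fun x => Tl y 0 l x * Tl y 0 l x + Tl y (PI / 2) l x * Tl y (PI / 2) l x) 0 1 =
  lsum (fun n => gn n y ^ 2 * Cmod (t n) ^ 2) l.
Proof.
 induction l as [|n l IH]; intros Hl.
 - unfold Tl. rewrite (RInt_ext _ (fun _ => 0)) by (intros; simpl; ring). rewrite RInt_const.
  unfold scal; simpl; unfold mult; simpl; ring.
 - inversion Hl as [|? ? Hn Hl']; subst. cbn [lsum]. rewrite <- IH by auto.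
  set (c := gn n y).
  set (G := fun m x => 2 * c * gn m y * (T n (2 * PI * (IZR n * x)) * T m (2 * PI * (IZR m * x)) + T n (2 * PI * (IZR n * x) - PI / 2) * T m (2 * PI * (IZR m * x) - PI / 2))).
  assert (cG : forall m x, continuous (G m) x).
  { intros m x. unfold G. apply continuous_mulR; [apply continuous_const|]. apply continuous_addR; apply continuous_mulR; apply T_cont; cont. }
  assert (E : forall x, Tl y 0 (n :: l) x * Tl y 0 (n :: l) x + Tl y (PI / 2) (n :: l) x * Tl y (PI / 2) (n :: l) x =
   (c ^ 2 * Cmod (t n) ^ 2 + (Tl y 0 l x * Tl y 0 l x + Tl y (PI / 2) l x * Tl y (PI / 2) l x)) + lsum (fun m => G m x) l).
  { intros x.
   assert (E1 : lsum (fun m => G m x) l = 2 * c * (T n (2 * PI * (IZR n * x)) * Tl y 0 l x + T n (2 * PI * (IZR n * x) - PI / 2) * Tl y (PI / 2) l x)).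
   { unfold Tl. rewrite <- !lsum_mul, <- lsum_add, <- lsum_mul. apply lsum_ext. intros m _. unfold G. rewrite Rminus_0_r. ring. }
   assert (E2 : Cmod (t n) ^ 2 = T n (2 * PI * (IZR n * x)) ^ 2 + T n (2 * PI * (IZR n * x) - PI / 2) ^ 2).
   { unfold T, Cmod. destruct (t n) as [u v]. simpl Re; simpl Im; simpl fst; simpl snd.
    rewrite pow2_sqrt by (apply Rplus_le_le_0_compat; apply pow2_ge_0).
    rewrite cos_minus, sin_minus, cos_PI2, sin_PI2. pose proof (sin2_cos2 (2 * PI * (IZR n * x))) as S. unfold Rsqr in S.
    nra. }
   rewrite E1, E2. unfold Tl. cbn [lsum]. fold c. rewrite !Rminus_0_r. ring. }
  rewrite (RInt_ext _ _ _ _ (fun x _ => E x)).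
  destruct (lsum_RInt G l 0 1) as [S1 S2].
  { intros m _. apply ex_RInt_cont. lra. intros; apply cG. }
  assert (ex_RInt (fun x => Tl y 0 l x * Tl y 0 l x + Tl y (PI / 2) l x * Tl y (PI / 2) l x) 0 1).
  { apply ex_RInt_cont. lra. intros. apply continuous_addR; apply continuous_mulR; apply Tl_cont. }
  rewrite RInt_addR; auto. 2: { apply ex_RInt_addR; auto. apply ex_RInt_const. }
  rewrite RInt_addR; auto. 2: apply ex_RInt_const.
  rewrite S1, RInt_const.
  rewrite (lsum_ext _ (fun _ => 0) l). rewrite lsum_const. unfold scal; simpl; unfold mult; simpl; ring.
  intros m Hm. assert (n <> m) by (intros ->; auto). unfold G.
  set (P := 2 * c * gn m y * (Re (t n) * Re (t m) + Im (t n) * Im (t m))). set (Q := 2 * c * gn m y * (Re (t n) * Im (t m) - Im (t n) * Re (t m))).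
  rewrite (RInt_ext _ (fun x => P * cos (2 * PI * (IZR (n - m) * x) + 0) + Q * cos (2 * PI * (IZR (n - m) * x) + - (PI / 2)))).
  + assert (ec : forall phi, ex_RInt (fun x => cos (2 * PI * (IZR (n - m) * x) + phi)) 0 1).
   { intros phi. apply ex_RInt_cont. lra. intros. cont. }
   assert (Hd : (n - m)%Z <> 0%Z) by lia.
   rewrite (RInt_addR (fun x => P * cos (2 * PI * (IZR (n - m) * x) + 0)) (fun x => Q * cos (2 * PI * (IZR (n - m) * x) + - (PI / 2)))).
   2, 3: apply ex_RInt_mulR; apply ec.
   rewrite (RInt_mulR P (fun x => cos (2 * PI * (IZR (n - m) * x) + 0)) 0 1 (ec 0)).
   rewrite (RInt_mulR Q (fun x => cos (2 * PI * (IZR (n - m) * x) + - (PI / 2))) 0 1 (ec (- (PI / 2)))).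
   rewrite (int_cos_period _ 0 Hd), (int_cos_period _ (- (PI / 2)) Hd). ring.
  + intros x _. rewrite T_prod. rewrite minus_IZR. unfold P, Q.
   replace (2 * PI * (IZR n * x) - 2 * PI * (IZR m * x)) with (2 * PI * ((IZR n - IZR m) * x)) by ring. unfold Rminus. bound.
Qed.

Lemma PS_Tl N phi x y : PS N phi x y = Tl y phi (zl N) x.
Proof. reflexivity. Qed.

(* Parseval and the boundedness of [psi], at height about [1 / N]. *)
Lemma coef_sum_block : exists C, 0 < C /\ forall N, (1 <= N)%nat ->
  rsum (fun k => Cmod (t (Z.of_nat (S k))) + Cmod (t (- Z.of_nat (S k)))) (2 * N) <=
  rsum (fun k => Cmod (t (Z.of_nat (S k))) + Cmod (t (- Z.of_nat (S k)))) N + C * INR N.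
Proof.
 destruct (psi_bounded) as [B [HB HBd]].
 destruct (bessel_lower) as [c [w0 [Hc [Hw0 Hlow]]]].
 pose proof PI_RGT_0 as HPI.
 (* [bessel_lower] at the far end [2 w0] of the range of arguments, whence the exponent [3 w0]. *)
 set (c2 := c * exp (- 3 * w0)).
 set (C := (2 * (B + 1) ^ 2) * (2 * PI) / (w0 * c2 ^ 2)).
 assert (HC0 : 0 < C) by bound.
 exists (C + 1). split; [lra|]. intros N HN.
 assert (HNR : 1 <= INR N) by bound.
 (* The height at which frequencies from [N] to [2 N] have Bessel arguments from [w0] to [2 w0]. *)
 set (y := w0 / (2 * PI * INR N)).
 assert (Hy : 0 < y) by bound.
 destruct (uniform_approx y 1 Hy Rlt_0_1) as [N0 HN0].
 set (N1 := (N0 + 2 * N)%nat).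
 assert (Hb : forall phi x, Rabs (Tl y phi (zl N1) x) <= B + 1).
 { intros phi x. specialize (HN0 N1 ltac:(unfold N1; lia) phi x y (Rle_refl _)). rewrite PS_Tl in HN0. specialize (HBd phi x y Hy).
  apply Rabs_le_between in HN0. apply Rabs_le_between in HBd. apply Rabs_le. lra. }
 pose proof (parseval y (zl N1) (NoDup_zl N1)) as P.
 assert (U : RInt (fun x => Tl y 0 (zl N1) x * Tl y 0 (zl N1) x + Tl y (PI / 2) (zl N1) x * Tl y (PI / 2) (zl N1) x) 0 1 <= 2 * (B + 1) ^ 2).
 { rhs ((1 - 0) * (2 * (B + 1) ^ 2)). apply RInt_le_const. lra.
  apply ex_RInt_cont. lra. intros; apply continuous_addR; apply continuous_mulR; apply Tl_cont.
  intros x _. pose proof (Hb 0 x) as h1. pose proof (Hb (PI / 2) x) as h2.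
  assert (forall u, Rabs u <= B + 1 -> u * u <= (B + 1) ^ 2). { intros u Hu. apply Rabs_le_between in Hu. nra. }
  pose proof (H _ h1). pose proof (H _ h2). lra. }
 rewrite P, lsum_zl in U.
 set (a := fun k => gn (Z.of_nat (S k)) y ^ 2 * Cmod (t (Z.of_nat (S k))) ^ 2 + gn (- Z.of_nat (S k)) y ^ 2 * Cmod (t (- Z.of_nat (S k))) ^ 2) in U.
 assert (Ha : forall k, 0 <= a k) by bound.
 assert (Hmono : forall p q, rsum a p <= rsum a (p + q)).
 { intros p q. induction q. rewrite Nat.add_0_r; lra. rewrite Nat.add_succ_r. simpl rsum. pose proof (Ha (p + q)%nat). lra. }
 assert (Hy2 : y * c2 ^ 2 = (2 * (B + 1) ^ 2) / (C * INR N)).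
 { unfold y, C. bound. }
 set (d := y * c2 ^ 2) in *. assert (0 < d) by bound.
 set (b := fun k => Cmod (t (Z.of_nat (S k))) + Cmod (t (- Z.of_nat (S k)))).
 (* [u <= (u^2 + 1) / 2] turns the second moment into a first moment; the [1] sums to [N]. *)
 assert (Hab : forall k, (N <= k < 2 * N)%nat -> b k <= a k / d / 2 + 1).
 { intros k Hk.
  assert (G : forall n, Rabs (IZR n) = INR k + 1 -> d <= gn n y ^ 2).
  { intros n Hn. unfold gn. rewrite Hn. set (w := 2 * PI * (INR k + 1) * y).
   assert (w = w0 * ((INR k + 1) / INR N)) by (unfold w, y; field; lra).
   assert (INR N <= INR k + 1 <= 2 * INR N).
   { split. trans_l (INR k). lra. rewrite <- S_INR. replace (2 * INR N) with (INR (2 * N)) by (rewrite mult_INR; simpl; ring). bound. }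
   assert (1 <= (INR k + 1) / INR N <= 2) by bound.
   assert (w0 <= w <= 2 * w0) by nra.
   pose proof (Hlow w ltac:(lra)) as HL.
   assert (c2 <= bessel_K kappa w). { eapply Rle_trans; [|apply HL]. mul_l. apply exp_le. lra. }
   rewrite Rpow_mult_distr, pow2_sqrt by lra. bound. }
  destruct (abs_pm k) as [E1 E2]. pose proof (G _ E1) as G1. pose proof (G _ E2) as G2.
  unfold a, b. set (u := Cmod (t (Z.of_nat (S k)))). set (v := Cmod (t (- Z.of_nat (S k)))).
  assert (h1 : u <= u ^ 2 / 2 + 1 / 2) by (pose proof (pow2_ge_0 (u - 1)); lra).
  assert (h2 : v <= v ^ 2 / 2 + 1 / 2) by (pose proof (pow2_ge_0 (v - 1)); lra).
  assert (u ^ 2 + v ^ 2 <= (gn (Z.of_nat (S k)) y ^ 2 * u ^ 2 + gn (- Z.of_nat (S k)) y ^ 2 * v ^ 2) / d).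
  { apply Rmult_le_reg_r with d; auto. unfold Rdiv. rewrite Rmult_assoc, Rinv_l by lra.
   nra. }
  lra. }
 assert (Hsum : forall j, (j <= N)%nat -> rsum b (N + j) <= rsum b N + rsum a (N + j) / d / 2 + INR j).
 { induction j; intros Hj.
  - rewrite Nat.add_0_r. simpl. assert (0 <= rsum a N) by (apply rsum_pos; auto).
   assert (0 <= rsum a N / d) by bound. lra.
  - rewrite Nat.add_succ_r. cbn [rsum]. rewrite S_INR. specialize (IHj ltac:(lia)). specialize (Hab (N + j)%nat ltac:(lia)).
   bound. }
 specialize (Hsum N (le_n _)). replace (N + N)%nat with (2 * N)%nat in Hsum by lia.
 le_by Hsum.
 assert (rsum a (2 * N) <= 2 * (B + 1) ^ 2). { eapply Rle_trans; [|apply U]. unfold N1. rewrite (Nat.add_comm N0). apply Hmono. }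
 assert (rsum a (2 * N) / d <= C * INR N).
 { apply Rmult_le_reg_r with d; auto. unfold Rdiv. rewrite Rmult_assoc, Rinv_l by lra. rewrite Hy2.
  rhs (2 * (B + 1) ^ 2). lra. }
 nra.
Qed.

(** Strong induction by halving. As the half [m] is at most [3 N / 4], a constant [K] reproduces
    itself once [3/4 (K + C1) <= K]. On average over [n] this is as strong as [t n] being
    bounded. *)
Lemma coef_sum : exists C, 0 < C /\ forall N,
  rsum (fun k => Cmod (t (Z.of_nat (S k))) + Cmod (t (- Z.of_nat (S k)))) N <= C * INR N.
Proof.
 destruct coef_sum_block as [C1 [HC1 H]].
 set (b := fun k => Cmod (t (Z.of_nat (S k))) + Cmod (t (- Z.of_nat (S k)))) in *.
 assert (Hb : forall k, 0 <= b k) by bound.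
 exists (3 * C1 + b 0%nat). pose proof (Hb 0%nat). split. lra.
 intros N. induction N as [N IH] using (well_founded_induction lt_wf).
 destruct (le_lt_dec N 1) as [HN|HN].
 - destruct N as [|[|N]]; [simpl; lra| simpl; lra | lia].
 - set (m := ((N + 1) / 2)%nat).
  assert (Hm : (N <= 2 * m)%nat /\ (2 * m <= N + 1)%nat). { unfold m. pose proof (Nat.div_mod (N + 1) 2 ltac:(lia)). pose proof (Nat.mod_upper_bound (N + 1) 2 ltac:(lia)). lia. }
  assert (Hmono : forall p q, rsum b p <= rsum b (p + q)).
  { intros p q. induction q. rewrite Nat.add_0_r; lra. rewrite Nat.add_succ_r. cbn [rsum]. pose proof (Hb (p + q)%nat). lra. }
  apply Rle_trans with (rsum b (2 * m)). { replace (2 * m)%nat with (N + (2 * m - N))%nat by lia. apply Hmono. }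
  le_by H. lia. specialize (IH m ltac:(lia)).
  assert (INR m <= 3 / 4 * INR N).
  { destruct Hm as [_ Hm]. apply le_INR in Hm. rewrite mult_INR, plus_INR in Hm. simpl in Hm.
   assert (INR 2 <= INR N) by bound. simpl in H1. lra. }
  trans_l ((3 * C1 + b 0%nat + C1) * INR m).
  trans_l ((3 * C1 + b 0%nat + C1) * (3 / 4 * INR N)).
  pose proof (pos_INR N). nra.
Qed.

(* The matrix (a b; k -h) sends [h/k + u + iy] to a point at hyperbolic distance [O(y / |u|)] from the one on the right. *)
Lemma unfolding : exists C, 0 < C /\ forall phi (h k a b : Z) u y, (- a * h - b * k = 1)%Z -> (1 <= k)%Z -> 0 < y -> 16 * y <= Rabs u ->
  Rabs (cp phi (psi (IZR h / IZR k + u, y)) - cp phi (psi (IZR a / IZR k - / (IZR k ^ 2 * u), y / (IZR k ^ 2 * u ^ 2)))) <= C * (y / Rabs u).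
Proof.
 destruct (psi_lip) as [C [HC H]]. exists (4 * C). split. lra.
 intros phi h k a b u y Hdet Hk Hy Hu.
 assert (1 <= IZR k) by bound.
 assert (HdR : IZR a * IZR (- h) - IZR b * IZR k = 1) by (rewrite <- !mult_IZR, <- minus_IZR; apply IZR_eq; lia).
 destruct (mobius_eq (IZR a) (IZR b) (IZR k) (IZR (- h)) (IZR h / IZR k + u) y HdR Hy) as [P E].
 rewrite <- (psi_inv a b k (- h)%Z ltac:(lia) (IZR h / IZR k + u, y) Hy). rewrite E. clear E.
 rewrite opp_IZR in *. set (K := IZR k) in *. set (Hh := IZR h) in *. set (A := IZR a) in *. set (Bb := IZR b) in *.
 assert (u <> 0). { intros ->. rewrite Rabs_R0 in Hu. lra. }
 assert (0 < u ^ 2) by nra.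
 assert (0 < Rabs u) by bound.
 assert (E1 : (K * (Hh / K + u) + - Hh) ^ 2 + (K * y) ^ 2 = K ^ 2 * (u ^ 2 + y ^ 2)) by bound.
 assert (E0 : K * (Hh / K + u) + - Hh = K * u) by bound.
 rewrite E1, E0.
 set (X := ((A * (Hh / K + u) + Bb) * (K * u) + A * K * y ^ 2) / (K ^ 2 * (u ^ 2 + y ^ 2))).
 set (Y := y / (K ^ 2 * (u ^ 2 + y ^ 2))).
 assert (EX : X = A / K - u / (K ^ 2 * (u ^ 2 + y ^ 2))).
 { unfold X. replace Bb with ((- A * Hh - 1) / K). bound. replace (- A * Hh) with (1 + Bb * K) by lra. bound. }
 assert (0 < Y) by bound.
 assert (Rabs (X - (A / K - / (K ^ 2 * u))) = Y * (y / Rabs u)).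
 { rewrite EX. replace (A / K - u / (K ^ 2 * (u ^ 2 + y ^ 2)) - (A / K - / (K ^ 2 * u))) with (Y * (y / u)) by bound.
  rewrite Rabs_mult, (Rabs_right Y) by lra. unfold Rdiv. rewrite Rabs_mult, Rabs_inv, (Rabs_right y) by lra. bound. }
 set (r := y / Rabs u) in *.
 assert (0 < r <= 1 / 16). { unfold r. split. bound. apply Rmult_le_reg_r with (Rabs u); auto. unfold Rdiv at 1. rewrite Rmult_assoc, Rinv_l; lra. }
 assert (Rabs (Y - y / (K ^ 2 * u ^ 2)) = Y * r ^ 2).
 { replace (Y - y / (K ^ 2 * u ^ 2)) with (- (Y * (y ^ 2 / u ^ 2))) by bound.
  rewrite Rabs_Ropp. unfold r. rewrite Rabs_right.
  - unfold Rdiv. rewrite Rpow_mult_distr, pow_inv, pow2_abs. ring.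
  - bound. }
 (* The total displacement is at most [2 Y r <= Y / 8], within the reach of [psi_lip]; this is why
    [16 y <= |u|] is asked. *)
 assert (Rabs (X - (A / K - / (K ^ 2 * u))) + Rabs (Y - y / (K ^ 2 * u ^ 2)) <= 2 * (Y * r)).
 { assert (r ^ 2 <= r) by nra. nra. }
 eapply Rle_trans. apply H; auto. nra.
 apply Rle_trans with (C * (2 * (Y * r) / Y)).
 - mul_l. mul_r. auto.
 - replace (2 * (Y * r) / Y) with (2 * r) by bound. nra.
Qed.

(** * Dual integrals *)

(** Amplitude of the [n]-th mode of [psi] at height [y / (k u)^2], with [s = sqrt y / k] and
    [om = 2 PI |n| y / k^2]; [amp1] is its derivative in [u]. *)
Definition amp (V s om u : R) : R := s / u * KV V (om / u ^ 2).
Definition amp1 (V s om u : R) : R := - (s / u ^ 2) * (KV V (om / u ^ 2) + 2 * (om / u ^ 2) * KV1 V (om / u ^ 2)).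

Lemma amp_derive V s om u : 0 <= V -> u <> 0 -> is_derive (amp V s om) u (amp1 V s om u).
Proof.
 intros HV Hu. unfold amp, amp1.
 pose proof (KV_derive V (om / u ^ 2) HV) as D.
 assert (is_derive (fun u => om / u ^ 2) u (- 2 * om / u ^ 3)).
 { auto_derive. nra. bound. }
 assert (is_derive (fun u => KV V (om / u ^ 2)) u ((- 2 * om / u ^ 3) * KV1 V (om / u ^ 2))).
 { apply (is_derive_comp (KV V) (fun u => om / u ^ 2)); auto. }
 assert (is_derive (fun u => s / u) u (- s / u ^ 2)) by (auto_derive; auto; field; auto).
 replace (- (s / u ^ 2) * (KV V (om / u ^ 2) + 2 * (om / u ^ 2) * KV1 V (om / u ^ 2))) with
  ((- s / u ^ 2) * KV V (om / u ^ 2) + s / u * ((- 2 * om / u ^ 3) * KV1 V (om / u ^ 2))) by bound.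
 apply (is_derive_mult (fun u => s / u) (fun u => KV V (om / u ^ 2))); auto. intros; apply Rmult_comm.
Qed.

Lemma amp1_cont V s om u : 0 <= V -> u <> 0 -> continuous (amp1 V s om) u.
Proof.
 intros HV Hu.
 assert (continuous (fun u => om / u ^ 2) u) by (cont; apply pow_nonzero; auto).
 apply continuous_mulR. cont; apply pow_nonzero; auto.
 apply continuous_addR.
 - apply continuous_comp; auto. eapply is_derive_continuous. apply KV_derive; auto.
 - apply continuous_mulR. apply continuous_mulR; auto. apply continuous_const.
  apply continuous_comp; auto. apply KV1_cont; auto.
Qed.

(** The two Bessel bounds, without and with a factor [/ W], combine into the minimum, which cuts the
    dual sum off beyond [|n|] of size [(k w)^2 / y]. The derivative loses only a factor [w], so the
    variation over a dyadic range is harmless. *)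
Lemma amp_bound V s om w u : 0 <= V -> 0 < s -> 0 < om -> 0 < w -> w <= u <= 2 * w ->
  Rabs (amp V s om u) <= 84 * s / sqrt om * Rmin 1 (4 * w ^ 2 / om) /\
  Rabs (amp1 V s om u) <= 3 * (84 * s / sqrt om * Rmin 1 (4 * w ^ 2 / om)) / w.
Proof.
 intros HV Hs Hom Hw Hu.
 set (W := om / u ^ 2). assert (HW : 0 < W) by bound.
 assert (HsW : sqrt W = sqrt om / u).
 { unfold W. replace (u ^ 2) with (u * u) by ring. rewrite sqrt_div by nra. rewrite sqrt_square by lra. bound. }
 assert (0 < u ^ 2) by nra.
 assert (/ W <= 4 * w ^ 2 / om).
 { unfold W. lhs (u ^ 2 / om). mul_r. nra. }
 set (mn := Rmin 1 (4 * w ^ 2 / om)).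
 assert (Key : forall z, z <= 42 / sqrt W -> z <= 42 / (W * sqrt W) -> z <= 42 * (2 * w) / sqrt om * mn).
 { intros z Hz1 Hz2. rewrite HsW in *.
  assert (42 / (sqrt om / u) <= 42 * (2 * w) / sqrt om).
  { lhs (42 * u / sqrt om). bound. }
  unfold mn, Rmin. destruct (Rle_dec 1 (4 * w ^ 2 / om)).
  - lra.
  - le_by Hz2. lhs (42 / (sqrt om / u) * / W).
   bound. }
 destruct (KV_bound V W HV HW) as [K1 K2]. destruct (KV1_bound V W HV HW) as [K3 K4].
 pose proof (Key _ K1 K2) as Q1. pose proof (Key _ K3 K4) as Q2.
 set (E := 42 * (2 * w) / sqrt om * mn) in *.
 assert (EA : 84 * s / sqrt om * mn = s / w * E) by bound. rewrite EA.
 assert (0 < s / u <= s / w) by bound.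
 split.
 - unfold amp. fold W. rewrite Rabs_mult, (Rabs_right (s / u)) by lra. apply Rmult_le_compat; try lra. apply Rabs_pos.
 - unfold amp1. fold W. rewrite Rabs_mult, Rabs_Ropp.
  rhs (s / w * / w * (3 * E)).
  apply Rmult_le_compat; try apply Rabs_pos.
  + rewrite Rabs_right. lhs (s / u * / u).
   bound.
   apply Rle_ge. apply Rdiv_le_0_compat; lra.
  + le_by Rabs_triang. rewrite Rabs_mult, (Rabs_right (2 * W)) by lra. lra.
Qed.

(** The phase of a dual mode with [nu = n / k^2]: the first term comes from the image point
    [A - sg / (k^2 u)], the second from the twist. For [nu > 0] it is stationary at
    [u = sqrt (nu / m)]. *)
Definition fph (nu m phi u : R) : R := 2 * PI * (- nu / u - m * u) + phi.

Lemma fph_derive nu m phi u : u <> 0 -> is_derive (fph nu m phi) u (2 * PI * (nu / u ^ 2 - m)).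
Proof. intros Hu. unfold fph. auto_derive; auto. bound. Qed.

Lemma fph_derive2 nu m u : u <> 0 -> is_derive (fun u => 2 * PI * (nu / u ^ 2 - m)) u (- 4 * PI * nu / u ^ 3).
Proof. intros Hu. auto_derive. nra. bound. Qed.

Definition Qint (V s om nu m phi u1 u2 : R) : R := RInt (fun u => amp V s om u * cos (fph nu m phi u)) u1 u2.

Lemma Q_cont V s om nu m phi u : 0 <= V -> u <> 0 -> continuous (fun u => amp V s om u * cos (fph nu m phi u)) u.
Proof.
 intros HV Hu. apply continuous_mulR. eapply is_derive_continuous; apply amp_derive; auto.
 apply continuous_cosR. eapply is_derive_continuous; apply fph_derive; auto.
Qed.

Lemma amp1_int V s om w u1 u2 A0 : 0 <= V -> 0 < s -> 0 < om -> 0 < w -> w <= u1 -> u1 <= u2 -> u2 <= 2 * w ->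
  A0 = 84 * s / sqrt om * Rmin 1 (4 * w ^ 2 / om) -> RInt (fun x => Rabs (amp1 V s om x)) u1 u2 <= 3 * A0.
Proof.
 intros HV Hs Hom Hw H1 H12 H2 ->.
 eapply Rle_trans. apply (RInt_le_const _ u1 u2 (3 * (84 * s / sqrt om * Rmin 1 (4 * w ^ 2 / om)) / w)); auto.
 - apply ex_RInt_cont; auto. intros; apply continuous_abs. apply amp1_cont; auto; lra.
 - intros u Hu. apply amp_bound; auto; lra.
 - set (A0 := 84 * s / sqrt om * Rmin 1 (4 * w ^ 2 / om)).
  trans_l (w * (3 * A0 / w)). bound.
Qed.

(** The derivative tests are stated for convex phases; for [nu > 0] the phase is negated, which
    cosine does not see. *)
Lemma cos_opp_ext (A f : R -> R) a b : RInt (fun u => A u * cos (f u)) a b = RInt (fun u => A u * cos (- f u)) a b.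
Proof. apply RInt_ext. intros. rewrite cos_neg. bound. Qed.

(** The second derivative has size [|nu| / w^3]. The constant is [8 + 2 * 3], because the variation
    is at most three times the bound for the amplitude. *)
Lemma Q_second V s om nu m phi w u1 u2 : 0 <= V -> 0 < s -> 0 < om -> nu <> 0 -> 0 < w -> w <= u1 -> u1 <= u2 -> u2 <= 2 * w ->
  Rabs (Qint V s om nu m phi u1 u2) <= 14 * (84 * s / sqrt om * Rmin 1 (4 * w ^ 2 / om)) * (w * sqrt w / sqrt (Rabs nu)).
Proof.
 intros HV Hs Hom Hnu Hw H1 H12 H2. set (A0 := 84 * s / sqrt om * Rmin 1 (4 * w ^ 2 / om)).
 pose proof PI2_3_2 as HP.
 assert (0 < Rabs nu) by (apply Rabs_pos_lt; auto).
 set (mu := Rabs nu / (w * w * w)). assert (0 < w * w * w) by bound.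
 assert (0 < mu) by bound.
 assert (0 < sqrt w) by bound. assert (0 < sqrt (Rabs nu)) by bound.
 assert (Hsm : sqrt mu = sqrt (Rabs nu) / (w * sqrt w)).
 { unfold mu. rewrite sqrt_div by lra. f_equal. rewrite sqrt_mult by nra. rewrite sqrt_square by lra. bound. }
 replace (14 * A0 * (w * sqrt w / sqrt (Rabs nu))) with ((8 * A0 + 2 * (3 * A0)) / sqrt mu) by (rewrite Hsm; field; lra).
 assert (Hf2 : forall u, w <= u <= 2 * w -> mu <= 4 * PI * Rabs nu / u ^ 3).
 { intros u Hu.
  apply Rle_trans with (4 * PI * Rabs nu / (2 * w) ^ 3).
  - apply Rmult_le_reg_r with (w * w * w); auto. lhs (Rabs nu).
   rhs (PI / 2 * Rabs nu). nra.
  - bound. }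
 destruct (Rlt_dec nu 0) as [Hneg|Hpos].
 - apply (osc_second (amp V s om) (amp1 V s om) (fph nu m phi) (fun u => 2 * PI * (nu / u ^ 2 - m)) (fun u => - 4 * PI * nu / u ^ 3)); auto.
  + intros; apply amp_derive; auto; lra.
  + intros; apply amp1_cont; auto; lra.
  + intros; apply fph_derive; lra.
  + intros; apply fph_derive2; lra.
  + intros x Hx. assert (x <> 0) by lra. cont. apply pow_nonzero; auto.
  + intros x Hx. eapply Rle_trans. apply (Hf2 x); lra. rewrite Rabs_left by lra. right. field. lra.
  + intros x Hx. apply amp_bound; auto; lra.
  + apply (amp1_int V s om w); auto.
 - unfold Qint. rewrite cos_opp_ext.
  apply (osc_second (amp V s om) (amp1 V s om) (fun u => - fph nu m phi u) (fun u => - (2 * PI * (nu / u ^ 2 - m))) (fun u => - (- 4 * PI * nu / u ^ 3))); auto.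
  + intros; apply amp_derive; auto; lra.
  + intros; apply amp1_cont; auto; lra.
  + intros. apply (is_derive_opp (fph nu m phi)). apply fph_derive; lra.
  + intros. apply (is_derive_opp (fun u => 2 * PI * (nu / u ^ 2 - m))). apply fph_derive2; lra.
  + intros x Hx. assert (x <> 0) by lra. cont. apply pow_nonzero; auto.
  + intros x Hx. eapply Rle_trans. apply (Hf2 x); lra. rewrite Rabs_right by lra. right. field. lra.
  + intros x Hx. apply amp_bound; auto; lra.
  + apply (amp1_int V s om w); auto.
Qed.

Lemma Q_first V s om nu m phi w u1 u2 lam : 0 <= V -> 0 < s -> 0 < om -> nu <> 0 -> 0 < w -> w <= u1 -> u1 <= u2 -> u2 <= 2 * w ->
  0 < lam -> (forall u, u1 <= u <= u2 -> lam <= nu / u ^ 2 - m) \/ (forall u, u1 <= u <= u2 -> nu / u ^ 2 - m <= - lam) ->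
  Rabs (Qint V s om nu m phi u1 u2) <= 84 * s / sqrt om * Rmin 1 (4 * w ^ 2 / om) / lam.
Proof.
 intros HV Hs Hom Hnu Hw H1 H12 H2 Hlam Hl. set (A0 := 84 * s / sqrt om * Rmin 1 (4 * w ^ 2 / om)).
 pose proof PI2_3_2 as HP.
 apply Rle_trans with ((3 * A0 + 3 * A0) / (2 * PI * lam)).
 2: { lhs (A0 / lam * (3 / PI)).
    bound. }
 assert (0 < 2 * PI * lam) by bound.
 destruct (Rlt_dec nu 0) as [Hneg|Hpos].
 - apply (osc_first (amp V s om) (amp1 V s om) (fph nu m phi) (fun u => 2 * PI * (nu / u ^ 2 - m)) (fun u => - 4 * PI * nu / u ^ 3)); auto.
  + intros; apply amp_derive; auto; lra.
  + intros; apply amp1_cont; auto; lra.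
  + intros; apply fph_derive; lra.
  + intros; apply fph_derive2; lra.
  + intros x Hx. assert (x <> 0) by lra. cont. apply pow_nonzero; auto.
  + intros x Hx. assert (0 < x ^ 3) by bound. apply Rdiv_le_0_compat; auto. nra.
  + destruct Hl as [Hl|Hl]; [left|right]; intros x Hx; specialize (Hl x Hx); nra.
  + intros x Hx. apply amp_bound; auto; lra.
  + apply (amp1_int V s om w); auto.
 - unfold Qint. rewrite cos_opp_ext.
  apply (osc_first (amp V s om) (amp1 V s om) (fun u => - fph nu m phi u) (fun u => - (2 * PI * (nu / u ^ 2 - m))) (fun u => - (- 4 * PI * nu / u ^ 3))); auto.
  + intros; apply amp_derive; auto; lra.
  + intros; apply amp1_cont; auto; lra.
  + intros. apply (is_derive_opp (fph nu m phi)). apply fph_derive; lra.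
  + intros. apply (is_derive_opp (fun u => 2 * PI * (nu / u ^ 2 - m))). apply fph_derive2; lra.
  + intros x Hx. assert (x <> 0) by lra. cont. apply pow_nonzero; auto.
  + intros x Hx. assert (0 < x ^ 3) by bound.
   rhs (4 * PI * nu / x ^ 3). apply Rdiv_le_0_compat; auto. nra.
  + destruct Hl as [Hl|Hl]; [right|left]; intros x Hx; specialize (Hl x Hx); nra.
  + intros x Hx. apply amp_bound; auto; lra.
  + apply (amp1_int V s om w); auto.
Qed.

(** Each term is at most [4 / sqrt x] times the increment of [sqrt n / (sqrt n + sqrt x)], a
    quantity that stays below [1]. *)
Lemma sum_c (x : R) N : 0 < x -> rsum (fun k => / (sqrt (INR k + 1) * (INR k + 1 + x))) N <= 4 / sqrt x.
Proof.
 intros Hx. set (s := sqrt x). assert (0 < s) by bound. assert (s * s = x) by bound.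
 set (h := fun n => sqrt n / (sqrt n + s)).
 assert (Hstep : forall k, / (sqrt (INR k + 1) * (INR k + 1 + x)) <= 4 / s * (h (INR k + 1) - h (INR k))).
 { intros k. unfold h. set (a := sqrt (INR k)). set (b := sqrt (INR k + 1)).
  assert (0 < b) by bound.
  assert (a * a = INR k) by bound. assert (b * b = INR k + 1) by bound.
  assert (a <= b) by nra.
  rhs (4 * (b - a) / ((b + s) * (a + s))).
  assert (/ (2 * b) <= b - a). { apply Rmult_le_reg_r with (2 * b). lra. rewrite Rinv_l by lra. nra. }
  apply Rle_trans with (4 * (/ (2 * b)) / ((b + s) * (b + s))).
  - rhs (/ (b * ((b + s) * (b + s) / 2))).
   apply Rinv_le_contravar. bound. mul_l. pose proof (Rle_0_sqr (b - s)) as Hq. unfold Rsqr in Hq. lra.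
  - bound. }
 assert (Hsum : rsum (fun k => / (sqrt (INR k + 1) * (INR k + 1 + x))) N <= 4 / s * h (INR N)).
 { induction N.
  - simpl. unfold h. simpl. rewrite sqrt_0. right. field. lra.
  - cbn [rsum]. rewrite S_INR. specialize (Hstep N). lra. }
 le_by Hsum. bound.
Qed.

(** Harmonic up to [La]; past it the terms are at most [La / n^2] and telescope to a constant. *)
Lemma sum_min (La : R) N : 0 < La -> rsum (fun k => / (INR k + 1) * Rmin 1 (La / (INR k + 1))) N <= 3 + ln (La + 2).
Proof.
 intros HL. destruct (nfloor_ex La ltac:(lra)) as [J0 HJ0]. set (J := S J0).
 assert (HJR : INR J = INR J0 + 1) by apply S_INR.
 assert (A1 : forall M, rsum (fun k => / (INR k + 1) * Rmin 1 (La / (INR k + 1))) M <= 1 + ln (INR M + 1)).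
 { intros M. eapply Rle_trans; [|apply harmonic_log]. apply rsum_le. intros k _.
  rewrite <- (Rmult_1_r (/ (INR k + 1))) at 2. mul_l. apply Rmin_l. }
 assert (A2 : forall j, rsum (fun k => / (INR k + 1) * Rmin 1 (La / (INR k + 1))) (J + j) <= 1 + ln (INR J + 1) + La * (/ INR J - / INR (J + j))).
 { induction j.
  - rewrite Nat.add_0_r. pose proof (A1 J). lra.
  - rewrite Nat.add_succ_r. cbn [rsum]. set (n := INR (J + j)) in *. rewrite S_INR. fold n.
   assert (Hn : 1 <= n) by bound.
   assert (/ (n + 1) * Rmin 1 (La / (n + 1)) <= La * (/ n - / (n + 1))).
   { apply Rle_trans with (/ (n + 1) * (La / (n + 1))). mul_l. apply Rmin_r.
    lhs (La * / ((n + 1) * (n + 1))).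
    replace (/ n - / (n + 1)) with (/ (n * (n + 1))) by bound.
    bound. }
   lra. }
 assert (HlnJ : ln (INR J + 1) <= ln (La + 2)) by bound.
 destruct (le_dec N J) as [H|H].
 - le_by A1. assert (ln (INR N + 1) <= ln (INR J + 1)) by bound. lra.
 - specialize (A2 (N - J)%nat). replace (J + (N - J))%nat with N in A2 by lia.
  assert (0 < / INR N). { apply Rinv_0_lt_compat. apply lt_0_INR. lia. }
  assert (La * / INR J <= 1). { apply Rmult_le_reg_r with (INR J). lra. rewrite Rmult_assoc, Rinv_l by lra. lra. }
  nra.
Qed.

Lemma RInt_lin2 a b (f g : R -> R) u v : ex_RInt f u v -> ex_RInt g u v ->
  RInt (fun x => a * f x + b * g x) u v = a * RInt f u v + b * RInt g u v.
Proof.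
 intros Hf Hg. rewrite (RInt_addR (fun x => a * f x) (fun x => b * g x)) by (apply ex_RInt_mulR; auto).
 rewrite (RInt_mulR a f u v Hf), (RInt_mulR b g u v Hg). bound.
Qed.

(** * Dual expansion of integrals along horocycles *)

Hypothesis psi_cont : forall z : C, upper_half z -> continuous psi z.

Lemma psi_2d x y : 0 < y -> continuity_2d_pt (fun x y => Re (psi (x, y))) x y /\ continuity_2d_pt (fun x y => Im (psi (x, y))) x y.
Proof.
 intros Hy.
 split; apply continuity_2d_pt_filterlim.
 - change (continuous (fun z : R * R => Re (psi (fst z, snd z))) (x, y)).
  apply (continuous_ext (fun z : R * R => fst (psi z))). intros [u v]; reflexivity.
  apply (continuous_comp psi fst); auto. apply continuous_fst.
 - change (continuous (fun z : R * R => Im (psi (fst z, snd z))) (x, y)).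
  apply (continuous_ext (fun z : R * R => snd (psi z))). intros [u v]; reflexivity.
  apply (continuous_comp psi snd); auto. apply continuous_snd.
Qed.

Lemma c2d_path (f : R -> R -> R) (X Y : R -> R) u : continuity_2d_pt f (X u) (Y u) -> continuous X u -> continuous Y u ->
  continuous (fun u => f (X u) (Y u)) u.
Proof.
 intros H HX HY. apply (continuous_comp_2 X Y f); auto. apply continuity_2d_pt_filterlim in H. bound.
Qed.

Lemma cp_path_cont (g X Y : R -> R) u : 0 < Y u -> continuous g u -> continuous X u -> continuous Y u ->
  continuous (fun u => cp (g u) (psi (X u, Y u))) u.
Proof.
 intros HY cg cX cY. destruct (psi_2d (X u) (Y u) HY) as [H1 H2].
 apply continuous_addR; apply continuous_mulR.
 - apply (c2d_path (fun x y => Re (psi (x, y)))); auto.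
 - apply continuous_cosR; auto.
 - apply (c2d_path (fun x y => Im (psi (x, y)))); auto.
 - apply continuous_sinR; auto.
Qed.

Definition PSV (V : R) (N : nat) (phi x y : R) : R :=
  lsum (fun n => sqrt y * KV V (2 * PI * Rabs (IZR n) * y) * T n (2 * PI * (IZR n * x) - phi)) (zl N).

Lemma PSV_approx y1 y2 N eps : 0 < y1 -> 0 < eps -> exists V, 0 <= V /\ forall phi x y, y1 <= y <= y2 ->
  Rabs (PS N phi x y - PSV V N phi x y) <= eps.
Proof.
 intros Hy1 He. set (D := sqrt y2 * (84 / y1) * lsum (fun n => Cmod (t n)) (zl N)).
 assert (0 <= lsum (fun n => Cmod (t n)) (zl N)) by (apply lsum_pos; intros; apply Cmod_ge_0).
 exists (D / eps). assert (0 <= D / eps) by bound. split; auto.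
 set (V := D / eps) in *. intros phi x y Hy.
 unfold PS, PSV.
 replace (lsum (fun n => gn n y * T n (2 * PI * (IZR n * x) - phi)) (zl N) - lsum (fun n => sqrt y * KV V (2 * PI * Rabs (IZR n) * y) * T n (2 * PI * (IZR n * x) - phi)) (zl N))
  with (lsum (fun n => (gn n y - sqrt y * KV V (2 * PI * Rabs (IZR n) * y)) * T n (2 * PI * (IZR n * x) - phi)) (zl N)).
 2: { generalize (zl N). induction l; simpl; [ring|]. bound. }
 eapply Rle_trans. apply lsum_abs.
 apply Rle_trans with (lsum (fun n => (sqrt y2 * (84 / y1) * exp (- V)) * Cmod (t n)) (zl N)).
 - apply lsum_le. intros n Hn. apply in_zl in Hn. rewrite Rabs_mult. apply Rmult_le_compat; try apply Rabs_pos; [|apply T_le].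
  unfold gn. rewrite <- Rmult_minus_distr_l, Rabs_mult, (Rabs_right (sqrt y)) by (apply Rle_ge, sqrt_pos).
  rewrite (Rmult_assoc (sqrt y2)). apply Rmult_le_compat; try apply Rabs_pos. bound. bound.
  assert (1 <= Rabs (IZR n)). { rewrite <- abs_IZR. bound. }
  pose proof PI2_3_2. set (w := 2 * PI * Rabs (IZR n) * y).
  assert (y1 <= w). { unfold w. assert (1 <= 2 * PI * Rabs (IZR n)) by nra. nra. }
  eapply Rle_trans. apply bessel_lim; auto. lra. mul_r.
  mul_l. apply Rinv_le_contravar; auto.
 - rewrite lsum_mul. lhs (D * exp (- V)).
  rewrite exp_Ropp. pose proof (exp_ineq1_le V). apply Rmult_le_reg_r with (exp V). bound.
  trans_l (eps * V). bound.
Qed.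

(* [psi] along the image horocycle is expanded again, each Fourier mode giving one dual integral [Qint]. *)
Lemma dual_bound (k : R) y m A sg phi u1 u2 (S : Z -> R) Bd : 0 < k -> 0 < y -> 0 < u1 -> u1 <= u2 -> sg = 1 \/ sg = -1 ->
  (forall n V phi', n <> 0%Z -> 0 <= V ->
     Rabs (Qint V (sqrt y / k) (2 * PI * Rabs (IZR n) * y / k ^ 2) (IZR n / k ^ 2) m phi' u1 u2) <= S n) ->
  (forall N, lsum (fun n => 2 * Cmod (t n) * S n) (zl N) <= Bd) ->
  Rabs (RInt (fun u => cp (2 * PI * m * (sg * u) + phi) (psi (A - sg / (k ^ 2 * u), y / (k ^ 2 * u ^ 2)))) u1 u2) <= Bd.
Proof.
 intros Hk Hy Hu1 Hu Hsg HS HBd.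
 apply le_epsilon. intros eps He. set (e' := eps / (2 * (u2 - u1) + 1)).
 assert (He' : 0 < e') by bound.
 assert (0 < k ^ 2) by nra.
 assert (Hden : forall u, u1 <= u -> 0 < k ^ 2 * u ^ 2) by bound.
 set (y1 := y / (k ^ 2 * u2 ^ 2)). set (y2 := y / (k ^ 2 * u1 ^ 2)).
 assert (Hy1 : 0 < y1) by bound.
 assert (HY : forall u, u1 <= u <= u2 -> y1 <= y / (k ^ 2 * u ^ 2) <= y2).
 { intros u Huu. unfold y1, y2, Rdiv. bound. }
 destruct (uniform_approx y1 e' Hy1 He') as [N HN]. specialize (HN N (le_n _)).
 destruct (PSV_approx y1 y2 N e' Hy1 He') as [V [HV HPV]].
 set (F := fun u => cp (2 * PI * m * (sg * u) + phi) (psi (A - sg / (k ^ 2 * u), y / (k ^ 2 * u ^ 2)))).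
 set (P := fun u => PSV V N (2 * PI * m * (sg * u) + phi) (A - sg / (k ^ 2 * u)) (y / (k ^ 2 * u ^ 2))).
 set (om := fun n => 2 * PI * Rabs (IZR n) * y / k ^ 2).
 set (c := fun n => 2 * PI * (IZR n * A) - phi).
 (* The real and imaginary parts of [t n] meet a cosine and minus a sine. Both are written as
    cosines with shifted constant phases, so that one bound for [Qint] covers them; hence the factor
    [2] in the hypothesis on the sums. *)
 set (Q := fun n u => Re (t n) * (amp V (sqrt y / k) (om n) u * cos (fph (IZR n / k ^ 2) m (sg * c n) u)) +
            Im (t n) * (amp V (sqrt y / k) (om n) u * cos (fph (IZR n / k ^ 2) m (sg * (c n + PI / 2)) u))).
 assert (EP : forall u, u1 <= u <= u2 -> P u = lsum (fun n => Q n u) (zl N)).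
 { intros u Huu. apply lsum_ext. intros n _. unfold Q, amp.
  assert (Es : sqrt (y / (k ^ 2 * u ^ 2)) = sqrt y / k / u).
  { rewrite sqrt_div by (try lra; apply Hden; lra). replace (k ^ 2 * u ^ 2) with ((k * u) * (k * u)) by ring.
   rewrite sqrt_square by nra. bound. }
  rewrite Es. replace (2 * PI * Rabs (IZR n) * (y / (k ^ 2 * u ^ 2))) with (om n / u ^ 2) by bound.
  set (th := 2 * PI * (- (IZR n / k ^ 2) / u - m * u)).
  assert (Eth : 2 * PI * (IZR n * (A - sg / (k ^ 2 * u))) - (2 * PI * m * (sg * u) + phi) = sg * th + c n).
  { unfold th, c. bound. }
  rewrite Eth. unfold fph. fold th.
  (* For [sg = -1] evenness of cosine moves the sign from the variable phase to the constant. *)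
  assert (E1 : cos (th + sg * c n) = cos (sg * th + c n)).
  { destruct Hsg as [->| ->]. f_equal; ring. rewrite <- cos_neg. f_equal. ring. }
  assert (E2 : cos (th + sg * (c n + PI / 2)) = - sin (sg * th + c n)).
  { assert (Ecs : forall z, - sin z = cos (z + PI / 2)) by (intros; rewrite cos_plus, cos_PI2, sin_PI2; ring). rewrite Ecs. destruct Hsg as [->| ->]. f_equal; ring. rewrite <- cos_neg. f_equal. ring. }
  rewrite E1, E2. unfold T. ring. }
 assert (forall n u, u1 <= u <= u2 -> continuous (Q n) u).
 { intros n u Huu. unfold Q. apply continuous_addR; (apply continuous_mulR; [apply continuous_const|]); apply Q_cont; auto; lra. }
 assert (forall u, u1 <= u <= u2 -> continuous F u).
 { intros u Huu. unfold F. apply cp_path_cont.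
  - apply Rdiv_lt_0_compat; auto; apply Hden; lra.
  - cont.
  - cont. apply Rgt_not_eq. apply Rmult_lt_0_compat; lra.
  - cont. bound. }
 destruct (lsum_RInt Q (zl N) u1 u2) as [S1 S2].
 { intros n _. apply ex_RInt_cont; auto. }
 assert (ex_RInt F u1 u2) by (apply ex_RInt_cont; auto).
 assert (Rabs (lsum (fun n => RInt (Q n) u1 u2) (zl N)) <= Bd).
 { eapply Rle_trans; [|apply (HBd N)]. eapply Rle_trans. apply lsum_abs. apply lsum_le. intros n Hn. apply in_zl in Hn.
  assert (Hn0 : n <> 0%Z) by lia.
  assert (eq : forall phi', ex_RInt (fun u => amp V (sqrt y / k) (om n) u * cos (fph (IZR n / k ^ 2) m phi' u)) u1 u2).
  { intros phi'. apply ex_RInt_cont; auto. intros; apply Q_cont; auto; lra. }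
  unfold Q. rewrite (RInt_lin2 (Re (t n)) (Im (t n)) (fun u => amp V (sqrt y / k) (om n) u * cos (fph (IZR n / k ^ 2) m (sg * c n) u))
   (fun u => amp V (sqrt y / k) (om n) u * cos (fph (IZR n / k ^ 2) m (sg * (c n + PI / 2)) u)) u1 u2 (eq _) (eq _)).
  pose proof (HS n V (sg * c n) Hn0 HV) as h1. pose proof (HS n V (sg * (c n + PI / 2)) Hn0 HV) as h2.
  le_by Rabs_triang.
  assert (Rabs (Re (t n)) <= Cmod (t n)). { eapply Rle_trans; [|apply Rmax_Cmod]. apply Rmax_l. }
  assert (Rabs (Im (t n)) <= Cmod (t n)). { eapply Rle_trans; [|apply Rmax_Cmod]. apply Rmax_r. }
  rhs (Cmod (t n) * S n + Cmod (t n) * S n).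
  bound. }
 replace (RInt F u1 u2) with (RInt (fun u => F u - lsum (fun n => Q n u) (zl N)) u1 u2 + lsum (fun n => RInt (Q n) u1 u2) (zl N)).
 2: { rewrite RInt_subR by auto. bound. }
 le_by Rabs_triang. rewrite Rplus_comm. apply Rplus_le_compat; auto.
 apply Rle_trans with ((u2 - u1) * (2 * e')).
 - apply abs_RInt_le_const; auto. apply ex_RInt_subR; auto.
  intros u Huu. rewrite <- EP by auto. unfold F, P.
  pose proof (HN (2 * PI * m * (sg * u) + phi) (A - sg / (k ^ 2 * u)) (y / (k ^ 2 * u ^ 2)) ltac:(apply HY; auto)) as a1.
  pose proof (HPV (2 * PI * m * (sg * u) + phi) (A - sg / (k ^ 2 * u)) (y / (k ^ 2 * u ^ 2)) ltac:(apply HY; auto)) as a2.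
  apply Rabs_le_between in a1. apply Rabs_le_between in a2. apply Rabs_le. lra.
 - lhs (eps * ((2 * (u2 - u1)) / (2 * (u2 - u1) + 1))).
  bound.
Qed.

(** As [sqrt (2 PI) >= 2], the amplitude of a mode is at most about [/ sqrt n], free of [k] and
    [y]. *)
Lemma s_over_om (n k y : R) : 0 < k -> 0 < y -> 1 <= n ->
  sqrt y / k / sqrt (2 * PI * n * y / k ^ 2) <= / (2 * sqrt n).
Proof.
 intros Hk Hy Hn. pose proof PI2_3_2 as HP.
 assert (2 * sqrt n * (sqrt y / k) <= sqrt (2 * PI * n * y / k ^ 2)).
 { apply Rsqr_incr_0_var; [|apply sqrt_pos]. unfold Rsqr. rewrite sqrt_sqrt.
  - lhs (4 * ((sqrt n * sqrt n) * (sqrt y * sqrt y)) / k ^ 2).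
   rewrite !sqrt_sqrt by lra. mul_r.
   rhs (2 * PI * (n * y)). mul_r. lra.
  - bound. }
 assert (0 < 2 * sqrt n * (sqrt y / k)) by bound.
 apply Rle_trans with (sqrt y / k / (2 * sqrt n * (sqrt y / k))).
 - mul_l. apply Rinv_le_contravar; auto.
 - bound.
Qed.

(** Every mode gets the second-derivative bound, about [k w^(3/2) / n], and the cut-off at
    [La = (k w)^2 / y] keeps the sum logarithmic. The weights decrease, so the mean bound [coef_sum]
    can stand in for pointwise bounds. *)
Lemma near_block : exists C, 0 < C /\ forall (k : R) y m A sg phi w u1 u2, 0 < k -> 0 < y -> 0 < w -> w <= u1 -> u1 <= u2 -> u2 <= 2 * w ->
  sg = 1 \/ sg = -1 ->
  Rabs (RInt (fun u => cp (2 * PI * m * (sg * u) + phi) (psi (A - sg / (k ^ 2 * u), y / (k ^ 2 * u ^ 2)))) u1 u2) <=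
   C * (k * (w * sqrt w)) * (3 + ln (w ^ 2 * k ^ 2 / y + 2)).
Proof.
 destruct (coef_sum) as [Ct [HCt Hsum]].
 exists (1176 * Ct). split. lra.
 intros k y m A sg phi w u1 u2 Hk Hy Hw H1 H12 H2 Hsg.
 set (La := w ^ 2 * k ^ 2 / y). assert (0 < k ^ 2) by nra.
 assert (HLa : 0 < La) by bound.
 assert (0 < sqrt w) by bound.
 set (S := fun n => 588 * (k * (w * sqrt w)) * (/ Rabs (IZR n) * Rmin 1 (La / Rabs (IZR n)))).
 apply (dual_bound k y m A sg phi u1 u2 S); auto; try lra.
 - intros n V phi' Hn HV. pose proof PI2_3_2 as HP.
  assert (Hn1 : 1 <= Rabs (IZR n)). { rewrite <- abs_IZR. bound. }
  set (N := Rabs (IZR n)) in *.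
  assert (0 < sqrt y / k) by bound.
  assert (0 < 2 * PI * N * y / k ^ 2) by bound.
  assert (IZR n / k ^ 2 <> 0). { intros E. apply Hn. apply eq_IZR. apply Rmult_eq_reg_r with (/ k ^ 2). bound. bound. }
  eapply Rle_trans. apply (Q_second V _ _ _ m phi' w u1 u2); auto; try lra.
  assert (EN : Rabs (IZR n / k ^ 2) = N / k ^ 2). { unfold Rdiv. rewrite Rabs_mult, Rabs_inv, (Rabs_right (k ^ 2)) by lra. bound. }
  rewrite EN. assert (Esn : sqrt (N / k ^ 2) = sqrt N / k). { rewrite sqrt_div by lra. replace (k ^ 2) with (k * k) by ring. rewrite sqrt_square by lra. bound. }
  rewrite Esn. pose proof (s_over_om N k y Hk Hy Hn1) as Hso. set (so := sqrt y / k / sqrt (2 * PI * N * y / k ^ 2)) in *.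
  assert (0 < sqrt N) by bound. assert (HsNN : sqrt N * sqrt N = N) by bound.
  replace (84 * (sqrt y / k) / sqrt (2 * PI * N * y / k ^ 2)) with (84 * so) by bound.
  set (mn := Rmin 1 (4 * w ^ 2 / (2 * PI * N * y / k ^ 2))).
  assert (0 <= mn <= Rmin 1 (La / N)).
  { split. bound. apply Rle_min_compat_l.
   lhs (La / N * (2 / PI)).
   bound. }
  assert (0 <= so) by bound.
  unfold S. fold N.
  apply Rle_trans with (14 * (84 * / (2 * sqrt N) * Rmin 1 (La / N)) * (w * sqrt w / (sqrt N / k))).
  + mul_r.
   mul_l. apply Rmult_le_compat; try lra.
  + right. replace (/ N) with (/ (sqrt N * sqrt N)) by (rewrite HsNN; reflexivity). field. lra.
 - intros N. rewrite lsum_zl.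
  apply Rle_trans with (rsum (fun j => (Cmod (t (Z.of_nat (Datatypes.S j))) + Cmod (t (- Z.of_nat (Datatypes.S j)))) * (1176 * (k * (w * sqrt w)) * (/ (INR j + 1) * Rmin 1 (La / (INR j + 1))))) N).
  + apply rsum_le. intros j _. unfold S. destruct (abs_pm j) as [E1 E2]. rewrite E1, E2. right. ring.
  + eapply Rle_trans. apply (rsum_abel _ _ Ct); auto.
   * intros j _. pose proof (pos_INR j). repeat apply Rmult_le_pos; try lra. bound.
    apply Rmin_glb. lra. apply Rdiv_le_0_compat; lra.
   * intros j _. pose proof (pos_INR j). rewrite S_INR. mul_l.
    apply Rmult_le_compat. bound. bound.
    bound. apply Rle_min_compat_l. mul_l. apply Rinv_le_contravar; lra.
   * rewrite rsum_mul. pose proof (sum_min La N HLa).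
    rhs (Ct * (1176 * (k * (w * sqrt w)) * (3 + ln (La + 2)))).
    bound.
Qed.

Lemma rsum_lsum f N : rsum f N = lsum f (seq 0 N).
Proof. induction N; [reflexivity|]. rewrite seq_S, lsum_app, <- IHN. simpl. ring. Qed.

Lemma spaced_inj {A} (f : A -> R) g l : NoDup l -> (forall x y, In x l -> In y l -> x <> y -> g <= Rabs (f x - f y)) -> spaced g (map f l).
Proof.
 induction l as [|x l IH]; intros Hn Hf; simpl; [constructor|].
 inversion Hn; subst. constructor.
 - rewrite Forall_forall. intros y Hy. apply in_map_iff in Hy. destruct Hy as [z [<- Hz]].
  apply Hf; simpl; auto. intros ->; auto.
 - apply IH; auto. intros; apply Hf; simpl; auto.
Qed.

Lemma INR_spaced x y : x <> y -> 1 <= Rabs (INR x - INR y).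
Proof.
 intros H. rewrite !INR_IZR_INZ, <- minus_IZR, <- abs_IZR. bound.
Qed.

Lemma spaced_sum_inv n : forall (l : list R) q, length l = n -> 0 < q -> spaced q l ->
  (forall x, In x l -> q <= x) -> lsum (fun x => / x) l <= / q * rsum (fun k => / (INR k + 1)) n.
Proof.
 induction n as [|n IH]; intros l q Hl Hq Hs Hb.
 - destruct l; [|discriminate]. simpl. lra.
 - destruct (list_max_R l) as [x [l' [P Hx]]]. { intros E. rewrite E in Hl. discriminate. }
  assert (Hl' : length l' = n). { apply Permutation_length in P. simpl in P. lia. }
  assert (Hs' : spaced q (x :: l')). { eapply ForallOrdPairs_perm; eauto. intros u v. rewrite Rabs_minus_sym; auto. }
  assert (Hin : forall y, In y (x :: l') -> q <= y). { intros y Hy; apply Hb. eapply Permutation_in. symmetry; apply P. auto. }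
  rewrite (lsum_perm _ _ _ P). cbn [lsum rsum].
  assert (H : lsum (fun x => / x) l' <= / q * rsum (fun k => / (INR k + 1)) n).
  { inversion Hs'; subst. apply IH; auto. intros; apply Hin; right; auto. }
  assert (Hxn : (INR n + 1) * q <= x).
  { assert (H0 : length (x :: l') = S n) by (simpl; lia).
   pose proof (spaced_count (S n) (x :: l') q q x H0 Hs' ltac:(lia)) as H1. rewrite S_INR in H1.
   assert ((INR n + 1 - 1) * q <= x - q).
   { apply H1. intros y Hy. split. auto. destruct Hy as [<-|Hy]; [lra|auto]. } lra. }
  assert (/ x <= / q * / (INR n + 1)).
  { rewrite <- Rinv_mult. bound. }
  lra.
Qed.

(** Both sides of the fraction [hk] are parametrised by the distance [u >= 0], with [sg] for the
    side, and the twist is measured from [hk]. *)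
Definition Uint (hk : R) (m phi sg y u1 u2 : R) : R :=
  RInt (fun u => cp (2 * PI * m * (sg * u) + phi) (psi (hk + sg * u, y))) u1 u2.

Lemma Uint_cont hk m phi sg y u : 0 < y -> continuous (fun u => cp (2 * PI * m * (sg * u) + phi) (psi (hk + sg * u, y))) u.
Proof. intros Hy. apply (cp_path_cont (fun u => 2 * PI * m * (sg * u) + phi) (fun u => hk + sg * u) (fun _ => y)); auto; cont. Qed.

(** The unfolding error [y / u] is at most [y / w] on a range of length at most [w], a loss of
    [O(y)] per dyadic range. *)
Lemma unfold_int : exists C, 0 < C /\ forall (h k a b : Z) y m phi sg w u1 u2 Bd, (- a * h - b * k = 1)%Z -> (1 <= k)%Z -> 0 < y -> sg = 1 \/ sg = -1 ->
  16 * y <= w -> w <= u1 -> u1 <= u2 -> u2 <= 2 * w ->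
  (Rabs (RInt (fun u => cp (2 * PI * m * (sg * u) + phi) (psi (IZR a / IZR k - sg / (IZR k ^ 2 * u), y / (IZR k ^ 2 * u ^ 2)))) u1 u2) <= Bd) ->
  Rabs (Uint (IZR h / IZR k) m phi sg y u1 u2) <= Bd + C * y.
Proof.
 destruct (unfolding) as [C [HC H]]. exists C. split; auto.
 intros h k a b y m phi sg w u1 u2 Bd Hdet Hk Hy Hsg Hw H1 H12 H2 HBd.
 assert (1 <= IZR k) by bound.
 set (G := fun u => cp (2 * PI * m * (sg * u) + phi) (psi (IZR a / IZR k - sg / (IZR k ^ 2 * u), y / (IZR k ^ 2 * u ^ 2)))) in *.
 set (F := fun u => cp (2 * PI * m * (sg * u) + phi) (psi (IZR h / IZR k + sg * u, y))).
 assert (Hd : forall u, u1 <= u -> 0 < IZR k ^ 2 * u ^ 2) by bound.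
 assert (eF : ex_RInt F u1 u2) by (apply ex_RInt_cont; auto; intros; apply Uint_cont; auto).
 assert (eG : ex_RInt G u1 u2).
 { apply ex_RInt_cont; auto. intros u Hu. unfold G. apply cp_path_cont; auto.
  - apply Rdiv_lt_0_compat; auto; apply Hd; lra.
  - cont.
  - cont. apply Rgt_not_eq. apply Rmult_lt_0_compat; nra.
  - cont. bound. }
 change (Rabs (RInt F u1 u2) <= Bd + C * y).
 replace (RInt F u1 u2) with (RInt G u1 u2 + RInt (fun u => F u - G u) u1 u2).
 2: { rewrite (RInt_subR F G u1 u2 eF eG). ring. }
 le_by Rabs_triang. apply Rplus_le_compat; auto.
 apply Rle_trans with ((u2 - u1) * (C * (y / w))).
 - apply abs_RInt_le_const; auto. apply ex_RInt_subR; auto.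
  intros u Hu.
  assert (Eu : Rabs (sg * u) = u). { destruct Hsg as [->| ->]; [rewrite Rmult_1_l, Rabs_right; lra | replace (-1 * u) with (- u) by ring; rewrite Rabs_Ropp, Rabs_right; lra]. }
  assert (sg * sg = 1) by nra.
  assert (sg <> 0) by bound.
  pose proof (H (2 * PI * m * (sg * u) + phi) h k a b (sg * u) y Hdet Hk Hy ltac:(rewrite Eu; lra)) as Q.
  replace (/ (IZR k ^ 2 * (sg * u))) with (sg / (IZR k ^ 2 * u)) in Q.
  2: { assert (/ sg = sg) by (apply Rmult_eq_reg_l with sg; auto; rewrite Rinv_r; auto).
     rhs (/ sg * / (IZR k ^ 2 * u)). nra. }
  replace ((sg * u) ^ 2) with (u ^ 2) in Q by nra.
  le_by Q. mul_l. mul_l. apply Rinv_le_contravar; lra.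
 - trans_l (w * (C * (y / w))).
  bound.
Qed.

Definition Ly (y : R) : R := 3 + ln (2 + / y).

Lemma Ly_ge y : 0 < y -> 3 <= Ly y.
Proof.
 intros Hy. unfold Ly. assert (0 < / y) by bound.
 assert (0 < ln (2 + / y)). { rewrite <- ln_1. apply ln_increasing; lra. } lra.
Qed.

(** Dyadic ranges downwards from [v]: the bounds [k w^(3/2)] decrease geometrically, so the top
    range dominates, while the errors [O(y)] accumulate over logarithmically many ranges. Below
    [32 y] the boundedness of [psi] finishes. *)
Lemma near_lemma : exists C, 0 < C /\ forall (h k a b : Z) y m phi sg v u1 u2, (- a * h - b * k = 1)%Z -> (1 <= k)%Z -> 0 < y -> sg = 1 \/ sg = -1 ->
  0 <= u1 -> u1 <= u2 -> u2 <= v -> IZR k * v <= 1 ->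
  Rabs (Uint (IZR h / IZR k) m phi sg y u1 u2) <= C * (IZR k * (v * sqrt v) + y) * Ly y.
Proof.
 destruct unfold_int as [C2 [HC2 HU]]. destruct (near_block) as [C1 [HC1 HN]].
 destruct (psi_bounded) as [B [HB HBd]].
 set (Bc := 32 * B + C2).
 exists (4 * C1 + 2 * Bc). split. bound.
 intros h k a b y m phi sg v u1 u2 Hdet Hk Hy Hsg.
 assert (HkR : 1 <= IZR k) by bound. pose proof (Ly_ge y Hy) as HL. set (L := Ly y) in *.
 assert (Main : forall j v u1 u2, 0 <= u1 -> u1 <= u2 -> u2 <= v -> IZR k * v <= 1 -> v <= 32 * y * 2 ^ j ->
  Rabs (Uint (IZR h / IZR k) m phi sg y u1 u2) <= 4 * C1 * (IZR k * (v * sqrt v)) * L + Bc * (INR j + 1) * y).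
 { induction j; intros v0 a1 a2 H1 H12 H2 Hkv Hv.
  - eapply Rle_trans. apply (abs_RInt_le_const _ a1 a2 B); auto.
   apply ex_RInt_cont; auto. intros; apply Uint_cont; auto.
   assert (0 <= 4 * C1 * (IZR k * (v0 * sqrt v0)) * L) by bound.
   simpl. unfold Bc. nra.
  - rewrite S_INR.
   destruct (Rle_dec v0 (32 * y)) as [Hle|Hgt].
   + assert (1 <= 2 ^ j) by bound.
    eapply Rle_trans. apply (IHj v0); auto. nra. assert (0 < Bc * y) by bound. lra.
   + set (w := v0 / 2). set (am := Rmax a1 (Rmin w a2)).
    assert (Ham : a1 <= am <= a2). { split. apply Rmax_l. apply Rmax_lub; auto. apply Rmin_r. }
    set (F := fun u : R => cp (2 * PI * m * (sg * u) + phi) (psi (IZR h / IZR k + sg * u, y))).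
    assert (cF : forall x, a1 <= x <= a2 -> continuous F x) by (intros; apply Uint_cont; auto).
    change (Uint (IZR h / IZR k) m phi sg y a1 a2) with (RInt F a1 a2). rewrite (RInt_split F a1 am a2 Ham cF).
    le_by Rabs_triang.
    (* Halving the range at least halves the main term, so the constant [4 C1] reproduces itself:
       [4 C1 / 2 + C1 / 2 <= 4 C1]. *)
    assert (Hsw : w * sqrt w <= v0 * sqrt v0 / 2).
    { rhs (w * sqrt v0). bound. }
    assert (HwL : forall c, 0 <= c -> c * (IZR k * (w * sqrt w)) * L <= c * (IZR k * (v0 * sqrt v0)) * L / 2).
    { intros c Hc. rhs (c * (IZR k * (v0 * sqrt v0 / 2)) * L).
     bound. }
    assert (Q1 : Rabs (RInt F a1 am) <= 4 * C1 * (IZR k * (w * sqrt w)) * L + Bc * (INR j + 1) * y).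
    { destruct (Rle_dec a1 w) as [Ha|Ha].
     - apply (IHj w a1 am); auto; try lra.
      + apply Rmax_lub; auto. apply Rmin_l.
      + unfold w. nra.
      + unfold w. simpl in Hv. lra.
     - assert (E : am = a1). { apply Rmax_left. le_by Rmin_l. lra. }
      rewrite E, RInt_point. change (@zero RV) with 0. rewrite Rabs_R0.
      bound. }
    assert (Q2 : Rabs (RInt F am a2) <= C1 * (IZR k * (w * sqrt w)) * L + C2 * y).
    { destruct (Rle_dec w a2) as [Ha|Ha].
     - assert (Hwa : w <= am). { unfold am. rewrite Rmin_left by lra. apply Rmax_r. }
      apply (HU h k a b y m phi sg w am a2); auto; try lra.
      + unfold w; lra.
      + unfold w in *; lra.
      + eapply Rle_trans. apply (HN (IZR k) y m (IZR a / IZR k) sg phi w am a2); auto; try lra; unfold w in *; try lra.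
       fold w. mul_l.
       apply Rplus_le_compat_l.
       assert (w ^ 2 * IZR k ^ 2 / y <= / y).
       { rewrite <- (Rmult_1_l (/ y)). mul_r.
        assert (0 <= IZR k * w <= 1) by bound. nra. }
       apply ln_le. bound. lra.
     - assert (E : am = a2). { unfold am. rewrite Rmin_right by lra. apply Rmax_right. auto. }
      rewrite E, RInt_point. change (@zero RV) with 0. rewrite Rabs_R0.
      bound. }
    pose proof (HwL C1 ltac:(lra)).
    assert (C2 * y <= Bc * y) by bound.
    assert (0 <= C1 * (IZR k * (v0 * sqrt v0)) * L) by bound.
    lra. }
 intros H1 H12 H2 Hkv.
 assert (Hiy : 0 < / y) by bound.
 assert (Hln : 0 < ln (2 + / y)). { assert (ln 1 < ln (2 + / y)) by (apply ln_increasing; lra). rewrite ln_1 in H. auto. }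
 (* As [ln 2 > 1/2], about this many halvings lead from [v <= 1] down to [32 y]. *)
 destruct (nfloor_ex (2 * ln (2 + / y)) ltac:(lra)) as [j Hj].
 assert (2 + / y <= 2 ^ S j).
 { rewrite <- (exp_ln (2 + / y)) by lra. replace (2 ^ S j) with (exp (INR (S j) * ln 2)).
  - apply exp_le. rewrite S_INR. pose proof ln_lt_2. nra.
  - rewrite exp_pow_nat, exp_ln by lra. bound. }
 assert (v <= 1) by nra.
 eapply Rle_trans. apply (Main (S j) v u1 u2); auto.
 - apply Rle_trans with (32 * y * (2 + / y)); [|apply Rmult_le_compat_l; lra].
  rhs (64 * y + 32). lra.
 - rewrite S_INR. assert (INR j + 1 + 1 <= 2 * L) by (unfold L, Ly; lra).
  assert (Bc * (INR j + 1 + 1) * y <= Bc * (2 * L) * y) by bound.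
  assert (0 <= Bc * (IZR k * (v * sqrt v)) * L) by bound.
  assert (0 <= C1 * y * L) by bound.
  bound.
Qed.

Lemma spaced_filter_count (p : nat -> bool) N A B : (forall j, (j < N)%nat -> p j = true -> A <= INR j + 1 <= B) -> A <= B ->
  INR (length (filter p (seq 0 N))) <= B - A + 1.
Proof.
 intros H HAB. set (l := filter p (seq 0 N)).
 assert (Hl : forall j, In j l -> (j < N)%nat /\ p j = true). { intros j Hj. apply filter_In in Hj. destruct Hj as [Hj Hp]. apply in_seq in Hj. split; auto. lia. }
 destruct (Nat.eq_dec (length l) 0) as [E|E]. rewrite E. simpl. lra.
 assert (Hs : spaced 1 (map (fun j => INR j + 1) l)).
 { apply spaced_inj. apply NoDup_filter, seq_NoDup. intros x y _ _ Hxy. replace (INR x + 1 - (INR y + 1)) with (INR x - INR y) by ring. apply INR_spaced; auto. }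
 pose proof (spaced_count (length l) _ 1 A B (length_map _ _) Hs ltac:(lia)) as Q.
 assert ((INR (length l) - 1) * 1 <= B - A).
 { apply Q. intros x Hx. apply in_map_iff in Hx. destruct Hx as [j [<- Hj]]. destruct (Hl j Hj). auto. }
 lra.
Qed.

(** On each side of [n0] the distances are spaced by [1] and start at [1/2] or later, so each side
    is dominated by a harmonic sum. *)
Lemma inv_dist_sum (n0 : R) (p : nat -> bool) N : 0 <= n0 ->
  (forall j, p j = true -> 1 / 2 <= Rabs (INR j + 1 - n0) /\ INR j + 1 < 4 * n0 + 4) ->
  lsum (fun j => / Rabs (INR j + 1 - n0)) (filter p (seq 0 N)) <= 4 * (1 + ln (4 * n0 + 6)).
Proof.
 intros Hn0 Hp. set (l := filter p (seq 0 N)).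
 assert (Hl : forall j, In j l -> 1 / 2 <= Rabs (INR j + 1 - n0) /\ INR j + 1 < 4 * n0 + 4). { intros j Hj. apply filter_In in Hj. apply Hp; tauto. }
 assert (Hcount : INR (length l) <= 4 * n0 + 4).
 { unfold l. trans_r (4 * n0 + 4 - 1 + 1). apply (spaced_filter_count p N 1 (4 * n0 + 4)); [|lra].
  intros j _ Hj. pose proof (pos_INR j). destruct (Hp j Hj). lra. }
 assert (Part : forall (q : nat -> bool) (f : nat -> R), (forall j, In j (filter q l) -> f j = Rabs (INR j + 1 - n0)) ->
   (forall i j, In i (filter q l) -> In j (filter q l) -> i <> j -> 1 <= Rabs (f i - f j)) ->
   lsum (fun j => / f j) (filter q l) <= 2 * (1 + ln (4 * n0 + 6))).
 { intros q f Hf Hsp.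
  assert (Hs : spaced (1 / 2) (map f (filter q l))).
  { apply spaced_inj. apply NoDup_filter, NoDup_filter, seq_NoDup. intros x y Hx Hy Hxy. specialize (Hsp x y Hx Hy Hxy). lra. }
  pose proof (spaced_sum_inv (length (filter q l)) (map f (filter q l)) (1 / 2) (length_map _ _) ltac:(lra) Hs) as Q.
  rewrite lsum_map in Q. le_by Q.
  - intros x Hx. apply in_map_iff in Hx. destruct Hx as [j [<- Hj]]. rewrite Hf by auto. apply filter_In in Hj. apply Hl; tauto.
  - pose proof (harmonic_log (length (filter q l))) as Hh.
   assert (INR (length (filter q l)) <= 4 * n0 + 4). { eapply Rle_trans; [|apply Hcount]. apply le_INR. apply filter_length_le. }
   assert (ln (INR (length (filter q l)) + 1) <= ln (4 * n0 + 6)) by bound.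
   bound. }
 set (q := fun j => if Rle_dec n0 (INR j + 1) then true else false).
 assert (lsum (fun j => / Rabs (INR j + 1 - n0)) l = lsum (fun j => / (INR j + 1 - n0)) (filter q l) + lsum (fun j => / (n0 - (INR j + 1))) (filter (fun j => negb (q j)) l)).
 { clear. generalize l. clear l. intros l. induction l as [|j l IH]. cbn [filter lsum]. ring. cbn [filter lsum].
  rewrite IH. assert (Hq : q j = true <-> n0 <= INR j + 1). { unfold q. destruct (Rle_dec n0 (INR j + 1)); split; intros; auto; try discriminate; lra. }
  destruct (q j); cbn [negb lsum]; [assert (H : n0 <= INR j + 1) by (apply Hq; auto) | assert (H : ~ n0 <= INR j + 1) by (intros H; apply Hq in H; discriminate)].
  - rewrite Rabs_right by lra. ring.
  - rewrite Rabs_left by lra. bound. }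
 assert (lsum (fun j => / (INR j + 1 - n0)) (filter q l) <= 2 * (1 + ln (4 * n0 + 6))).
 { apply (Part q (fun j => INR j + 1 - n0)).
  - intros j Hj. apply filter_In in Hj. destruct Hj as [_ Hj]. unfold q in Hj. destruct (Rle_dec n0 (INR j + 1)); [|discriminate]. rewrite Rabs_right; lra.
  - intros i j _ _ Hij. replace (INR i + 1 - n0 - (INR j + 1 - n0)) with (INR i - INR j) by ring. apply INR_spaced; auto. }
 assert (lsum (fun j => / (n0 - (INR j + 1))) (filter (fun j => negb (q j)) l) <= 2 * (1 + ln (4 * n0 + 6))).
 { apply (Part (fun j => negb (q j)) (fun j => n0 - (INR j + 1))).
  - intros j Hj. apply filter_In in Hj. destruct Hj as [_ Hj]. unfold q in Hj. destruct (Rle_dec n0 (INR j + 1)); [discriminate|]. rewrite Rabs_left; lra.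
  - intros i j _ _ Hij. replace (n0 - (INR i + 1) - (n0 - (INR j + 1))) with (- (INR i - INR j)) by ring. rewrite Rabs_Ropp. apply INR_spaced; auto. }
 lra.
Qed.

(* [n0] is the stationary frequency: dual terms away from it are handled by the first-derivative test. *)
Lemma far_block : exists C, 0 < C /\ forall (k : R) y m A sg phi eta l u1 u2 Th A1, 1 <= k -> 0 < y -> 0 < m -> 0 < eta ->
  0 <= l -> 16 * l <= eta -> eta <= u1 -> u1 <= u2 -> u2 <= eta + l -> sg = 1 \/ sg = -1 -> 1 <= Th -> 0 <= A1 ->
  (forall n, (1 <= n)%Z -> IZR n <= 4 * (k ^ 2 * eta ^ 2 * m) + 4 -> Cmod (t n) <= Th) ->
  (forall n, (1 <= n)%Z -> Cmod (t n) <= A1 * sqrt (sqrt (IZR n))) ->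
  Rabs (RInt (fun u => cp (2 * PI * m * (sg * u) + phi) (psi (A - sg / (k ^ 2 * u), y / (k ^ 2 * u ^ 2)))) u1 u2) <=
   C * (Th * l * k * sqrt eta + A1 / (sqrt m * sqrt (sqrt m)) + Th * (1 + ln (4 * (k ^ 2 * eta ^ 2 * m) + 6)) * (k * eta / sqrt m)).
Proof.
 destruct (coef_sum) as [Ct [HCt Hsum]].
 exists (1008 * Ct + 20000). split. lra.
 intros k y m A sg phi eta l u1 u2 Th A1 Hk Hy Hm Heta Hl Hl16 Hu1 Hu12 Hu2 Hsg HTh HA1 HtTh Ht4.
 set (n0 := k ^ 2 * eta ^ 2 * m) in *.
 assert (Hk2 : 0 < k ^ 2) by nra. assert (He2 : 0 < eta ^ 2) by nra.
 set (D := k ^ 2 * eta ^ 2). assert (HD : 0 < D) by bound.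
 assert (Hn0 : 0 < n0) by bound.
 assert (Hn0D : n0 = D * m) by (unfold n0, D; ring).
 set (q := sqrt m). assert (Hq : 0 < q) by bound.
 assert (Hsn0 : sqrt n0 = k * eta * q).
 { rewrite Hn0D. unfold D. rewrite sqrt_mult by nra. replace (k ^ 2 * eta ^ 2) with ((k * eta) * (k * eta)) by ring. rewrite sqrt_square by nra. bound. }
 assert (Hsn0p : 0 < sqrt n0) by bound.
 assert (Hse : 0 < sqrt eta) by bound.
 (* Relative length of the range; over it [nu / u^2] changes by a proportion of at most [2 lam]. *)
 set (lam := l / eta). assert (Hlam : 0 <= lam <= 1 / 16).
 { unfold lam. split. bound. apply Rmult_le_reg_r with eta; auto. unfold Rdiv at 1. rewrite Rmult_assoc, Rinv_l; lra. }
 assert (Hleta : l = lam * eta) by bound.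
 (* Outside [mid] the derivative of the phase is at least a multiple of [(N + n0) / D]. Inside,
    frequencies farther from [n0] than about [4 lam n0] have no stationary point in the range and a
    derivative of size at least [|N - n0| / (4 D)], up to [2 PI]. Only the rest needs the
    second-derivative test. *)
 set (mid := fun x => if Rlt_dec (n0 / 2) x then if Rlt_dec x (4 * n0 + 4) then true else false else false).
 set (far := fun x => if Rle_dec (4 * lam * n0 + 1 / 2) (Rabs (x - n0)) then true else false).
 set (c := fun x => / (sqrt x * (x + n0))).
 set (F := fun x => 240 * (k * eta / q) * / Rabs (x - n0)).
 set (H := 1176 * (k * (eta * sqrt eta)) / n0).
 set (S := fun n => 126 * D * c (Rabs (IZR n)) +
   (if Z_lt_dec 0 n then if mid (IZR n) then if far (IZR n) then F (IZR n) else H else 0 else 0)).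
 apply (dual_bound k y m A sg phi u1 u2 S); auto; try lra.
 - intros n V phi' Hn HV. pose proof PI2_3_2 as HP.
  assert (Hn1 : 1 <= Rabs (IZR n)). { rewrite <- abs_IZR. bound. }
  set (N := Rabs (IZR n)) in *.
  assert (0 < sqrt N) by bound. assert (sqrt N * sqrt N = N) by bound.
  assert (0 < sqrt y / k) by bound.
  assert (0 < 2 * PI * N * y / k ^ 2) by bound.
  assert (IZR n / k ^ 2 <> 0). { intros E. apply Hn. apply eq_IZR. apply Rmult_eq_reg_r with (/ k ^ 2). bound. bound. }
  assert (0 <= 84 * (sqrt y / k) / sqrt (2 * PI * N * y / k ^ 2) * Rmin 1 (4 * eta ^ 2 / (2 * PI * N * y / k ^ 2)) <= 42 / sqrt N).
  { pose proof (s_over_om N k y ltac:(lra) Hy Hn1) as Hso.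
   set (so := sqrt y / k / sqrt (2 * PI * N * y / k ^ 2)) in *.
   replace (84 * (sqrt y / k) / sqrt (2 * PI * N * y / k ^ 2)) with (84 * so) by bound.
   assert (0 <= Rmin 1 (4 * eta ^ 2 / (2 * PI * N * y / k ^ 2)) <= 1).
   { split. bound. apply Rmin_l. }
   split. bound.
   rhs (84 * / (2 * sqrt N) * 1).
   bound. }
  set (A0 := 84 * (sqrt y / k) / sqrt (2 * PI * N * y / k ^ 2) * Rmin 1 (4 * eta ^ 2 / (2 * PI * N * y / k ^ 2))) in *.
  assert (First : forall lm, 0 < lm -> (forall u, u1 <= u <= u2 -> lm <= IZR n / k ^ 2 / u ^ 2 - m) \/ (forall u, u1 <= u <= u2 -> IZR n / k ^ 2 / u ^ 2 - m <= - lm) ->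
   Rabs (Qint V (sqrt y / k) (2 * PI * N * y / k ^ 2) (IZR n / k ^ 2) m phi' u1 u2) <= 42 / sqrt N / lm).
  { intros lm Hlm Hd. eapply Rle_trans. apply (Q_first V _ _ _ m phi' eta u1 u2 lm); auto; lra.
   fold A0. bound. }
  assert (Hc : forall b, 0 < b -> 42 / sqrt N / ((N + n0) / (b * D)) = 42 * b * D * c N) by bound.
  assert (0 < c N) by bound.
  assert (0 <= 126 * D * c N) by bound.
  assert (Hnu2 : forall u, u1 <= u <= u2 -> IZR n / k ^ 2 / u ^ 2 - m = (IZR n * (eta ^ 2 / u ^ 2) - n0) / D).
  { intros u Hu. rewrite Hn0D. bound. }
  assert (Hratio : forall u, u1 <= u <= u2 -> 1 - 2 * lam <= eta ^ 2 / u ^ 2 <= 1).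
  { intros u Hu. assert (0 < u ^ 2) by nra.
   assert (eta ^ 2 <= u ^ 2) by bound.
   assert (u ^ 2 <= (eta * (1 + lam)) ^ 2) by bound.
   split; apply Rmult_le_reg_r with (u ^ 2); auto; unfold Rdiv; rewrite Rmult_assoc, Rinv_l by lra; [|lra].
   trans_l ((1 - 2 * lam) * (eta * (1 + lam)) ^ 2).
   lhs (eta ^ 2 * ((1 - 2 * lam) * (1 + lam) ^ 2)).
   mul_l. nra. }
  unfold S. fold N.
  destruct (Z_lt_dec 0 n) as [Hpos|Hneg].
  + assert (EN : IZR n = N). { unfold N. rewrite Rabs_right; auto. apply Rle_ge. bound. }
   rewrite EN in *.
   assert (LowHigh : (N <= n0 / 2 \/ 4 * n0 + 4 <= N) -> Rabs (Qint V (sqrt y / k) (2 * PI * N * y / k ^ 2) (N / k ^ 2) m phi' u1 u2) <= 126 * D * c N).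
   { intros [Hlow|Hhigh].
    - rhs (42 * 3 * D * c N). rewrite <- Hc by lra. apply First. bound.
     right. intros u Hu. rewrite Hnu2 by auto. destruct (Hratio u Hu).
     rhs ((- (N + n0) / 3) / D).
     mul_r. nra.
    - apply Rle_trans with (42 * 2 * D * c N). 2: { bound. }
     rewrite <- Hc by lra. apply First. bound.
     left. intros u Hu. rewrite Hnu2 by auto. destruct (Hratio u Hu).
     lhs (((N + n0) / 2) / D).
     mul_r.
     assert (N * (7 / 8) <= N * (eta ^ 2 / u ^ 2)) by bound. lra. }
   unfold mid. destruct (Rlt_dec (n0 / 2) N) as [Hm1|Hm1]; [|specialize (LowHigh ltac:(lra)); lra].
   destruct (Rlt_dec N (4 * n0 + 4)) as [Hm2|Hm2]; [|specialize (LowHigh ltac:(lra)); lra].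
   unfold far. destruct (Rle_dec (4 * lam * n0 + 1 / 2) (Rabs (N - n0))) as [Hf|Hf].
   * assert (0 < Rabs (N - n0)) by nra.
    assert (Rabs (Qint V (sqrt y / k) (2 * PI * N * y / k ^ 2) (N / k ^ 2) m phi' u1 u2) <= 42 / sqrt N / (Rabs (N - n0) / (4 * D))).
    { apply First. bound.
     replace (Rabs (N - n0) / (4 * D)) with (Rabs (N - n0) / 4 / D) by bound.
     destruct (Rle_dec n0 N) as [Hge|Hlt].
     - left. rewrite Rabs_right in * by lra. intros u Hu. rewrite Hnu2 by auto. destruct (Hratio u Hu) as [R1 R2].
      mul_r.
      assert (N * (1 - 2 * lam) <= N * (eta ^ 2 / u ^ 2)) by bound.
      assert (lam * (N - n0) <= 1 / 16 * (N - n0)) by bound. nra.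
     - right. rewrite Rabs_left in * by lra. intros u Hu. rewrite Hnu2 by auto. destruct (Hratio u Hu) as [R1 R2].
      rhs (((N - n0) / 4) / D).
      mul_r.
      assert (N * (eta ^ 2 / u ^ 2) <= N * 1) by bound. lra. }
    (* Here [N > n0 / 2], and [168 / 240] lies just below [/ sqrt 2]: the origin of the constant
       [240] in [F]. *)
    assert (sqrt n0 * (168 / 240) <= sqrt N).
    { apply Rsqr_incr_0_var; [|lra]. unfold Rsqr. lhs ((sqrt n0 * sqrt n0) * (168 / 240 * (168 / 240))).
     rewrite sqrt_sqrt by lra. lra. }
    assert (42 / sqrt N / (Rabs (N - n0) / (4 * D)) <= F N).
    { unfold F. lhs (168 * D * / sqrt N * / Rabs (N - n0)).
     mul_r.
     apply Rle_trans with (168 * D * / (sqrt n0 * (168 / 240))).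
     - mul_l. apply Rinv_le_contravar. nra. auto.
     - right. rewrite Hsn0. bound. }
    lra.
   * assert (Hnear : Rabs (N - n0) < 4 * lam * n0 + 1 / 2) by lra.
    apply Rabs_def2 in Hnear.
    assert (Rabs (Qint V (sqrt y / k) (2 * PI * N * y / k ^ 2) (N / k ^ 2) m phi' u1 u2) <= 14 * (42 / sqrt N) * (eta * sqrt eta / (sqrt N / k))).
    { eapply Rle_trans. apply (Q_second V _ _ _ m phi' eta u1 u2); auto; lra.
     fold A0. rewrite (Rabs_right (N / k ^ 2)) by (apply Rle_ge, Rdiv_le_0_compat; lra).
     replace (sqrt (N / k ^ 2)) with (sqrt N / k). 2: { rewrite sqrt_div by lra. replace (k ^ 2) with (k * k) by ring. rewrite sqrt_square by lra. bound. }
     bound. }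
    assert (14 * (42 / sqrt N) * (eta * sqrt eta / (sqrt N / k)) <= H).
    { lhs (588 * (k * (eta * sqrt eta)) / (sqrt N * sqrt N)).
     unfold H. rhs (588 * (k * (eta * sqrt eta)) / (n0 / 2)).
     bound. }
    lra.
  + assert (EN : IZR n = - N). { unfold N. rewrite Rabs_left; [ring|]. apply IZR_lt. lia. }
   apply Rle_trans with (42 * 2 * D * c N). 2: { bound. }
   rewrite <- Hc by lra. apply First. bound.
   right. intros u Hu. rewrite Hnu2 by auto. destruct (Hratio u Hu). rewrite EN.
   rhs ((- (N + n0) / 2) / D).
   mul_r.
   assert (N * (7 / 8) <= N * (eta ^ 2 / u ^ 2)) by bound. lra.
 - intros N. rewrite lsum_zl.
  set (T1 := fun j => Cmod (t (Z.of_nat (Datatypes.S j)))). set (Tm := fun j => T1 j + Cmod (t (- Z.of_nat (Datatypes.S j)))).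
  set (X := fun j => INR j + 1).
  assert (EX : forall j, IZR (Z.of_nat (Datatypes.S j)) = X j) by (intros; unfold X; rewrite <- INR_IZR_INZ, S_INR; auto).
  set (pf := fun j => andb (mid (X j)) (far (X j))). set (pn := fun j => andb (mid (X j)) (negb (far (X j)))).
  assert (rsum (fun k0 => 2 * Cmod (t (Z.of_nat (Datatypes.S k0))) * S (Z.of_nat (Datatypes.S k0)) + 2 * Cmod (t (- Z.of_nat (Datatypes.S k0))) * S (- Z.of_nat (Datatypes.S k0))%Z) N
   = rsum (fun j => Tm j * (252 * D * c (X j))) N + (lsum (fun j => 2 * T1 j * F (X j)) (filter pf (seq 0 N)) + lsum (fun j => 2 * T1 j * H) (filter pn (seq 0 N)))).
  { rewrite !lsum_filter, <- lsum_add, <- rsum_lsum, <- rsum_add. apply rsum_ext. intros j _.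
   unfold S. destruct (abs_pm j) as [E1 E2]. rewrite E1, E2, EX. fold (X j).
   destruct (Z_lt_dec 0 (Z.of_nat (Datatypes.S j))); [|lia]. destruct (Z_lt_dec 0 (- Z.of_nat (Datatypes.S j))); [lia|].
   unfold Tm, T1, pf, pn. destruct (mid (X j)); [destruct (far (X j))|]; simpl andb; simpl negb; cbn iota; ring. }
  assert (HX1 : forall j, 1 <= X j) by (intros j; unfold X; pose proof (pos_INR j); lra).
  assert (Hmid : forall j, mid (X j) = true -> n0 / 2 < X j < 4 * n0 + 4).
  { intros j. unfold mid. destruct (Rlt_dec (n0 / 2) (X j)); [|discriminate]. destruct (Rlt_dec (X j) (4 * n0 + 4)); [auto|discriminate]. }
  assert (HTTh : forall j, mid (X j) = true -> T1 j <= Th).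
  { intros j Hj. apply HtTh. lia. rewrite EX. apply Hmid in Hj. lra. }
  set (Eo := k * eta / q). assert (0 < Eo) by bound.
  set (Lg := 1 + ln (4 * n0 + 6)). assert (1 <= Lg). { unfold Lg. assert (0 < ln (4 * n0 + 6)) by (rewrite <- ln_1; apply ln_increasing; lra). lra. }
  assert (rsum (fun j => Tm j * (252 * D * c (X j))) N <= 1008 * Ct * Eo).
  { eapply Rle_trans. apply (rsum_abel Tm _ Ct); auto.
   - intros j _. specialize (HX1 j). assert (0 < c (X j)) by bound. nra.
   - intros j _. specialize (HX1 j). mul_l. unfold c. apply Rinv_le_contravar.
    bound.
    assert (X j <= X (Datatypes.S j)) by bound.
    apply Rmult_le_compat; try lra. bound. apply sqrt_le_1_alt; auto.
   - rewrite rsum_mul. pose proof (sum_c n0 N Hn0) as Hc4.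
    trans_l (Ct * (252 * D * (4 / sqrt n0))).
    right. rewrite Hsn0. unfold D, Eo. bound. }
  assert (lsum (fun j => 2 * T1 j * F (X j)) (filter pf (seq 0 N)) <= 1920 * (Th * Lg * Eo)).
  { apply Rle_trans with (lsum (fun j => (480 * Th * Eo) * / Rabs (X j - n0)) (filter pf (seq 0 N))).
   - apply lsum_le. intros j Hj. apply filter_In in Hj. destruct Hj as [_ Hj]. apply andb_prop in Hj. destruct Hj as [Hj1 Hj2].
    specialize (HTTh j Hj1). unfold far in Hj2. destruct (Rle_dec (4 * lam * n0 + 1 / 2) (Rabs (X j - n0))); [|discriminate].
    assert (0 < / Rabs (X j - n0)) by (apply Rinv_0_lt_compat; assert (0 <= lam * n0) by (apply Rmult_le_pos; lra); lra).
    unfold F. fold Eo.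
    lhs (480 * T1 j * Eo * / Rabs (X j - n0)).
    mul_r. mul_r. lra.
   - rewrite lsum_mul. rhs (480 * Th * Eo * (4 * Lg)).
    mul_l. apply (inv_dist_sum n0 pf N). lra.
    intros j Hj. apply andb_prop in Hj. destruct Hj as [Hj1 Hj2].
    unfold far in Hj2. destruct (Rle_dec (4 * lam * n0 + 1 / 2) (Rabs (X j - n0))); [|discriminate].
    apply Hmid in Hj1. fold (X j). nra. }
  assert (lsum (fun j => 2 * T1 j * H) (filter pn (seq 0 N)) <= 20000 * (Th * l * k * sqrt eta + A1 / (q * sqrt q))).
  { assert (0 < H) by bound.
   assert (Hpn : forall j, pn j = true -> mid (X j) = true /\ Rabs (X j - n0) < 4 * lam * n0 + 1 / 2).
   { intros j Hj. apply andb_prop in Hj. destruct Hj as [Hj1 Hj2]. split; auto.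
    unfold far in Hj2. destruct (Rle_dec (4 * lam * n0 + 1 / 2) (Rabs (X j - n0))); [discriminate|lra]. }
   set (r := sqrt (sqrt n0)).
   (* There are at most [8 lam n0 + 2] frequencies of this kind. The part proportional to [lam n0]
      is charged with [Th]. The remaining [2], present even for very short ranges, is charged with
      the bound by [n^(1/4)], which leaves [m^(-3/4)]. *)
   set (P := Rmin Th (2 * A1 * r)).
   assert (HTP : forall j, pn j = true -> T1 j <= P).
   { intros j Hj. destruct (Hpn j Hj) as [Hj1 Hj2]. unfold P. apply Rmin_glb. auto.
    le_by Ht4. lia. rewrite EX. rewrite (Rmult_comm 2), Rmult_assoc. mul_l.
    specialize (HX1 j). apply Rabs_def2 in Hj2.
    assert (lam * n0 <= 1 / 16 * n0) by bound.
    trans_l (sqrt (sqrt (16 * n0))).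
    right. unfold r. rewrite sqrt_mult by lra. replace 16 with (4 * 4) by ring. rewrite sqrt_square by lra.
    rewrite sqrt_mult by (try lra; apply sqrt_pos). replace 4 with (2 * 2) by ring. rewrite sqrt_square by lra. bound. }
   assert (INR (length (filter pn (seq 0 N))) <= 8 * lam * n0 + 2).
   { le_by (spaced_filter_count pn N (n0 - (4 * lam * n0 + 1 / 2)) (n0 + (4 * lam * n0 + 1 / 2))).
    intros j _ Hj. destruct (Hpn j Hj) as [_ Hj2]. apply Rabs_def2 in Hj2. fold (X j). lra. nra. lra. }
   apply Rle_trans with (lsum (fun _ => 2 * P * H) (filter pn (seq 0 N))).
   - apply lsum_le. intros j Hj. apply filter_In in Hj. destruct Hj as [_ Hj]. specialize (HTP j Hj). apply Rmult_le_compat_r; lra.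
   - rewrite lsum_const.
    trans_l ((8 * lam * n0 + 2) * (2 * P * H)).
    assert (E1 : lam * n0 * H = 1176 * (l * k * sqrt eta)). { unfold H. bound. }
    assert (E2 : r * H <= 1176 * (1 / (q * sqrt q))).
    { assert (Err : r * r = k * eta * q). { unfold r. rewrite sqrt_sqrt by lra. auto. }
     assert (Hr4 : n0 = (r * r) * (r * r)). { rewrite Err. rewrite <- Hsn0. bound. }
     assert (sqrt eta * sqrt q <= r).
     { rewrite <- sqrt_mult by lra. unfold r. rewrite Hsn0. bound. }
     assert (EH : r * H = 1176 * (sqrt eta / (r * q))).
     { unfold H. rewrite Hr4. rewrite Err at 1. bound. }
     rewrite EH. mul_l.
     apply Rle_trans with (sqrt eta / ((sqrt eta * sqrt q) * q)).
     - mul_l. apply Rinv_le_contravar. bound. apply Rmult_le_compat_r; lra.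
     - bound. }
    assert (P <= Th) by apply Rmin_l. assert (P <= 2 * A1 * r) by apply Rmin_r.
    assert (lam * n0 * H * P <= 1176 * (l * k * sqrt eta) * Th) by bound.
    assert (P * H <= 2 * A1 * (1176 * (1 / (q * sqrt q)))) by nra.
    assert (0 <= Th * l * k * sqrt eta) by bound.
    assert (0 <= A1 / (q * sqrt q)) by bound.
    bound. }
  fold q.
  assert (Eo <= Th * Lg * Eo) by bound.
  assert (Ct * Eo <= Ct * (Th * Lg * Eo)) by bound.
  assert (0 <= Ct * (Th * l * k * sqrt eta)) by bound. assert (0 <= Ct * (A1 / (q * sqrt q))) by bound.
  lra.
Qed.

Lemma far_lemma : exists C, 0 < C /\ forall (h k a b : Z) y m phi sg eta l u1 u2 Th A1, (- a * h - b * k = 1)%Z -> (1 <= k)%Z -> 0 < y -> 0 < m ->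
  16 * y <= eta -> 0 <= l -> 16 * l <= eta -> eta <= u1 -> u1 <= u2 -> u2 <= eta + l -> sg = 1 \/ sg = -1 -> 1 <= Th -> 0 <= A1 ->
  (forall n, (1 <= n)%Z -> IZR n <= 4 * (IZR k ^ 2 * eta ^ 2 * m) + 4 -> Cmod (t n) <= Th) ->
  (forall n, (1 <= n)%Z -> Cmod (t n) <= A1 * sqrt (sqrt (IZR n))) ->
  Rabs (Uint (IZR h / IZR k) m phi sg y u1 u2) <=
   C * (Th * l * IZR k * sqrt eta + A1 / (sqrt m * sqrt (sqrt m)) + Th * (1 + ln (4 * (IZR k ^ 2 * eta ^ 2 * m) + 6)) * (IZR k * eta / sqrt m) + y).
Proof.
 destruct (unfold_int) as [C2 [HC2 HU]]. destruct far_block as [C1 [HC1 HF]].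
 exists (C1 + C2). split. lra.
 intros h k a b y m phi sg eta l u1 u2 Th A1 Hdet Hk Hy Hm H16 Hl Hl16 H1 H12 H2 Hsg HTh HA1 Hth H4.
 assert (HkR : 1 <= IZR k) by bound.
 pose proof (HF (IZR k) y m (IZR a / IZR k) sg phi eta l u1 u2 Th A1 HkR Hy Hm ltac:(lra) Hl Hl16 H1 H12 H2 Hsg HTh HA1 Hth H4) as Q.
 le_by (HU h k a b y m phi sg eta u1 u2 _ Hdet Hk Hy Hsg H16 H1 H12 ltac:(lra) Q).
 set (E := Th * l * IZR k * sqrt eta + A1 / (sqrt m * sqrt (sqrt m)) + Th * (1 + ln (4 * (IZR k ^ 2 * eta ^ 2 * m) + 6)) * (IZR k * eta / sqrt m)) in *.
 assert (0 <= E). { pose proof (Rabs_pos (RInt (fun u => cp (2 * PI * m * (sg * u) + phi) (psi (IZR a / IZR k - sg / (IZR k ^ 2 * u), y / (IZR k ^ 2 * u ^ 2)))) u1 u2)).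
  nra. }
 nra.
Qed.

(** * Pairs of phases *)

Lemma RInt_FTC (G g : R -> R) a b : a <= b -> (forall x, a <= x <= b -> is_derive G x (g x)) ->
  (forall x, a <= x <= b -> continuous g x) -> RInt g a b = G b - G a.
Proof.
 intros Hab HG Hg. assert (I : is_RInt g a b (minus (G b) (G a))).
 { apply (is_RInt_derive (V := RV)); rewrite Rmin_left, Rmax_right by lra; auto. }
 apply (is_RInt_unique (V := RV)) in I. bound.
Qed.

(* First-derivative test when [f1 / dl] is tame and [dl] is affine: no lower bound for [f2] is needed. *)
Lemma osc_lin (B B' f f1 : R -> R) a b e0 q d0 B0 V1 : a <= b -> 0 < d0 ->
  (forall x, a <= x <= b -> is_derive B x (B' x)) -> (forall x, a <= x <= b -> continuous B' x) ->
  (forall x, a <= x <= b -> is_derive f x (f1 x)) -> (forall x, a <= x <= b -> continuous f1 x) ->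
  (forall x, a <= x <= b -> d0 <= Rabs (e0 - q * x)) ->
  (forall x, a <= x <= b -> Rabs (B x) <= B0) -> (forall x, a <= x <= b -> Rabs (B' x) <= V1) ->
  Rabs (RInt (fun x => B x * f1 x / (e0 - q * x) * cos (f x)) a b) <= (4 * B0 + (b - a) * V1) / d0.
Proof.
 intros Hab Hd0 HB HB' Hf Hf1 Hd HB0 HV1.
 set (de := fun x => e0 - q * x). change (forall x, a <= x <= b -> d0 <= Rabs (de x)) in Hd.
 assert (Hn0 : forall x, a <= x <= b -> de x <> 0). { intros x Hx E. specialize (Hd x Hx). rewrite E, Rabs_R0 in Hd. lra. }
 assert (Hpos : forall x, a <= x <= b -> 0 < de x ^ 2) by (intros; apply pow2_gt_0; auto).
 assert (forall x, a <= x <= b -> continuous B x) by (intros; eapply is_derive_continuous; eauto).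
 assert (forall x, a <= x <= b -> continuous f x) by (intros; eapply is_derive_continuous; eauto).
 assert (forall x, continuous de x) by (intros; unfold de; cont).
 set (G := fun x => B x * sin (f x) / de x).
 set (r := fun x => B' x * sin (f x) / de x + B x * sin (f x) * (q / de x ^ 2)).
 set (g := fun x => B x * f1 x / de x * cos (f x)).
 assert (forall x, a <= x <= b -> is_derive G x (g x + r x)).
 { intros x Hx. unfold G, g, r. pose proof (HB x Hx) as D1. pose proof (Hf x Hx) as D2. specialize (Hn0 x Hx). unfold de in *.
  auto_derive.
  - repeat split; auto; eexists; eassumption.
  - apply is_derive_unique in D1. apply is_derive_unique in D2. change (fun x0 : R => B x0) with B; change (fun x0 : R => f x0) with f. rewrite D1, D2. bound. }
 assert (forall x, a <= x <= b -> continuous r x) by (intros x Hx; unfold r; cont; auto; apply Rgt_not_eq; apply Hpos; auto).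
 assert (forall x, a <= x <= b -> continuous g x) by (intros x Hx; unfold g; cont; auto).
 assert (E : RInt g a b = G b - G a - RInt r a b).
 { assert (I : RInt (fun x => g x + r x) a b = G b - G a) by (apply RInt_FTC; auto; intros; cont; auto).
  rewrite (RInt_addR g r a b) in I; [lra| |]; apply ex_RInt_cont; auto. }
 assert (0 <= B0). { trans_l (Rabs (B a)). apply HB0; lra. }
 assert (Hinv : forall x, a <= x <= b -> Rabs (/ de x) <= / d0).
 { intros x Hx. rewrite Rabs_inv. apply Rinv_le_contravar; auto. }
 assert (forall x, Rabs (sin x) <= 1) by (intros; apply Rabs_le, SIN_bound).
 assert (HGb : forall x, a <= x <= b -> Rabs (G x) <= B0 / d0).
 { intros x Hx. unfold G, Rdiv. rewrite !Rabs_mult. apply Rmult_le_compat; try apply Rabs_pos; auto.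
  bound. rewrite <- (Rmult_1_r B0). apply Rmult_le_compat; try apply Rabs_pos; auto. }
 assert (EI : q * RInt (fun x => / de x ^ 2) a b = / de b - / de a).
 { rewrite <- RInt_mulR. 2: { apply ex_RInt_cont; auto. intros; cont; auto. apply Rgt_not_eq; apply Hpos; auto. }
  apply (RInt_FTC (fun x => / de x)); auto.
  - intros x Hx. specialize (Hn0 x Hx). unfold de in *. auto_derive; auto. field. auto.
  - intros x Hx. cont; auto. apply Rgt_not_eq; apply Hpos; auto. }
 assert (forall x, a <= x <= b -> continuous (fun x => / de x ^ 2) x) by (intros; cont; auto; apply Rgt_not_eq; apply Hpos; auto).
 assert (0 <= RInt (fun x => / de x ^ 2) a b).
 { apply RInt_ge0; auto. apply ex_RInt_cont; auto. intros x Hx. left; apply Rinv_0_lt_compat; auto. }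
 assert (Rabs q * RInt (fun x => / de x ^ 2) a b <= 2 / d0).
 { rewrite <- (Rabs_right (RInt (fun x => / de x ^ 2) a b)) by lra. rewrite <- Rabs_mult, EI.
  le_by Rabs_triang. rewrite Rabs_Ropp. pose proof (Hinv a ltac:(lra)). pose proof (Hinv b ltac:(lra)). bound. }
 assert (Rabs (RInt r a b) <= (b - a) * (V1 / d0) + B0 * (2 / d0)).
 { eapply Rle_trans. apply abs_RInt_le; auto. apply ex_RInt_cont; auto.
  set (i2 := fun x => / de x ^ 2) in *.
  apply Rle_trans with (RInt (fun x => V1 / d0 * 1 + B0 * Rabs q * i2 x) a b).
  - apply RInt_le; auto.
   + apply ex_RInt_cont; auto. intros; cont; auto.
   + apply ex_RInt_cont; auto. intros; cont; auto.
   + intros x Hx. assert (a <= x <= b) by lra. unfold r. le_by Rabs_triang. apply Rplus_le_compat.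
    * rewrite Rmult_1_r. unfold Rdiv. rewrite !Rabs_mult. apply Rmult_le_compat; try apply Rabs_pos; auto.
     bound. rewrite <- (Rmult_1_r V1). apply Rmult_le_compat; try apply Rabs_pos; auto.
    * unfold Rdiv. rewrite !Rabs_mult. rewrite (Rabs_right (/ de x ^ 2)). 2: { left. apply Rinv_0_lt_compat; auto. }
     rewrite <- Rmult_assoc. apply Rmult_le_compat_r. left. apply Rinv_0_lt_compat; auto.
     mul_r. rewrite <- (Rmult_1_r B0). apply Rmult_le_compat; try apply Rabs_pos; auto.
  - rewrite (RInt_lin2 (V1 / d0) (B0 * Rabs q) (fun _ => 1) i2 a b).
   2: apply ex_RInt_const. 2: apply ex_RInt_cont; auto.
   rewrite RInt_const. change (scal (b - a) 1) with ((b - a) * 1). nra. }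
 change (Rabs (RInt g a b) <= (4 * B0 + (b - a) * V1) / d0). rewrite E.
 le_by Rabs_triang. rewrite Rabs_Ropp.
 assert (Rabs (G b - G a) <= 2 * (B0 / d0)).
 { le_by Rabs_triang. rewrite Rabs_Ropp. pose proof (HGb a ltac:(lra)). pose proof (HGb b ltac:(lra)). lra. }
 bound.
Qed.

Section Pair.
Variables w w' : R -> R.
Variables L W0 m ka : R.
Hypothesis HL : 0 < L.
Hypothesis Hm : 0 < m.
Hypothesis Hka : 0 < ka.
Hypothesis Hw : forall p, L <= p <= 2 * L -> is_derive w p (w' p).
Hypothesis Hwc : forall p, L <= p <= 2 * L -> continuous w' p.
Hypothesis HW : forall p, L <= p <= 2 * L -> Rabs (w p) <= W0.
Hypothesis HW' : forall p, L <= p <= 2 * L -> Rabs (w' p) <= W0 / L.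

(** The correlation of two arcs in the common variable [X]: the product of their amplitudes times
    the cosine of the difference of their phases. For the arc with denominator [k], the quantity
    [p = a - k X] is [/ (k u)]. *)
Definition pint (k1 a1 th1 k2 a2 th2 X : R) : R :=
  w (a1 - k1 * X) / (a1 - k1 * X) ^ 2 * (w (a2 - k2 * X) / (a2 - k2 * X) ^ 2) *
  cos (2 * PI * m / (k1 * (a1 - k1 * X)) + th1 - (2 * PI * m / (k2 * (a2 - k2 * X)) + th2)).

Lemma w_cont p : L <= p <= 2 * L -> continuous w p.
Proof. intros Hp. eapply is_derive_continuous. apply Hw; auto. Qed.

(** In [X] the phase [2 PI m / (k p)] has derivative [2 PI m / p^2], so the difference of the phases
    has derivative [2 PI m (p2 - p1) (p2 + p1) / (p1 p2)^2]. The weights [/ p^2] absorb the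
    denominator, and the affine [p2 - p1] is left as the only small factor: the setting of
    [osc_lin]. *)
Lemma pair_osc k1 a1 th1 k2 a2 th2 c d d0 : c <= d -> 0 < d0 -> ka <= k1 <= 2 * ka -> ka <= k2 <= 2 * ka ->
  (forall X, c <= X <= d -> L <= a1 - k1 * X <= 2 * L /\ L <= a2 - k2 * X <= 2 * L) ->
  (forall X, c <= X <= d -> d0 <= Rabs ((a2 - a1) - (k2 - k1) * X)) ->
  Rabs (RInt (pint k1 a1 th1 k2 a2 th2) c d) <= 5 * W0 ^ 2 / (m * L * d0).
Proof.
 intros Hcd Hd0 Hk1 Hk2 Hp Hd. pose proof PI2_3_2 as HPI.
 set (p1 := fun X => a1 - k1 * X) in *. set (p2 := fun X => a2 - k2 * X) in *.
 assert (Hp1 : forall X, c <= X <= d -> L <= p1 X <= 2 * L) by (intros; apply Hp; auto).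
 assert (Hp2 : forall X, c <= X <= d -> L <= p2 X <= 2 * L) by (intros; apply Hp; auto).
 set (B := fun X => w (p1 X) * w (p2 X) / (2 * PI * m * (p1 X + p2 X))).
 set (B' := fun X => (- k1 * w' (p1 X) * w (p2 X) - k2 * w (p1 X) * w' (p2 X)) / (2 * PI * m * (p1 X + p2 X))
   + w (p1 X) * w (p2 X) * (k1 + k2) / (2 * PI * m * (p1 X + p2 X) ^ 2)).
 set (f := fun X => 2 * PI * m / (k1 * p1 X) + th1 - (2 * PI * m / (k2 * p2 X) + th2)).
 set (f1 := fun X => 2 * PI * m / p1 X ^ 2 - 2 * PI * m / p2 X ^ 2).
 assert (cp1 : forall X, continuous p1 X) by (intros; unfold p1; cont).
 assert (cp2 : forall X, continuous p2 X) by (intros; unfold p2; cont).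
 assert (cw : forall (g p : R -> R) X, continuous g (p X) -> continuous p X -> continuous (fun X => g (p X)) X) by (intros; apply continuous_comp; auto).
 assert (Hs : forall X, c <= X <= d -> 0 < 2 * PI * m * (p1 X + p2 X)).
 { intros X HX. specialize (Hp1 X HX). specialize (Hp2 X HX). bound. }
 assert (Hs2 : forall X, c <= X <= d -> 0 < 2 * PI * m * (p1 X + p2 X) ^ 2).
 { intros X HX. specialize (Hp1 X HX). specialize (Hp2 X HX). bound. }
 rewrite (RInt_ext (V := RV) (pint k1 a1 th1 k2 a2 th2) (fun X => B X * f1 X / ((a2 - a1) - (k2 - k1) * X) * cos (f X))).
 2: { intros X HX. rewrite Rmin_left, Rmax_right in HX by lra. assert (HX' : c <= X <= d) by lra.
  change (@eq R (w (p1 X) / p1 X ^ 2 * (w (p2 X) / p2 X ^ 2) * cos (2 * PI * m / (k1 * p1 X) + th1 - (2 * PI * m / (k2 * p2 X) + th2)))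
   (B X * f1 X / (a2 - a1 - (k2 - k1) * X) * cos (2 * PI * m / (k1 * p1 X) + th1 - (2 * PI * m / (k2 * p2 X) + th2)))).
  f_equal. specialize (Hd X HX'). replace (a2 - a1 - (k2 - k1) * X) with (p2 X - p1 X) in * by (unfold p1, p2; ring).
  assert (p2 X - p1 X <> 0). { intros E. rewrite E, Rabs_R0 in Hd. lra. }
  unfold B, f1. specialize (Hp1 X HX'). specialize (Hp2 X HX'). bound. }
 assert (forall X, c <= X <= d -> Rabs (B X) <= W0 ^ 2 / (m * L)).
 { intros X HX. unfold B, Rdiv. rewrite !Rabs_mult, Rabs_inv, (Rabs_right (2 * PI * m * (p1 X + p2 X))) by (specialize (Hs X HX); lra).
  apply Rmult_le_compat. bound. left; apply Rinv_0_lt_compat; auto.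
  rhs (W0 * W0). apply Rmult_le_compat; try apply Rabs_pos; auto.
  apply Rinv_le_contravar. bound. specialize (Hp1 X HX). specialize (Hp2 X HX).
  bound. }
 assert (HB'b : forall X, c <= X <= d -> Rabs (B' X) <= ka * (W0 ^ 2 / (m * L ^ 2))).
 { intros X HX. pose proof (Hp1 X HX) as P1. pose proof (Hp2 X HX) as P2.
  assert (/ (2 * PI * m * (p1 X + p2 X)) <= / (12 * (m * L))).
  { apply Rinv_le_contravar. nra. rhs (m * (2 * PI * (p1 X + p2 X))). lhs (m * (12 * L)). mul_l. nra. }
  assert (/ (2 * PI * m * (p1 X + p2 X) ^ 2) <= / (24 * (m * L ^ 2))).
  { apply Rinv_le_contravar. bound.
   rhs (m * (2 * PI * (p1 X + p2 X) ^ 2)). lhs (m * (6 * (2 * L) ^ 2)). bound. }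
  assert (Pr : forall x y X0 Y0, Rabs x <= X0 -> Rabs y <= Y0 -> Rabs (x * y) <= X0 * Y0) by bound.
  assert (Rabs (- k1) <= 2 * ka) by (rewrite Rabs_Ropp, Rabs_right; lra).
  assert (Rabs k2 <= 2 * ka) by (rewrite Rabs_right; lra).
  le_by Rabs_triang.
  assert (Rabs ((- k1 * w' (p1 X) * w (p2 X) - k2 * w (p1 X) * w' (p2 X)) / (2 * PI * m * (p1 X + p2 X))) <= (4 * ka * (W0 * (W0 / L))) * / (12 * (m * L))).
  { apply Pr.
   - le_by Rabs_triang. rewrite Rabs_Ropp.
    assert (Rabs (- k1 * w' (p1 X) * w (p2 X)) <= 2 * ka * (W0 / L) * W0) by (apply Pr; [apply Pr|]; auto).
    assert (Rabs (k2 * w (p1 X) * w' (p2 X)) <= 2 * ka * W0 * (W0 / L)) by (apply Pr; [apply Pr|]; auto). lra.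
   - rewrite Rabs_inv, Rabs_right; auto. bound. }
  assert (Rabs (w (p1 X) * w (p2 X) * (k1 + k2) / (2 * PI * m * (p1 X + p2 X) ^ 2)) <= (W0 * W0 * (4 * ka)) * / (24 * (m * L ^ 2))).
  { apply Pr. apply Pr. apply Pr; auto. rewrite Rabs_right; lra.
   rewrite Rabs_inv, Rabs_right; auto. bound. }
  eapply Rle_trans. apply Rplus_le_compat; eassumption.
  lhs (1 / 2 * (ka * (W0 ^ 2 / (m * L ^ 2)))).
  bound. }
 eapply Rle_trans. apply (osc_lin B B' f f1 c d (a2 - a1) (k2 - k1) d0 (W0 ^ 2 / (m * L)) (ka * (W0 ^ 2 / (m * L ^ 2)))); auto.
 - intros X HX. pose proof (Hw (p1 X) (Hp1 X HX)) as D1. pose proof (Hw (p2 X) (Hp2 X HX)) as D2. specialize (Hs X HX). specialize (Hp1 X HX). specialize (Hp2 X HX). unfold B, B', p1, p2 in *.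
  auto_derive. repeat split; try lra; eexists; eassumption.
  apply is_derive_unique in D1. apply is_derive_unique in D2.
  change (fun x0 : R => w x0) with w. unfold Rminus in D1, D2 |- *. rewrite D1, D2. field. repeat split; lra.
 - intros X HX. unfold B'. specialize (Hp1 X HX). specialize (Hp2 X HX).
  pose proof (cw w p1 X (w_cont _ Hp1) (cp1 X)). pose proof (cw w p2 X (w_cont _ Hp2) (cp2 X)).
  cont; auto; apply Rgt_not_eq; [apply Hs | apply Hs2]; auto.
 - intros X HX. specialize (Hp1 X HX). specialize (Hp2 X HX). unfold f, f1, p1, p2 in *.
  auto_derive. bound. field. repeat split; lra.
 - intros X HX. specialize (Hp1 X HX). specialize (Hp2 X HX). unfold f1. cont; auto; apply Rgt_not_eq; apply pow_lt; lra.
 - assert (ka * (d - c) <= L).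
  { pose proof (Hp1 c ltac:(lra)) as A1. pose proof (Hp1 d ltac:(lra)) as A2. unfold p1 in A1, A2. nra. }
  rhs ((4 * (W0 ^ 2 / (m * L)) + L * (W0 ^ 2 / (m * L ^ 2))) / d0).
  mul_r. apply Rplus_le_compat_l.
  rewrite <- Rmult_assoc, (Rmult_comm (d - c)). bound.
Qed.

Lemma pint_le k1 a1 th1 k2 a2 th2 X : L <= a1 - k1 * X <= 2 * L -> L <= a2 - k2 * X <= 2 * L -> Rabs (pint k1 a1 th1 k2 a2 th2 X) <= W0 ^ 2 / L ^ 4.
Proof.
 intros H1 H2.
 assert (forall p, L <= p <= 2 * L -> Rabs (w p / p ^ 2) <= W0 / L ^ 2).
 { intros p Hp. unfold Rdiv. rewrite Rabs_mult, Rabs_inv, (Rabs_right (p ^ 2)) by (apply Rle_ge, pow2_ge_0).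
  apply Rmult_le_compat; try apply Rabs_pos; auto. bound.
  bound. }
 le_by abs_cos_mul. rewrite Rabs_mult.
 rhs (W0 / L ^ 2 * (W0 / L ^ 2)). apply Rmult_le_compat; try apply Rabs_pos; auto.
Qed.

Lemma pint_cont k1 a1 th1 k2 a2 th2 X : k1 <> 0 -> k2 <> 0 -> L <= a1 - k1 * X <= 2 * L -> L <= a2 - k2 * X <= 2 * L ->
  continuous (pint k1 a1 th1 k2 a2 th2) X.
Proof.
 intros Hk1 Hk2 H1 H2. unfold pint.
 assert (continuous (fun X => w (a1 - k1 * X)) X). { apply (continuous_comp (fun X => a1 - k1 * X) w). cont. apply w_cont; auto. }
 assert (continuous (fun X => w (a2 - k2 * X)) X). { apply (continuous_comp (fun X => a2 - k2 * X) w). cont. apply w_cont; auto. }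
 cont; auto; try (apply pow_nonzero; lra); apply Rmult_integral_contrapositive_currified; auto; lra.
Qed.

(** [p2 - p1] has slope [k1 - k2] and a single zero [X0]. Within distance [s] of it the trivial
    bound gives [s / L^4], outside [pair_osc] gives [/ (m L |k1 - k2| s)], both times [W0^2]; [s]
    equates the two. *)
Lemma pair_bound k1 a1 th1 k2 a2 th2 c d : c <= d -> ka <= k1 <= 2 * ka -> ka <= k2 <= 2 * ka -> k1 <> k2 ->
  (forall X, c <= X <= d -> L <= a1 - k1 * X <= 2 * L /\ L <= a2 - k2 * X <= 2 * L) ->
  Rabs (RInt (pint k1 a1 th1 k2 a2 th2) c d) <= 12 * (W0 ^ 2 / L ^ 4) * sqrt (L ^ 3 / (m * Rabs (k1 - k2))).
Proof.
 intros Hcd Hk1 Hk2 Hne Hp.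
 set (q := Rabs (k1 - k2)). assert (Hq : 0 < q) by (apply Rabs_pos_lt; lra).
 set (s := sqrt (L ^ 3 / (m * q))). assert (Hs : 0 < s) by bound.
 assert (Hss : s * s = L ^ 3 / (m * q)) by bound.
 set (X0 := (a2 - a1) / (k2 - k1)).
 set (z1 := clamp c d (X0 - s)). set (z2 := clamp c d (X0 + s)).
 pose proof (clamp_in c d (X0 - s) Hcd) as Z1. pose proof (clamp_in c d (X0 + s) Hcd) as Z2.
 assert (Z12 : z1 <= z2) by (apply clamp_mono; lra). fold z1 in Z1. fold z2 in Z2.
 set (g := pint k1 a1 th1 k2 a2 th2) in *.
 assert (cg : forall X, c <= X <= d -> continuous g X). { intros X HX. destruct (Hp X HX). apply pint_cont; auto; lra. }
 rewrite (RInt_split g c z1 d) by (auto; lra). rewrite (RInt_split g z1 z2 d); [|lra|intros; apply cg; lra].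
 assert (Lin : forall X, a2 - a1 - (k2 - k1) * X = (k2 - k1) * (X0 - X)) by bound.
 assert (Hab : Rabs (k2 - k1) = q) by (unfold q; apply Rabs_minus_sym).
 assert (Out : forall u v, c <= u -> u <= v -> v <= d -> (forall X, u <= X <= v -> s <= Rabs (X0 - X)) -> Rabs (RInt g u v) <= 5 * (W0 ^ 2 / L ^ 4) * s).
 { intros u v Hu Huv Hv HX. eapply Rle_trans. apply (pair_osc k1 a1 th1 k2 a2 th2 u v (q * s)); auto.
  bound. intros; apply Hp; lra.
  intros X HXX. rewrite Lin, Rabs_mult, Hab. mul_l. auto.
  right. rhs (5 * (W0 ^ 2 / L ^ 4) * (s * s) / s). rewrite Hss. bound. }
 assert (Zero : forall u v, u = v -> Rabs (RInt g u v) <= 5 * (W0 ^ 2 / L ^ 4) * s).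
 { intros u v ->. rewrite RInt_point. change (@zero RV) with 0. rewrite Rabs_R0. bound. }
 assert (I1 : Rabs (RInt g c z1) <= 5 * (W0 ^ 2 / L ^ 4) * s).
 { destruct (Rle_dec c (X0 - s)) as [H|H].
  - apply Out; try lra. intros X HX. assert (z1 <= X0 - s) by (unfold z1, clamp, Rmax, Rmin; repeat destruct Rle_dec; lra). rewrite Rabs_right; lra.
  - apply Zero. unfold z1, clamp, Rmax, Rmin; repeat destruct Rle_dec; lra. }
 assert (Rabs (RInt g z2 d) <= 5 * (W0 ^ 2 / L ^ 4) * s).
 { destruct (Rle_dec (X0 + s) d) as [H|H].
  - apply Out; try lra. intros X HX. assert (X0 + s <= z2) by (unfold z2, clamp, Rmax, Rmin; repeat destruct Rle_dec; lra). rewrite Rabs_left1; lra.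
  - apply Zero. unfold z2, clamp, Rmax, Rmin; repeat destruct Rle_dec; lra. }
 assert (Rabs (RInt g z1 z2) <= 2 * s * (W0 ^ 2 / L ^ 4)).
 { eapply Rle_trans. apply (abs_RInt_le_const g z1 z2 (W0 ^ 2 / L ^ 4)); auto. apply ex_RInt_cont; auto; intros; apply cg; lra.
  intros X HX. destruct (Hp X ltac:(lra)). apply pint_le; auto.
  mul_r.
  pose proof (clamp_lip c d (X0 + s) (X0 - s)) as Q. fold z1 z2 in Q. rewrite (Rabs_right (z2 - z1)) in Q by lra. rewrite Rabs_right in Q; lra. }
 le_by Rabs_triang. le_by Rplus_le_compat_l. apply Rabs_triang. lra.
Qed.

End Pair.

(** * Reduction to one period and separation of pairs *)

Definition ext (c d : R) (f : R -> R) (x : R) : R :=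
  if Rle_dec c x then if Rle_dec x d then f x else 0 else 0.

Lemma ext_in c d f x : c <= x <= d -> ext c d f x = f x.
Proof. intros [H1 H2]. unfold ext. destruct (Rle_dec c x); [|lra]. destruct (Rle_dec x d); lra. Qed.

Lemma ext_out c d f x : ~ (c <= x <= d) -> ext c d f x = 0.
Proof. intros H. unfold ext. destruct (Rle_dec c x); auto. destruct (Rle_dec x d); auto. bound. Qed.

Lemma ext_mul c d f c' d' g x : ext c d f x * ext c' d' g x = ext (Rmax c c') (Rmin d d') (fun x => f x * g x) x.
Proof.
 destruct (Rle_dec (Rmax c c') x) as [H1|H1]; [destruct (Rle_dec x (Rmin d d')) as [H2|H2]|].
 - pose proof (Rmax_l c c'). pose proof (Rmax_r c c'). pose proof (Rmin_l d d'). pose proof (Rmin_r d d'). rewrite !ext_in; lra.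
 - rewrite (ext_out (Rmax c c')) by lra. destruct (Rle_dec x d). rewrite (ext_out c' d'). ring. intros [? ?]. apply H2. bound.
  rewrite (ext_out c d). ring. lra.
 - rewrite (ext_out (Rmax c c')) by lra. destruct (Rle_dec c x). rewrite (ext_out c' d'). ring. intros [? ?]. apply H1. bound.
  rewrite (ext_out c d). ring. lra.
Qed.

Lemma ex_RInt_zero (f : R -> R) a b : a <= b -> (forall x, a < x < b -> f x = 0) -> ex_RInt f a b /\ RInt f a b = 0.
Proof.
 intros Hab Hf. assert (is_RInt f a b 0).
 { apply (is_RInt_ext (V := R_NormedModule) (fun _ => 0)). intros x Hx. rewrite Rmin_left, Rmax_right in Hx by lra. symmetry; apply Hf; auto.
  pose proof (is_RInt_const (V := R_NormedModule) a b 0) as Q. rewrite Rmult_0_r in Q. bound. }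
 split. exists 0. bound. apply (is_RInt_unique (V := RV)). bound.
Qed.

Lemma ext_RInt c d f : 0 <= c -> d <= 1 -> (forall x, c <= x <= d -> continuous f x) ->
  ex_RInt (ext c d f) 0 1 /\ RInt (ext c d f) 0 1 = if Rle_dec c d then RInt f c d else 0.
Proof.
 intros Hc Hd Hf. destruct (Rle_dec c d) as [H|H].
 - destruct (ex_RInt_zero (ext c d f) 0 c Hc) as [e1 E1]. { intros x Hx. apply ext_out. lra. }
  destruct (ex_RInt_zero (ext c d f) d 1 Hd) as [e3 E3]. { intros x Hx. apply ext_out. lra. }
  assert (ex_RInt (ext c d f) c d).
  { apply (ex_RInt_ext (V := R_NormedModule) f). intros x Hx. rewrite Rmin_left, Rmax_right in Hx by lra. symmetry; apply ext_in; lra. apply ex_RInt_cont; auto. }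
  assert (ex_RInt (ext c d f) 0 d) by (apply (ex_RInt_Chasles (V := R_NormedModule) _ 0 c d); auto).
  split. apply (ex_RInt_Chasles (V := R_NormedModule) _ 0 d 1); auto.
  rewrite <- (RInt_Chasles (V := RV) _ 0 d 1), <- (RInt_Chasles (V := RV) _ 0 c d) by auto.
  rewrite E1, E3. rewrite (RInt_ext (V := RV) (ext c d f) f).
  unfold plus; simpl. ring. intros x Hx. rewrite Rmin_left, Rmax_right in Hx by lra. apply ext_in; lra.
 - apply ex_RInt_zero. lra. intros x _. apply ext_out. lra.
Qed.

(* Cutting [X1, X2] at the integers and moving every part back to [0, 1]. *)
Lemma periodize (h : R -> R) X1 X2 (J0 : Z) N : X1 <= X2 -> IZR J0 <= X1 -> X2 <= IZR J0 + INR N ->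
  (forall x, X1 <= x <= X2 -> continuous h x) ->
  RInt h X1 X2 = rsum (fun j => RInt (ext (Rmax 0 (X1 - (IZR J0 + INR j))) (Rmin 1 (X2 - (IZR J0 + INR j))) (fun x => h (x + (IZR J0 + INR j)))) 0 1) N.
Proof.
 intros H12 HJ HN Hh. set (q := fun j => clamp X1 X2 (IZR J0 + INR j)).
 assert (Hq : forall j, X1 <= q j <= X2) by (intros; apply clamp_in; auto).
 assert (T : forall n, RInt h X1 (q n) = rsum (fun j => RInt h (q j) (q (S j))) n).
 { induction n. replace (q 0%nat) with X1. rewrite RInt_point. reflexivity.
  unfold q, clamp. simpl. unfold Rmax, Rmin. repeat destruct Rle_dec; lra.
  cbn [rsum]. rewrite <- IHn. apply RInt_split. split. apply Hq. apply clamp_mono. bound.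
  intros x Hx. apply Hh. destruct (Hq (S n)). lra. }
 replace X2 with (q N) at 1. 2: { unfold q, clamp, Rmax, Rmin. repeat destruct Rle_dec; lra. }
 rewrite T. apply rsum_ext. intros j _. set (J := IZR J0 + INR j).
 assert (Ej : q j = clamp X1 X2 J) by reflexivity. assert (Ej1 : q (S j) = clamp X1 X2 (J + 1)) by (unfold q, J; rewrite S_INR; f_equal; ring).
 rewrite Ej, Ej1.
 assert (Hc0 : 0 <= Rmax 0 (X1 - J)) by bound. assert (Hd1 : Rmin 1 (X2 - J) <= 1) by apply Rmin_l.
 destruct (ext_RInt (Rmax 0 (X1 - J)) (Rmin 1 (X2 - J)) (fun x => h (x + J)) Hc0 Hd1) as [_ E].
 { intros x Hx. apply (continuous_comp (fun x => x + J) h). cont. apply Hh.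
  pose proof (Rmax_r 0 (X1 - J)). pose proof (Rmin_r 1 (X2 - J)). lra. }
 etransitivity; [|symmetry; exact E]. destruct (Rle_dec (Rmax 0 (X1 - J)) (Rmin 1 (X2 - J))) as [H|H].
 - assert (A1 : clamp X1 X2 J = 1 * Rmax 0 (X1 - J) + J) by (revert H; unfold clamp, Rmax, Rmin; repeat destruct Rle_dec; intros; lra).
  assert (A2 : clamp X1 X2 (J + 1) = 1 * Rmin 1 (X2 - J) + J) by (revert H; unfold clamp, Rmax, Rmin; repeat destruct Rle_dec; intros; lra).
  pose proof (clamp_in X1 X2 J H12) as B1. pose proof (clamp_in X1 X2 (J + 1) H12) as B2.
  rewrite A1, A2. rewrite <- (RInt_comp_lin (V := RV) h 1 J).
  apply RInt_ext. intros x _. rewrite !Rmult_1_l. bound.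
  apply ex_RInt_cont. lra. intros; apply Hh; lra.
 - assert (A : clamp X1 X2 J = clamp X1 X2 (J + 1)) by (revert H; unfold clamp, Rmax, Rmin; repeat destruct Rle_dec; intros; lra).
  rewrite A. rewrite RInt_point. reflexivity.
Qed.

(** On either side of [f x] the distances to it form a set that is spaced by [q] and starts at [q]
    or later, to which the hypothesis on [lsum F] applies; the two sides give the factor [2]. *)
Lemma split_pairs {T : Type} (l : list T) (f : T -> R) (H : T -> R) (F : R -> R) x q E S : NoDup l -> In x l -> 0 < q -> 0 <= E ->
  (forall y z, In y l -> In z l -> y <> z -> q <= Rabs (f y - f z)) ->
  (forall y, In y l -> y <> x -> H y <= E * F (Rabs (f y - f x))) ->
  (forall l', spaced q l' -> (forall u, In u l' -> q <= u) -> INR (length l') <= INR (length l) - 1 -> lsum F l' <= S) ->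
  lsum H l <= H x + 2 * (E * S).
Proof.
 intros Hnd Hx Hq HE Hsp HH HS. apply in_split in Hx. destruct Hx as [l1 [l2 ->]].
 assert (P : Permutation (l1 ++ x :: l2) (x :: (l1 ++ l2))) by (symmetry; apply Permutation_middle).
 rewrite (lsum_perm _ _ _ P). apply Rplus_le_compat_l.
 assert (Hnd' : NoDup (x :: (l1 ++ l2))) by (eapply Permutation_NoDup; eauto).
 assert (Hin : forall y, In y (x :: (l1 ++ l2)) -> In y (l1 ++ x :: l2)) by (intros y Hy; eapply Permutation_in; [symmetry; apply P|auto]).
 set (l := l1 ++ l2) in *. inversion Hnd' as [|? ? Hnx Hndl]; subst.
 assert (INR (length (l1 ++ x :: l2)) = INR (length l) + 1). { rewrite (Permutation_length P). cbn [length]. rewrite S_INR. bound. }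
 assert (forall y, In y l -> y <> x) by (intros y Hy ->; auto).
 assert (HyR : forall y, In y l -> q <= Rabs (f y - f x)) by (intros y Hy; apply Hsp; [apply Hin; right; auto | apply Hin; left; auto | auto]).
 set (up := fun y => if Rle_dec (f x) (f y) then true else false).
 apply Rle_trans with (lsum (fun y => E * F (Rabs (f y - f x))) l).
 { apply lsum_le. intros y Hy. apply HH; auto. apply Hin; right; auto. }
 rewrite lsum_mul.
 assert (lsum (fun y => F (Rabs (f y - f x))) l = lsum F (map (fun y => f y - f x) (filter up l)) + lsum F (map (fun y => f x - f y) (filter (fun y => negb (up y)) l))).
 { rewrite !lsum_map. clear. generalize l. clear l. intros l. induction l as [|j l IH]. cbn [filter lsum]. ring. cbn [filter lsum]. rewrite IH.
  assert (Hq : up j = true <-> f x <= f j). { unfold up. destruct (Rle_dec (f x) (f j)); split; intros; auto; try discriminate; lra. }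
  destruct (up j); cbn [negb lsum]; [assert (H : f x <= f j) by (apply Hq; auto) | assert (H : ~ f x <= f j) by (intros H; apply Hq in H; discriminate)].
  - rewrite Rabs_right by lra. ring.
  - rewrite Rabs_left by lra. rewrite Ropp_minus_distr. ring. }
 assert (Part : forall p g, (forall y, In y (filter p l) -> g y = Rabs (f y - f x)) -> (forall y z, Rabs (g y - g z) = Rabs (f y - f z)) -> lsum F (map g (filter p l)) <= S).
 { intros p g Hg Hgg. apply HS.
  - apply spaced_inj. apply NoDup_filter; auto. intros y z Hy Hz Hyz. rewrite Hgg. apply filter_In in Hy. apply filter_In in Hz. apply Hsp; auto; apply Hin; right; tauto.
  - intros u Hu. apply in_map_iff in Hu. destruct Hu as [y [<- Hy]]. rewrite Hg by auto. apply HyR. apply filter_In in Hy; tauto.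
  - rewrite length_map. assert (INR (length (filter p l)) <= INR (length l)) by (apply le_INR, filter_length_le). lra. }
 assert (lsum F (map (fun y => f y - f x) (filter up l)) <= S).
 { apply Part. intros y Hy. apply filter_In in Hy. destruct Hy as [_ Hy]. unfold up in Hy. destruct (Rle_dec (f x) (f y)); [|discriminate]. rewrite Rabs_right; lra.
  intros y z. f_equal. ring. }
 assert (lsum F (map (fun y => f x - f y) (filter (fun y => negb (up y)) l)) <= S).
 { apply (Part (fun y => negb (up y))). intros y Hy. apply filter_In in Hy. destruct Hy as [_ Hy]. unfold up in Hy. destruct (Rle_dec (f x) (f y)); [discriminate|]. rewrite Rabs_left; lra.
  intros y z. rewrite <- Rabs_Ropp. f_equal. ring. }
 nra.
Qed.

(** * Cauchy-Schwarz over a dyadic class of arcs *)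

Record piece := Piece { pk : R; pa : R; pth : R; pc : R; pd : R }.

Section Cauchy.
Variables w w' : R -> R.
Variables L W0 m ka : R.
Hypothesis HL : 0 < L.
Hypothesis Hm : 0 < m.
Hypothesis Hka : 0 < ka.
Hypothesis Hw : forall p, L <= p <= 2 * L -> is_derive w p (w' p).
Hypothesis Hwc : forall p, L <= p <= 2 * L -> continuous w' p.
Hypothesis HW : forall p, L <= p <= 2 * L -> Rabs (w p) <= W0.
Hypothesis HW' : forall p, L <= p <= 2 * L -> Rabs (w' p) <= W0 / L.

Definition pamp (s : piece) (X : R) : R := w (pa s - pk s * X) / (pa s - pk s * X) ^ 2.
Definition pph (s : piece) (X : R) : R := 2 * PI * m / (pk s * (pa s - pk s * X)) + pth s.
Definition good (s : piece) : Prop := 0 <= pc s /\ pd s <= 1 /\ ka <= pk s <= 2 * ka /\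
  forall X, pc s <= X <= pd s -> L <= pa s - pk s * X <= 2 * L.
Definition pcor (s s' : piece) : R :=
  RInt (ext (Rmax (pc s) (pc s')) (Rmin (pd s) (pd s')) (pint w m (pk s) (pa s) (pth s) (pk s') (pa s') (pth s'))) 0 1.

Lemma pamp_cont s X : L <= pa s - pk s * X <= 2 * L -> continuous (pamp s) X.
Proof.
 intros H. unfold pamp. assert (continuous (fun X => w (pa s - pk s * X)) X).
 { apply (continuous_comp (fun X => pa s - pk s * X) w). cont. eapply is_derive_continuous. apply Hw; auto. }
 cont; auto. bound.
Qed.

Lemma pph_cont s X : pk s <> 0 -> L <= pa s - pk s * X <= 2 * L -> continuous (pph s) X.
Proof. intros Hk H. unfold pph. cont. nra. Qed.

Lemma pcor_ex s s' : good s -> good s' ->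
  ex_RInt (ext (Rmax (pc s) (pc s')) (Rmin (pd s) (pd s')) (pint w m (pk s) (pa s) (pth s) (pk s') (pa s') (pth s'))) 0 1 /\
  pcor s s' = if Rle_dec (Rmax (pc s) (pc s')) (Rmin (pd s) (pd s')) then RInt (pint w m (pk s) (pa s) (pth s) (pk s') (pa s') (pth s')) (Rmax (pc s) (pc s')) (Rmin (pd s) (pd s')) else 0.
Proof.
 intros [A1 [A2 [A3 A4]]] [B1 [B2 [B3 B4]]]. apply ext_RInt.
 - eapply Rle_trans; [apply A1|apply Rmax_l].
 - eapply Rle_trans; [apply Rmin_l|auto].
 - intros X HX. pose proof (Rmax_l (pc s) (pc s')). pose proof (Rmax_r (pc s) (pc s')). pose proof (Rmin_l (pd s) (pd s')). pose proof (Rmin_r (pd s) (pd s')).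
  apply (pint_cont w w' L m HL Hw); try lra; [apply A4 | apply B4]; lra.
Qed.

(** The inequality [|g| <= (g^2 + h^2 + la^2) / (2 la)] stands in for Cauchy-Schwarz. The sine
    companion [h] is added so that [g^2 + h^2] contains only cosines of phase differences, which
    integrate to the correlations [pcor]; [la = sqrt Q] balances the two halves. *)
Lemma cauchy (F : R -> R) B (l : list piece) Q : (forall x, continuous F x) -> (forall x, Rabs (F x) <= B) -> 0 < B ->
  (forall s, In s l -> good s) -> 0 < Q -> lsum (fun s => lsum (fun s' => Rabs (pcor s s')) l) l <= Q ->
  Rabs (lsum (fun s => RInt (ext (pc s) (pd s) (fun X => F X * (pamp s X * cos (pph s X)))) 0 1) l) <= B * sqrt Q.
Proof.
 intros HF HFB HB Hg HQ HQl.
 set (gc := fun s X => ext (pc s) (pd s) (fun X => pamp s X * cos (pph s X)) X).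
 set (gs := fun s X => ext (pc s) (pd s) (fun X => pamp s X * sin (pph s X)) X).
 assert (Hpk : forall s, In s l -> pk s <> 0) by (intros s Hs; destruct (Hg s Hs) as [_ [_ [? _]]]; lra).
 assert (e1 : forall s, In s l -> ex_RInt (ext (pc s) (pd s) (fun X => F X * (pamp s X * cos (pph s X)))) 0 1).
 { intros s Hs. destruct (Hg s Hs) as [A1 [A2 [A3 A4]]]. apply ext_RInt; auto. intros X HX.
  pose proof (pamp_cont s X (A4 X HX)). pose proof (pph_cont s X (Hpk s Hs) (A4 X HX)). cont; auto. }
 destruct (lsum_RInt (fun s => ext (pc s) (pd s) (fun X => F X * (pamp s X * cos (pph s X)))) l 0 1 e1) as [E ex].
 rewrite <- E.
 set (cor := fun X => lsum (fun s => lsum (fun s' => ext (Rmax (pc s) (pc s')) (Rmin (pd s) (pd s')) (pint w m (pk s) (pa s) (pth s) (pk s') (pa s') (pth s')) X) l) l).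
 assert (Hcor : ex_RInt cor 0 1 /\ RInt cor 0 1 <= Q).
 { unfold cor.
  assert (In1 : forall s, In s l -> RInt (fun X => lsum (fun s' => ext (Rmax (pc s) (pc s')) (Rmin (pd s) (pd s')) (pint w m (pk s) (pa s) (pth s) (pk s') (pa s') (pth s')) X) l) 0 1 = lsum (fun s' => pcor s s') l /\
   ex_RInt (fun X => lsum (fun s' => ext (Rmax (pc s) (pc s')) (Rmin (pd s) (pd s')) (pint w m (pk s) (pa s) (pth s) (pk s') (pa s') (pth s')) X) l) 0 1).
  { intros s Hs. apply (lsum_RInt (fun s' => ext (Rmax (pc s) (pc s')) (Rmin (pd s) (pd s')) (pint w m (pk s) (pa s) (pth s) (pk s') (pa s') (pth s')))).
   intros s' Hs'. apply pcor_ex; auto. }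
  destruct (lsum_RInt (fun s X => lsum (fun s' => ext (Rmax (pc s) (pc s')) (Rmin (pd s) (pd s')) (pint w m (pk s) (pa s) (pth s) (pk s') (pa s') (pth s')) X) l) l 0 1) as [E2 ex2].
  { intros s Hs. apply In1; auto. }
  split; auto. rewrite E2. eapply Rle_trans; [|apply HQl]. apply lsum_le. intros s Hs. destruct (In1 s Hs) as [-> _].
  apply lsum_le. intros s' _. apply Rle_abs. }
 destruct Hcor as [exc HcQ].
 set (la := sqrt Q). assert (Hla2 : la * la = Q) by bound.
 assert (forall X, Rabs (lsum (fun s => ext (pc s) (pd s) (fun X => F X * (pamp s X * cos (pph s X))) X) l) <= B / (2 * la) * cor X + B * la / 2 * 1).
 { intros X.
  replace (lsum (fun s => ext (pc s) (pd s) (fun X => F X * (pamp s X * cos (pph s X))) X) l) with (F X * lsum (fun s => gc s X) l).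
  2: { rewrite <- lsum_mul. apply lsum_ext. intros s _. unfold gc, ext. destruct Rle_dec; [destruct Rle_dec|]; ring. }
  assert (Ec : cor X = lsum (fun s => gc s X) l * lsum (fun s => gc s X) l + lsum (fun s => gs s X) l * lsum (fun s => gs s X) l).
  { rewrite <- !lsum_mul, <- lsum_add. apply lsum_ext. intros s _. rewrite (Rmult_comm _ (gc s X)), (Rmult_comm _ (gs s X)), <- !lsum_mul, <- lsum_add. apply lsum_ext. intros s' _.
   unfold gc, gs. rewrite !ext_mul. unfold ext. destruct Rle_dec; [destruct Rle_dec|]; try ring.
   unfold pint, pamp, pph. rewrite cos_minus. ring. }
  set (g := lsum (fun s => gc s X) l) in *. rewrite Ec. rewrite Rabs_mult.
  apply Rle_trans with (B * Rabs g). apply Rmult_le_compat_r; auto. bound.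
  set (h := lsum (fun s => gs s X) l).
  rhs (B / (2 * la) * (g * g + h * h + la * la)).
  trans_l (B / (2 * la) * (2 * la * Rabs g)).
  mul_l. pose proof (pow2_ge_0 (Rabs g - la)). pose proof (pow2_abs g). nra. }
 assert (ex_RInt (fun X => B / (2 * la) * cor X + B * la / 2 * 1) 0 1).
 { apply ex_RInt_addR. apply ex_RInt_mulR; auto. apply ex_RInt_const. }
 eapply Rle_trans. apply (abs_RInt_le _ 0 1); auto. lra.
 eapply Rle_trans. apply (RInt_le _ (fun X => B / (2 * la) * cor X + B * la / 2 * 1) 0 1); auto. lra.
 { apply (ex_RInt_norm _ 0 1 ex). }
 rewrite (RInt_lin2 (B / (2 * la)) (B * la / 2) cor (fun _ => 1)); auto; [|apply ex_RInt_const].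
 rewrite RInt_const. change (scal (1 - 0) 1) with ((1 - 0) * 1).
 trans_l (B / (2 * la) * Q + B * la / 2 * ((1 - 0) * 1)).
 rewrite <- Hla2. bound.
Qed.

(** The part of an arc in [[J, J + 1]] moved to [[0, 1]]: replacing [a] by [a - k J] keeps [p],
    hence amplitude and phase, unchanged. *)
Definition shifted (k a th X1 X2 : R) (j : nat) : piece :=
  let J := IZR (Int_part X1) + INR j in Piece k (a - k * J) th (Rmax 0 (X1 - J)) (Rmin 1 (X2 - J)).

Definition arc_good (r : piece) : Prop := pc r <= pd r /\ ka <= pk r <= 2 * ka /\
  forall X, pc r <= X <= pd r -> L <= pa r - pk r * X <= 2 * L.

Definition cut (r : piece) (j : nat) : piece := shifted (pk r) (pa r) (pth r) (pc r) (pd r) j.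

Lemma cut_good r j : arc_good r -> good (cut r j).
Proof.
 intros [H1 [H2 H3]]. unfold cut, shifted, good. simpl. set (J := IZR (Int_part (pc r)) + INR j).
 split. bound. split. apply Rmin_l. split; auto.
 intros X HX. replace (pa r - pk r * J - pk r * X) with (pa r - pk r * (X + J)) by ring. apply H3.
 pose proof (Rmax_r 0 (pc r - J)). pose proof (Rmin_r 1 (pd r - J)). lra.
Qed.

(** The parts of one arc have total length [pd r - pc r], so the diagonal costs a length rather than
    a count. *)
Lemma pcor_diag r N : arc_good r -> pd r <= IZR (Int_part (pc r)) + INR N ->
  rsum (fun j => Rabs (pcor (cut r j) (cut r j))) N <= W0 ^ 2 / L ^ 4 * (pd r - pc r).
Proof.
 intros Hr HN. destruct Hr as [H1 [H2 H3]]. pose proof (base_Int_part (pc r)) as [I1 I2].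
 assert (E : pd r - pc r = RInt (fun _ => 1) (pc r) (pd r)) by (rewrite RInt_const; unfold scal; simpl; unfold mult; simpl; ring).
 rewrite E, (periodize (fun _ => 1) _ _ (Int_part (pc r)) N); auto. 2: intros; cont.
 rewrite <- rsum_mul. apply rsum_le. intros j _.
 assert (G : good (cut r j)) by (apply cut_good; split; auto).
 destruct (pcor_ex _ _ G G) as [_ ->]. rewrite Rmax_left, Rmin_left by lra.
 destruct G as [G1 [G2 [G3 G4]]].
 destruct (ext_RInt (pc (cut r j)) (pd (cut r j)) (fun _ => 1) G1 G2 ltac:(intros; cont)) as [_ E2]. unfold cut, shifted in E2 |- *; cbn [pc pd pk pa pth] in E2 |- *.
 eapply Rle_trans; [|right; apply (f_equal (Rmult (W0 ^ 2 / L ^ 4))); symmetry; exact E2]. clear E2. destruct Rle_dec as [Hle|Hle].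
 - rewrite RInt_const. set (c := Rmax _ _) in *. set (d := Rmin _ _) in *. change (scal (d - c) 1) with ((d - c) * 1).
  rhs ((d - c) * (W0 ^ 2 / L ^ 4)).
  apply abs_RInt_le_const; auto.
  + apply ex_RInt_cont; auto. intros X HX. apply (pint_cont w w' L m HL Hw); try lra; apply G4; auto.
  + intros X HX. apply (pint_le w L W0 m HL HW); apply G4; auto.
 - rewrite Rabs_R0. lra.
Qed.

(** Two translates of one arc have equal denominators, so [p2 - p1] is constant, a multiple of
    [i - j], and [pair_osc] applies on the whole interval. *)
Lemma pcor_same r i j : arc_good r -> i <> j ->
  Rabs (pcor (cut r j) (cut r i)) <= 5 * W0 ^ 2 / (m * L * ka) * / Rabs (INR i - INR j).
Proof.
 intros Hr Hij. pose proof (INR_spaced i j Hij) as Hsp.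
 assert (0 <= 5 * W0 ^ 2 / (m * L * ka) * / Rabs (INR i - INR j)) by bound.
 destruct (pcor_ex _ _ (cut_good r j Hr) (cut_good r i Hr)) as [_ ->].
 destruct Rle_dec as [Hle|Hle]; [|rewrite Rabs_R0; auto].
 pose proof (cut_good r j Hr) as [_ [_ [G3 G4]]]. pose proof (cut_good r i Hr) as [_ [_ [K3 K4]]].
 set (s := cut r j) in *. set (s' := cut r i) in *.
 eapply Rle_trans. apply (pair_osc w w' L W0 m ka HL Hm Hka Hw Hwc HW HW' _ _ _ _ _ _ _ _ (ka * Rabs (INR i - INR j)) Hle); auto.
 - apply Rmult_lt_0_compat; lra.
 - intros X HX. pose proof (Rmax_l (pc s) (pc s')). pose proof (Rmax_r (pc s) (pc s')). pose proof (Rmin_l (pd s) (pd s')). pose proof (Rmin_r (pd s) (pd s')).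
  split; [apply G4 | apply K4]; lra.
 - intros X _. unfold s, s', cut, shifted; cbn [pc pd pk pa pth] in *.
  match goal with |- _ <= Rabs ?x => replace x with (pk r * - (INR i - INR j)) by ring end.
  rewrite Rabs_mult, Rabs_Ropp. mul_r. destruct Hr as [_ [Hk _]]. rewrite Rabs_right; lra.
 - bound.
Qed.

Lemma pcor_diff r r' i j : arc_good r -> arc_good r' -> pk r <> pk r' ->
  Rabs (pcor (cut r j) (cut r' i)) <= 12 * (W0 ^ 2 / L ^ 4) * sqrt (L ^ 3 / (m * Rabs (pk r - pk r'))).
Proof.
 intros Hr Hr' Hne.
 destruct (pcor_ex _ _ (cut_good r j Hr) (cut_good r' i Hr')) as [_ ->].
 destruct Rle_dec as [Hle|Hle]. 2: { rewrite Rabs_R0. bound. }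
 pose proof (cut_good r j Hr) as [_ [_ [G3 G4]]]. pose proof (cut_good r' i Hr') as [_ [_ [K3 K4]]].
 set (s := cut r j) in *. set (s' := cut r' i) in *.
 apply (pair_bound w w' L W0 m ka HL Hm Hka Hw Hwc HW HW' _ _ _ _ _ _ _ _ Hle); auto.
 intros X HX. pose proof (Rmax_l (pc s) (pc s')). pose proof (Rmax_r (pc s) (pc s')). pose proof (Rmin_l (pd s) (pd s')). pose proof (Rmin_r (pd s) (pd s')).
 split; [apply G4 | apply K4]; lra.
Qed.

(** The three terms bound the diagonal, the translates of one arc, where [/ |i - j|] sums to a
    logarithm, and the pairs of different arcs, where [/ sqrt |k - k'|] is summed over spaced
    denominators. An arc has length at most [L / ka] in [X], so [N] periods cover it. *)
Lemma class_fixed (F : R -> R) B (l : list piece) N q0 Q : (forall x, continuous F x) -> (forall x, Rabs (F x) <= B) -> 0 < B ->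
  (forall x, F (x + 1) = F x) -> NoDup l -> (forall r, In r l -> arc_good r) -> 0 < q0 ->
  (forall r r', In r l -> In r' l -> r <> r' -> q0 <= Rabs (pk r - pk r')) ->
  L / ka + 1 <= INR N -> 0 < Q ->
  W0 ^ 2 / L ^ 4 * (lsum (fun r => pd r - pc r) l + INR (length l) * (INR N * (10 * (L ^ 3 / (m * ka)) * (1 + ln (INR N + 1)))) +
    INR (length l) * (48 * INR N ^ 2 * sqrt (L ^ 3 / m) * (sqrt (INR (length l) - 1) / sqrt q0))) <= Q ->
  Rabs (lsum (fun r => RInt (fun X => F X * (pamp r X * cos (pph r X))) (pc r) (pd r)) l) <= B * sqrt Q.
Proof.
 intros HF HFB HB HFp Hnd Hg Hq0 Hsp HN HQ HQl.
 assert (HFz : forall (n : nat) x, F (x + INR n) = F x).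
 { induction n; intros x. simpl. f_equal; ring. rewrite S_INR. replace (x + (INR n + 1)) with (x + INR n + 1) by ring. rewrite HFp; auto. }
 assert (HFZ : forall (z : Z) x, F (x + IZR z) = F x).
 { intros z x. destruct (Z_le_dec 0 z). rewrite <- (Z2Nat.id z), <- INR_IZR_INZ by auto. apply HFz.
  replace x with (x + IZR z + INR (Z.to_nat (- z))) at 2. rewrite HFz; auto. rewrite INR_IZR_INZ, Z2Nat.id, opp_IZR by lia. ring. }
 assert (HNr : forall r, In r l -> pd r <= IZR (Int_part (pc r)) + INR N).
 { intros r Hr. destruct (Hg r Hr) as [H1 [H2 H3]]. pose proof (base_Int_part (pc r)). pose proof (H3 (pc r) ltac:(lra)). pose proof (H3 (pd r) ltac:(lra)).
  assert (pd r - pc r <= L / ka). { apply Rmult_le_reg_l with ka; auto. rhs L. nra. }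
  lra. }
 set (l2 := flat_map (fun r => map (cut r) (seq 0 N)) l).
 assert (E : lsum (fun r => RInt (fun X => F X * (pamp r X * cos (pph r X))) (pc r) (pd r)) l =
   lsum (fun s => RInt (ext (pc s) (pd s) (fun X => F X * (pamp s X * cos (pph s X)))) 0 1) l2).
 { unfold l2. rewrite lsum_flat_map. apply lsum_ext. intros r Hr. destruct (Hg r Hr) as [H1 [H2 H3]].
  pose proof (base_Int_part (pc r)) as [I1 I2]. rewrite lsum_map, <- rsum_lsum.
  rewrite (periodize (fun X => F X * (pamp r X * cos (pph r X))) _ _ (Int_part (pc r)) N); auto.
  - apply rsum_ext. intros j _. apply RInt_ext. intros x _.
   unfold ext. destruct Rle_dec; [|auto]. destruct Rle_dec; [|auto].
   replace (x + (IZR (Int_part (pc r)) + INR j)) with (x + IZR (Int_part (pc r)) + INR j) by ring. rewrite HFz, HFZ.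
   unfold pamp, pph, cut, shifted; cbn [pc pd pk pa pth].
   replace (pa r - pk r * (IZR (Int_part (pc r)) + INR j) - pk r * x) with (pa r - pk r * (x + IZR (Int_part (pc r)) + INR j)) by ring. reflexivity.
  - intros X HX. pose proof (pamp_cont r X (H3 X HX)). pose proof (pph_cont r X ltac:(lra) (H3 X HX)). cont; auto. }
 rewrite E. apply cauchy; auto.
 { intros s Hs. apply in_flat_map in Hs. destruct Hs as [r [Hr Hs]]. apply in_map_iff in Hs. destruct Hs as [j [<- _]]. apply cut_good; auto. }
 eapply Rle_trans; [|apply HQl]. unfold l2. rewrite lsum_flat_map.
 set (H := fun r r' => rsum (fun j => rsum (fun i => Rabs (pcor (cut r j) (cut r' i))) N) N).
 rewrite (lsum_ext _ (fun r => lsum (fun r' => H r r') l)).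
 2: { intros r _. rewrite lsum_map, <- rsum_lsum. unfold H.
  rewrite (rsum_ext _ (fun j => lsum (fun r' => rsum (fun i => Rabs (pcor (cut r j) (cut r' i))) N) l)).
  2: { intros j _. rewrite lsum_flat_map. apply lsum_ext. intros r' _. rewrite lsum_map, <- rsum_lsum. bound. }
  rewrite rsum_lsum, lsum_swap. apply lsum_ext. intros r' _. rewrite <- rsum_lsum. bound. }
 set (E1 := 5 * W0 ^ 2 / (m * L * ka)). assert (0 <= E1) by bound.
 set (S1 := 1 + ln (INR N + 1)).
 assert (Hsame : forall r, In r l -> H r r <= W0 ^ 2 / L ^ 4 * (pd r - pc r) + INR N * (2 * (E1 * S1))).
 { intros r Hr. apply Rle_trans with (rsum (fun j => Rabs (pcor (cut r j) (cut r j)) + 2 * (E1 * S1)) N).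
  - unfold H. apply rsum_le. intros j Hj. rewrite rsum_lsum.
   apply (split_pairs (seq 0 N) INR (fun i => Rabs (pcor (cut r j) (cut r i))) Rinv j 1 E1 S1); try lra.
   + apply seq_NoDup.
   + apply in_seq. lia.
   + intros y z _ _ Hyz. apply INR_spaced; auto.
   + intros i _ Hij. apply pcor_same; auto.
   + intros l' Hl' Hu Hlen. rewrite length_seq in Hlen. eapply Rle_trans. apply (spaced_sum_inv (length l') l' 1); auto; lra.
    rewrite Rinv_1, Rmult_1_l. le_by harmonic_log. apply Rplus_le_compat_l. apply ln_le. bound. lra.
  - rewrite rsum_add, rsum_const. apply Rplus_le_compat_r. apply pcor_diag; auto. }
 set (E2 := INR N ^ 2 * (12 * (W0 ^ 2 / L ^ 4) * sqrt (L ^ 3 / m))).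
 set (S2 := 2 * (sqrt (INR (length l) - 1) / sqrt q0)).
 assert (0 <= E2) by bound.
 assert (Hr2 : forall r, In r l -> lsum (fun r' => H r r') l <= W0 ^ 2 / L ^ 4 * (pd r - pc r) + INR N * (2 * (E1 * S1)) + 2 * (E2 * S2)).
 { intros r Hr. eapply Rle_trans; [|apply Rplus_le_compat_r, (Hsame r Hr)].
  apply (split_pairs l pk (fun r' => H r r') (fun u => / sqrt u) r q0 E2 S2); auto.
  - intros r' Hr' Hne. specialize (Hsp r' r Hr' Hr Hne). rewrite (Rabs_minus_sym (pk r') (pk r)) in *. set (u := Rabs (pk r - pk r')) in *.
   assert (pk r <> pk r'). { intros Eq. unfold u in Hsp. rewrite Eq, Rminus_diag, Rabs_R0 in Hsp. lra. }
   apply Rle_trans with (rsum (fun _ => rsum (fun _ => 12 * (W0 ^ 2 / L ^ 4) * sqrt (L ^ 3 / (m * u))) N) N).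
   + unfold H. apply rsum_le. intros j _. apply rsum_le. intros i _. apply pcor_diff; auto.
   + rewrite !rsum_const. right.
    replace (L ^ 3 / (m * u)) with (L ^ 3 / m / u) by bound. rewrite (sqrt_div (L ^ 3 / m)). bound.
    bound. lra.
  - intros l' Hl' Hu Hlen. eapply Rle_trans. apply (spaced_sum_sqrt (length l') l' q0); auto.
   bound. }
 eapply Rle_trans. apply lsum_le. apply Hr2.
 rewrite (lsum_ext _ (fun r => W0 ^ 2 / L ^ 4 * (pd r - pc r) + (INR N * (2 * (E1 * S1)) + 2 * (E2 * S2)))) by (intros; ring).
 rewrite lsum_add, lsum_mul, lsum_const. right. unfold E1, S1, E2, S2. bound.
Qed.

End Cauchy.

(** * The smooth average *)

(** A bump on [[1, 2]] of class [C^1], which is the smoothness that the derivative tests ask of an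
    amplitude. *)
Definition chi (s : R) : R := Rmax 0 ((s - 1) * (2 - s)) ^ 2.
Definition chi' (s : R) : R := 2 * Rmax 0 ((s - 1) * (2 - s)) * (3 - 2 * s).

(** The error of the linear approximation is at most [h^2], also across the corner at [0]. *)
Lemma sq_pos_derive x : is_derive (fun x => Rmax 0 x ^ 2) x (2 * Rmax 0 x).
Proof.
 apply is_derive_Reals. intros eps He. exists (mkposreal eps He). intros h Hh Hhe.
 assert (Rabs (Rmax 0 (x + h) ^ 2 - Rmax 0 x ^ 2 - 2 * Rmax 0 x * h) <= h ^ 2).
 { apply Rabs_le. unfold Rmax. destruct (Rle_dec 0 (x + h)); destruct (Rle_dec 0 x); nra. }
 replace ((Rmax 0 (x + h) ^ 2 - Rmax 0 x ^ 2) / h - 2 * Rmax 0 x) with ((Rmax 0 (x + h) ^ 2 - Rmax 0 x ^ 2 - 2 * Rmax 0 x * h) / h) by bound.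
 unfold Rdiv. rewrite Rabs_mult, Rabs_inv. apply Rle_lt_trans with (h ^ 2 * / Rabs h).
 apply Rmult_le_compat_r; auto. left; apply Rinv_0_lt_compat, Rabs_pos_lt; auto.
 rewrite <- pow2_abs. replace (Rabs h ^ 2 * / Rabs h) with (Rabs h); auto. field. apply Rabs_no_R0; auto.
Qed.

Lemma chi_derive s : is_derive chi s (chi' s).
Proof.
 unfold chi, chi'. replace (2 * Rmax 0 ((s - 1) * (2 - s)) * (3 - 2 * s)) with ((3 - 2 * s) * (2 * Rmax 0 ((s - 1) * (2 - s)))) by ring.
 apply (is_derive_comp (fun x => Rmax 0 x ^ 2) (fun s => (s - 1) * (2 - s))). apply sq_pos_derive. auto_derive; auto. ring.
Qed.

Lemma continuous_max0 (f : R -> R) x : continuous f x -> continuous (fun x => Rmax 0 (f x)) x.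
Proof.
 intros H. apply (continuous_ext (fun x => (f x + Rabs (f x)) / 2)).
 intros y. unfold Rmax, Rabs. destruct (Rle_dec 0 (f y)); destruct Rcase_abs; lra. cont; auto.
Qed.

Lemma chi'_cont s : continuous chi' s.
Proof. unfold chi'. assert (continuous (fun s => Rmax 0 ((s - 1) * (2 - s))) s) by (apply continuous_max0; cont). cont; auto. Qed.

Lemma chi_cont s : continuous chi s.
Proof. eapply is_derive_continuous. apply chi_derive. Qed.

Lemma chi_bound s : 0 <= chi s <= 1 / 16.
Proof.
 unfold chi. split. bound. rhs ((1 / 4) ^ 2). apply pow_incr. split. bound.
 apply Rmax_lub. lra. pose proof (pow2_ge_0 (s - 3 / 2)). nra.
Qed.

Lemma chi_out s : s <= 1 \/ 2 <= s -> chi s = 0.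
Proof. intros H. unfold chi. rewrite Rmax_left. ring. nra. Qed.

Lemma chi'_bound s : 0 <= s -> Rabs (s * chi' s) <= 1.
Proof.
 intros Hs. unfold chi'. destruct (Rle_dec ((s - 1) * (2 - s)) 0) as [H|H].
 - rewrite Rmax_left by auto. rewrite Rmult_0_r, Rmult_0_l, Rmult_0_r, Rabs_R0. lra.
 - rewrite Rmax_right by lra. assert (1 < s < 2) by nra. pose proof (pow2_ge_0 (s - 3 / 2)).
  set (v := (s - 1) * (2 - s)) in *.
  rewrite Rabs_mult, Rabs_mult. rewrite (Rabs_right s), (Rabs_right (2 * v)) by lra. assert (Rabs (3 - 2 * s) <= 1) by (apply Rabs_le; lra).
  assert (2 * v * Rabs (3 - 2 * s) <= 1 / 2 * 1) by bound. nra.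
Qed.

Definition rho (y0 y : R) : R := / y0 * chi (y / y0).

Lemma rho_cont y0 y : continuous (rho y0) y.
Proof. unfold rho. assert (continuous (fun y => chi (y / y0)) y). { apply (continuous_comp (fun y => y / y0) chi). apply (continuous_ext (fun y => / y0 * y)). bound. cont. apply chi_cont. } cont; auto. Qed.

Lemma rho_bound y0 y : 0 < y0 -> 0 <= rho y0 y <= / y0.
Proof.
 intros Hy. unfold rho. pose proof (chi_bound (y / y0)).
 bound.
Qed.

Lemma rho_out y0 y : 0 < y0 -> y <= y0 \/ 2 * y0 <= y -> rho y0 y = 0.
Proof.
 intros Hy H. unfold rho. rewrite chi_out. ring. destruct H; [left|right].
 bound.
 bound.
Qed.

(** At fixed [Y] and with [p = / (k u)] one has [y = Y / p^2]; the outer [/ p^2] is the Jacobian of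
    this change of height. A second [/ p^2], from the change of [u] into [X], sits in [pamp]. *)
Definition wY (y0 Y p : R) : R := rho y0 (Y / p ^ 2) / p ^ 2.
Definition wY' (y0 Y p : R) : R := - (2 / (y0 * p ^ 3)) * (chi (Y / (y0 * p ^ 2)) + Y / (y0 * p ^ 2) * chi' (Y / (y0 * p ^ 2))).

Lemma wY_derive y0 Y p : 0 < y0 -> 0 < p -> is_derive (wY y0 Y) p (wY' y0 Y p).
Proof.
 intros Hy Hp.
 apply (is_derive_ext_loc (fun p => / y0 * chi (Y / (y0 * p ^ 2)) / p ^ 2)).
 { exists (mkposreal p Hp). intros q Hq. apply Rabs_def2 in Hq. unfold minus, plus, opp in Hq; simpl in Hq.
  change (@eq R (/ y0 * chi (Y / (y0 * q ^ 2)) / q ^ 2) (/ y0 * chi (Y / q ^ 2 / y0) / q ^ 2)).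
  replace (Y / (y0 * q ^ 2)) with (Y / q ^ 2 / y0) by bound. bound. }
 auto_derive.
 - repeat split. eexists; apply chi_derive. bound. change (p ^ 2 <> 0). apply pow_nonzero; lra.
 - change (fun x : R => chi x) with chi. rewrite (is_derive_unique _ _ _ (chi_derive (Y * / (y0 * (p * (p * 1)))))). unfold wY'.
  replace (Y * / (y0 * (p * (p * 1)))) with (Y / (y0 * p ^ 2)) by bound.
  bound.
Qed.

Lemma wY'_cont y0 Y p : 0 < y0 -> 0 < p -> continuous (wY' y0 Y) p.
Proof.
 intros Hy Hp. unfold wY'. assert (y0 * p ^ 2 <> 0) by bound.
 assert (continuous (fun p => Y / (y0 * p ^ 2)) p) by (cont; auto).
 assert (continuous (fun p => chi (Y / (y0 * p ^ 2))) p) by (apply (continuous_comp (fun p => Y / (y0 * p ^ 2)) chi); auto; apply chi_cont).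
 assert (continuous (fun p => chi' (Y / (y0 * p ^ 2))) p) by (apply (continuous_comp (fun p => Y / (y0 * p ^ 2)) chi'); auto; apply chi'_cont).
 cont; auto. bound.
Qed.

(** The derivative loses exactly a factor [L], because [s * chi' s] is bounded. *)
Lemma wY_bound y0 Y p L : 0 < y0 -> 0 < Y -> 0 < L -> L <= p -> Rabs (wY y0 Y p) <= 3 / (y0 * L ^ 2) /\ Rabs (wY' y0 Y p) <= 3 / (y0 * L ^ 2) / L.
Proof.
 intros Hy HY HL Hp. assert (0 < L ^ 2) by bound.
 assert (L ^ 2 <= p ^ 2) by bound. assert (L ^ 3 <= p ^ 3) by bound.
 split.
 - unfold wY, Rdiv. pose proof (rho_bound y0 (Y * / p ^ 2) Hy). rewrite Rabs_mult, Rabs_inv, (Rabs_right (rho _ _)), (Rabs_right (p ^ 2)) by lra.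
  rewrite Rinv_mult. trans_l (/ y0 * / L ^ 2).
  assert (0 < / y0 * / L ^ 2) by bound. lra.
 - unfold wY'. set (s := Y / (y0 * p ^ 2)). assert (Hs : 0 <= s) by bound.
  pose proof (chi_bound s). pose proof (chi'_bound s Hs).
  rewrite Rabs_mult, Rabs_Ropp, (Rabs_right (2 / (y0 * p ^ 3))). 2: { bound. }
  assert (Rabs (chi s + s * chi' s) <= 3 / 2). { le_by Rabs_triang. rewrite Rabs_right; lra. }
  apply Rle_trans with (2 / (y0 * L ^ 3) * (3 / 2)).
  + apply Rmult_le_compat; try apply Rabs_pos; auto. bound.
   mul_l. apply Rinv_le_contravar. bound. apply Rmult_le_compat_l; lra.
  + bound.
Qed.

Lemma c2d_sub (F : R -> R -> R) (X : R -> R) u Y : continuity_2d_pt F (X u) Y -> continuous X u ->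
  continuity_2d_pt (fun u Y => F (X u) Y) u Y.
Proof.
 intros HF HX eps. destruct (HF eps) as [d Hd]. destruct (c2d_continuous_l X u Y HX d) as [d2 Hd2].
 assert (Hm : 0 < Rmin d d2) by (apply Rmin_case; apply cond_pos). exists (mkposreal _ Hm). simpl. intros v W Hv HW.
 apply Hd. apply (Hd2 v W). eapply Rlt_le_trans; [apply Hv|apply Rmin_r]. eapply Rlt_le_trans; [apply HW|apply Rmin_r].
 eapply Rlt_le_trans; [apply HW|apply Rmin_l].
Qed.

(** * Exchange of the height and the arc parameter *)

Section ClassY.
Variable F : R -> R -> R.
Variables B y0 L m ka : R.
Hypothesis HF2 : forall x Y, 0 < Y -> continuity_2d_pt F x Y.
Hypothesis HFB : forall x Y, 0 < Y -> Rabs (F x Y) <= B.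
Hypothesis HFp : forall x Y, 0 < Y -> F (x + 1) Y = F x Y.
Hypothesis HB : 0 < B.
Hypothesis Hy0 : 0 < y0.
Hypothesis HL : 0 < L.
Hypothesis Hm : 0 < m.
Hypothesis Hka : 0 < ka.

(** The last two conditions say that [p = / (k u)] stays within [[L, 2 L]] along the arc. *)
Definition uarc (r : piece) : Prop := 0 < pc r /\ pc r <= pd r /\ ka <= pk r <= 2 * ka /\ 1 <= 2 * L * (pk r * pc r) /\ L * (pk r * pd r) <= 1.

(** The horizontal coordinate of the image point, for which [a - k X = / (k u)]. *)
Definition Xof (k a u : R) : R := a / k - / (k ^ 2 * u).

Definition uterm (r : piece) (u : R) : R :=
  RInt (fun y => rho y0 y * (F (Xof (pk r) (pa r) u) (y / (pk r ^ 2 * u ^ 2)) * cos (2 * PI * m * u + pth r))) y0 (2 * y0).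

Definition xarc (r : piece) : piece := Piece (pk r) (pa r) (pth r) (Xof (pk r) (pa r) (pc r)) (Xof (pk r) (pa r) (pd r)).

Lemma uarc_p r u : uarc r -> pc r <= u <= pd r -> 0 < pk r * u /\ L <= / (pk r * u) <= 2 * L.
Proof.
 intros [H1 [H2 [H3 [H4 H5]]]] Hu. assert (0 < pk r * u) by bound.
 split; auto. split.
 - apply Rmult_le_reg_r with (pk r * u); auto. rewrite Rinv_l by lra. nra.
 - apply Rmult_le_reg_r with (pk r * u); auto. rewrite Rinv_l by lra. nra.
Qed.

Lemma Xof_p k a u : 0 < k -> 0 < u -> a - k * Xof k a u = / (k * u).
Proof. intros. unfold Xof. bound. Qed.

(** The range of [Y = y / (k u)^2] depends on [k u]; as [rho] vanishes outside its support, it may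
    be enlarged to one interval common to all arcs of the class. *)
Lemma uterm_Y r u : uarc r -> pc r <= u <= pd r ->
  uterm r u = RInt (fun Y => (pk r * u) ^ 2 * rho y0 (Y * (pk r * u) ^ 2) * F (Xof (pk r) (pa r) u) Y * cos (2 * PI * m * u + pth r)) (L ^ 2 * y0) (8 * L ^ 2 * y0).
Proof.
 intros Hr Hu. destruct (uarc_p r u Hr Hu) as [Hku Hp]. destruct Hr as [H1 [H2 [H3 _]]].
 set (v := (pk r * u) ^ 2).
 assert (L ^ 2 <= / v <= 4 * L ^ 2). { replace (/ v) with ((/ (pk r * u)) ^ 2) by bound. nra. }
 set (X := Xof (pk r) (pa r) u). set (cs := cos (2 * PI * m * u + pth r)).
 set (g := fun Y => v * rho y0 (Y * v) * F X Y * cs).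
 assert (forall Y, 0 < Y -> continuous (F X) Y). { intros Y HY. apply (continuity_2d_pt_r F X Y). apply HF2; auto. }
 assert (cg : forall Y, 0 < Y -> continuous g Y).
 { intros Y HY. unfold g. assert (continuous (fun Y => rho y0 (Y * v)) Y). { apply (continuous_comp (fun Y => Y * v) (rho y0)). cont. apply rho_cont. } cont; auto. }
 set (Y1 := y0 * / v). set (Y2 := 2 * y0 * / v).
 assert (HY1 : L ^ 2 * y0 <= Y1). { unfold Y1. nra. }
 assert (Y1 <= Y2). { unfold Y1, Y2. bound. }
 assert (HY2 : Y2 <= 8 * L ^ 2 * y0). { trans_l (2 * y0 * (4 * L ^ 2)). lra. }
 assert (0 < L ^ 2 * y0) by bound.
 rewrite (RInt_split g _ Y1 _) by (try lra; intros; apply cg; lra). rewrite (RInt_split g Y1 Y2 _) by (try lra; intros; apply cg; lra).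
 destruct (ex_RInt_zero g (L ^ 2 * y0) Y1 HY1) as [_ E1].
 { intros Y HY. unfold g. rewrite rho_out; auto. ring. left. trans_l (Y1 * v). bound. }
 destruct (ex_RInt_zero g Y2 (8 * L ^ 2 * y0) HY2) as [_ E3].
 { intros Y HY. unfold g. rewrite rho_out; auto. ring. right. trans_l (Y2 * v). bound. }
 rewrite E1, E3, Rplus_0_l, Rplus_0_r.
 replace Y1 with (/ v * y0 + 0) by bound. replace Y2 with (/ v * (2 * y0) + 0) by bound.
 rewrite <- (RInt_comp_lin (V := RV) g (/ v) 0 y0 (2 * y0)).
 - apply RInt_ext. intros y _. unfold g.
  replace ((/ v * y + 0) * v) with y by bound. replace (/ v * y + 0) with (y / (pk r ^ 2 * u ^ 2)).
  change (@eq R (rho y0 y * (F X (y / (pk r ^ 2 * u ^ 2)) * cs)) (/ v * (v * rho y0 y * F X (y / (pk r ^ 2 * u ^ 2)) * cs))). bound.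
  unfold v. field. split; nra.
 - replace (/ v * y0 + 0) with Y1 by bound. replace (/ v * (2 * y0) + 0) with Y2 by bound.
  apply ex_RInt_cont; auto. intros; apply cg; lra.
Qed.

Definition uintegrand (r : piece) (u Y : R) : R :=
  (pk r * u) ^ 2 * rho y0 (Y * (pk r * u) ^ 2) * F (Xof (pk r) (pa r) u) Y * cos (2 * PI * m * u + pth r).

Lemma uintegrand_cont r u Y : 0 < pk r -> 0 < u -> 0 < Y -> continuity_2d_pt (uintegrand r) u Y.
Proof.
 intros Hk Hu HY.
 assert (continuous (Xof (pk r) (pa r)) u). { unfold Xof. cont. bound. }
 apply continuity_2d_pt_mult; [apply continuity_2d_pt_mult; [apply continuity_2d_pt_mult|]|].
 - apply (c2d_continuous_l (fun u => (pk r * u) ^ 2)). cont.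
 - apply c2d_comp. apply rho_cont. apply continuity_2d_pt_mult. apply (c2d_continuous_r (fun Y => Y)). cont. apply (c2d_continuous_l (fun u => (pk r * u) ^ 2)). cont.
 - apply c2d_sub; auto.
 - apply (c2d_continuous_l (fun u => cos (2 * PI * m * u + pth r))). cont.
Qed.

(** Fubini first, then the change from [u] to [X] at fixed [Y]; after this [F] is evaluated at
    [(X, Y)] without reference to the arc. *)
Lemma uarc_swap r : uarc r ->
  RInt (uterm r) (pc r) (pd r) = RInt (fun Y => RInt (fun X => F X Y * (pamp (wY y0 Y) (xarc r) X * cos (pph m (xarc r) X))) (pc (xarc r)) (pd (xarc r))) (L ^ 2 * y0) (8 * L ^ 2 * y0) /\
  ex_RInt (fun Y => RInt (fun X => F X Y * (pamp (wY y0 Y) (xarc r) X * cos (pph m (xarc r) X))) (pc (xarc r)) (pd (xarc r))) (L ^ 2 * y0) (8 * L ^ 2 * y0).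
Proof.
 intros Hr. pose proof Hr as [H1 [H2 [H3 _]]].
 assert (0 < L ^ 2 * y0) by bound.
 set (G := fun u Y => (pk r * u) ^ 2 * rho y0 (Y * (pk r * u) ^ 2) * F (Xof (pk r) (pa r) u) Y * cos (2 * PI * m * u + pth r)).
 assert (cG : forall u Y, 0 < u -> 0 < Y -> continuity_2d_pt G u Y) by (intros; apply uintegrand_cont; auto; lra).
 assert (Eq : forall Y, L ^ 2 * y0 <= Y -> RInt (fun u => G u Y) (pc r) (pd r) = RInt (fun X => F X Y * (pamp (wY y0 Y) (xarc r) X * cos (pph m (xarc r) X))) (pc (xarc r)) (pd (xarc r))).
 { intros Y HY. assert (0 < Y) by lra.
  set (h := fun X => F X Y * (pamp (wY y0 Y) (xarc r) X * cos (pph m (xarc r) X))).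
  change (RInt (fun u => G u Y) (pc r) (pd r) = RInt h (Xof (pk r) (pa r) (pc r)) (Xof (pk r) (pa r) (pd r))).
  rewrite <- (RInt_comp (V := RV) h (Xof (pk r) (pa r)) (fun u => / (pk r ^ 2 * u ^ 2))).
  - apply RInt_ext. intros u Hu. rewrite Rmin_left, Rmax_right in Hu by lra. assert (Hu' : pc r <= u <= pd r) by lra. destruct (uarc_p r u Hr Hu') as [Hku _].
   unfold scal; simpl; unfold mult; simpl. unfold h, G, pamp, pph, xarc, wY; cbn [pk pa pth]. rewrite Xof_p by lra.
   replace (Y / (/ (pk r * u)) ^ 2) with (Y * (pk r * u) ^ 2) by bound.
   replace (2 * PI * m / (pk r * / (pk r * u)) + pth r) with (2 * PI * m * u + pth r) by bound.
   field. split; lra.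
  - intros u Hu. rewrite Rmin_left, Rmax_right in Hu by lra. destruct (uarc_p r u Hr Hu) as [Hku Hp].
   assert (L <= pa (xarc r) - pk (xarc r) * Xof (pk r) (pa r) u <= 2 * L) by (cbn [xarc pk pa]; rewrite Xof_p; lra).
   set (X := Xof (pk r) (pa r) u) in *.
   assert (continuous (fun X => F X Y) X) by (apply (continuity_2d_pt_l F); apply HF2; auto).
   assert (continuous (pamp (wY y0 Y) (xarc r)) X). { apply (pamp_cont (wY y0 Y) (wY' y0 Y) L HL); auto. intros p Hpp. apply wY_derive; lra. }
   assert (continuous (pph m (xarc r)) X). { apply (pph_cont L m HL); auto. cbn [xarc pk]. lra. }
   unfold h. cont; auto.
  - intros u Hu. rewrite Rmin_left, Rmax_right in Hu by lra. split.
   + unfold Xof. auto_derive. bound. field. split; lra.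
   + cont. bound. }
 split.
 - rewrite (RInt_ext (V := RV) (uterm r) (fun u => RInt (fun Y => G u Y) (L ^ 2 * y0) (8 * L ^ 2 * y0))).
  2: { intros u Hu. rewrite Rmin_left, Rmax_right in Hu by lra. apply uterm_Y; auto. lra. }
  rewrite (fubini G); auto; try lra. 2: { intros; apply cG; lra. }
  apply RInt_ext. intros Y HY. rewrite Rmin_left, Rmax_right in HY by lra. apply Eq. lra.
 - apply (ex_RInt_ext (V := R_NormedModule) (fun Y => RInt (fun u => G u Y) (pc r) (pd r))).
  intros Y HY. rewrite Rmin_left, Rmax_right in HY by lra. apply Eq. lra.
  apply ex_RInt_param; try lra. intros; apply cG; lra.
Qed.

Lemma uterm_ex r : uarc r -> ex_RInt (uterm r) (pc r) (pd r).
Proof.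
 intros Hr. pose proof Hr as [H1 [H2 [H3 _]]].
 assert (0 < L ^ 2 * y0) by bound.
 apply (ex_RInt_ext (V := R_NormedModule) (fun u => RInt (fun Y => uintegrand r u Y) (L ^ 2 * y0) (8 * L ^ 2 * y0))).
 { intros u Hu. rewrite Rmin_left, Rmax_right in Hu by lra. symmetry. apply uterm_Y; auto. lra. }
 apply (ex_RInt_param (fun Y u => uintegrand r u Y)); try lra. intros Y u HY Hu eps. destruct (uintegrand_cont r u Y ltac:(lra) ltac:(lra) ltac:(lra) eps) as [d Hd]. exists d. intros; apply Hd; auto.
Qed.

(** [class_fixed] for each [Y] with one and the same right-hand side, integrated over an interval of
    length [7 L^2 y0]; together with the bound [3 / (y0 L^2)] for the weight this gives the [21]. *)
Lemma class_y (l : list piece) N q0 Z : NoDup l -> (forall r, In r l -> uarc r) -> 0 < q0 ->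
  (forall r r', In r l -> In r' l -> r <> r' -> q0 <= Rabs (pk r - pk r')) ->
  L / ka + 1 <= INR N -> 0 < Z ->
  4 * L ^ 2 * lsum (fun r => pd r - pc r) l + INR (length l) * (INR N * (10 * (L ^ 3 / (m * ka)) * (1 + ln (INR N + 1)))) +
    INR (length l) * (48 * INR N ^ 2 * sqrt (L ^ 3 / m) * (sqrt (INR (length l) - 1) / sqrt q0)) <= Z ->
  Rabs (lsum (fun r => RInt (uterm r) (pc r) (pd r)) l) <= 21 * B / L ^ 2 * sqrt Z.
Proof.
 intros Hnd Hl Hq0 Hsp HN HZ HZl.
 rewrite (lsum_ext _ (fun r => RInt (fun Y => RInt (fun X => F X Y * (pamp (wY y0 Y) (xarc r) X * cos (pph m (xarc r) X))) (pc (xarc r)) (pd (xarc r))) (L ^ 2 * y0) (8 * L ^ 2 * y0))).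
 2: { intros r Hr. apply uarc_swap; auto. }
 destruct (lsum_RInt (fun r Y => RInt (fun X => F X Y * (pamp (wY y0 Y) (xarc r) X * cos (pph m (xarc r) X))) (pc (xarc r)) (pd (xarc r))) l (L ^ 2 * y0) (8 * L ^ 2 * y0)) as [<- ex].
 { intros r Hr. apply uarc_swap; auto. }
 set (W0 := 3 / (y0 * L ^ 2)).
 assert (Hden : 0 < y0 * L ^ 2) by bound.
 set (Q := W0 ^ 2 / L ^ 4 * Z).
 assert (HWL : 0 < W0 ^ 2 / L ^ 4) by bound.
 assert (HQ : 0 < Q) by bound.
 eapply Rle_trans. apply (abs_RInt_le_const _ (L ^ 2 * y0) (8 * L ^ 2 * y0) (B * sqrt Q)); auto; try lra.
 - intros Y HY. assert (HYp : 0 < Y) by lra.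
  assert (Hxk : forall r, In r l -> Xof (pk r) (pa r) (pd r) - Xof (pk r) (pa r) (pc r) <= 4 * L ^ 2 * (pd r - pc r)).
  { intros r Hr. pose proof (Hl r Hr) as Hu. pose proof Hu as [H1 [H2 [H3 _]]]. destruct (uarc_p r (pc r) Hu ltac:(lra)) as [P1 P2]. destruct (uarc_p r (pd r) Hu ltac:(lra)) as [P3 P4].
   replace (Xof (pk r) (pa r) (pd r) - Xof (pk r) (pa r) (pc r)) with (/ (pk r * pc r) * / (pk r * pd r) * (pd r - pc r)) by (unfold Xof; field; repeat split; lra).
   mul_r. nra. }
  pose proof (class_fixed (wY y0 Y) (wY' y0 Y) L W0 m ka HL Hm Hka
   ltac:(intros p Hp; apply wY_derive; lra) ltac:(intros p Hp; apply wY'_cont; lra)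
   ltac:(intros p Hp; apply wY_bound; lra) ltac:(intros p Hp; apply wY_bound; lra)
   (fun X => F X Y) B (map xarc l) N q0 Q) as CF.
  rewrite !lsum_map, length_map in CF. apply CF; auto.
  + intros x. apply (continuity_2d_pt_l F); apply HF2; auto.
  + apply FinFun.Injective_map_NoDup_in; auto. intros r r' Hr Hr' E.
   assert (Ek : pk r = pk r') by (change (pk (xarc r) = pk (xarc r')); rewrite E; auto).
   destruct (Classical_Prop.classic (r = r')); auto. specialize (Hsp r r' Hr Hr' H). rewrite Ek, Rminus_diag, Rabs_R0 in Hsp. lra.
  + intros r Hr. apply in_map_iff in Hr. destruct Hr as [r0 [<- Hr0]]. pose proof (Hl r0 Hr0) as Hu. pose proof Hu as [H1 [H2 [H3 _]]].
   destruct (uarc_p r0 (pc r0) Hu ltac:(lra)) as [P1 P2]. destruct (uarc_p r0 (pd r0) Hu ltac:(lra)) as [P3 P4].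
   pose proof (Xof_p (pk r0) (pa r0) (pc r0) ltac:(lra) ltac:(lra)) as E1. pose proof (Xof_p (pk r0) (pa r0) (pd r0) ltac:(lra) ltac:(lra)) as E2.
   unfold arc_good. cbn [xarc pk pa pc pd]. split; [|split; auto].
   * apply Rplus_le_compat_l, Ropp_le_contravar. apply Rinv_le_contravar. bound. apply Rmult_le_compat_l; auto. apply pow2_ge_0.
   * intros X HX. assert (pk r0 * Xof (pk r0) (pa r0) (pc r0) <= pk r0 * X) by bound. assert (pk r0 * X <= pk r0 * Xof (pk r0) (pa r0) (pd r0)) by bound. lra.
  + intros r r' Hr Hr' Hne. apply in_map_iff in Hr. apply in_map_iff in Hr'. destruct Hr as [r0 [<- Hr0]]. destruct Hr' as [r1 [<- Hr1]].
   cbn [xarc pk]. apply Hsp; auto. intros ->. auto.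
  + unfold Q. mul_l. eapply Rle_trans; [|apply HZl]. apply Rplus_le_compat_r. apply Rplus_le_compat_r.
   rewrite <- lsum_mul. apply lsum_le. intros r Hr. apply Hxk; auto.
 - right. unfold Q. rewrite sqrt_mult by lra. replace (W0 ^ 2 / L ^ 4) with ((W0 / L ^ 2) * (W0 / L ^ 2)) by bound. rewrite sqrt_square. bound. bound.
Qed.

End ClassY.

(** * Farey dissection *)

(** [fa] and [fb] form the first row of a unimodular matrix whose second row is [(k, -h)]; the last
    two fields are distances from the fraction. *)
Record farc := Farc { fh : Z; fk : Z; fa : Z; fb : Z; fu1 : R; fu2 : R }.

Record leaf := Leaf { lh : Z; lk : Z; lh' : Z; lk' : Z }.

Definition lf (p : leaf) : R := IZR (lh p) / IZR (lk p).
Definition rf (p : leaf) : R := IZR (lh' p) / IZR (lk' p).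
Definition mf (p : leaf) : R := IZR (lh p + lh' p) / IZR (lk p + lk' p).

Lemma FOP_app {A} (R : A -> A -> Prop) l1 l2 : ForallOrdPairs R l1 -> ForallOrdPairs R l2 ->
  (forall x y, In x l1 -> In y l2 -> R x y) -> ForallOrdPairs R (l1 ++ l2).
Proof.
 induction l1 as [|x l1 IH]; intros H1 H2 H; simpl; auto.
 inversion H1; subst. constructor.
 - apply Forall_app. split; auto. rewrite Forall_forall. intros y Hy. apply H; simpl; auto.
 - apply IH; auto. intros; apply H; simpl; auto.
Qed.

Lemma RInt_shift (f : R -> R) hk u1 u2 : (forall x, continuous f x) ->
  RInt f (hk + u1) (hk + u2) = RInt (fun u => f (hk + 1 * u)) u1 u2.
Proof.
 intros Hf. replace (hk + u1) with (1 * u1 + hk) by ring. replace (hk + u2) with (1 * u2 + hk) by ring.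
 rewrite <- (RInt_comp_lin (V := RV) f 1 hk). 2: apply (ex_RInt_continuous (V := RV)); auto.
 apply RInt_ext. intros u _. rewrite Rmult_1_l. f_equal. ring.
Qed.

Lemma RInt_reflect (f : R -> R) hk u1 u2 : (forall x, continuous f x) ->
  RInt f (hk - u2) (hk - u1) = RInt (fun u => f (hk + -1 * u)) u1 u2.
Proof.
 intros Hf. replace (hk - u1) with (-1 * u1 + hk) by ring. replace (hk - u2) with (-1 * u2 + hk) by ring.
 assert (forall u, continuous (fun u => f (-1 * u + hk)) u) by (intros u; apply (continuous_comp (fun u => -1 * u + hk) f); [cont | auto]).
 rewrite <- (RInt_comp_lin (V := RV) f (-1) hk). 2: apply (ex_RInt_continuous (V := RV)); auto.
 rewrite <- (opp_RInt_swap (V := RV)). 2: { apply (ex_RInt_continuous (V := RV)). intros u _. unfold scal; simpl; unfold mult; simpl. cont; auto. }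
 rewrite <- (RInt_opp (V := RV)). 2: { apply (ex_RInt_continuous (V := RV)). intros u _. unfold scal; simpl; unfold mult; simpl. cont; auto. }
 apply RInt_ext. intros u _. unfold scal, opp; simpl; unfold mult; simpl.
 replace (-1 * u + hk) with (hk + -1 * u) by ring. bound.
Qed.

Section Farey.
Variable K : Z.

(** Stern-Brocot subdivision: mediants are inserted as long as their denominators are at most [K];
    [n] bounds the depth. *)
Fixpoint farey (n : nat) (p : leaf) : list leaf :=
  match n with
  | O => p :: nil
  | S n => if Z_le_dec (lk p + lk' p) K then
      farey n (Leaf (lh p) (lk p) (lh p + lh' p) (lk p + lk' p)) ++ farey n (Leaf (lh p + lh' p) (lk p + lk' p) (lh' p) (lk' p))
    else p :: nil
  end.

Definition neighbours (p : leaf) : Prop :=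
  (1 <= lk p <= K)%Z /\ (1 <= lk' p <= K)%Z /\ (lh' p * lk p - lh p * lk' p = 1)%Z.

Lemma frac_lt h k h' k' : (1 <= k)%Z -> (1 <= k')%Z -> (h * k' < h' * k)%Z -> IZR h / IZR k < IZR h' / IZR k'.
Proof.
 intros Hk Hk' H. assert (1 <= IZR k) by bound. assert (1 <= IZR k') by bound.
 apply IZR_lt in H. rewrite !mult_IZR in H. apply Rmult_lt_reg_r with (IZR k * IZR k'). bound.
 lhs (IZR h * IZR k').
 rhs (IZR h' * IZR k). auto.
Qed.

Lemma leaf_order p : neighbours p -> lf p < mf p /\ mf p < rf p.
Proof.
 intros [H1 [H2 H3]]. split; apply frac_lt; try lia; nia.
Qed.

Lemma neighbours_sub p : neighbours p -> (lk p + lk' p <= K)%Z ->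
  neighbours (Leaf (lh p) (lk p) (lh p + lh' p) (lk p + lk' p)) /\ neighbours (Leaf (lh p + lh' p) (lk p + lk' p) (lh' p) (lk' p)).
Proof. intros [H1 [H2 H3]] H. split; (split; [|split]); simpl; try lia; nia. Qed.

Lemma farey_leaves n : forall p, neighbours p -> (K + 1 - (lk p + lk' p) <= Z.of_nat n)%Z ->
  (forall q, In q (farey n p) -> neighbours q /\ (K < lk q + lk' q)%Z /\ lf p <= lf q /\ rf q <= rf p) /\
  ForallOrdPairs (fun q q' => rf q <= lf q') (farey n p).
Proof.
 induction n as [|n IH]; intros p Hp Hn.
 - simpl. split. intros q [<-|[]]. split; auto. split. lia. lra. constructor; constructor.
 - simpl. destruct (Z_le_dec (lk p + lk' p) K) as [H|H].
  + destruct (neighbours_sub p Hp H) as [N1 N2]. destruct (leaf_order p Hp) as [O1 O2].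
   destruct (IH _ N1) as [A1 A2]. { simpl. destruct Hp; lia. } destruct (IH _ N2) as [B1 B2]. { simpl. destruct Hp; lia. }
   split.
   * intros q Hq. apply in_app_iff in Hq. destruct Hq as [Hq|Hq].
    destruct (A1 q Hq) as [Q1 [Q2 [Q3 Q4]]]. split; auto. split; auto. change (lf p <= lf q) in Q3. change (rf q <= mf p) in Q4. lra.
    destruct (B1 q Hq) as [Q1 [Q2 [Q3 Q4]]]. split; auto. split; auto. change (mf p <= lf q) in Q3. change (rf q <= rf p) in Q4. lra.
   * apply FOP_app; auto. intros q q' Hq Hq'. destruct (A1 q Hq) as [_ [_ [_ Q4]]]. destruct (B1 q' Hq') as [_ [_ [Q3 _]]].
    change (rf q <= mf p) in Q4. change (mf p <= lf q') in Q3. lra.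
  + split. intros q [<-|[]]. split; auto. split. lia. lra. constructor; constructor.
Qed.

Lemma farey_int (f : R -> R) c d n : c <= d -> (forall x, continuous f x) -> forall p, neighbours p ->
  lsum (fun q => RInt f (clamp c d (lf q)) (clamp c d (mf q)) + RInt f (clamp c d (mf q)) (clamp c d (rf q))) (farey n p) =
  RInt f (clamp c d (lf p)) (clamp c d (rf p)).
Proof.
 intros Hcd Hf.
 assert (Ch : forall a b e, RInt f a b + RInt f b e = RInt f a e).
 { intros. apply (RInt_Chasles (V := RV) f a b e); apply (ex_RInt_continuous (V := RV)); auto. }
 induction n as [|n IH]; intros p Hp; cbn [farey].
 - cbn [lsum]. rewrite Ch. ring.
 - destruct (Z_le_dec (lk p + lk' p) K) as [H|H].
  + destruct (neighbours_sub p Hp H) as [N1 N2]. rewrite lsum_app, !IH by auto. apply Ch.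
  + cbn [lsum]. rewrite Ch. ring.
Qed.

(** The gap between neighbours is cut at their mediant and each half is attached to its own
    fraction. Neighbours have determinant [1], so the other fraction supplies the missing row of the
    matrix. *)
Definition rarc (c d : R) (q : leaf) : farc := Farc (lh q) (lk q) (lk' q) (- lh' q) (clamp c d (lf q) - lf q) (clamp c d (mf q) - lf q).
Definition larc (c d : R) (q : leaf) : farc := Farc (lh' q) (lk' q) (- lk q) (lh q) (rf q - clamp c d (rf q)) (rf q - clamp c d (mf q)).

(* The conditions on a family of Farey arcs [h/k + sg [u1, u2]] cut out of the interval [c, d]. *)
Definition farc_ok (c d sg : R) (r : farc) : Prop :=
  (- fa r * fh r - fb r * fk r = 1)%Z /\ (1 <= fk r <= K)%Z /\ 0 <= fu1 r /\ fu1 r <= fu2 r /\ IZR (fk r) * (IZR K + 1) * fu2 r <= 1 /\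
  c <= IZR (fh r) / IZR (fk r) + sg * fu1 r <= d /\ c <= IZR (fh r) / IZR (fk r) + sg * fu2 r <= d.

(** An interval of length at most [1] lies in the union of two consecutive unit intervals, which
    serve as the two starting leaves. *)
Lemma dissection (f : R -> R) c d : (1 <= K)%Z -> c <= d -> d <= c + 1 -> (forall x, continuous f x) -> exists lr ll : list farc,
  (forall r, In r lr -> farc_ok c d 1 r) /\ (forall r, In r ll -> farc_ok c d (-1) r) /\ NoDup lr /\ NoDup ll /\
  (forall r r', In r lr -> In r' lr -> r <> r' -> (fh r * fk r' <> fh r' * fk r)%Z) /\
  (forall r r', In r ll -> In r' ll -> r <> r' -> (fh r * fk r' <> fh r' * fk r)%Z) /\
  lsum (fun r => fu2 r - fu1 r) lr <= d - c /\ lsum (fun r => fu2 r - fu1 r) ll <= d - c /\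
  RInt f c d = lsum (fun r => RInt (fun u => f (IZR (fh r) / IZR (fk r) + 1 * u)) (fu1 r) (fu2 r)) lr +
               lsum (fun r => RInt (fun u => f (IZR (fh r) / IZR (fk r) + -1 * u)) (fu1 r) (fu2 r)) ll.
Proof.
 intros HK Hcd Hd1 Hf. set (j0 := Int_part c). pose proof (base_Int_part c) as [J1 J2]. fold j0 in J1, J2.
 set (p1 := Leaf j0 1 (j0 + 1) 1). set (p2 := Leaf (j0 + 1) 1 (j0 + 2) 1).
 assert (N1 : neighbours p1) by (split; [|split]; simpl; lia). assert (N2 : neighbours p2) by (split; [|split]; simpl; lia).
 set (n := Z.to_nat K). set (l := farey n p1 ++ farey n p2).
 destruct (farey_leaves n p1 N1 ltac:(simpl; lia)) as [A1 A2]. destruct (farey_leaves n p2 N2 ltac:(simpl; lia)) as [B1 B2].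
 assert (Hl : forall q, In q l -> neighbours q /\ (K < lk q + lk' q)%Z).
 { intros q Hq. apply in_app_iff in Hq. destruct Hq as [Hq|Hq]; [apply A1 in Hq | apply B1 in Hq]; tauto. }
 assert (HO : ForallOrdPairs (fun q q' => rf q <= lf q') l).
 { apply FOP_app; auto. intros q q' Hq Hq'. destruct (A1 q Hq) as [_ [_ [_ Q4]]]. destruct (B1 q' Hq') as [_ [_ [Q3 _]]]. change (rf p1) with (lf p2) in Q4. lra. }
 assert (HOI : forall q q', In q l -> In q' l -> q <> q' -> lf q <> lf q' /\ rf q <> rf q').
 { intros q q' Hq Hq' Hne. destruct (leaf_order q) as [? ?]. apply Hl; auto. destruct (leaf_order q') as [? ?]. apply Hl; auto.
  destruct (ForallOrdPairs_In HO q q' Hq Hq') as [E|[E|E]]; [contradiction| |]; split; lra. }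
 assert (NoDup l).
 { assert (Hl' : forall q, In q l -> lf q < rf q) by (intros q Hq; destruct (leaf_order q); [apply Hl; auto|lra]).
  clear - HO Hl'. induction HO as [|a l Hal HO IH]; constructor.
  - intros Hin. rewrite Forall_forall in Hal. specialize (Hal a Hin). specialize (Hl' a (or_introl eq_refl)). lra.
  - apply IH. intros; apply Hl'; right; auto. }
 assert (Ch : forall (g : R -> R) a b e, (forall x, continuous g x) -> RInt g a b + RInt g b e = RInt g a e).
 { intros g a b e Hg. apply (RInt_Chasles (V := RV) g a b e); apply (ex_RInt_continuous (V := RV)); auto. }
 assert (Int : forall g : R -> R, (forall x, continuous g x) -> RInt g c d = lsum (fun q => RInt g (clamp c d (lf q)) (clamp c d (mf q)) + RInt g (clamp c d (mf q)) (clamp c d (rf q))) l).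
 { intros g Hg. unfold l. rewrite lsum_app, !farey_int by auto. rewrite Ch by auto.
  assert (lf p1 <= c). { unfold lf, p1. cbn [lh lk]. bound. }
  assert (E2 : c + 1 <= rf p2). { unfold rf, p2. cbn [lh' lk']. unfold Rdiv. rewrite Rinv_1, Rmult_1_r, plus_IZR. lra. }
  replace (clamp c d (lf p1)) with c by (unfold clamp, Rmax, Rmin; repeat destruct Rle_dec; lra).
  replace (clamp c d (rf p2)) with d by (unfold clamp, Rmax, Rmin; repeat destruct Rle_dec; lra). bound. }
 (* Empty halves are discarded: for them the clamped endpoints need not lie on the arc. *)
 set (pr := fun q => if Rlt_dec (clamp c d (lf q)) (clamp c d (mf q)) then true else false).
 set (pl := fun q => if Rlt_dec (clamp c d (mf q)) (clamp c d (rf q)) then true else false).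
 assert (Hpr : forall q, In q (filter pr l) -> In q l /\ clamp c d (lf q) < clamp c d (mf q)).
 { intros q Hq. apply filter_In in Hq. destruct Hq as [H1 H2]. split; auto. unfold pr in H2. destruct Rlt_dec; [auto|discriminate]. }
 assert (Hpl : forall q, In q (filter pl l) -> In q l /\ clamp c d (mf q) < clamp c d (rf q)).
 { intros q Hq. apply filter_In in Hq. destruct Hq as [H1 H2]. split; auto. unfold pl in H2. destruct Rlt_dec; [auto|discriminate]. }
 assert (Len : forall q, In q l -> 0 <= clamp c d (mf q) - clamp c d (lf q) /\ 0 <= clamp c d (rf q) - clamp c d (mf q)).
 { intros q Hq. destruct (leaf_order q) as [O1 O2]. apply Hl; auto.
  pose proof (clamp_mono c d (lf q) (mf q) ltac:(lra)). pose proof (clamp_mono c d (mf q) (rf q) ltac:(lra)). lra. }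
 assert (Tot : lsum (fun q => (clamp c d (mf q) - clamp c d (lf q)) + (clamp c d (rf q) - clamp c d (mf q))) l = d - c).
 { assert (E := Int (fun _ => 1) ltac:(intros; cont)). rewrite RInt_const in E. rewrite Rmult_1_r in E. rewrite E.
  apply lsum_ext. intros q _. rewrite !RInt_const. unfold scal; simpl; unfold mult; simpl. ring. }
 rewrite lsum_add in Tot.
 assert (T1 : 0 <= lsum (fun q => clamp c d (mf q) - clamp c d (lf q)) l) by (apply lsum_pos; intros; apply Len; auto).
 assert (T2 : 0 <= lsum (fun q => clamp c d (rf q) - clamp c d (mf q)) l) by (apply lsum_pos; intros; apply Len; auto).
 assert (Mden : forall q, In q l -> 1 <= IZR (lk q) /\ 1 <= IZR (lk' q) /\ IZR K + 1 <= IZR (lk q) + IZR (lk' q) /\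
  mf q - lf q = / (IZR (lk q) * (IZR (lk q) + IZR (lk' q))) /\ rf q - mf q = / (IZR (lk' q) * (IZR (lk q) + IZR (lk' q)))).
 { intros q Hq. destruct (Hl q Hq) as [[H1 [H2 H3]] H4].
  assert (P1 : 1 <= IZR (lk q)) by bound. assert (P2 : 1 <= IZR (lk' q)) by bound.
  split; auto. split; auto. split. rewrite <- !plus_IZR. bound.
  apply (f_equal IZR) in H3. rewrite minus_IZR, !mult_IZR in H3. unfold lf, mf, rf. rewrite !plus_IZR.
  assert (D : IZR (lh' q) = (1 + IZR (lh q) * IZR (lk' q)) / IZR (lk q)) by (apply Rmult_eq_reg_r with (IZR (lk q)); [field_simplify; lra|lra]).
  rewrite D. split; field; lra. }
 assert (Fil : forall p (g : leaf -> R), (forall q, In q l -> p q = false -> g q = 0) -> lsum g (filter p l) = lsum g l).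
 { intros p g Hg. rewrite lsum_filter. apply lsum_ext. intros q Hq. destruct (p q) eqn:E; auto. symmetry; auto. }
 exists (map (rarc c d) (filter pr l)), (map (larc c d) (filter pl l)).
 assert (Finj : forall p (g : leaf -> farc), (forall q q', In q l -> In q' l -> q <> q' -> (fh (g q) * fk (g q') <> fh (g q') * fk (g q))%Z) ->
  NoDup (map g (filter p l)) /\ forall r r', In r (map g (filter p l)) -> In r' (map g (filter p l)) -> r <> r' -> (fh r * fk r' <> fh r' * fk r)%Z).
 { intros p g Hg. split.
  - apply FinFun.Injective_map_NoDup_in; [|apply NoDup_filter; auto]. intros q q' Hq Hq' E. apply filter_In in Hq. apply filter_In in Hq'.
   destruct (Classical_Prop.classic (q = q')); auto. exfalso. apply (Hg q q'); try tauto. rewrite E. reflexivity.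
  - intros r r' Hr Hr' Hne. apply in_map_iff in Hr. apply in_map_iff in Hr'. destruct Hr as [q [<- Hq]]. destruct Hr' as [q' [<- Hq']].
   apply filter_In in Hq. apply filter_In in Hq'. apply Hg; try tauto. intros ->. auto. }
 assert (Fne : forall h k h' k', (1 <= k)%Z -> (1 <= k')%Z -> IZR h / IZR k <> IZR h' / IZR k' -> (h * k' <> h' * k)%Z).
 { intros h k h' k' H1 H2 Hne E. apply Hne. apply IZR_le in H1. apply IZR_le in H2. apply (f_equal IZR) in E. rewrite !mult_IZR in E.
  apply Rmult_eq_reg_r with (IZR k * IZR k'). 2: { bound. }
  lhs (IZR h * IZR k').
  rhs (IZR h' * IZR k). auto. }
 destruct (Finj pr (rarc c d)) as [ND1 F1].
 { intros q q' Hq Hq' Hne. cbn [rarc fh fk]. destruct (HOI q q' Hq Hq' Hne) as [Hf1 _]. destruct (Hl q Hq) as [[? _] _]. destruct (Hl q' Hq') as [[? _] _]. apply Fne; auto; lia. }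
 destruct (Finj pl (larc c d)) as [ND2 F2].
 { intros q q' Hq Hq' Hne. cbn [larc fh fk]. destruct (HOI q q' Hq Hq' Hne) as [_ Hf1]. destruct (Hl q Hq) as [[_ [? _]] _]. destruct (Hl q' Hq') as [[_ [? _]] _]. apply Fne; auto; lia. }
 split; [|split; [|split; [auto|split; [auto|split; [auto|split; [auto|split; [|split]]]]]]].
 - intros r Hr. apply in_map_iff in Hr. destruct Hr as [q [<- Hq]]. destruct (Hpr q Hq) as [Hql Hlt].
  destruct (Hl q Hql) as [[H1 [H2 H3]] H4]. destruct (Mden q Hql) as [P1 [P2 [P3 [P4 P5]]]]. destruct (leaf_order q) as [O1 O2]. apply Hl; auto.
  pose proof (clamp_in c d (lf q) Hcd) as C1. pose proof (clamp_in c d (mf q) Hcd) as C2.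
  assert (clamp c d (mf q) <= mf q) by (revert Hlt; unfold clamp, Rmax, Rmin; repeat destruct Rle_dec; intros; lra).
  assert (lf q <= clamp c d (lf q)) by (revert Hlt; unfold clamp, Rmax, Rmin; repeat destruct Rle_dec; intros; lra).
  unfold farc_ok. cbn [rarc fh fk fa fb fu1 fu2]. fold (lf q). split; [lia|]. split; [lia|]. split; [lra|]. split; [lra|]. split; [|lra].
  (* The distance to the mediant is exactly [/ (k (k + k'))], and final neighbours have
     [k + k' >= K + 1]. *)
  apply Rle_trans with (IZR (lk q) * (IZR (lk q) + IZR (lk' q)) * (mf q - lf q)).
  + apply Rmult_le_compat; try lra. apply Rmult_le_pos. lra. apply Rle_trans with (0 + 1); [lra|]. bound. apply Rmult_le_compat_l; lra.
  + rewrite P4. right. field. lra.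
 - intros r Hr. apply in_map_iff in Hr. destruct Hr as [q [<- Hq]]. destruct (Hpl q Hq) as [Hql Hlt].
  destruct (Hl q Hql) as [[H1 [H2 H3]] H4]. destruct (Mden q Hql) as [P1 [P2 [P3 [P4 P5]]]]. destruct (leaf_order q) as [O1 O2]. apply Hl; auto.
  pose proof (clamp_in c d (rf q) Hcd) as C1. pose proof (clamp_in c d (mf q) Hcd) as C2.
  assert (mf q <= clamp c d (mf q)) by (revert Hlt; unfold clamp, Rmax, Rmin; repeat destruct Rle_dec; intros; lra).
  assert (clamp c d (rf q) <= rf q) by (revert Hlt; unfold clamp, Rmax, Rmin; repeat destruct Rle_dec; intros; lra).
  unfold farc_ok. cbn [larc fh fk fa fb fu1 fu2]. fold (rf q). split; [lia|]. split; [lia|]. split; [lra|]. split; [lra|]. split; [|lra].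
  apply Rle_trans with (IZR (lk' q) * (IZR (lk q) + IZR (lk' q)) * (rf q - mf q)).
  + apply Rmult_le_compat; try lra. apply Rmult_le_pos. lra. apply Rle_trans with (0 + 1); [lra|]. bound. apply Rmult_le_compat_l; lra.
  + rewrite P5. right. field. lra.
 - rewrite lsum_map. rewrite (lsum_ext _ (fun q => clamp c d (mf q) - clamp c d (lf q))) by (intros; cbn [rarc fu1 fu2]; ring).
  rewrite Fil. lra. intros q Hq E. unfold pr in E. destruct Rlt_dec; [discriminate|]. specialize (Len q Hq). lra.
 - rewrite lsum_map. rewrite (lsum_ext _ (fun q => clamp c d (rf q) - clamp c d (mf q))) by (intros; cbn [larc fu1 fu2]; ring).
  rewrite Fil. lra. intros q Hq E. unfold pl in E. destruct Rlt_dec; [discriminate|]. specialize (Len q Hq). lra.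
 - rewrite (Int f Hf), lsum_add, !lsum_map.
  assert (Z0 : forall u v, 0 <= v - u -> ~ u < v -> RInt f u v = 0). { intros u v H1 H2. replace v with u by lra. rewrite RInt_point. reflexivity. }
  f_equal.
  + rewrite <- (Fil pr). 2: { intros q Hq E. unfold pr in E. destruct Rlt_dec; [discriminate|]. destruct (Len q Hq). apply Z0; auto. }
   apply lsum_ext. intros q Hq. cbn [rarc fh fk fu1 fu2]. fold (lf q).
   rewrite <- RInt_shift by auto. f_equal; ring.
  + rewrite <- (Fil pl). 2: { intros q Hq E. unfold pl in E. destruct Rlt_dec; [discriminate|]. destruct (Len q Hq). apply Z0; auto. }
   apply lsum_ext. intros q Hq. cbn [larc fh fk fu1 fu2]. fold (rf q).
   rewrite <- RInt_reflect by auto. f_equal; ring.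
Qed.

End Farey.

(** * The averaged form on Farey arcs *)

Lemma rho_mass y0 : 0 < y0 -> ex_RInt (rho y0) y0 (2 * y0) /\ 0 <= RInt (rho y0) y0 (2 * y0) <= 1.
Proof.
 intros Hy. assert (ex_RInt (rho y0) y0 (2 * y0)) by (apply ex_RInt_cont; [lra|intros; apply rho_cont]).
 split; auto. split. apply RInt_ge0; auto. lra. intros; apply rho_bound; auto.
 apply Rle_trans with ((2 * y0 - y0) * / y0). apply RInt_le_const; auto. lra. intros; apply rho_bound; auto. bound.
Qed.

Lemma rho_avg y0 (g : R -> R) E : 0 < y0 -> (forall y, y0 <= y <= 2 * y0 -> Rabs (g y) <= E) ->
  ex_RInt (fun y => rho y0 y * g y) y0 (2 * y0) -> Rabs (RInt (fun y => rho y0 y * g y) y0 (2 * y0)) <= E.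
Proof.
 intros Hy Hg ex.
 apply Rle_trans with ((2 * y0 - y0) * (/ y0 * E)).
 - apply abs_RInt_le_const; auto. lra. intros y H. rewrite Rabs_mult. pose proof (rho_bound y0 y Hy). rewrite Rabs_right by lra.
  apply Rmult_le_compat; try lra. bound. auto.
 - bound.
Qed.

(** A component of the average of [psi (x + i y)] over [y], twisted by [e (- m x)]; [m] may be any
    real number. *)
Definition Phi (y0 m phi x : R) : R := RInt (fun y => rho y0 y * cp (2 * PI * m * x + phi) (psi (x, y))) y0 (2 * y0).

Lemma phi_2d y0 m phi x y : 0 < y -> continuity_2d_pt (fun x y => rho y0 y * cp (2 * PI * m * x + phi) (psi (x, y))) x y.
Proof.
 intros Hy. destruct (psi_2d x y Hy) as [H1 H2]. apply continuity_2d_pt_mult.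
 apply (c2d_continuous_r (rho y0)). apply rho_cont.
 apply continuity_2d_pt_plus; apply continuity_2d_pt_mult; auto.
 apply (c2d_continuous_l (fun x => cos (2 * PI * m * x + phi))). cont.
 apply (c2d_continuous_l (fun x => sin (2 * PI * m * x + phi))). cont.
Qed.

Lemma Phi_cont y0 m phi x : 0 < y0 -> continuous (Phi y0 m phi) x.
Proof.
 intros Hy. apply (RInt_param_cont (fun y x => rho y0 y * cp (2 * PI * m * x + phi) (psi (x, y)))). lra.
 intros y x' Hy'. apply (continuity_2d_swap (fun x y => rho y0 y * cp (2 * PI * m * x + phi) (psi (x, y)))). apply phi_2d. lra.
Qed.

(** A bound valid at each height passes to the average since the mass of [rho] is at most [1]; the
    extra constant in the phase is the twist at [hk]. *)
Lemma Phi_int y0 m phi hk sg u1 u2 E : 0 < y0 -> u1 <= u2 ->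
  (forall y, y0 <= y <= 2 * y0 -> Rabs (Uint hk m (2 * PI * m * hk + phi) sg y u1 u2) <= E) ->
  Rabs (RInt (fun u => Phi y0 m phi (hk + sg * u)) u1 u2) <= E.
Proof.
 intros Hy H12 HE.
 set (f := fun u y => rho y0 y * cp (2 * PI * m * (hk + sg * u) + phi) (psi (hk + sg * u, y))).
 assert (cf : forall u y, 0 < y -> continuity_2d_pt f u y).
 { intros u y Hy'. apply (c2d_sub (fun x y => rho y0 y * cp (2 * PI * m * x + phi) (psi (x, y))) (fun u => hk + sg * u)). apply phi_2d; auto. cont. }
 change (RInt (fun u => Phi y0 m phi (hk + sg * u)) u1 u2) with (RInt (fun u => RInt (fun y => f u y) y0 (2 * y0)) u1 u2).
 rewrite (fubini f) by (auto; try lra; intros; apply cf; lra).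
 assert (Eq : forall y, y0 <= y -> RInt (fun u => f u y) u1 u2 = rho y0 y * Uint hk m (2 * PI * m * hk + phi) sg y u1 u2).
 { intros y Hy'. unfold Uint. rewrite <- RInt_mulR. 2: apply ex_RInt_cont; auto; intros; apply Uint_cont; auto; lra.
  apply RInt_ext. intros u _. unfold f. replace (2 * PI * m * (hk + sg * u) + phi) with (2 * PI * m * (sg * u) + (2 * PI * m * hk + phi)) by ring. bound. }
 rewrite (RInt_ext (V := RV) _ (fun y => rho y0 y * Uint hk m (2 * PI * m * hk + phi) sg y u1 u2)).
 - apply rho_avg; auto. apply (ex_RInt_ext (V := R_NormedModule) (fun y => RInt (fun u => f u y) u1 u2)).
  intros y Hy'. rewrite Rmin_left, Rmax_right in Hy' by lra. apply Eq; lra.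
  apply ex_RInt_param; auto; try lra. intros; apply cf; lra.
 - intros y Hy'. rewrite Rmin_left, Rmax_right in Hy' by lra. apply Eq; lra.
Qed.

(** Arcs to the left of their fraction are reflected, so that [X] increases with [u] on both sides.
    The component of [psi] then splits as [F1] times a cosine plus [F2] times the same cosine
    shifted by [PI / 2]. *)
Definition F1 (sg X Y : R) : R := Re (psi (sg * X, Y)).
Definition F2 (sg X Y : R) : R := sg * Im (psi (sg * X, Y)).
Definition arc1 (m phi sg : R) (r : farc) : piece :=
  Piece (IZR (fk r)) (sg * IZR (fa r)) (sg * (2 * PI * m * (IZR (fh r) / IZR (fk r)) + phi)) (fu1 r) (fu2 r).
Definition arc2 (m phi sg : R) (r : farc) : piece :=
  Piece (IZR (fk r)) (sg * IZR (fa r)) (sg * (2 * PI * m * (IZR (fh r) / IZR (fk r)) + phi) - PI / 2) (fu1 r) (fu2 r).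

Lemma Phi_unfold : exists C, 0 < C /\ forall y0 m phi sg r u, 0 < y0 -> sg = 1 \/ sg = -1 -> (- fa r * fh r - fb r * fk r = 1)%Z -> (1 <= fk r)%Z ->
  32 * y0 <= u ->
  Rabs (Phi y0 m phi (IZR (fh r) / IZR (fk r) + sg * u) -
    (uterm (F1 sg) y0 m (arc1 m phi sg r) u + uterm (F2 sg) y0 m (arc2 m phi sg r) u)) <= C * (y0 / u).
Proof.
 destruct (unfolding) as [C [HC H]]. exists (2 * C). split. lra.
 intros y0 m phi sg r u Hy0 Hsg Hdet Hk Hu. assert (1 <= IZR (fk r)) by bound.
 assert (sg * sg = 1) by nra.
 set (k := IZR (fk r)) in *. set (hk := IZR (fh r) / k). set (a := IZR (fa r)).
 set (g1 := fun y => rho y0 y * cp (2 * PI * m * (hk + sg * u) + phi) (psi (hk + sg * u, y))).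
 set (g2 := fun y => rho y0 y * cp (2 * PI * m * (hk + sg * u) + phi) (psi (a / k - sg / (k ^ 2 * u), y / (k ^ 2 * u ^ 2)))).
 assert (0 < k ^ 2 * u ^ 2) by bound.
 assert (c1 : forall y, 0 < y -> continuous g1 y).
 { intros y Hy. apply continuous_mulR. apply rho_cont. apply (cp_path_cont (fun _ => 2 * PI * m * (hk + sg * u) + phi) (fun _ => hk + sg * u) (fun y => y)); auto; cont. }
 assert (c2 : forall y, 0 < y -> continuous g2 y).
 { intros y Hy. apply continuous_mulR. apply rho_cont. apply (cp_path_cont (fun _ => 2 * PI * m * (hk + sg * u) + phi) (fun _ => a / k - sg / (k ^ 2 * u)) (fun y => y / (k ^ 2 * u ^ 2))); try cont. bound. }
 assert (X1 : sg * Xof k (sg * a) u = a / k - sg / (k ^ 2 * u)).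
 { unfold Xof. nra. }
 assert (Cs : cos (2 * PI * m * (hk + sg * u) + phi) = cos (2 * PI * m * u + sg * (2 * PI * m * hk + phi))).
 { destruct Hsg as [->| ->]. f_equal; ring. rewrite <- cos_neg. f_equal. ring. }
 assert (Sn : sin (2 * PI * m * (hk + sg * u) + phi) = sg * cos (2 * PI * m * u + (sg * (2 * PI * m * hk + phi) - PI / 2))).
 { replace (2 * PI * m * u + (sg * (2 * PI * m * hk + phi) - PI / 2)) with (2 * PI * m * u + sg * (2 * PI * m * hk + phi) - PI / 2) by ring.
  rewrite cos_minus, cos_PI2, sin_PI2. destruct Hsg as [->| ->].
  replace (2 * PI * m * (hk + 1 * u) + phi) with (2 * PI * m * u + 1 * (2 * PI * m * hk + phi)) by ring. ring.
  replace (2 * PI * m * (hk + -1 * u) + phi) with (- (2 * PI * m * u + -1 * (2 * PI * m * hk + phi))) by ring. rewrite sin_neg. ring. }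
 set (h1 := fun y => rho y0 y * (F1 sg (Xof k (sg * a) u) (y / (k ^ 2 * u ^ 2)) * cos (2 * PI * m * u + sg * (2 * PI * m * hk + phi)))).
 set (h2 := fun y => rho y0 y * (F2 sg (Xof k (sg * a) u) (y / (k ^ 2 * u ^ 2)) * cos (2 * PI * m * u + (sg * (2 * PI * m * hk + phi) - PI / 2)))).
 assert (cpsi : forall y, 0 < y -> continuous (fun y => Re (psi (a / k - sg / (k ^ 2 * u), y / (k ^ 2 * u ^ 2)))) y /\ continuous (fun y => Im (psi (a / k - sg / (k ^ 2 * u), y / (k ^ 2 * u ^ 2)))) y).
 { intros y Hy. destruct (psi_2d (a / k - sg / (k ^ 2 * u)) (y / (k ^ 2 * u ^ 2)) ltac:(apply Rdiv_lt_0_compat; lra)) as [P1 P2].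
  split; [apply (c2d_path (fun x y => Re (psi (x, y))) (fun _ => a / k - sg / (k ^ 2 * u)) (fun y => y / (k ^ 2 * u ^ 2)))|apply (c2d_path (fun x y => Im (psi (x, y))) (fun _ => a / k - sg / (k ^ 2 * u)) (fun y => y / (k ^ 2 * u ^ 2)))]; auto; cont. }
 assert (ex_RInt h1 y0 (2 * y0)).
 { apply ex_RInt_cont. lra. intros y Hy. unfold h1, F1. rewrite X1. destruct (cpsi y ltac:(lra)). apply continuous_mulR. apply rho_cont. apply continuous_mulR; auto. cont. }
 assert (ex_RInt h2 y0 (2 * y0)).
 { apply ex_RInt_cont. lra. intros y Hy. unfold h2, F2. rewrite X1. destruct (cpsi y ltac:(lra)). apply continuous_mulR. apply rho_cont. apply continuous_mulR; auto. apply continuous_mulR; auto. cont. cont. }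
 assert (E2 : uterm (F1 sg) y0 m (arc1 m phi sg r) u + uterm (F2 sg) y0 m (arc2 m phi sg r) u = RInt g2 y0 (2 * y0)).
 { change (RInt h1 y0 (2 * y0) + RInt h2 y0 (2 * y0) = RInt g2 y0 (2 * y0)). rewrite <- (RInt_addR h1 h2) by auto.
  apply RInt_ext. intros y _. unfold h1, h2, g2, F1, F2, cp. rewrite X1, Cs, Sn. bound. }
 rewrite E2. change (Phi y0 m phi (hk + sg * u)) with (RInt g1 y0 (2 * y0)).
 rewrite <- (RInt_subR g1 g2); [|apply ex_RInt_cont; [lra|intros; apply c1; lra]|apply ex_RInt_cont; [lra|intros; apply c2; lra]].
 rewrite (RInt_ext (V := RV) _ (fun y => rho y0 y * (cp (2 * PI * m * (hk + sg * u) + phi) (psi (hk + sg * u, y)) - cp (2 * PI * m * (hk + sg * u) + phi) (psi (a / k - sg / (k ^ 2 * u), y / (k ^ 2 * u ^ 2)))))).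
 2: { intros y _. unfold g1, g2. bound. }
 apply rho_avg; auto.
 - intros y Hy.
  assert (Eu : Rabs (sg * u) = u). { destruct Hsg as [->| ->]; unfold Rabs; destruct Rcase_abs; lra. }
  pose proof (H (2 * PI * m * (hk + sg * u) + phi) (fh r) (fk r) (fa r) (fb r) (sg * u) y Hdet Hk ltac:(lra) ltac:(rewrite Eu; lra)) as Q.
  fold k a in Q.
  replace (/ (k ^ 2 * (sg * u))) with (sg / (k ^ 2 * u)) in Q.
  2: { assert (sg <> 0) by bound. assert (Is : / sg = sg) by (apply Rmult_eq_reg_l with sg; auto; rewrite Rinv_r; auto).
   rewrite <- Is at 1. bound. }
  replace ((sg * u) ^ 2) with (u ^ 2) in Q by nra.
  le_by Q. rewrite Eu. rhs (C * (2 * y0 / u)).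
  mul_l. mul_r. lra.
 - apply (ex_RInt_ext (V := R_NormedModule) (fun y => g1 y - g2 y)).
  intros y _. unfold g1, g2. bound.
  apply ex_RInt_subR; apply ex_RInt_cont; try lra; intros; [apply c1|apply c2]; lra.
Qed.

Lemma F12_props sg : sg = 1 \/ sg = -1 -> exists B, 0 < B /\
  (forall x Y, 0 < Y -> continuity_2d_pt (F1 sg) x Y /\ Rabs (F1 sg x Y) <= B /\ F1 sg (x + 1) Y = F1 sg x Y) /\
  (forall x Y, 0 < Y -> continuity_2d_pt (F2 sg) x Y /\ Rabs (F2 sg x Y) <= B /\ F2 sg (x + 1) Y = F2 sg x Y).
Proof.
 intros Hsg. destruct (psi_bounded) as [B [HB HBd]]. exists B. split; auto.
 assert (forall (x Y : R) n, 0 < Y -> psi (x + IZR n, Y) = psi (x, Y)).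
 { intros x Y n HY. rewrite <- (psi_inv 1%Z n 0%Z 1%Z ltac:(lia) (x, Y) HY).
  destruct (mobius_eq 1 (IZR n) 0 1 x Y ltac:(ring) HY) as [_ ->]. f_equal.
  f_equal; field; nra. }
 assert (Ps : forall x Y, 0 < Y -> psi (sg * (x + 1), Y) = psi (sg * x, Y)).
 { intros x Y HY. destruct Hsg as [->| ->]. replace (1 * (x + 1)) with (1 * x + IZR 1) by ring. auto. replace (-1 * (x + 1)) with (-1 * x + IZR (-1)) by ring. auto. }
 assert (Habs : Rabs sg = 1) by (destruct Hsg as [->| ->]; unfold Rabs; destruct Rcase_abs; lra).
 split; intros x Y HY; destruct (psi_2d (sg * x) Y HY) as [H1 H2].
 - split; [|split].
  + apply (c2d_sub (fun x y => Re (psi (x, y))) (fun x => sg * x)); auto. cont.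
  + pose proof (HBd 0 (sg * x) Y HY) as Q. unfold cp in Q. rewrite cos_0, sin_0, Rmult_1_r, Rmult_0_r, Rplus_0_r in Q. exact Q.
  + unfold F1. rewrite Ps; auto.
 - split; [|split].
  + apply continuity_2d_pt_mult. apply continuity_2d_pt_const. apply (c2d_sub (fun x y => Im (psi (x, y))) (fun x => sg * x)); auto. cont.
  + pose proof (HBd (PI / 2) (sg * x) Y HY) as Q. unfold cp in Q. rewrite cos_PI2, sin_PI2, Rmult_1_r, Rmult_0_r, Rplus_0_l in Q.
   unfold F2. rewrite Rabs_mult, Habs, Rmult_1_l. exact Q.
  + unfold F2. rewrite Ps; auto.
Qed.

Definition class_ok (L ka : R) (r : farc) : Prop :=
  (- fa r * fh r - fb r * fk r = 1)%Z /\ (1 <= fk r)%Z /\ ka <= IZR (fk r) <= 2 * ka /\ 0 < fu1 r /\ fu1 r <= fu2 r /\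
  1 <= 2 * L * (IZR (fk r) * fu1 r) /\ L * (IZR (fk r) * fu2 r) <= 1.

(** [class_y] is applied to [F1] and to [F2]. Unfolding costs [y0 / u] along an arc with
    [fu2 r <= 2 * fu1 r], hence [O(y0)] per arc. *)
Lemma class_arcs : exists C, 0 < C /\ forall y0 m phi sg L ka N q0 Z l, 0 < y0 -> 0 < m -> 0 < L -> 0 < ka -> sg = 1 \/ sg = -1 ->
  NoDup l -> (forall r, In r l -> class_ok L ka r /\ 32 * y0 <= fu1 r) -> 0 < q0 ->
  (forall r r', In r l -> In r' l -> r <> r' -> q0 <= Rabs (IZR (fk r) - IZR (fk r'))) -> L / ka + 1 <= INR N -> 0 < Z ->
  4 * L ^ 2 * lsum (fun r => fu2 r - fu1 r) l + INR (length l) * (INR N * (10 * (L ^ 3 / (m * ka)) * (1 + ln (INR N + 1)))) +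
    INR (length l) * (48 * INR N ^ 2 * sqrt (L ^ 3 / m) * (sqrt (INR (length l) - 1) / sqrt q0)) <= Z ->
  Rabs (lsum (fun r => RInt (fun u => Phi y0 m phi (IZR (fh r) / IZR (fk r) + sg * u)) (fu1 r) (fu2 r)) l) <= C * (sqrt Z / L ^ 2 + INR (length l) * y0).
Proof.
 destruct Phi_unfold as [C1 [HC1 HU]]. destruct (F12_props 1 (or_introl eq_refl)) as [B [HB [HB1 HB2]]]. destruct (F12_props (-1) (or_intror eq_refl)) as [B' [HB' [HB1' HB2']]].
 set (Bm := B + B'). exists (C1 + 42 * Bm). unfold Bm. split. lra. fold Bm.
 intros y0 m phi sg L ka N q0 Z l Hy0 Hm HL Hka Hsg Hnd Hl Hq0 Hsp HN HZ HZl.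
 assert (FP : (forall x Y, 0 < Y -> continuity_2d_pt (F1 sg) x Y /\ Rabs (F1 sg x Y) <= Bm /\ F1 sg (x + 1) Y = F1 sg x Y) /\
  (forall x Y, 0 < Y -> continuity_2d_pt (F2 sg) x Y /\ Rabs (F2 sg x Y) <= Bm /\ F2 sg (x + 1) Y = F2 sg x Y)).
 { unfold Bm. destruct Hsg as [->| ->]; (split; intros x Y HY; [destruct (HB1 x Y HY) as [? [? ?]]; destruct (HB1' x Y HY) as [? [? ?]]|destruct (HB2 x Y HY) as [? [? ?]]; destruct (HB2' x Y HY) as [? [? ?]]]); split; auto; split; auto; lra. }
 destruct FP as [FP1 FP2]. assert (0 < Bm) by bound.
 assert (U1 : forall r, In r l -> uarc L ka (arc1 m phi sg r) /\ uarc L ka (arc2 m phi sg r)).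
 { intros r Hr. destruct (Hl r Hr) as [[D1 [D2 [D3 [D4 [D5 [D6 D7]]]]]] D8]. split; unfold uarc; cbn [arc1 arc2 pk pc pd]; repeat split; auto; lra. }
 assert (CY : forall F (A : farc -> piece), (forall x Y, 0 < Y -> continuity_2d_pt F x Y /\ Rabs (F x Y) <= Bm /\ F (x + 1) Y = F x Y) ->
  (forall r, In r l -> uarc L ka (A r)) -> (forall r, pk (A r) = IZR (fk r) /\ pc (A r) = fu1 r /\ pd (A r) = fu2 r) ->
  Rabs (lsum (fun r => RInt (uterm F y0 m (A r)) (fu1 r) (fu2 r)) l) <= 21 * Bm / L ^ 2 * sqrt Z).
 { intros F A HF HA HAk.
  assert (E : lsum (fun r => RInt (uterm F y0 m (A r)) (fu1 r) (fu2 r)) l = lsum (fun s => RInt (uterm F y0 m s) (pc s) (pd s)) (map A l)).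
  { rewrite lsum_map. apply lsum_ext. intros r _. destruct (HAk r) as [_ [-> ->]]. bound. }
  rewrite E. apply (class_y F Bm y0 L m ka) with (N := N) (q0 := q0); auto.
  - intros x Y HY. apply HF; auto.
  - intros x Y HY. apply HF; auto.
  - intros x Y HY. apply HF; auto.
  - apply FinFun.Injective_map_NoDup_in; auto. intros r r' Hr Hr' EA.
   destruct (Classical_Prop.classic (r = r')) as [|Hne]; auto. specialize (Hsp r r' Hr Hr' Hne).
   destruct (HAk r) as [Ek _]. destruct (HAk r') as [Ek' _]. rewrite <- Ek, <- Ek', EA, Rminus_diag, Rabs_R0 in Hsp. lra.
  - intros s Hs. apply in_map_iff in Hs. destruct Hs as [r [<- Hr]]. auto.
  - intros s s' Hs Hs' Hne. apply in_map_iff in Hs. apply in_map_iff in Hs'. destruct Hs as [r [<- Hr]]. destruct Hs' as [r' [<- Hr']].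
   destruct (HAk r) as [-> _]. destruct (HAk r') as [-> _]. apply Hsp; auto. intros ->. auto.
  - rewrite lsum_map, length_map. rewrite (lsum_ext _ (fun r => fu2 r - fu1 r)). auto. intros r _. destruct (HAk r) as [_ [-> ->]]. bound. }
 pose proof (CY (F1 sg) (arc1 m phi sg) FP1 ltac:(intros; apply U1; auto) ltac:(intros; auto)) as Q1.
 pose proof (CY (F2 sg) (arc2 m phi sg) FP2 ltac:(intros; apply U1; auto) ltac:(intros; auto)) as Q2.
 assert (forall r, In r l -> ex_RInt (uterm (F1 sg) y0 m (arc1 m phi sg r)) (fu1 r) (fu2 r)).
 { intros r Hr. apply (uterm_ex (F1 sg) y0 L m ka) with (r := arc1 m phi sg r); auto. intros; apply FP1; auto. apply U1; auto. }
 assert (forall r, In r l -> ex_RInt (uterm (F2 sg) y0 m (arc2 m phi sg r)) (fu1 r) (fu2 r)).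
 { intros r Hr. apply (uterm_ex (F2 sg) y0 L m ka) with (r := arc2 m phi sg r); auto. intros; apply FP2; auto. apply U1; auto. }
 set (P := fun r u => Phi y0 m phi (IZR (fh r) / IZR (fk r) + sg * u)).
 assert (forall r u, continuous (P r) u). { intros r u. apply (continuous_comp (fun u => IZR (fh r) / IZR (fk r) + sg * u) (Phi y0 m phi)). cont. apply Phi_cont; auto. }
 assert (forall r, In r l -> Rabs (RInt (P r) (fu1 r) (fu2 r) - (RInt (uterm (F1 sg) y0 m (arc1 m phi sg r)) (fu1 r) (fu2 r) + RInt (uterm (F2 sg) y0 m (arc2 m phi sg r)) (fu1 r) (fu2 r))) <= C1 * y0).
 { intros r Hr. destruct (Hl r Hr) as [[D1 [D2 [D3 [D4 [D5 [D6 D7]]]]]] D8].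
  assert (ex_RInt (P r) (fu1 r) (fu2 r)) by (apply ex_RInt_cont; auto).
  rewrite <- (RInt_addR (uterm (F1 sg) y0 m (arc1 m phi sg r)) (uterm (F2 sg) y0 m (arc2 m phi sg r))) by auto.
  assert (ex_RInt (fun u => uterm (F1 sg) y0 m (arc1 m phi sg r) u + uterm (F2 sg) y0 m (arc2 m phi sg r) u) (fu1 r) (fu2 r)) by (apply ex_RInt_addR; auto).
  rewrite <- (RInt_subR (P r) (fun u => uterm (F1 sg) y0 m (arc1 m phi sg r) u + uterm (F2 sg) y0 m (arc2 m phi sg r) u)) by auto.
  apply Rle_trans with ((fu2 r - fu1 r) * (C1 * (y0 / fu1 r))).
  - apply abs_RInt_le_const; auto. apply ex_RInt_subR; auto. intros u Hu. apply Rle_trans with (C1 * (y0 / u)). exact (HU y0 m phi sg r u Hy0 Hsg D1 D2 ltac:(lra)).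
   mul_l. mul_l. apply Rinv_le_contravar; lra.
  - assert (fu2 r <= 2 * fu1 r) by nra.
   trans_l (fu1 r * (C1 * (y0 / fu1 r))).
   bound. }
 assert (Rabs (lsum (fun r => RInt (P r) (fu1 r) (fu2 r) - (RInt (uterm (F1 sg) y0 m (arc1 m phi sg r)) (fu1 r) (fu2 r) + RInt (uterm (F2 sg) y0 m (arc2 m phi sg r)) (fu1 r) (fu2 r))) l) <= INR (length l) * (C1 * y0)).
 { eapply Rle_trans. apply lsum_abs. rewrite <- lsum_const. apply lsum_le. auto. }
 assert (E : lsum (fun r => RInt (P r) (fu1 r) (fu2 r)) l = lsum (fun r => RInt (P r) (fu1 r) (fu2 r) - (RInt (uterm (F1 sg) y0 m (arc1 m phi sg r)) (fu1 r) (fu2 r) + RInt (uterm (F2 sg) y0 m (arc2 m phi sg r)) (fu1 r) (fu2 r))) l +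
  (lsum (fun r => RInt (uterm (F1 sg) y0 m (arc1 m phi sg r)) (fu1 r) (fu2 r)) l + lsum (fun r => RInt (uterm (F2 sg) y0 m (arc2 m phi sg r)) (fu1 r) (fu2 r)) l)).
 { rewrite <- !lsum_add. apply lsum_ext. bound. }
 change (Rabs (lsum (fun r => RInt (P r) (fu1 r) (fu2 r)) l) <= (C1 + 42 * Bm) * (sqrt Z / L ^ 2 + INR (length l) * y0)). rewrite E.
 le_by Rabs_triang. le_by Rplus_le_compat_l. apply Rabs_triang.
 assert (0 <= C1 * (sqrt Z / L ^ 2)) by bound. assert (0 <= Bm * (INR (length l) * y0)) by bound.
 bound.
Qed.

Lemma dyadic_ex K X : 1 <= K -> K <= X -> exists J, X <= 2 ^ J * K /\ 2 ^ J * K <= 2 * X /\ INR J <= 1 + 2 * ln X.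
Proof.
 intros HK HX.
 assert (H : forall n, 2 ^ n * K < X \/ exists J, X <= 2 ^ J * K /\ 2 ^ J * K <= 2 * X).
 { induction n as [|n [IH|IH]]; auto.
  - destruct (Rlt_dec (2 ^ 0 * K) X); auto. right. exists O. lra.
  - destruct (Rlt_dec (2 ^ S n * K) X); auto. right. exists (S n). simpl in *. lra. }
 destruct (Pow_x_infinity 2 ltac:(rewrite Rabs_right; lra) X) as [n0 Hn0].
 specialize (Hn0 n0 (le_n _)). rewrite Rabs_right in Hn0 by (apply Rle_ge, pow_le; lra).
 destruct (H n0) as [H1|[J [H1 H2]]]. nra.
 exists J. split; auto. split; auto.
 assert (2 ^ J <= 2 * X) by nra.
 assert (INR J * ln 2 <= ln 2 + ln X).
 { rewrite <- ln_mult by lra. replace (INR J * ln 2) with (ln (2 ^ J)). bound. rewrite ln_pow by lra. bound. }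
 pose proof ln_lt_2 as H2'. assert (0 <= ln X) by bound.
 nra.
Qed.

Lemma dyadic_indicator I : forall x v, 1 <= x -> x < 2 ^ I ->
  rsum (fun i => if Rle_dec (2 ^ i) x then if Rlt_dec x (2 * 2 ^ i) then v else 0 else 0) I = v.
Proof.
 induction I; intros x v Hx H. bound.
 cbn [rsum]. destruct (Rle_dec (2 ^ I) x) as [H1|H1].
 - destruct (Rlt_dec x (2 * 2 ^ I)) as [H2|H2]; [|simpl in H; lra].
  rewrite (rsum_ext _ (fun _ => 0)). rewrite rsum_const. ring.
  intros i Hi. destruct (Rle_dec (2 ^ i) x); auto. destruct (Rlt_dec x (2 * 2 ^ i)) as [H3|H3]; auto.
  assert (2 ^ S i <= 2 ^ I) by (apply Rle_pow; [lra|lia]). simpl in H0. lra.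
 - rewrite IHI by lra. ring.
Qed.

(** Evaluates the quantity [Z] of [class_arcs]: its square root divided by [L^2] is the wanted
    [/ (U sqrt R)] up to logarithms. The diagonal rests on [U R = K^2 <= L^2], the other two terms
    on [U R^4 Th^4 <= M]. *)
Lemma class_arith (n N : nat) U R Th M m K L ka qs len : 1 <= R -> 1 <= Th -> 1 <= U -> 0 < K -> K * K = U * R -> K <= L -> L <= 2 * M ->
  1 <= ka -> ka <= K -> qs = U / (4 * K * R * Th ^ 2) -> (1 <= n)%nat -> qs <= 2 * ka -> INR n <= 9 + 4 * ka ^ 2 / U -> ((2 <= n)%nat -> U <= 256 * ka ^ 2) ->
  L / ka + 1 <= INR N -> INR N <= L / ka + 2 -> len <= / U -> U * R ^ 4 * Th ^ 4 <= M -> M <= m -> 1 <= M ->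
  4 * L ^ 2 * len + INR n * (INR N * (10 * (L ^ 3 / (m * ka)) * (1 + ln (INR N + 1)))) +
    INR n * (48 * INR N ^ 2 * sqrt (L ^ 3 / m) * (sqrt (INR n - 1) / sqrt qs)) <= 10 ^ 9 * (L ^ 4 / (U ^ 2 * R)) * (1 + ln M).
Proof.
 intros HR HTh HU HK HKK HKL HLM Hka HkaK Hqs Hn1 Hqka Hn Hn2 HN1 HN2 Hlen HM Hm HM1.
 assert (Hl0 : 0 <= ln M) by bound.
 assert (L4 : 0 < L ^ 4) by bound.
 assert (Th4 : 1 <= Th ^ 4) by bound.
 set (W := L ^ 4 / (U ^ 2 * R)). assert (HW : 0 < W) by bound.
 assert (Hden : 0 < 4 * K * R * Th ^ 2) by bound.
 assert (Hq : 0 < qs) by (rewrite Hqs; apply Rdiv_lt_0_compat; lra).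
 assert (HKK2 : K * K <= L ^ 2) by nra.
 assert (T1 : 4 * L ^ 2 * len <= 4 * W).
 { trans_l (4 * L ^ 2 * / U).
  rhs (4 * L ^ 2 * (L ^ 2 / (U ^ 2 * R))). mul_l.
  lhs ((U * R) / (U ^ 2 * R)). bound. }
 assert (HLka : 1 <= L / ka) by bound.
 assert (HLk : L / ka <= L) by bound.
 assert (Hlog : 1 + ln (INR N + 1) <= 4 * (1 + ln M)).
 { assert (ln (INR N + 1) <= ln (8 * M)) by bound. rewrite ln_mult in H by lra.
  assert (ln 8 <= 3). { rewrite <- (ln_exp 3). apply ln_le. lra. pose proof (exp_ineq1_le 1) as E1. replace 3 with (1 + 1 + 1) by ring. rewrite !exp_plus. nra. }
  lra. }
 assert (1 <= INR n) by bound.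
 assert (/ qs ^ 2 = 16 * (R ^ 3 * Th ^ 4) / U).
 { rewrite Hqs. lhs (16 * (K * K) * R ^ 2 * Th ^ 4 / U ^ 2). rewrite HKK. bound. }
 assert (Hkq : / ka ^ 2 <= 4 * / qs ^ 2).
 { rhs (/ ((qs / 2) ^ 2)). bound. }
 set (P := R ^ 3 * Th ^ 4) in *.
 assert (HPU : P / (U * M) <= / (U ^ 2 * R)).
 { rhs (M / (U ^ 2 * R * M)). lhs ((U * R ^ 4 * Th ^ 4) / (U ^ 2 * R * M)).
  bound. }
 assert (Hnk : INR n * / (ka ^ 2 * m) <= 580 * / (U ^ 2 * R)).
 { apply Rle_trans with ((9 * / ka ^ 2 + 4 / U) * / M).
  - lhs (INR n * / ka ^ 2 * / m). apply Rmult_le_compat.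
   bound. bound.
   rhs ((9 + 4 * ka ^ 2 / U) * / ka ^ 2). bound.
   apply Rinv_le_contravar; lra.
  - trans_r (580 * (P / (U * M))).
   rhs ((580 * P / U) * / M).
   mul_r.
   assert (4 / U <= 4 * P / U) by bound.
   bound. }
 assert (T2 : INR n * (INR N * (10 * (L ^ 3 / (m * ka)) * (1 + ln (INR N + 1)))) <= 69600 * W * (1 + ln M)).
 { apply Rle_trans with (INR n * ((3 * (L / ka)) * (10 * (L ^ 3 / (m * ka)) * (4 * (1 + ln M))))).
  - mul_l. assert (0 <= L ^ 3 / (m * ka)) by bound.
   apply Rmult_le_compat; try lra. bound. apply Rmult_le_compat_l; lra.
  - lhs ((120 * L ^ 4 * (1 + ln M)) * (INR n * / (ka ^ 2 * m))).
   rhs ((120 * L ^ 4 * (1 + ln M)) * (580 * / (U ^ 2 * R))).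
   bound. }
 assert (T3 : INR n * (48 * INR N ^ 2 * sqrt (L ^ 3 / m) * (sqrt (INR n - 1) / sqrt qs)) <= 10 ^ 8 * W).
 (* A single arc has no pairs and [sqrt (INR n - 1)] vanishes; the bound [U <= 256 ka^2] is assumed
    exactly when it does not. *)
 { destruct (le_lt_dec 2 n) as [H2|H2].
  2: { replace (INR n - 1) with 0 by (replace n with 1%nat by lia; simpl; ring). rewrite sqrt_0. bound. }
  specialize (Hn2 H2).
  assert (Hnu : INR n <= 2308 * ka ^ 2 / U).
  { assert (1 <= 256 * ka ^ 2 / U) by bound. lra. }
  assert (sqrt (L ^ 3 / m) * (sqrt (INR n - 1) / sqrt qs) <= 100 * (L ^ 2 / (U * R))).
  { rewrite <- sqrt_div by lra. rewrite <- sqrt_mult. 2: { bound. } 2: { bound. }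
   replace (100 * (L ^ 2 / (U * R))) with (sqrt ((100 * (L ^ 2 / (U * R))) * (100 * (L ^ 2 / (U * R))))).
   2: { bound. }
   apply sqrt_le_1_alt.
   apply Rle_trans with (L ^ 3 * INR n / (M * qs)).
   - lhs (L ^ 3 * (INR n - 1) * / (m * qs)).
    apply Rmult_le_compat. bound. bound. bound.
    apply Rinv_le_contravar. bound. apply Rmult_le_compat_r; lra.
   - apply Rle_trans with (L ^ 3 * (2308 * (K * L) / U) / (M * qs)).
    + mul_r. mul_l.
     le_by Hnu. mul_r. mul_l.
     apply Rmult_le_compat; lra.
    + replace (L ^ 3 * (2308 * (K * L) / U) / (M * qs)) with ((9232 * L ^ 4 / (U ^ 2 * R ^ 2)) * ((K * K) * R ^ 3 * Th ^ 2 / M)).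
     2: { rewrite Hqs. bound. }
     rhs (10000 * L ^ 4 / (U ^ 2 * R ^ 2) * 1).
     assert (0 < U ^ 2 * R ^ 2) by bound.
     apply Rmult_le_compat.
     * apply Rdiv_le_0_compat; lra.
     * apply Rdiv_le_0_compat; [|lra]. repeat apply Rmult_le_pos; try lra.
     * mul_r. lra.
     * apply Rmult_le_reg_r with M. lra. unfold Rdiv. rewrite Rmult_assoc, Rinv_l, Rmult_1_l, Rmult_1_r by lra.
      rewrite HKK. nra. }
  assert (INR N ^ 2 <= 9 * (L ^ 2 / ka ^ 2)). { rhs ((3 * (L / ka)) ^ 2). bound. }
  lhs ((INR n * (48 * INR N ^ 2)) * (sqrt (L ^ 3 / m) * (sqrt (INR n - 1) / sqrt qs))).
  apply Rle_trans with ((2308 * ka ^ 2 / U * (48 * (9 * (L ^ 2 / ka ^ 2)))) * (100 * (L ^ 2 / (U * R)))).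
  - apply Rmult_le_compat; auto.
   + apply Rmult_le_pos. lra. apply Rmult_le_pos. lra. apply pow2_ge_0.
   + apply Rmult_le_pos. bound. apply Rdiv_le_0_compat. bound. apply sqrt_lt_R0; auto.
   + apply Rmult_le_compat; try lra. apply Rmult_le_pos. lra. apply pow2_ge_0.
  - lhs (99705600 * W).
   bound. }
 nra.
Qed.

Lemma frac_gap h k h' k' (x : R) : (1 <= k)%Z -> (1 <= k')%Z -> (h * k' <> h' * k)%Z -> IZR k <= x -> IZR k' <= x ->
  / x ^ 2 <= Rabs (IZR h / IZR k - IZR h' / IZR k').
Proof.
 intros Hk Hk' Hne Hx Hx'. apply IZR_le in Hk. apply IZR_le in Hk'.
 replace (IZR h / IZR k - IZR h' / IZR k') with ((IZR h * IZR k' - IZR h' * IZR k) * / (IZR k * IZR k')) by bound.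
 assert (1 <= Rabs (IZR h * IZR k' - IZR h' * IZR k)). { rewrite <- !mult_IZR, <- minus_IZR, <- abs_IZR. bound. }
 assert (0 < IZR k * IZR k') by bound.
 rewrite Rabs_mult, (Rabs_right (/ _)) by (left; apply Rinv_0_lt_compat; auto).
 apply Rle_trans with (1 * / (IZR k * IZR k')). rewrite Rmult_1_l. apply Rinv_le_contravar; auto. nra.
 bound.
Qed.

(** Distinct fractions with denominators at most [2 ka] are spaced by [/ (2 ka)^2], and all of them
    lie within [/ (ka K)] of [[c, d]]. As this interval is shorter than [/ U], two of them already
    force [U] to be [O(ka^2)]. *)
Lemma farc_count Kz (K : R) U c d sg ka l : 1 <= ka -> ka <= K -> K <= IZR Kz + 1 -> U <= K * K -> 0 < U -> sg = 1 \/ sg = -1 -> d - c <= / U ->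
  NoDup l -> (forall r, In r l -> farc_ok Kz c d sg r /\ ka <= IZR (fk r) <= 2 * ka) ->
  (forall r r', In r l -> In r' l -> r <> r' -> (fh r * fk r' <> fh r' * fk r)%Z) -> (1 <= length l)%nat ->
  INR (length l) <= 9 + 4 * ka ^ 2 / U /\ ((2 <= length l)%nat -> U <= 256 * ka ^ 2).
Proof.
 intros Hka HkaK HKz HUK HU Hsg Hdc Hnd Hl Hx Hlen.
 set (e := / (ka * K)).
 assert (Hk2 : 0 < ka ^ 2) by bound.
 assert (S : (INR (length l) - 1) * / (2 * ka) ^ 2 <= (d + e) - (c - e)).
 { apply (spaced_count (length l) (map (fun r => IZR (fh r) / IZR (fk r)) l)); auto. apply length_map.
  - apply spaced_inj; auto. intros r r' Hr Hr' Hne. destruct (Hl r Hr) as [[_ [Hk _]] Hk1]. destruct (Hl r' Hr') as [[_ [Hk' _]] Hk1'].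
   apply frac_gap; try lia; auto; lra.
  - intros x Hin. apply in_map_iff in Hin. destruct Hin as [r [<- Hr]]. destruct (Hl r Hr) as [[_ [Hk [H0 [H1 [H2 [H3 _]]]]]] Hk1].
   assert (Hu : fu1 r <= e).
   { apply Rle_trans with (fu2 r); auto. unfold e. apply Rmult_le_reg_l with (ka * K). bound. rewrite Rinv_r by (apply Rgt_not_eq, Rmult_lt_0_compat; lra).
    eapply Rle_trans; [|apply H2]. bound. }
   nra. }
 assert (S2 : INR (length l) - 1 <= (2 * ka) ^ 2 * (/ U + 2 * e)).
 { apply Rmult_le_reg_l with (/ (2 * ka) ^ 2). bound. rewrite <- Rmult_assoc, Rinv_l, Rmult_1_l by (apply Rgt_not_eq, pow_lt; lra). lra. }
 split.
 - assert ((2 * ka) ^ 2 * (/ U + 2 * e) <= 4 * ka ^ 2 / U + 8). 2: lra.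
  trans_l ((2 * ka) ^ 2 * (/ U + 2 * / (ka * ka))). right. field. split; lra.
 - intros H2. destruct (Rle_dec U (256 * ka ^ 2)) as [|Hn]; auto. exfalso.
  assert (H2' : 2 <= INR (length l)) by (apply (le_INR 2); auto).
  assert (E2 : e <= / (16 * ka ^ 2)). { apply Rinv_le_contravar. lra. nra. }
  assert ((2 * ka) ^ 2 * (/ U + 2 * e) <= (2 * ka) ^ 2 * (/ (256 * ka ^ 2) + 2 * / (16 * ka ^ 2))) by bound.
  replace ((2 * ka) ^ 2 * (/ (256 * ka ^ 2) + 2 * / (16 * ka ^ 2))) with (33 / 64) in H by bound. lra.
Qed.

Lemma Ly_bound c0 M y : 0 < c0 -> 1 <= M -> c0 / M <= y -> Ly y <= (3 + ln (2 + / c0)) * (1 + ln M).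
Proof.
 intros Hc HM Hy. assert (0 < / c0) by bound.
 assert (0 < ln (2 + / c0)) by (rewrite <- ln_1; apply ln_increasing; lra).
 assert (0 < c0 / M) by bound.
 assert (/ y <= M * / c0). { trans_l (/ (c0 / M)). bound. }
 assert (ln (2 + / y) <= ln (2 + / c0) + ln M).
 { rewrite <- ln_mult by lra. bound. }
 unfold Ly. assert (0 <= ln (2 + / c0) * ln M) by bound. nra.
Qed.

(** Each arc is cut at the points [u = / (k 2^j K)], so that the pieces have [p = / (k u)] in
    [[L, 2 L]] with [L = 2^j K]. Pieces are sorted by [j] and by the dyadic size of [k], and
    [class_arcs] bounds each class. The cutting stops at [L] of size [sqrt M], where [near_lemma]
    already gives enough. *)
Lemma arcs_bound c0 : 0 < c0 -> exists C, 1 <= C /\ forall M U R0 Th m phi sg c d qs Kz l,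
  1 <= M -> 1 <= R0 -> 1 <= Th -> C * R0 <= U -> C * U * R0 ^ 4 * Th ^ 4 <= M -> M <= m -> sg = 1 \/ sg = -1 -> d - c <= / U ->
  Kz = Int_part (sqrt (U * R0)) -> qs = U / (4 * sqrt (U * R0) * R0 * Th ^ 2) ->
  NoDup l -> (forall r, In r l -> farc_ok Kz c d sg r) ->
  (forall r r', In r l -> In r' l -> r <> r' -> (fh r * fk r' <> fh r' * fk r)%Z) ->
  lsum (fun r => fu2 r - fu1 r) l <= / U -> (forall r, In r l -> qs <= IZR (fk r)) ->
  (forall r r', In r l -> In r' l -> r <> r' -> qs <= Rabs (IZR (fk r) - IZR (fk r'))) ->
  Rabs (lsum (fun r => RInt (fun u => Phi (c0 / M) m phi (IZR (fh r) / IZR (fk r) + sg * u)) (fu1 r) (fu2 r)) l) <= C * (1 + ln M) ^ 3 / (U * sqrt R0).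
Proof.
 intros Hc0. destruct (near_lemma) as [C1 [HC1 HN]]. destruct (class_arcs) as [C2 [HC2 HCl]].
 set (CL := 3 + ln (2 + / c0)).
 assert (HCL : 3 <= CL). { unfold CL. assert (0 < / c0) by bound. assert (0 < ln (2 + / c0)) by (rewrite <- ln_1; apply ln_increasing; lra). lra. }
 set (Cf := C1 * CL * (2 + 8 * c0) + 3 * (C2 * (10 ^ 5 + 4 * c0))).
 assert (HCf : 0 <= Cf) by bound.
 (* The term [4096 c0^2] ensures [64 c0 K <= sqrt M], which keeps the pieces of all classes at
    distance at least [32 y0] from their fractions. *)
 exists (16 + 4096 * c0 ^ 2 + Cf). pose proof (pow2_ge_0 c0) as Hc02. split. lra. set (CC := 16 + 4096 * c0 ^ 2 + Cf).
 intros M U R0 Th m phi sg c d qs Kz l HM HR HTh HCU HCM Hm Hsg Hdc HKz Hqs Hnd Hok Hx Hlen Hlow Hsp.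
 assert (HCC : 16 <= CC /\ 4096 * c0 ^ 2 <= CC) by bound.
 assert (Hl0 : 0 <= ln M) by bound. set (Lg := 1 + ln M). assert (HLg : 1 <= Lg) by bound.
 assert (HU : 1 <= U) by nra.
 assert (T2 : 1 <= Th ^ 2) by bound.
 set (X := U * R0 ^ 4 * Th ^ 4). assert (HX : CC * X <= M) by bound.
 assert (HX16 : 16 * X <= M) by nra.
 assert (HURX : U * R0 <= X). { unfold X. rhs (U * R0 * (R0 ^ 3 * Th ^ 4)). bound. }
 set (K := sqrt (U * R0)) in *. assert (HKK : K * K = U * R0) by bound.
 assert (HK1 : 1 <= K) by bound.
 set (sM := sqrt M). assert (HsM : sM * sM = M) by bound.
 assert (HKM : K <= sM). { unfold K, sM. bound. }
 set (y0 := c0 / M). assert (Hy0 : 0 < y0) by bound.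
 destruct (dyadic_ex K sM HK1 HKM) as [J [HJ1 [HJ2 HJ3]]].
 destruct (dyadic_ex 1 (K + 1) ltac:(lra) ltac:(lra)) as [I [HI1 [_ HI3]]].
 assert (HlnsM : 2 * ln sM = ln M). { rewrite <- HsM. rewrite ln_mult by lra. ring. }
 assert (HJL : INR J <= Lg) by bound.
 assert (HIL : INR I <= 3 * Lg).
 { assert (ln (K + 1) <= ln 2 + ln sM). { rewrite <- ln_mult by lra. bound. }
  assert (ln 2 < 1). { rewrite <- (ln_exp 1). apply ln_increasing. lra. pose proof (exp_ineq1 1 ltac:(lra)). lra. } bound. }
 set (V := 2 ^ J * K) in *.
 pose proof (base_Int_part K) as [Kz1 Kz2]. rewrite <- HKz in Kz1, Kz2.
 set (k := fun r => IZR (fk r)).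
 assert (Hk : forall r, In r l -> 1 <= k r /\ k r <= K). { intros r Hr. destruct (Hok r Hr) as [_ [H _]]. split. bound. apply Rle_trans with (IZR Kz); auto. bound. }
 set (sp := fun r j => clamp (fu1 r) (fu2 r) (/ (k r * (2 ^ j * K)))).
 assert (Hsp_in : forall r j, In r l -> fu1 r <= sp r j <= fu2 r). { intros r j Hr. apply clamp_in. apply Hok; auto. }
 (* The Farey bound [k (K + 1) u <= 1] places the whole arc below the first cut point. *)
 assert (Hsp0 : forall r, In r l -> sp r 0%nat = fu2 r).
 { intros r Hr. destruct (Hok r Hr) as [_ [_ [H0 [H1 [H2 _]]]]]. destruct (Hk r Hr) as [K1 K2].
  assert (fu2 r <= / (k r * (2 ^ 0 * K))). { simpl. rewrite Rmult_1_l. assert (0 < k r * K) by bound. apply Rmult_le_reg_l with (k r * K); auto. rewrite Rinv_r by lra. eapply Rle_trans; [|apply H2]. fold (k r). bound. }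
  unfold sp, clamp, Rmax, Rmin. repeat destruct Rle_dec; lra. }
 assert (Hspm : forall r j, In r l -> sp r (S j) <= sp r j).
 { intros r j Hr. destruct (Hk r Hr) as [K1 K2]. apply clamp_mono. apply Rinv_le_contravar. bound. mul_l. simpl. bound. }
 set (P := fun r u => Phi y0 m phi (IZR (fh r) / k r + sg * u)).
 assert (cP : forall r u, continuous (P r) u). { intros r u. apply (continuous_comp (fun u => IZR (fh r) / k r + sg * u) (Phi y0 m phi)). cont. apply (Phi_cont); auto. }
 set (It := fun r a b => RInt (P r) a b : R).
 assert (Spl : forall r, In r l -> It r (fu1 r) (fu2 r) = It r (fu1 r) (sp r J) + rsum (fun j => It r (sp r (S j)) (sp r j)) J).
 { intros r Hr. rewrite <- (Hsp0 r Hr). clear HJ1 HJ2 HJ3 HJL. clearbody V. induction J as [|n IH]; cbn [rsum]. ring.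
  rewrite IH. unfold It. rewrite (RInt_split (P r) (fu1 r) (sp r (S n)) (sp r n)). ring. split. apply Hsp_in; auto. apply Hspm; auto. auto. }
 set (n := INR (length l)). assert (Hn0 : 0 <= n) by bound.
 assert (Hqs0 : 0 < qs). { rewrite Hqs. bound. }
 assert (HnK : n * qs <= K).
 { destruct (Nat.eq_dec (length l) 0) as [E|E]. unfold n. rewrite E. simpl. lra.
  assert (Q : (n - 1) * qs <= K - qs).
  { apply (spaced_count (length l) (map k l)); auto. apply length_map. apply spaced_inj; auto. lia.
   intros x Hin. apply in_map_iff in Hin. destruct Hin as [r [<- Hr]]. split. apply Hlow; auto. apply Hk; auto. } lra. }
 assert (Iqs : / qs = 4 * K * R0 * Th ^ 2 / U). { rewrite Hqs. bound. }
 (* Denominators up to [K] that are spaced by [qs] and start there: their number is at most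
    [K / qs]. *)
 assert (Hn4 : n <= 4 * R0 ^ 2 * Th ^ 2).
 { replace (4 * R0 ^ 2 * Th ^ 2) with (K * / qs). 2: { rewrite Iqs. lhs (4 * (K * K) * R0 * Th ^ 2 / U). rewrite HKK. bound. }
  apply Rmult_le_reg_r with qs; auto. rewrite Rmult_assoc, Rinv_l by lra. lra. }
 set (sR := sqrt R0). assert (HsR : 1 <= sR) by bound. assert (HsRR : sR * sR = R0) by bound.
 set (T := / (U * sR)). assert (HT : 0 < T) by bound.
 assert (Hny : n * y0 <= 4 * c0 * T).
 { trans_l (4 * R0 ^ 2 * Th ^ 2 * y0).
  lhs (4 * c0 * (R0 ^ 2 * Th ^ 2 * / M)).
  mul_l. apply Rmult_le_reg_r with (U * sR * M). bound.
  lhs (U * R0 ^ 2 * sR * Th ^ 2). rhs M.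
  trans_r X. unfold X. assert (sR <= R0) by (rewrite <- HsRR; rewrite <- (Rmult_1_r sR) at 1; apply Rmult_le_compat_l; lra).
  assert (R0 ^ 2 * sR <= R0 ^ 4). { rhs (R0 ^ 2 * (R0 * R0)). mul_l. rewrite <- (Rmult_1_l sR). bound. }
  lhs (U * (R0 ^ 2 * sR) * Th ^ 2).
  apply Rmult_le_compat; try lra. bound. bound. rhs (Th ^ 2 * Th ^ 2). bound. }
 (* innermost parts, where the direct estimate applies *)
 set (ssM := sqrt sM). assert (HssM : ssM * ssM = sM) by bound.
 assert (In1 : forall r, In r l -> Rabs (It r (fu1 r) (sp r J)) <= C1 * CL * Lg * (/ (sM * ssM) * / sqrt (k r) + 2 * y0)).
 { intros r Hr. destruct (Hok r Hr) as [Hdet [Hkz [H0 [H1 [H2 _]]]]]. destruct (Hk r Hr) as [K1 K2].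
  apply (Phi_int y0 m phi (IZR (fh r) / k r) sg (fu1 r) (sp r J)); [exact Hy0|apply Hsp_in; exact Hr|].
  intros y Hy. destruct (Rle_dec (fu1 r) (/ (k r * V))) as [Hc|Hc].
  2: { assert (E : sp r J = fu1 r). { apply Rmax_left. le_by Rmin_r. fold V. lra. }
   rewrite E. unfold Uint. rewrite RInt_point. change (@zero RV) with 0. rewrite Rabs_R0. bound. }
  assert (sp r J <= / (k r * V)). { apply Rmax_lub; auto. apply Rmin_r. }
  eapply Rle_trans. apply (HN (fh r) (fk r) (fa r) (fb r) y m _ sg (/ (k r * V)) (fu1 r) (sp r J)); auto; try lia; try lra. apply Hsp_in; auto.
  { fold (k r). lhs (/ V). bound. }
  fold (k r). pose proof (Ly_bound c0 M y Hc0 HM ltac:(fold y0; lra)) as HLy. pose proof (Ly_ge y ltac:(lra)).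
  apply Rle_trans with (C1 * (/ (sM * ssM) * / sqrt (k r) + 2 * y0) * (CL * Lg)); [|right; ring].
  assert (k r * (/ (k r * V) * sqrt (/ (k r * V))) <= / (sM * ssM) * / sqrt (k r)).
  { rewrite sqrt_inv, sqrt_mult by lra.
   lhs (/ (V * sqrt V) * / sqrt (k r)).
   bound. }
  bound. }
 assert (Rabs (lsum (fun r => It r (fu1 r) (sp r J)) l) <= C1 * CL * Lg * ((2 + 8 * c0) * T)).
 { eapply Rle_trans. apply lsum_abs. eapply Rle_trans. apply lsum_le. apply In1.
  rewrite lsum_mul. mul_l.
  rewrite lsum_add, lsum_mul, lsum_const. fold n.
  assert (lsum (fun r => / sqrt (k r)) l <= 2 * (sqrt n / sqrt qs)).
  { rewrite <- (lsum_map k (fun x => / sqrt x)). apply (spaced_sum_sqrt (length l) (map k l) qs); auto. apply length_map. apply spaced_inj; auto.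
   intros x Hin. apply in_map_iff in Hin. destruct Hin as [r [<- Hr]]. apply Hlow; auto. }
  assert (/ (sM * ssM) * (sqrt n / sqrt qs) <= T).
  { assert (0 < sM * ssM) by bound.
   apply Rmult_le_reg_l with (sM * ssM); auto. rewrite <- Rmult_assoc, Rinv_r, Rmult_1_l by lra.
   rewrite <- sqrt_div by lra. rewrite <- (sqrt_square (sM * ssM * T)) by (apply Rmult_le_pos; lra). apply sqrt_le_1_alt.
   replace (sM * ssM * T * (sM * ssM * T)) with (M * sM * (T * T)). 2: { rewrite <- HsM. rhs (sM * sM * (ssM * ssM) * (T * T)). rewrite HssM. ring. }
   assert (ET : T * T = / (U ^ 2 * R0)). { unfold T. rewrite <- HsRR. bound. } rewrite ET.
   apply Rle_trans with (4 * R0 ^ 2 * Th ^ 2 * / qs). unfold Rdiv. bound.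
   rewrite Iqs. apply Rmult_le_reg_r with (U ^ 2 * R0). bound.
   rewrite (Rmult_assoc (M * sM)), Rinv_l, Rmult_1_r by (apply Rgt_not_eq, Rmult_lt_0_compat; [apply pow_lt|]; lra).
   lhs (16 * X * K).
   bound. }
  assert (/ (sM * ssM) * lsum (fun r => / sqrt (k r)) l <= / (sM * ssM) * (2 * (sqrt n / sqrt qs))) by bound.
  lra. }
 (* dyadic classes, where the pair method applies *)
 set (mk := fun j r => Farc (fh r) (fk r) (fa r) (fb r) (sp r (S j)) (sp r j)).
 set (p := fun i j r => if Rle_dec (2 ^ i) (k r) then if Rlt_dec (k r) (2 * 2 ^ i) then if Rlt_dec (sp r (S j)) (sp r j) then true else false else false else false).
 assert (forall i j r, p i j r = true -> 2 ^ i <= k r < 2 * 2 ^ i /\ sp r (S j) < sp r j).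
 { intros i j r. unfold p. destruct Rle_dec; [|discriminate]. destruct Rlt_dec; [|discriminate]. destruct Rlt_dec; [|discriminate]. auto. }
 assert (Cls : forall i j, (j < J)%nat -> Rabs (lsum (fun r => It r (sp r (S j)) (sp r j)) (filter (p i j) l)) <= C2 * ((10 ^ 5 + 4 * c0) * Lg * T)).
 { intros i j Hj. set (l' := filter (p i j) l).
  assert (Hl' : forall r, In r l' -> In r l /\ 2 ^ i <= k r < 2 * 2 ^ i /\ sp r (S j) < sp r j). { intros r Hr. apply filter_In in Hr. destruct Hr. split; auto. }
  assert ((length l' <= length l)%nat) by apply filter_length_le.
  destruct (Nat.eq_dec (length l') 0) as [E0|E0].
  { apply length_zero_iff_nil in E0. rewrite E0. cbn [lsum]. rewrite Rabs_R0. bound. }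
  assert (exists r0, In r0 l') as [r0 Hr0]. { destruct l' as [|r0 ?]. simpl in E0; lia. exists r0. left; auto. }
  destruct (Hl' r0 Hr0) as [Hr0l [Hr0k _]]. pose proof (Hk r0 Hr0l) as [Hr01 Hr02].
  assert (U <= K * K). { rewrite HKK. bound. }
  set (L := 2 ^ j * K) in *. set (ka := 2 ^ i) in *. assert (Hka : 1 <= ka) by bound.
  assert (HLK : K <= L) by bound.
  assert (2 * L <= V). { unfold L, V. replace (2 * (2 ^ j * K)) with (2 ^ S j * K) by (simpl; ring). mul_r. apply Rle_pow. lra. lia. }
  assert (Bnd : forall r, In r l' -> / (k r * (2 * L)) <= sp r (S j) /\ sp r j <= / (k r * L)).
  { intros r Hr. destruct (Hl' r Hr) as [Hrl [_ Hlt]]. revert Hlt. unfold sp. replace (2 ^ S j * K) with (2 * L) by (unfold L; simpl; ring). fold L.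
   unfold clamp, Rmax, Rmin. repeat destruct Rle_dec; intros; lra. }
  destruct (nfloor_ex (L / ka + 1)) as [N0 [HN1 HN2]]. { bound. }
  assert (HNok : exists N, L / ka + 1 <= INR N /\ INR N <= L / ka + 2). { exists (S N0). rewrite S_INR. lra. }
  destruct HNok as [N [HNa HNb]].
  destruct (farc_count Kz K U c d sg ka l') as [Cn1 Cn2]; try assumption; try lra; try lia.
  { apply NoDup_filter; auto. }
  { intros r Hr. destruct (Hl' r Hr) as [Hrl [Hrk _]]. split. apply Hok; auto. fold (k r). lra. }
  { intros r r' Hr Hr' Hne. apply Hx; auto; apply Hl'; auto. }
  set (Z := 10 ^ 9 * (L ^ 4 / (U ^ 2 * R0)) * Lg).
  assert (0 < Z) by bound.
  assert (HlenS : lsum (fun r => sp r j - sp r (S j)) l' <= / U).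
  { apply Rle_trans with (lsum (fun r => fu2 r - fu1 r) l); auto. unfold l'. rewrite lsum_filter. apply lsum_le. intros r Hr.
   destruct (Hsp_in r j Hr). destruct (Hsp_in r (S j) Hr). destruct (p i j r). lra. lra. }
  pose proof (class_arith (length l') N U R0 Th M m K L ka qs (lsum (fun r => sp r j - sp r (S j)) l') HR HTh HU ltac:(lra) HKK HLK ltac:(assert (sM <= M) by (rewrite <- HsM; rewrite <- (Rmult_1_r sM) at 1; apply Rmult_le_compat_l; lra); lra) Hka ltac:(lra) Hqs ltac:(lia)
   ltac:(specialize (Hlow r0 Hr0l); fold (k r0) in Hlow; lra) Cn1 Cn2 HNa HNb HlenS ltac:(fold X; lra) Hm HM) as CA.
  pose proof (HCl y0 m phi sg L ka N qs Z (map (mk j) l') Hy0 ltac:(lra) ltac:(lra) ltac:(lra) Hsg) as CQ.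
  rewrite !lsum_map, length_map in CQ.
  assert (QQ : Rabs (lsum (fun r => It r (sp r (S j)) (sp r j)) l') <= C2 * (sqrt Z / L ^ 2 + INR (length l') * y0)).
  { apply CQ; auto.
   - apply FinFun.Injective_map_NoDup_in; [|apply NoDup_filter; auto]. intros r r' Hr Hr' E. destruct (Classical_Prop.classic (r = r')) as [|Hne]; auto. exfalso.
    apply (Hx r r'); auto; try apply Hl'; auto. injection E. intros. congruence.
   - intros r Hr. apply in_map_iff in Hr. destruct Hr as [r1 [<- Hr1]]. destruct (Hl' r1 Hr1) as [Hrl [Hrk Hlt]]. destruct (Bnd r1 Hr1) as [B1 B2].
    destruct (Hok r1 Hrl) as [Hdet [Hkz _]]. destruct (Hk r1 Hrl) as [K1 K2].
    assert (0 < k r1 * (2 * L)) by bound.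
    assert (0 < / (k r1 * (2 * L))) by bound.
    split; [|cbn [mk fu1]].
    + unfold class_ok. cbn [mk fh fk fa fb fu1 fu2]. fold (k r1). split; auto. split. lia. split. lra. split. lra. split. lra. split.
     * lhs (2 * L * (k r1 * / (k r1 * (2 * L)))). mul_l. apply Rmult_le_compat_l; lra.
     * rhs (L * (k r1 * / (k r1 * L))). mul_l. apply Rmult_le_compat_l; lra.
    + apply Rle_trans with (/ (k r1 * (2 * L))); auto. apply Rmult_le_reg_r with (k r1 * (2 * L)); auto. rewrite Rinv_l by lra.
     apply Rmult_le_reg_r with M. lra. lhs (32 * c0 * (k r1 * (2 * L))). rewrite Rmult_1_l, <- HsM.
     assert (64 * c0 * K <= sM).
     { rewrite <- (sqrt_square (64 * c0 * K)) by (apply Rmult_le_pos; lra). apply sqrt_le_1_alt. lhs (4096 * c0 ^ 2 * (K * K)).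
      apply Rle_trans with (CC * X); auto. bound. }
     trans_l (32 * c0 * (K * (2 * sM))). lhs (64 * c0 * K * sM). apply Rmult_le_compat_r; lra.
   - intros r r' Hr Hr' Hne. apply in_map_iff in Hr. apply in_map_iff in Hr'. destruct Hr as [r1 [<- Hr1]]. destruct Hr' as [r2 [<- Hr2]].
    cbn [mk fk]. apply Hsp; try apply Hl'; auto. intros ->. auto. }
  le_by QQ. mul_l.
  assert (sqrt Z / L ^ 2 <= 10 ^ 5 * Lg * T).
  { assert (0 < L ^ 2) by bound. apply Rmult_le_reg_r with (L ^ 2); auto. unfold Rdiv. rewrite Rmult_assoc, Rinv_l, Rmult_1_r by lra.
   rewrite <- (sqrt_square (10 ^ 5 * Lg * T * L ^ 2)) by (apply Rmult_le_pos; [apply Rmult_le_pos; [apply Rmult_le_pos|]|]; lra). apply sqrt_le_1_alt.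
   assert (ET : T * T = / (U ^ 2 * R0)). { unfold T. rewrite <- HsRR. bound. }
   rhs (10 ^ 10 * Lg * Lg * (T * T) * L ^ 4).
   unfold Z. lhs (10 ^ 9 * Lg * 1 * / (U ^ 2 * R0) * L ^ 4).
   bound. }
  assert (INR (length l') * y0 <= n * y0) by bound.
  assert (4 * c0 * T <= 4 * c0 * Lg * T) by bound.
  lra. }
 assert (Eq : lsum (fun r => It r (fu1 r) (fu2 r)) l = lsum (fun r => It r (fu1 r) (sp r J)) l +
  rsum (fun j => rsum (fun i => lsum (fun r => It r (sp r (S j)) (sp r j)) (filter (p i j) l)) I) J).
 { rewrite (lsum_ext _ (fun r => It r (fu1 r) (sp r J) + rsum (fun j => It r (sp r (S j)) (sp r j)) J)) by (intros; apply Spl; auto).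
  rewrite lsum_add. f_equal. rewrite rsum_lsum. rewrite (lsum_ext _ (fun r => lsum (fun j => It r (sp r (S j)) (sp r j)) (seq 0 J))) by (intros; apply rsum_lsum).
  rewrite lsum_swap. apply lsum_ext. intros j _. rewrite rsum_lsum.
  rewrite (lsum_ext (fun i => lsum (fun r => It r (sp r (S j)) (sp r j)) (filter (p i j) l)) (fun i => lsum (fun r => if p i j r then It r (sp r (S j)) (sp r j) else 0) l)) by (intros; apply lsum_filter).
  rewrite lsum_swap. apply lsum_ext. intros r Hr. rewrite <- rsum_lsum. destruct (Hk r Hr) as [K1 K2].
  rewrite <- (dyadic_indicator I (k r) (It r (sp r (S j)) (sp r j))) at 1 by lra. apply rsum_ext. intros i _. unfold p.
  destruct Rle_dec; auto. destruct Rlt_dec; auto. destruct Rlt_dec as [|Hd]; auto.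
  replace (sp r (S j)) with (sp r j) by (pose proof (Hspm r j Hr); lra). unfold It. rewrite RInt_point. reflexivity. }
 change (Rabs (lsum (fun r => It r (fu1 r) (fu2 r)) l) <= CC * Lg ^ 3 / (U * sR)). rewrite Eq.
 le_by Rabs_triang.
 assert (Rabs (rsum (fun j => rsum (fun i => lsum (fun r => It r (sp r (S j)) (sp r j)) (filter (p i j) l)) I) J) <= Lg * (3 * Lg * (C2 * ((10 ^ 5 + 4 * c0) * Lg * T)))).
 { set (D := C2 * ((10 ^ 5 + 4 * c0) * Lg * T)) in *. assert (0 <= D) by bound.
  le_by rsum_abs. eapply Rle_trans. apply (rsum_le _ (fun _ => 3 * Lg * D)).
  - intros j Hj. le_by rsum_abs. eapply Rle_trans. apply (rsum_le _ (fun _ => D)). intros i _. apply Cls; auto. rewrite rsum_const. apply Rmult_le_compat_r; auto.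
  - rewrite rsum_const. bound. }
 rhs (CC * Lg ^ 3 * T).
 apply Rle_trans with (Cf * Lg ^ 3 * T).
 2: { bound. }
 assert (Lg <= Lg ^ 3). { rhs (Lg * (Lg * Lg)). bound. }
 assert (C1 * CL * Lg * ((2 + 8 * c0) * T) <= C1 * CL * (2 + 8 * c0) * Lg ^ 3 * T).
 { lhs (C1 * CL * (2 + 8 * c0) * Lg * T). bound. }
 bound.
Qed.

(** * The key bound *)

(** Cancelling the gcd only improves the approximation, and Bezout's identity supplies the other row
    of the matrix. *)
Lemma reduce_frac (q p : Z) x : (1 <= q)%Z -> exists k h a b : Z, (1 <= k <= q)%Z /\ (- a * h - b * k = 1)%Z /\ Rabs (IZR k * x - IZR h) <= Rabs (IZR q * x - IZR p).
Proof.
 intros Hq. set (g := Z.gcd q p). assert ((1 <= g)%Z). { pose proof (Z.gcd_nonneg q p). assert (g <> 0)%Z. { unfold g. intros E. apply Z.gcd_eq_0 in E. lia. } bound. }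
 destruct (Z.gcd_divide_l q p) as [k Ek]. destruct (Z.gcd_divide_r q p) as [h Eh]. fold g in Ek, Eh.
 destruct (Z.gcd_bezout q p g eq_refl) as [u [v E]].
 exists k, h, (- v)%Z, (- u)%Z. split. nia. split. nia.
 assert (1 <= IZR g) by bound.
 rewrite Ek, Eh, !mult_IZR. replace (IZR k * IZR g * x - IZR h * IZR g) with ((IZR k * x - IZR h) * IZR g) by ring.
 rewrite Rabs_mult, (Rabs_right (IZR g)) by lra. bound.
Qed.

(** The alternative is whether some [q < qs] satisfies [|q c - p| <= 4 K / U]. Every fraction of the
    Farey dissection satisfies this even with [2 K / U]. If no such [q] exists, then neither a
    denominator nor the distance of two denominators lies below [qs]. *)
Lemma key_prop c0 : 0 < c0 -> exists C, 1 <= C /\ forall M U R0 Th A1 m phi c d,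
  1 <= M -> 1 <= R0 -> 1 <= Th -> 0 <= A1 -> C * R0 <= U -> C * U * R0 ^ 4 * Th ^ 4 <= M -> M <= m <= 4 * M -> c <= d -> d - c <= / U ->
  (forall n, (1 <= n)%Z -> IZR n <= C * R0 * M / U -> Cmod (t n) <= Th) ->
  (forall n, (1 <= n)%Z -> Cmod (t n) <= A1 * sqrt (sqrt (IZR n))) ->
  Rabs (RInt (Phi (c0 / M) m phi) c d) <= C * (1 + A1) * (1 + ln M) ^ 3 * (/ (U * sqrt R0) + / (sqrt M * sqrt (sqrt M))).
Proof.
 intros Hc0. destruct (near_lemma) as [C1 [HC1 HN]]. destruct (far_lemma) as [C2 [HC2 HF]].
 destruct (arcs_bound c0 Hc0) as [C3 [HC3 HA]].
 set (CL := 3 + ln (2 + / c0)).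
 assert (HCL : 3 <= CL). { unfold CL. assert (0 < / c0) by bound. assert (0 < ln (2 + / c0)) by (rewrite <- ln_1; apply ln_increasing; lra). lra. }
 set (CN := C1 * CL * (50 + 2 * c0)). assert (HCN : 0 <= CN) by bound.
 set (CF := C2 * (42 + 2 * c0)). assert (HCF : 0 <= CF) by bound.
 set (CC := 300 + 2 * c0 + 2 * C3 + 2 * CN + CF). exists CC. split. bound.
 intros M U R0 Th A1 m phi c d HM HR HTh HA1 HCU HCM Hm Hcd Hdc Hth H4.
 assert (HCC : 300 <= CC /\ 2 * c0 <= CC /\ C3 <= CC) by bound.
 assert (Hl0 : 0 <= ln M) by bound. set (Lg := 1 + ln M).
 assert (HU0 : 300 * R0 <= U). { apply Rle_trans with (CC * R0); auto. bound. } assert (T2 : 1 <= Th ^ 2) by bound.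
 set (X := U * R0 ^ 4 * Th ^ 4). assert (HX : CC * X <= M) by bound.
 assert (HX1 : X <= M). { apply Rle_trans with (CC * X); auto. bound. }
 assert (HX2 : 2 * c0 * X <= M). { apply Rle_trans with (CC * X); auto. bound. }
 assert (HX3 : C3 * X <= M). { apply Rle_trans with (CC * X); auto. bound. }
 assert (HURX : U * R0 <= X). { unfold X. rhs (U * R0 * (R0 ^ 3 * Th ^ 4)). bound. }
 assert (HUUR : U <= U * R0) by bound.
 assert (HUX : U * R0 ^ 2 * Th ^ 2 <= X).
 { unfold X. rhs (U * R0 ^ 2 * Th ^ 2 * (R0 ^ 2 * Th ^ 2)). bound. }
 set (K := sqrt (U * R0)). assert (HKK : K * K = U * R0) by (apply sqrt_sqrt; lra).
 assert (HK1 : 1 <= K) by bound.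
 assert (HKU : 4 * K < U). { unfold K. apply Rsqr_incrst_0; [|pose proof (sqrt_pos (U * R0)); lra|lra]. fold K. unfold Rsqr. lhs (16 * (K * K)). rewrite HKK.
  lhs (U * (16 * R0)). bound. }
 set (sM := sqrt M). assert (HsM1 : 1 <= sM) by bound.
 set (ssM := sqrt sM).
 set (sR := sqrt R0). assert (HsR : 1 <= sR) by bound. assert (HsRR : sR * sR = R0) by (apply sqrt_sqrt; lra).
 assert (HsRle : sR <= R0). { rewrite <- HsRR. bound. }
 assert (HUsR : 0 < U * sR) by bound.
 set (T := / (U * sR)). assert (HT : 0 < T) by bound.
 set (T3 := / (sM * ssM)). assert (HT3 : 0 < T3) by bound.
 (* Chosen so that [k <= qs] and [k eta <= 4 K / U] imply [k^2 eta <= / (R0 Th^2)], which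
    compensates the factor [Th] in the near-stationary part of [far_lemma]. *)
 set (qs := U / (4 * K * R0 * Th ^ 2)).
 set (y0 := c0 / M). assert (Hy0 : 0 < y0) by bound.
 assert (HyT : y0 <= c0 * T).
 { mul_l. apply Rinv_le_contravar; auto. apply Rle_trans with X; auto. apply Rle_trans with (U * R0); auto. bound. }
 assert (cPhi : forall x, continuous (Phi y0 m phi) x) by (intros; apply (Phi_cont); auto).
 assert (HLg3 : Lg <= Lg ^ 3). { rhs (Lg * (Lg * Lg)). bound. }
 set (Fin := CC * (1 + A1) * Lg ^ 3 * (T + T3)).
 assert (HFin : forall a, 0 <= a -> a <= CC -> a * Lg ^ 3 * (T + T3) * (1 + A1) <= Fin).
 { intros a Ha Hac. unfold Fin. lhs (a * ((1 + A1) * Lg ^ 3 * (T + T3))). rhs (CC * ((1 + A1) * Lg ^ 3 * (T + T3))).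
  bound. }
 assert (HFinT : forall a, 0 <= a -> a <= CC -> a * Lg * T <= Fin).
 { intros a Ha Hac. eapply Rle_trans; [|apply (HFin a Ha Hac)].
  trans_l (a * Lg ^ 3 * (T + T3)).
  bound. }
 destruct (Classical_Prop.classic (exists q p : Z, (1 <= q)%Z /\ IZR q < qs /\ Rabs (IZR q * c - IZR p) <= 4 * K / U)) as [[q [p [Hq [Hqq Hqp]]]]|Hno].
 - destruct (reduce_frac q p c Hq) as [k [h [a [b [Hk [Hdet Hkh]]]]]].
  assert (HkR : 1 <= IZR k) by bound. assert (Hkq : IZR k <= qs). { apply Rle_trans with (IZR q); [apply IZR_le; lia|lra]. }
  set (hk := IZR h / IZR k). set (e := c - hk).
  assert (Hke : IZR k * Rabs e <= 4 * K / U).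
  { rewrite <- (Rabs_right (IZR k)) at 1 by lra. rewrite <- Rabs_mult. replace (IZR k * e) with (IZR k * c - IZR h) by (unfold e, hk; field; lra). lra. }
  assert (HLyM : forall y, y0 <= y -> 3 <= Ly y <= CL * Lg). { intros y Hy. split. apply Ly_ge; lra. apply (Ly_bound c0 M y Hc0 HM Hy). }
  assert (HiU : 0 < / U) by bound.
  assert (HqsU : qs <= U / (4 * K * R0)) by bound.
  destruct (Rle_dec (Rabs e) (32 / U)) as [Hnear|Hfar].
  + (* [h/k] is within [O(1/U)] of the interval *)
   set (v := 33 / U).
   set (sU := sqrt U). assert (HsU : sU * sU = U) by (apply sqrt_sqrt; lra). assert (HsU1 : 17 <= sU). { lhs (sqrt (17 * 17)). bound. }
   assert (HKs : K = sU * sR) by (unfold K, sU, sR; apply sqrt_mult; lra).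
   assert (Hkv : IZR k * v <= 1).
   { trans_l (U / (4 * K * R0) * v).
    unfold v. lhs (33 * / (4 * K * R0)).
    apply Rmult_le_reg_r with (4 * K * R0). bound. rewrite Rmult_assoc, Rinv_l, Rmult_1_l, Rmult_1_r by (apply Rgt_not_eq; repeat apply Rmult_lt_0_compat; lra).
    assert (17 * 1 <= K * R0). { apply Rmult_le_compat; try lra. rewrite HKs. rewrite <- (Rmult_1_r 17). bound. } lra. }
   assert (Nr : forall sg u1 u2, sg = 1 \/ sg = -1 -> 0 <= u1 -> u1 <= u2 -> u2 <= v -> Rabs (RInt (fun u => Phi y0 m phi (hk + sg * u)) u1 u2) <= CN * Lg * T).
   { intros sg u1 u2 Hsg H0 H12 H2. apply (Phi_int y0 m phi hk sg u1 u2); auto. intros y Hy.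
    le_by (HN h k a b y m (2 * PI * m * hk + phi) sg v u1 u2 Hdet ltac:(lia) ltac:(lra) Hsg H0 H12 H2 Hkv).
    destruct (HLyM y ltac:(lra)) as [Hly1 Hly2].
    assert (Hv0 : 0 <= v) by lra.
    assert (Hkvv : IZR k * (v * sqrt v) <= 50 * T).
    { apply Rle_trans with (U / (4 * K * R0) * (v * (6 / sU))).
     - apply Rmult_le_compat; try lra. bound. mul_l. unfold v. rewrite sqrt_div by lra. fold sU. mul_r.
      rhs (sqrt (6 * 6)). apply sqrt_le_1_alt; lra.
     - unfold v, T. rewrite HKs. lhs (99 / 2 * / (sU * sU * sR * R0)). rewrite HsU.
      bound. }
    unfold CN. rhs (C1 * (50 * T + 2 * (c0 * T)) * (CL * Lg)).
    bound. }
   (* The fraction may lie inside the interval, which is then cut there; otherwise [z] is an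
      endpoint and one of the two parts is empty. *)
   set (z := clamp c d hk). pose proof (clamp_in c d hk Hcd) as Hz. fold z in Hz.
   rewrite (RInt_split _ c z d) by (auto; intros; apply cPhi). apply Rabs_le_between in Hnear.
   assert (Evv : 32 / U + / U = v) by bound.
   assert (Zero : forall x, Rabs (RInt (Phi y0 m phi) x x) <= CN * Lg * T). { intros x. rewrite RInt_point. change (@zero RV) with 0. rewrite Rabs_R0. bound. }
   assert (I1 : Rabs (RInt (Phi y0 m phi) c z) <= CN * Lg * T).
   { destruct (Rle_dec z hk) as [Hzh|Hzh].
    - replace c with (hk - (hk - c)) by ring. replace z with (hk - (hk - z)) by ring. rewrite RInt_reflect by auto. apply Nr; auto; try lra. unfold e in Hnear. lra.
    - replace z with c. apply Zero. unfold z, clamp, Rmax, Rmin in *. repeat destruct Rle_dec; lra. }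
   assert (I2 : Rabs (RInt (Phi y0 m phi) z d) <= CN * Lg * T).
   { destruct (Rle_dec hk z) as [Hzh|Hzh].
    - replace z with (hk + (z - hk)) by ring. replace d with (hk + (d - hk)) by ring. rewrite RInt_shift by auto. apply Nr; auto; try lra. unfold e in Hnear. lra.
    - replace z with d. apply Zero. unfold z, clamp, Rmax, Rmin in *. repeat destruct Rle_dec; lra. }
   le_by Rabs_triang. eapply Rle_trans; [|apply (HFinT (2 * CN)); unfold CC; lra]. lra.
  + (* [h/k] is farther away *)
   apply Rnot_le_lt in Hfar.
   assert (Fr : forall sg eta u1 u2, sg = 1 \/ sg = -1 -> 31 * / U <= eta -> IZR k * eta <= 4 * K / U -> eta <= u1 -> u1 <= u2 -> u2 <= eta + / U ->
    Rabs (RInt (fun u => Phi y0 m phi (hk + sg * u)) u1 u2) <= CF * (1 + A1) * Lg * (T + T3)).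
   { intros sg eta u1 u2 Hsg He1 He2 H1 H12 H2. apply (Phi_int y0 m phi hk sg u1 u2); auto. intros y Hy.
    assert (Hke2 : IZR k ^ 2 * eta ^ 2 * m <= 64 * (R0 * M / U)).
    { lhs ((IZR k * eta) ^ 2 * m).
     trans_l ((4 * K / U) ^ 2 * (4 * M)).
     lhs (64 * ((K * K) * M / U ^ 2)). rewrite HKK. bound. }
    assert (HRMU : 1 <= R0 * M / U) by bound.
    assert (HRMM : R0 * M / U <= M). { apply Rmult_le_reg_r with U. lra. unfold Rdiv. rewrite Rmult_assoc, Rinv_l, Rmult_1_r by lra. rewrite Rmult_comm. bound. }
    assert (Hn0 : 0 <= IZR k ^ 2 * eta ^ 2 * m) by bound.
    eapply Rle_trans. apply (HF h k a b y m (2 * PI * m * hk + phi) sg eta (/ U) u1 u2 Th A1 Hdet ltac:(lia) ltac:(lra) ltac:(lra)); auto; try lra.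
    { trans_l (16 * (2 * y0)). apply Rle_trans with (31 * / U); auto.
     assert (y0 * 2 <= / U). { unfold y0. apply Rmult_le_reg_r with (U * M). bound. lhs (2 * c0 * U). rhs M.
      apply Rle_trans with (2 * c0 * X); auto. bound. } lra. }
    { intros n Hn Hn4. apply Hth; auto. le_by Hn4. rhs (CC * (R0 * M / U)).
     trans_l (300 * (R0 * M / U)). bound. }
    unfold CF. rhs (C2 * ((42 + 2 * c0) * (1 + A1) * Lg * (T + T3))). mul_l.
    assert (F1 : Th * / U * IZR k * sqrt eta <= T).
    { lhs (/ U * (Th * (IZR k * sqrt eta))). unfold T. rewrite Rinv_mult. mul_l.
     assert (IZR k * sqrt eta <= sqrt (/ (R0 * Th ^ 2))).
     { rewrite <- (sqrt_square (IZR k)) by lra. rewrite <- sqrt_mult; [|apply Rmult_le_pos; lra|lra]. apply sqrt_le_1_alt.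
      apply Rle_trans with (qs * (4 * K / U)). rewrite Rmult_assoc. bound. bound. }
     rewrite sqrt_inv, sqrt_mult in H by lra. replace (Th ^ 2) with (Th * Th) in H by ring. rewrite sqrt_square in H by lra.
     trans_l (Th * / (sR * Th)). bound. }
    assert (F2 : A1 / (sqrt m * sqrt (sqrt m)) <= A1 * T3).
    { mul_l. unfold T3. assert (sM <= sqrt m) by bound. bound. }
    assert (F3 : Th * (1 + ln (4 * (IZR k ^ 2 * eta ^ 2 * m) + 6)) * (IZR k * eta / sqrt m) <= 40 * Lg * T).
    { assert (Hlog : 0 <= 1 + ln (4 * (IZR k ^ 2 * eta ^ 2 * m) + 6) <= 10 * Lg).
     { split. bound.
      assert (ln (4 * (IZR k ^ 2 * eta ^ 2 * m) + 6) <= ln (300 * M)) by bound. rewrite ln_mult in H by lra.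
      assert (ln 300 <= 9). { rewrite <- (ln_exp 9). apply ln_le. lra. pose proof (exp_ineq1_le 1) as E1.
       trans_l (2 ^ 9). replace (exp 9) with (exp 1 ^ 9). bound. rewrite <- exp_pow_nat. f_equal. simpl; ring. }
      bound. }
     assert (Hsm : sM <= sqrt m) by bound.
     apply Rle_trans with (Th * (10 * Lg) * ((4 * K / U) * / sM)).
     - apply Rmult_le_compat. bound. bound. bound.
      apply Rmult_le_compat; try lra. bound. bound. apply Rinv_le_contravar; lra.
     - lhs (40 * Lg * (Th * K / (U * sM))). mul_l.
      unfold T. lhs ((Th * K * sR) * / (U * sR * sM)). rhs (sM * / (U * sR * sM)).
      mul_r.
      rewrite <- (sqrt_square (Th * K * sR)) by (repeat apply Rmult_le_pos; lra). apply sqrt_le_1_alt.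
      lhs (Th ^ 2 * (K * K) * (sR * sR)). rewrite HKK, HsRR. bound. }
    set (W := Lg * (T + T3)).
    assert (W1 : Lg * T <= W) by bound. assert (W2 : T3 <= W). { unfold W. rewrite <- (Rmult_1_l T3). bound. }
    assert (W3 : T <= W). { unfold W. rewrite <- (Rmult_1_l T) at 1. bound. }
    assert (A1 * T3 <= A1 * W) by bound. assert (2 * c0 * T <= 2 * c0 * W) by bound.
    rhs (42 * W + 2 * c0 * W + 42 * (A1 * W) + 2 * (c0 * A1 * W)).
    assert (0 <= A1 * W) by bound. assert (0 <= c0 * A1 * W) by bound. lra. }
   assert (HCFin : CF * (1 + A1) * Lg * (T + T3) <= Fin).
   { eapply Rle_trans; [|apply (HFin CF); [auto|unfold CC; lra]]. lhs (CF * (1 + A1) * (T + T3) * Lg). rhs (CF * (1 + A1) * (T + T3) * Lg ^ 3).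
    bound. }
   eapply Rle_trans; [|apply HCFin].
   destruct (Rle_dec 0 e) as [Hpos|Hneg].
   * rewrite Rabs_right in Hfar, Hke by lra. replace c with (hk + e) by bound. replace d with (hk + (d - hk)) by ring. rewrite RInt_shift by auto.
    apply (Fr 1 e); auto; unfold e in *; lra.
   * apply Rnot_le_lt in Hneg. rewrite Rabs_left in Hfar, Hke by lra. replace c with (hk - (hk - c)) by ring. replace d with (hk - (hk - d)) by ring. rewrite RInt_reflect by auto.
    (* The interval lies to the left of the fraction and its distances run up to [hk - c], so the
       reference distance is taken [/ U] below that. *)
    apply (Fr (-1) (hk - c - / U)); auto; unfold e in *; try lra.
    eapply Rle_trans; [|apply Hke]. apply Rmult_le_compat_l; lra.
 - set (Kz := Int_part K). pose proof (base_Int_part K) as [Kz1 Kz2]. fold Kz in Kz1, Kz2.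
  assert (HKz : (1 <= Kz)%Z). { assert (0 < Kz)%Z; [|lia]. apply lt_IZR. lra. }
  assert (HiU1 : / U <= 1) by bound.
  destruct (dissection Kz (Phi y0 m phi) c d HKz Hcd ltac:(lra) cPhi) as [lr [ll [Ok1 [Ok2 [N1 [N2 [X1 [X2 [L1 [L2 E]]]]]]]]]].
  (* The arc meets [[c, d]], so [|k c - h|] is at most [k / U] plus [k u <= / K], and both are at
     most [K / U]. *)
  assert (App : forall sg r, sg = 1 \/ sg = -1 -> farc_ok Kz c d sg r -> (1 <= fk r)%Z /\ Rabs (IZR (fk r) * c - IZR (fh r)) <= 2 * K / U).
  { intros sg r Hsg [_ [Hk [H0 [H1 [H2 [H3 _]]]]]]. split. lia.
   assert (HkR : 1 <= IZR (fk r)) by bound. assert (HkK : IZR (fk r) <= K) by (apply Rle_trans with (IZR Kz); auto; apply IZR_le; lia).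
   set (k := IZR (fk r)) in *. set (h := IZR (fh r)) in *.
   assert (Hu : k * fu1 r <= / K). { apply Rmult_le_reg_r with K. lra. rewrite Rinv_l by lra. eapply Rle_trans; [|apply H2]. lhs (k * K * fu1 r). bound. }
   assert (HiK : / K <= K / U). { apply Rmult_le_reg_r with (K * U). bound. lhs U. rhs (K * K). lra. }
   assert (HkU : k * / U <= K / U). { unfold Rdiv. bound. }
   replace (k * c - h) with (k * (c - (h / k + sg * fu1 r)) + sg * (k * fu1 r)) by bound.
   le_by Rabs_triang. rewrite !Rabs_mult. rewrite (Rabs_right k) by lra. rewrite (Rabs_right (fu1 r)) by lra.
   assert (Esg : Rabs sg = 1) by (destruct Hsg as [->| ->]; unfold Rabs; destruct Rcase_abs; lra). rewrite Esg.
   assert (Rabs (c - (h / k + sg * fu1 r)) <= / U) by (apply Rabs_le; lra).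
   assert (k * Rabs (c - (h / k + sg * fu1 r)) <= k * / U) by bound.
   bound. }
  assert (HKU4 : 4 * K / U < 1) by bound.
  assert (E24 : 2 * K / U <= 4 * K / U) by bound.
  assert (Side : forall sg l, sg = 1 \/ sg = -1 -> (forall r, In r l -> farc_ok Kz c d sg r) -> NoDup l -> (forall r r', In r l -> In r' l -> r <> r' -> (fh r * fk r' <> fh r' * fk r)%Z) ->
   lsum (fun r => fu2 r - fu1 r) l <= d - c ->
   Rabs (lsum (fun r => RInt (fun u => Phi y0 m phi (IZR (fh r) / IZR (fk r) + sg * u)) (fu1 r) (fu2 r)) l) <= C3 * Lg ^ 3 * T).
  { intros sg l Hsg Hok Hnd Hx Hlen.
   apply (HA M U R0 Th m phi sg c d qs Kz l); auto; try lra.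
   - apply Rle_trans with (CC * R0); auto. apply Rmult_le_compat_r; lra.
   - fold X. lhs (C3 * X). auto.
   - intros r Hr. destruct (App sg r Hsg (Hok r Hr)) as [Hk Hap]. apply Rnot_lt_le. intros Hlt. apply Hno. exists (fk r), (fh r). repeat split; auto. lra.
   - intros r r' Hr Hr' Hne. destruct (App sg r Hsg (Hok r Hr)) as [Hk Hap]. destruct (App sg r' Hsg (Hok r' Hr')) as [Hk' Hap']. specialize (Hx r r' Hr Hr' Hne).
    assert (Dif : Rabs ((IZR (fk r) - IZR (fk r')) * c - (IZR (fh r) - IZR (fh r'))) <= 4 * K / U).
    { replace ((IZR (fk r) - IZR (fk r')) * c - (IZR (fh r) - IZR (fh r'))) with ((IZR (fk r) * c - IZR (fh r)) + - (IZR (fk r') * c - IZR (fh r'))) by ring.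
     le_by Rabs_triang. rewrite Rabs_Ropp. bound. }
    apply Rnot_lt_le. intros Hlt. destruct (Z.eq_dec (fk r) (fk r')) as [Ek|Ek].
    (* Equal denominators would put two distinct numerators at distance at most [4 K / U < 1]. *)
    + assert (Hh : (fh r - fh r' <> 0)%Z) by bound.
     rewrite Ek, Rminus_diag, Rmult_0_l in Dif. rewrite <- minus_IZR in Dif. rewrite Rminus_0_l, Rabs_Ropp, <- abs_IZR in Dif.
     assert (1 <= IZR (Z.abs (fh r - fh r'))) by bound. lra.
    + destruct (Z_lt_le_dec (fk r') (fk r)).
     * apply Hno. exists (fk r - fk r')%Z, (fh r - fh r')%Z. split. lia. rewrite !minus_IZR. split; auto. eapply Rle_lt_trans; [|apply Hlt]. apply Rle_abs.
     * apply Hno. exists (fk r' - fk r)%Z, (fh r' - fh r)%Z. split. lia. rewrite !minus_IZR. split. eapply Rle_lt_trans; [|apply Hlt]. rewrite Rabs_minus_sym. apply Rle_abs.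
      rewrite <- Rabs_Ropp. replace (- ((IZR (fk r') - IZR (fk r)) * c - (IZR (fh r') - IZR (fh r)))) with ((IZR (fk r) - IZR (fk r')) * c - (IZR (fh r) - IZR (fh r'))) by ring. auto. }
  rewrite E. le_by Rabs_triang.
  pose proof (Side 1 lr (or_introl eq_refl) Ok1 N1 X1 L1) as S1. pose proof (Side (-1) ll (or_intror eq_refl) Ok2 N2 X2 L2) as S2.
  eapply Rle_trans. apply Rplus_le_compat; eassumption.
  eapply Rle_trans; [|apply (HFin (2 * C3)); [lra|unfold CC; lra]].
  apply Rle_trans with (2 * C3 * Lg ^ 3 * (T + T3)). trans_l (2 * C3 * Lg ^ 3 * T). bound.
  bound.
Qed.

Ltac ringR := match goal with |- ?a = ?b => change (@eq R a b) end; ring.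

(** * Recovering the coefficients from the average *)

Lemma rsum_single (f : nat -> R) k0 N : (k0 < N)%nat -> (forall k, (k < N)%nat -> k <> k0 -> f k = 0) -> rsum f N = f k0.
Proof.
 induction N as [|N IH]; intros Hk H. lia. cbn [rsum]. destruct (Nat.eq_dec k0 N) as [->|Hne].
 - rewrite (rsum_ext f (fun _ => 0)) by (intros; apply H; lia). rewrite rsum_const. ring.
 - rewrite IH, (H N) by (try lia; intros; apply H; lia). ring.
Qed.

Lemma int_cos_centered j phi : j <> 0%Z -> RInt (fun x => cos (2 * PI * (IZR j * x) + phi)) (- (1 / 2)) (1 / 2) = 0.
Proof.
 intros Hj. set (f := fun x => cos (2 * PI * (IZR j * x) + phi)).
 replace (- (1 / 2)) with (1 * 0 + - (1 / 2)) by ring. replace (1 / 2) with (1 * 1 + - (1 / 2)) at 2 by field.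
 rewrite <- (RInt_comp_lin (V := RV) f 1 (- (1 / 2))). 2: { apply (ex_RInt_continuous (V := RV)). intros; unfold f; cont. }
 etransitivity; [|apply (int_cos_period j (phi - PI * IZR j) Hj)]. apply RInt_ext. intros x _.
 rewrite Rmult_1_l. unfold f. f_equal. field.
Qed.

(** The Beta integral [B(3, 3)]; a positive mass independent of [y0] is what the lower bound for
    [gbar] asks for. *)
Lemma rho_integral y0 : 0 < y0 -> RInt (rho y0) y0 (2 * y0) = 1 / 30.
Proof.
 intros Hy. set (P := fun s => (s - 1) ^ 3 / 3 - (s - 1) ^ 4 / 2 + (s - 1) ^ 5 / 5).
 rewrite (RInt_ext (V := RV) (rho y0) (fun y => / y0 * ((y / y0 - 1) * (2 - y / y0)) ^ 2)).
 - rewrite (RInt_FTC (fun y => P (y / y0))).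
  + match goal with |- ?a = ?b => change (@eq R a b) end. unfold P. replace (2 * y0 / y0) with 2 by bound. replace (y0 / y0) with 1 by bound. field.
  + lra.
  + intros y _. unfold P. auto_derive. auto. field. lra.
  + intros y _. apply (continuous_ext (fun y => / y0 * ((/ y0 * y - 1) * (2 - / y0 * y)) ^ 2)). bound. cont.
 - intros y H. rewrite Rmin_left, Rmax_right in H by lra. unfold rho, chi. f_equal. f_equal. apply Rmax_right.
  assert (1 <= y / y0) by bound.
  assert (y / y0 <= 2) by bound.
  bound.
Qed.

Lemma bessel_cont w : 1 < w -> continuous (bessel_K kappa) w.
Proof.
 intros Hw. apply continuity_pt_filterlim. intros eps He.
 exists (Rmin (w - 1) (eps / 127)). split. bound.
 intros v [_ Hv].
 assert (Hv1 : Rabs (v - w) < w - 1) by (eapply Rlt_le_trans; [apply Hv|apply Rmin_l]). assert (Rabs (v - w) < eps / 127) by (eapply Rlt_le_trans; [apply Hv|apply Rmin_r]).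
 pose proof (Rabs_def2 _ _ Hv1) as Hv3. eapply Rle_lt_trans. apply (bessel_lip 1 v w); lra.
 assert (exp (- (1)) <= 1) by (left; apply exp_lt1; lra).
 apply Rle_lt_trans with (126 * 1 * Rabs (v - w)). bound. lra.
Qed.

Lemma T_int j l b : j <> 0%Z -> RInt (fun x => T l (2 * PI * (IZR j * x) + b)) (- (1 / 2)) (1 / 2) = 0.
Proof.
 intros Hj.
 rewrite (RInt_ext (V := RV) _ (fun x => Re (t l) * cos (2 * PI * (IZR j * x) + b) + - Im (t l) * cos (2 * PI * (IZR j * x) + (b - PI / 2)))).
 - rewrite (RInt_lin2 (Re (t l)) (- Im (t l)) (fun x => cos (2 * PI * (IZR j * x) + b)) (fun x => cos (2 * PI * (IZR j * x) + (b - PI / 2)))).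
  rewrite !int_cos_centered by auto. ringR.
  apply (ex_RInt_continuous (V := RV)). intros; cont. apply (ex_RInt_continuous (V := RV)). intros; cont.
 - intros x _. unfold T. replace (2 * PI * (IZR j * x) + (b - PI / 2)) with ((2 * PI * (IZR j * x) + b) - PI / 2) by ring.
  rewrite cos_minus, cos_PI2, sin_PI2. ringR.
Qed.

(** Under the uniform approximation by [PS], every mode but [n] integrates to zero over a period. *)
Lemma extract_y k phi al y : 0 < y ->
  RInt (fun x => cp (2 * PI * IZR (Z.of_nat (S k)) * x + phi) (psi (al + x, y))) (- (1 / 2)) (1 / 2) =
  gn (Z.of_nat (S k)) y * T (Z.of_nat (S k)) (2 * PI * (IZR (Z.of_nat (S k)) * al) - phi).
Proof.
 intros Hy. set (n := Z.of_nat (S k)). apply cond_eq. intros eps He.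
 destruct (uniform_approx y (eps / 2) Hy ltac:(lra)) as [N0 HN0].
 set (N := Nat.max N0 (S k)). specialize (HN0 N ltac:(lia)).
 set (f := fun x => cp (2 * PI * IZR n * x + phi) (psi (al + x, y))).
 set (h := fun l x => gn l y * T l (2 * PI * (IZR l * (al + x)) - (2 * PI * IZR n * x + phi))).
 assert (forall x, continuous f x). { intros x. apply (cp_path_cont (fun x => 2 * PI * IZR n * x + phi) (fun x => al + x) (fun _ => y)); auto; cont. }
 assert (ch : forall l x, continuous (h l) x). { intros l x. unfold h. apply continuous_mulR. apply continuous_const. apply T_cont. cont. }
 destruct (lsum_RInt h (zl N) (- (1 / 2)) (1 / 2)) as [E ex]. { intros; apply ex_RInt_cont; [lra|intros; apply ch]. }
 assert (EI : RInt (fun x => lsum (fun l => h l x) (zl N)) (- (1 / 2)) (1 / 2) = gn n y * T n (2 * PI * (IZR n * al) - phi)).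
 { rewrite E, lsum_zl.
  assert (Hz : forall l, l <> n -> RInt (h l) (- (1 / 2)) (1 / 2) = 0).
  { intros l Hl. unfold h. rewrite (RInt_ext (V := RV) _ (fun x => gn l y * T l (2 * PI * (IZR (l - n) * x) + (2 * PI * (IZR l * al) - phi)))).
   - rewrite (RInt_mulR (gn l y) (fun x => T l (2 * PI * (IZR (l - n) * x) + (2 * PI * (IZR l * al) - phi)))).
    + rewrite T_int by lia. ringR.
    + apply ex_RInt_cont. lra. intros; apply T_cont; cont.
   - intros x _. f_equal. f_equal. rewrite minus_IZR. ring. }
  rewrite (rsum_single _ k N ltac:(lia)).
  - fold n. rewrite (Hz (- n)%Z) by (unfold n; lia). rewrite Rplus_0_r.
   rewrite (RInt_ext (V := RV) (h n) (fun _ => gn n y * T n (2 * PI * (IZR n * al) - phi))).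
   rewrite RInt_const. match goal with |- scal ?u ?v = ?w => change (@eq R (u * v) w) end. field.
   intros x _. unfold h. f_equal. f_equal. ring.
  - intros k' Hk' Hne. rewrite !Hz by (unfold n; lia). ring. }
 rewrite <- EI. rewrite <- (RInt_subR f (fun x => lsum (fun l => h l x) (zl N))); auto. 2: apply ex_RInt_cont; auto; lra.
 eapply Rle_lt_trans. apply (abs_RInt_le_const _ (- (1 / 2)) (1 / 2) (eps / 2)); try lra.
 apply ex_RInt_subR; auto. apply ex_RInt_cont; auto; lra.
 intros x Hx. apply (HN0 (2 * PI * IZR n * x + phi) (al + x) y). lra. lra.
Qed.

Definition gbar (y0 : R) (n : Z) : R := RInt (fun y => rho y0 y * gn n y) y0 (2 * y0).

Lemma extract y0 k phi al : 0 < y0 ->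
  RInt (fun x => Phi y0 (IZR (Z.of_nat (S k))) (phi - 2 * PI * IZR (Z.of_nat (S k)) * al) (al + x)) (- (1 / 2)) (1 / 2) =
  gbar y0 (Z.of_nat (S k)) * T (Z.of_nat (S k)) (2 * PI * (IZR (Z.of_nat (S k)) * al) - phi).
Proof.
 intros Hy. set (n := Z.of_nat (S k)). set (Tn := T n (2 * PI * (IZR n * al) - phi)).
 set (f := fun x y => rho y0 y * cp (2 * PI * IZR n * (al + x) + (phi - 2 * PI * IZR n * al)) (psi (al + x, y))).
 change (RInt (fun x => RInt (fun y => f x y) y0 (2 * y0)) (- (1 / 2)) (1 / 2) = gbar y0 n * Tn).
 assert (cf : forall x y, 0 < y -> continuity_2d_pt f x y).
 { intros x y Hy'. apply (c2d_sub (fun x y => rho y0 y * cp (2 * PI * IZR n * x + (phi - 2 * PI * IZR n * al)) (psi (x, y))) (fun x => al + x)). apply (phi_2d); auto. cont. }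
 rewrite (fubini f) by (try lra; intros; apply cf; lra).
 assert (Ey : forall y, 0 < y -> RInt (fun x => f x y) (- (1 / 2)) (1 / 2) = rho y0 y * (gn n y * Tn)).
 { intros y Hy'. unfold Tn, n. rewrite <- (extract_y k phi al y Hy'). fold n. rewrite <- RInt_mulR.
  apply RInt_ext. intros x _. unfold f. replace (2 * PI * IZR n * (al + x) + (phi - 2 * PI * IZR n * al)) with (2 * PI * IZR n * x + phi) by ring. bound.
  apply ex_RInt_cont. lra. intros x _. apply (cp_path_cont (fun x => 2 * PI * IZR n * x + phi) (fun x => al + x) (fun _ => y)); auto; cont. }
 (* Integrability of [rho y0 y * gn n y] is read off from the inner integral after division by [Tn],
    so the case [Tn = 0] is separate. *)
 destruct (Req_dec Tn 0) as [E0|E0].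
 - rewrite E0, Rmult_0_r. apply ex_RInt_zero. lra. intros y H. rewrite Ey by lra. rewrite E0. ring.
 - assert (exf : ex_RInt (fun y => RInt (fun x => f x y) (- (1 / 2)) (1 / 2)) y0 (2 * y0)) by (apply ex_RInt_param; try lra; intros; apply cf; lra).
  assert (exg : ex_RInt (fun y => rho y0 y * gn n y) y0 (2 * y0)).
  { apply (ex_RInt_ext (V := R_NormedModule) (fun y => / Tn * RInt (fun x => f x y) (- (1 / 2)) (1 / 2))).
   intros y H. rewrite Rmin_left, Rmax_right in H by lra. rewrite Ey by lra.
   match goal with |- ?a = ?b => change (@eq R a b) end. bound. apply ex_RInt_mulR; auto. }
  unfold gbar. rewrite (Rmult_comm _ Tn), <- (RInt_mulR Tn (fun y => rho y0 y * gn n y)) by auto. apply RInt_ext. intros y H. rewrite Rmin_left, Rmax_right in H by lra. rewrite Ey by lra.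
  ringR.
Qed.

(** With [c0 = w0 / PI] all Bessel arguments lie in [[2 w0, 16 w0]], where [bessel_K] is positive
    and Lipschitz. So [gbar] has size [/ sqrt M] and its variation over the whole block is no larger
    in order, which allows its removal by partial summation. *)
Lemma gbar_facts : exists c0 Cg, 0 < c0 /\ 1 <= Cg /\ forall M, 1 <= M ->
  (forall n, M <= IZR n <= 4 * M -> / (Cg * sqrt M) <= gbar (c0 / M) n <= Cg / sqrt M) /\
  (forall n, M <= IZR n -> IZR n + 1 <= 4 * M -> Rabs (gbar (c0 / M) n - gbar (c0 / M) (n + 1)) <= Cg / (M * sqrt M)).
Proof.
 destruct (bessel_lower) as [c [w0 [Hc [Hw0 Hlow]]]]. pose proof PI2_3_2 as HP. pose proof PI_4 as HP4.
 set (c0 := w0 / PI). assert (0 < c0) by bound.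
 set (s0 := sqrt c0). assert (0 < s0) by bound.
 set (cl := c * exp (- (3 / 2) * (16 * w0))). assert (0 < cl) by bound.
 set (Cg := 1 + 84 * s0 + 4032 * (s0 * c0) + 30 / (s0 * cl)).
 assert (0 < 30 / (s0 * cl)) by bound. assert (0 < s0 * c0) by bound.
 exists c0, Cg. split; auto. split. bound. intros M HM.
 set (y0 := c0 / M). assert (Hy0 : 0 < y0) by bound.
 set (sM := sqrt M). assert (0 < sM) by bound.
 assert (Hsy : sqrt y0 = s0 / sM) by (unfold y0; rewrite sqrt_div by lra; reflexivity).
 assert (Hw : forall n y, M <= IZR n <= 4 * M -> y0 <= y <= 2 * y0 -> 2 * w0 <= 2 * PI * Rabs (IZR n) * y <= 16 * w0).
 { intros n y Hn Hy. rewrite Rabs_right by lra. split.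
  - apply Rle_trans with (2 * PI * M * y0). unfold y0, c0. bound. apply Rmult_le_compat; try lra. bound. apply Rmult_le_compat_l; lra.
  - trans_l (2 * PI * (4 * M) * (2 * y0)). unfold y0, c0. bound. }
 assert (Hsq : forall y, y0 <= y <= 2 * y0 -> s0 / sM <= sqrt y <= 2 * (s0 / sM)).
 { intros y Hy. rewrite <- Hsy. split. bound. replace (2 * sqrt y0) with (sqrt (2 * 2 * y0)). bound. rewrite sqrt_mult by lra. rewrite sqrt_square by lra. bound. }
 assert (cg : forall n y, M <= IZR n <= 4 * M -> y0 <= y <= 2 * y0 -> continuous (gn n) y).
 { intros n y Hn Hy. apply continuous_mulR. apply continuity_pt_filterlim, continuity_pt_sqrt; lra.
  apply (continuous_comp (fun y => 2 * PI * Rabs (IZR n) * y) (bessel_K kappa)). cont. apply bessel_cont. specialize (Hw n y Hn Hy). lra. }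
 assert (forall n, M <= IZR n <= 4 * M -> ex_RInt (fun y => rho y0 y * gn n y) y0 (2 * y0)).
 { intros n Hn. apply ex_RInt_cont. lra. intros y Hy. apply continuous_mulR. apply rho_cont. apply cg; auto. }
 destruct (rho_mass y0 Hy0) as [exr _].
 split.
 - intros n Hn. split.
  + apply Rle_trans with (s0 / sM * cl * (1 / 30)).
   * trans_l (/ (30 / (s0 * cl) * sM)). right. field. repeat split; lra.
   * rewrite <- (rho_integral y0 Hy0), <- RInt_mulR by auto. apply RInt_le; auto. lra. apply ex_RInt_mulR; auto.
    intros y Hy. rewrite Rmult_comm. apply Rmult_le_compat_l. apply rho_bound; auto. destruct (Hsq y ltac:(lra)). destruct (Hw n y Hn ltac:(lra)).
    apply Rmult_le_compat; try lra. eapply Rle_trans; [|apply Hlow; lra]. mul_l. apply exp_le. lra.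
  + apply Rle_trans with (84 * (s0 / sM)). 2: { unfold Rdiv. rewrite <- Rmult_assoc. bound. }
   le_by Rle_abs. apply rho_avg; auto. intros y Hy. unfold gn. destruct (Hsq y ltac:(lra)). destruct (Hw n y Hn ltac:(lra)).
   rewrite Rabs_mult, Rabs_right by (apply Rle_ge, sqrt_pos). rhs (2 * (s0 / sM) * 42).
   apply Rmult_le_compat; auto. bound. bound. le_by bessel_bound. lra.
   apply Rmult_le_reg_r with (sqrt (2 * PI * Rabs (IZR n) * y)). bound. unfold Rdiv. rewrite Rmult_assoc, Rinv_l by (apply Rgt_not_eq, sqrt_lt_R0; lra).
   mul_l. rewrite <- sqrt_1. apply sqrt_le_1_alt; lra.
 - intros n Hn1 Hn2.
  assert (Hn : M <= IZR n <= 4 * M) by lra. assert (Hn' : M <= IZR (n + 1) <= 4 * M) by (rewrite plus_IZR; lra).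
  unfold gbar. rewrite <- (RInt_subR (fun y => rho y0 y * gn n y) (fun y => rho y0 y * gn (n + 1) y)) by auto.
  rewrite (RInt_ext (V := RV) _ (fun y => rho y0 y * (gn n y - gn (n + 1) y))).
  2: { bound. }
  apply Rle_trans with (4032 * (s0 * c0) / (M * sM)). 2: { bound. }
  apply rho_avg; auto.
  + intros y Hy. unfold gn. destruct (Hsq y ltac:(lra)). destruct (Hw n y Hn ltac:(lra)). destruct (Hw (n + 1)%Z y Hn' ltac:(lra)).
   rewrite <- Rmult_minus_distr_l, Rabs_mult, Rabs_right by (apply Rle_ge, sqrt_pos).
   rhs (2 * (s0 / sM) * (126 * (2 * 4 * (2 * y0)))).
   apply Rmult_le_compat; auto. bound. bound.
   eapply Rle_trans. apply (bessel_lip 1); lra. rewrite Rmult_assoc. mul_l.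
   assert (exp (- (1)) <= 1) by (left; apply exp_lt1; lra).
   pose proof (exp_pos (- (1))). rewrite <- (Rmult_1_l (2 * 4 * (2 * y0))). apply Rmult_le_compat; try lra. bound.
   rewrite plus_IZR. rewrite !(Rabs_right (IZR n)), (Rabs_right (IZR n + 1)) by lra.
   replace (2 * PI * IZR n * y - 2 * PI * (IZR n + 1) * y) with (- (2 * PI * y)) by ring. rewrite Rabs_Ropp, Rabs_right by (apply Rle_ge, Rmult_le_pos; lra).
   apply Rmult_le_compat; lra.
  + apply (ex_RInt_ext (V := R_NormedModule) (fun y => rho y0 y * gn n y - rho y0 y * gn (n + 1) y)).
   bound. apply ex_RInt_subR; auto.
Qed.

(** * From integrals to sums *)

Lemma sin_lower x : 0 <= x <= 1 / 2 -> x <= sin (PI * x).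
Proof.
 intros Hx. pose proof PI2_3_2 as HP. pose proof PI_4 as HP4. set (u := PI * x). assert (Hu : 0 <= u <= 2) by (unfold u; split; [apply Rmult_le_pos; lra|]; assert (PI * x <= 4 * (1 / 2)) by (apply Rmult_le_compat; lra); lra).
 destruct (pre_sin_bound u 0 ltac:(lra) ltac:(lra)) as [H _].
 assert (E : sin_approx u (2 * 0 + 1) = u - u ^ 3 / 6). { unfold sin_approx, sin_term. simpl. field. }
 assert (u ^ 3 / 6 <= u * (2 / 3)) by nra.
 assert (3 * x <= u) by bound. lra.
Qed.

Lemma sin_abs_lower x : Rabs x <= 1 / 2 -> Rabs x <= Rabs (sin (PI * x)).
Proof.
 intros Hx. destruct (Rle_dec 0 x) as [H|H].
 - rewrite Rabs_right in * by lra. eapply Rle_trans; [|apply Rle_abs]. apply sin_lower; lra.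
 - rewrite (Rabs_left x) in * by lra. rewrite <- Rabs_Ropp, <- sin_neg. eapply Rle_trans; [|apply Rle_abs].
  replace (- (PI * x)) with (PI * - x) by ring. apply sin_lower; lra.
Qed.

(** Multiplication by [2 sin (PI x)] turns each term into a difference, and the sum telescopes. For
    integral [a] the end frequencies are half-integers, a reason to allow real [m] in the key
    bound. *)
Lemma kernel1 z a x phi N : 2 * sin (PI * x) * rsum (fun i => cp (2 * PI * (a + INR i) * x + phi) z) N =
  cp (2 * PI * (a + INR N - 1 / 2) * x + (phi - PI / 2)) z - cp (2 * PI * (a - 1 / 2) * x + (phi - PI / 2)) z.
Proof.
 assert (St : forall A, 2 * sin (PI * x) * cp A z = cp (A + PI * x - PI / 2) z - cp (A - PI * x - PI / 2) z).
 { intros A. unfold cp. rewrite !cos_minus, !sin_minus, !cos_plus, !sin_plus, ?cos_minus, ?sin_minus, cos_PI2, sin_PI2. ring. }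
 induction N as [|N IH].
 - cbn [rsum]. replace (a + INR 0 - 1 / 2) with (a - 1 / 2) by (simpl; ring). ring.
 - cbn [rsum]. rewrite Rmult_plus_distr_l, IH, St, S_INR.
  replace (2 * PI * (a + INR N) * x + phi + PI * x - PI / 2) with (2 * PI * (a + (INR N + 1) - 1 / 2) * x + (phi - PI / 2)) by field.
  replace (2 * PI * (a + INR N) * x + phi - PI * x - PI / 2) with (2 * PI * (a + INR N - 1 / 2) * x + (phi - PI / 2)) by field. ring.
Qed.

Lemma kernel2 z a x phi N H : 4 * sin (PI * x) ^ 2 * rsum (fun h => rsum (fun i => cp (2 * PI * (a + INR h + INR i) * x + phi) z) N) H =
  cp (2 * PI * (a + INR N + INR H - 1) * x + (phi - PI)) z - cp (2 * PI * (a + INR N - 1) * x + (phi - PI)) z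
  - (cp (2 * PI * (a + INR H - 1) * x + (phi - PI)) z - cp (2 * PI * (a - 1) * x + (phi - PI)) z).
Proof.
 replace (4 * sin (PI * x) ^ 2 * rsum (fun h => rsum (fun i => cp (2 * PI * (a + INR h + INR i) * x + phi) z) N) H)
  with (2 * sin (PI * x) * rsum (fun h => 2 * sin (PI * x) * rsum (fun i => cp (2 * PI * (a + INR h + INR i) * x + phi) z) N) H) by (rewrite rsum_mul; ring).
 rewrite (rsum_ext _ (fun h => cp (2 * PI * ((a + INR N - 1 / 2) + INR h) * x + (phi - PI / 2)) z + -1 * cp (2 * PI * ((a - 1 / 2) + INR h) * x + (phi - PI / 2)) z)).
 2: { intros h _. rewrite kernel1. replace (a + INR h + INR N - 1 / 2) with (a + INR N - 1 / 2 + INR h) by ring. replace (a + INR h - 1 / 2) with (a - 1 / 2 + INR h) by ring. ring. }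
 rewrite rsum_add, rsum_mul.
 lhs (2 * sin (PI * x) * rsum (fun h => cp (2 * PI * (a + INR N - 1 / 2 + INR h) * x + (phi - PI / 2)) z) H - 2 * sin (PI * x) * rsum (fun h => cp (2 * PI * (a - 1 / 2 + INR h) * x + (phi - PI / 2)) z) H).
 rewrite !kernel1.
 replace (phi - PI / 2 - PI / 2) with (phi - PI) by field.
 replace (a + INR N - 1 / 2 + INR H - 1 / 2) with (a + INR N + INR H - 1) by field. replace (a + INR N - 1 / 2 - 1 / 2) with (a + INR N - 1) by field.
 replace (a - 1 / 2 + INR H - 1 / 2) with (a + INR H - 1) by field. replace (a - 1 / 2 - 1 / 2) with (a - 1) by field. bound.
Qed.

Lemma dyadic_split (f : R -> R) J : (forall x, continuous f x) ->
  RInt f (- (1 / 2)) (1 / 2) = RInt f (- / 2 ^ S J) (/ 2 ^ S J) +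
    rsum (fun j => RInt f (- / 2 ^ S j) (- / 2 ^ S (S j)) + RInt f (/ 2 ^ S (S j)) (/ 2 ^ S j)) J.
Proof.
 intros Hf. set (I := fun a b : R => (RInt f a b : R)).
 assert (Ch : forall a b e, I a b + I b e = I a e).
 { intros a b e. apply (RInt_Chasles (V := RV) f a b e); apply (ex_RInt_continuous (V := RV)); auto. }
 change (I (- (1 / 2)) (1 / 2) = I (- / 2 ^ S J) (/ 2 ^ S J) + rsum (fun j => I (- / 2 ^ S j) (- / 2 ^ S (S j)) + I (/ 2 ^ S (S j)) (/ 2 ^ S j)) J).
 clearbody I. induction J as [|J IH].
 - cbn [rsum]. replace (/ 2 ^ 1) with (1 / 2) by bound. ring.
 - cbn [rsum]. rewrite IH. rewrite <- (Ch (- / 2 ^ S J) (- / 2 ^ S (S J)) (/ 2 ^ S J)). rewrite <- (Ch (- / 2 ^ S (S J)) (/ 2 ^ S (S J)) (/ 2 ^ S J)). ring.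
Qed.

Definition Ps (y0 al m phi x : R) : R := Phi y0 m (phi - 2 * PI * m * al) (al + x).

(** The twisted average is a component of one complex number that does not depend on [m] and [phi],
    so that the kernel identities apply to it. *)
Lemma Ps_cp y0 al : 0 < y0 -> exists Z : R -> C, forall m phi x, Ps y0 al m phi x = cp (2 * PI * m * x + phi) (Z x).
Proof.
 intros Hy. exists (fun x => (RInt (fun y => rho y0 y * Re (psi (al + x, y))) y0 (2 * y0), RInt (fun y => rho y0 y * Im (psi (al + x, y))) y0 (2 * y0))).
 intros m phi x. unfold Ps, Phi, cp at 2. simpl Re. simpl Im.
 assert (P : forall y, 0 < y -> continuous (fun y => Re (psi (al + x, y))) y /\ continuous (fun y => Im (psi (al + x, y))) y).
 { intros y Hy'. destruct (psi_2d (al + x) y Hy') as [P1 P2].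
  split; [apply (continuity_2d_pt_r (fun x y => Re (psi (x, y)))) | apply (continuity_2d_pt_r (fun x y => Im (psi (x, y))))]; auto. }
 replace (2 * PI * m * (al + x) + (phi - 2 * PI * m * al)) with (2 * PI * m * x + phi) by ring. set (A := 2 * PI * m * x + phi).
 rewrite (RInt_ext (V := RV) _ (fun y => cos A * (rho y0 y * Re (psi (al + x, y))) + sin A * (rho y0 y * Im (psi (al + x, y))))).
 - rewrite (RInt_lin2 (cos A) (sin A) (fun y => rho y0 y * Re (psi (al + x, y))) (fun y => rho y0 y * Im (psi (al + x, y)))).
  ringR.
  apply ex_RInt_cont. lra. intros y Hy'. destruct (P y ltac:(lra)). apply continuous_mulR; auto. apply rho_cont.
  apply ex_RInt_cont. lra. intros y Hy'. destruct (P y ltac:(lra)). apply continuous_mulR; auto. apply rho_cont.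
 - intros y _. unfold cp. ringR.
Qed.

Lemma Ps_cont y0 al m phi x : 0 < y0 -> continuous (Ps y0 al m phi) x.
Proof. intros Hy. apply (continuous_comp (fun x => al + x) (Phi y0 m (phi - 2 * PI * m * al))). cont. apply (Phi_cont); auto. Qed.

Lemma Ps_bound : exists B, 0 < B /\ forall y0 al m phi x, 0 < y0 -> Rabs (Ps y0 al m phi x) <= B.
Proof.
 destruct (psi_bounded) as [B [HB H]]. exists B. split; auto. intros y0 al m phi x Hy.
 apply rho_avg; auto. intros y Hy'. apply H; lra.
 apply ex_RInt_cont. lra. intros y Hy'. apply continuous_mulR. apply rho_cont.
 apply (cp_path_cont (fun _ => 2 * PI * m * (al + x) + (phi - 2 * PI * m * al)) (fun _ => al + x) (fun y => y)); try cont; lra.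
Qed.

Definition bn (y0 al phi : R) (n : nat) : R := gbar y0 (Z.of_nat n) * T (Z.of_nat n) (2 * PI * (INR n * al) - phi).

Lemma core c0 : 0 < c0 -> exists C, 1 <= C /\ forall M R0 A1 De (H len n1 : nat) Th al phi,
  1 <= M -> 1 <= R0 -> 0 <= A1 -> (1 <= H)%nat -> C * R0 * sqrt R0 <= INR H -> 2 * INR H <= De -> De <= M -> 4 <= De -> INR len <= 2 * De ->
  M + 1 <= INR n1 -> INR n1 + INR len + INR H <= 4 * M ->
  (forall U, INR H / sqrt R0 <= U <= De -> 1 <= Th U /\ C * U * R0 ^ 4 * Th U ^ 4 <= M /\ forall n, (1 <= n)%Z -> IZR n <= C * R0 * M / U -> Cmod (t n) <= Th U) ->
  (forall n, (1 <= n)%Z -> Cmod (t n) <= A1 * sqrt (sqrt (IZR n))) ->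
  Rabs (/ INR H * rsum (fun h => rsum (fun i => bn (c0 / M) al phi (n1 + h + i)) len) H) <= C * (1 + A1) * (1 + ln M) ^ 4 * (/ sqrt R0 + De / (sqrt M * sqrt (sqrt M))).
Proof.
 intros Hc0. destruct (key_prop c0 Hc0) as [Ck [HCk Key]]. destruct Ps_bound as [B [HB HPB]].
 set (Cd := 68 * Ck + 4 * B). exists (7 * Cd). assert (HCd : 68 * Ck <= Cd) by bound. split. lra.
 intros M R0 A1 De H len n1 Th al phi HM HR HA1 HH HHR HHD HDM HD4 Hlen Hn1 Hn2 HTh H4.
 assert (Hl0 : 0 <= ln M) by bound. set (Lg := 1 + ln M). assert (HLg : 1 <= Lg) by bound.
 set (sR := sqrt R0) in *. assert (HsR : 1 <= sR) by bound.
 set (T3 := / (sqrt M * sqrt (sqrt M))). assert (HT3 : 0 < T3) by bound.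
 set (y0 := c0 / M). assert (Hy0 : 0 < y0) by bound.
 assert (HHp : 1 <= INR H) by bound. set (Hr := INR H) in *.
 set (L3 := (1 + A1) * Lg ^ 3).
 set (W := L3 * (/ sR + De * T3)).
 assert (HDT : 0 < De * T3) by bound.
 assert (HW : 0 < W) by bound.
 assert (HWR : / sR <= W). { unfold W. rewrite <- (Rmult_1_l (/ sR)) at 1. bound. }
 set (E := fun U => Ck * L3 * (/ (U * sR) + T3)).
 assert (KeyU : forall U m ph c d, Hr / sR <= U <= De -> M <= m <= 4 * M -> c <= d -> d - c <= / U -> Rabs (RInt (Ps y0 al m ph) c d) <= E U).
 { intros U m ph c d HU Hm Hcd Hdc. destruct (HTh U HU) as [T1 [T2 T3']].
  assert (HUlow : Ck * R0 <= U). { apply Rle_trans with (Hr / sR); [|tauto]. apply Rmult_le_reg_r with sR. lra. unfold Rdiv. rewrite (Rmult_assoc Hr), Rinv_l, Rmult_1_r by lra.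
   nra. }
  assert (HU0 : 0 < U) by nra.
  assert (HTp : 0 <= U * R0 ^ 4 * Th U ^ 4) by bound.
  replace (E U) with (Ck * (1 + A1) * (1 + ln M) ^ 3 * (/ (U * sqrt R0) + / (sqrt M * sqrt (sqrt M)))) by (unfold E, L3, T3, Lg, sR; ring).
  replace (RInt (Ps y0 al m ph) c d) with (RInt (Phi y0 m (ph - 2 * PI * m * al)) (al + c) (al + d)).
  2: { rewrite RInt_shift by (intros; apply (Phi_cont); auto). apply RInt_ext. intros x _. unfold Ps. f_equal. ring. }
  apply (Key M U R0 (Th U) A1 m (ph - 2 * PI * m * al) (al + c) (al + d)); auto; try lra.
  - lhs (Ck * (U * R0 ^ 4 * Th U ^ 4)). replace (7 * Cd * U * R0 ^ 4 * Th U ^ 4) with (7 * Cd * (U * R0 ^ 4 * Th U ^ 4)) in T2 by ring.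
   eapply Rle_trans; [|apply T2]. apply Rmult_le_compat_r; lra.
  - intros n Hn Hn'. apply T3'; auto. eapply Rle_trans. apply Hn'. bound. }
 set (Avg := fun x => / Hr * rsum (fun h => rsum (fun i => Ps y0 al (INR n1 + INR h + INR i) phi x) len) H).
 assert (cPs : forall m ph x, continuous (Ps y0 al m ph) x) by (intros; apply Ps_cont; auto).
 assert (exPs : forall m ph a b, ex_RInt (Ps y0 al m ph) a b) by (intros; apply (ex_RInt_continuous (V := RV)); intros; apply cPs).
 assert (cAvg : forall x, continuous Avg x).
 { intros x. apply continuous_mulR. apply continuous_const. apply rsum_cont. intros h _. apply rsum_cont. intros i _. apply cPs. }
 assert (HiH : 0 < / Hr) by bound.
 assert (EqI : forall a b, RInt Avg a b = / Hr * rsum (fun h => rsum (fun i => RInt (Ps y0 al (INR n1 + INR h + INR i) phi) a b) len) H).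
 { intros a b.
  assert (I1 : forall h, RInt (fun x => rsum (fun i => Ps y0 al (INR n1 + INR h + INR i) phi x) len) a b = rsum (fun i => RInt (Ps y0 al (INR n1 + INR h + INR i) phi) a b) len /\ ex_RInt (fun x => rsum (fun i => Ps y0 al (INR n1 + INR h + INR i) phi x) len) a b).
  { intros h. apply (rsum_RInt (fun i => Ps y0 al (INR n1 + INR h + INR i) phi)). auto. }
  destruct (rsum_RInt (fun h x => rsum (fun i => Ps y0 al (INR n1 + INR h + INR i) phi x) len) H a b) as [E2 ex2]. { intros h _. apply I1. }
  rewrite (RInt_mulR (/ Hr) (fun x => rsum (fun h => rsum (fun i => Ps y0 al (INR n1 + INR h + INR i) phi x) len) H)) by auto. rewrite E2. f_equal. apply rsum_ext. intros h _. apply I1. }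
 assert (Eb : forall n, (1 <= n)%nat -> bn y0 al phi n = RInt (Ps y0 al (INR n) phi) (- (1 / 2)) (1 / 2)).
 { intros n Hn. destruct n as [|k]. lia. unfold bn. rewrite !INR_IZR_INZ. rewrite <- (extract y0 k phi al Hy0). reflexivity. }
 assert (Hn1' : (1 <= n1)%nat). { apply INR_le. change (INR 1) with 1. lra. }
 replace (/ Hr * rsum (fun h => rsum (fun i => bn y0 al phi (n1 + h + i)) len) H) with (RInt Avg (- (1 / 2)) (1 / 2)).
 2: { rewrite EqI. f_equal. apply rsum_ext. intros h _. apply rsum_ext. intros i _. rewrite Eb by lia. rewrite !plus_INR. bound. }
 destruct (Ps_cp y0 al Hy0) as [Z HZ].
 assert (Dy : forall U p q, 2 <= U -> U <= De -> p <= q -> q - p <= / U -> (forall x, p <= x <= q -> / (2 * U) <= Rabs x <= 1 / 2) -> Rabs (RInt Avg p q) <= Cd * W).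
 { intros U p q HU2 HUD Hpq Hqp Hx.
  assert (Hsin : forall x, p <= x <= q -> / (2 * U) <= Rabs (sin (PI * x))). { intros x Hxx. destruct (Hx x Hxx). eapply Rle_trans; [|apply sin_abs_lower]; auto. }
  assert (Hi2 : 0 < / (2 * U)) by bound.
  assert (Hs0 : forall x, p <= x <= q -> sin (PI * x) <> 0). { intros x Hxx E0. specialize (Hsin x Hxx). rewrite E0, Rabs_R0 in Hsin. lra. }
  assert (Hinv1 : forall x, p <= x <= q -> Rabs (/ sin (PI * x)) <= 2 * U). { intros x Hxx. rewrite Rabs_inv. rewrite <- (Rinv_inv (2 * U)). apply Rinv_le_contravar; auto. }
  assert (HPI : PI <= 4) by apply PI_4. assert (HPI0 : 3 < PI) by (pose proof PI2_3_2; lra).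
  assert (Hcos : forall x, Rabs (cos (PI * x)) <= 1) by (intros; apply Rabs_le, COS_bound).
  destruct (Rle_dec U (Hr / sR)) as [Hsmall|Hbig].
  - (* [U <= H / sqrt R0]: the trivial bound for the kernel [1 / (4 H sin^2)] produced by averaging over the shifts *)
   assert (Q : Rabs (RInt Avg p q) <= (q - p) * (4 * B * (U * U) * / Hr)).
   { apply abs_RInt_le_const; auto. apply ex_RInt_cont; auto. intros x Hxx.
    assert (E4 : Avg x = / Hr * (/ sin (PI * x) * / sin (PI * x)) * / 4 * (4 * sin (PI * x) ^ 2 * rsum (fun h => rsum (fun i => cp (2 * PI * (INR n1 + INR h + INR i) * x + phi) (Z x)) len) H)).
    { unfold Avg. rewrite (rsum_ext _ (fun h => rsum (fun i => cp (2 * PI * (INR n1 + INR h + INR i) * x + phi) (Z x)) len)) by (intros; apply rsum_ext; intros; apply HZ). field. split; [auto|lra]. }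
    rewrite E4, kernel2, <- !HZ.
    rewrite !Rabs_mult. rewrite (Rabs_right (/ Hr)), (Rabs_right (/ 4)) by lra.
    assert (K4 : Rabs (Ps y0 al (INR n1 + INR len + INR H - 1) (phi - PI) x - Ps y0 al (INR n1 + INR len - 1) (phi - PI) x - (Ps y0 al (INR n1 + INR H - 1) (phi - PI) x - Ps y0 al (INR n1 - 1) (phi - PI) x)) <= 4 * B).
    { assert (forall m, - B <= Ps y0 al m (phi - PI) x <= B) by (intros m; apply Rabs_le_between; apply HPB; auto).
     pose proof (H0 (INR n1 + INR len + INR H - 1)). pose proof (H0 (INR n1 + INR len - 1)). pose proof (H0 (INR n1 + INR H - 1)). pose proof (H0 (INR n1 - 1)). apply Rabs_le. lra. }
    specialize (Hinv1 x Hxx).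
    apply Rle_trans with (/ Hr * (2 * U * (2 * U)) * / 4 * (4 * B)). 2: right; field; lra.
    bound. }
   le_by Q. trans_l (/ U * (4 * B * (U * U) * / Hr)).
   lhs (4 * B * (U * / Hr)).
   assert (U * / Hr <= / sR). { apply Rmult_le_reg_r with Hr. lra. rewrite Rmult_assoc, Rinv_l, Rmult_1_r by lra. bound. }
   trans_l (4 * B * W). mul_r. unfold Cd; lra.
  - assert (U * E U <= Ck * W). { lhs (Ck * (L3 * (/ sR + U * T3))).
    bound. }
   assert (Amp : forall (A A' : R -> R) A0 V1 m ph, (forall x, p <= x <= q -> is_derive A x (A' x)) -> (forall x, p <= x <= q -> continuous A' x) -> (forall x, p <= x <= q -> Rabs (A x) <= A0) ->
    (forall x, p <= x <= q -> Rabs (A' x) <= V1) -> M <= m <= 4 * M -> Rabs (RInt (fun x => A x * Ps y0 al m ph x) p q) <= E U * (A0 + / U * V1)).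
   { intros A A' A0 V1 m ph HA HA' HA0 HV1 Hm. apply (RInt_amplitude A A' (Ps y0 al m ph) p q (E U) A0 (/ U * V1)); auto.
    - intros x Hxx. apply KeyU; auto; lra.
    - apply Rle_trans with ((q - p) * V1). apply RInt_le_const; auto. apply ex_RInt_cont; auto. intros; apply continuous_abs; auto.
     apply Rmult_le_compat_r; auto. le_by Rabs_pos. apply (HV1 p); lra. }
   assert (0 <= INR len) by bound.
   destruct (Rle_dec U Hr) as [HUH|HUH].
   + (* [U <= H]: the kernel [1 / (4 H sin^2)] again, now with the key bound *)
    set (A := fun x => / (4 * Hr * sin (PI * x) ^ 2)). set (A' := fun x => - PI * cos (PI * x) / (2 * Hr * sin (PI * x) ^ 3)).
    assert (Am : forall m ph, M <= m <= 4 * M -> Rabs (RInt (fun x => A x * Ps y0 al m ph x) p q) <= E U * (17 * (U * U / Hr))).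
    { intros m ph Hm. eapply Rle_trans. apply (Amp A A' (U * U / Hr) (16 * (U * U * U / Hr))); auto.
     - intros x Hxx. unfold A, A'. auto_derive. repeat apply Rmult_integral_contrapositive_currified; auto; lra. field. split; [auto|lra].
     - intros x Hxx. unfold A'. cont. repeat apply Rmult_integral_contrapositive_currified; auto; lra.
     - intros x Hxx. specialize (Hs0 x Hxx). unfold A. replace (/ (4 * Hr * sin (PI * x) ^ 2)) with (/ sin (PI * x) * / sin (PI * x) * (/ 4 * / Hr)) by bound.
      rewrite !Rabs_mult. rewrite (Rabs_right (/ 4)), (Rabs_right (/ Hr)) by lra. apply Rle_trans with (2 * U * (2 * U) * (/ 4 * / Hr)). 2: right; field; lra.
      mul_r. apply Rmult_le_compat; auto; apply Rabs_pos.
     - intros x Hxx. specialize (Hs0 x Hxx). unfold A'. replace (- PI * cos (PI * x) / (2 * Hr * sin (PI * x) ^ 3)) with (- (PI * / 2 * / Hr * (cos (PI * x) * (/ sin (PI * x) * / sin (PI * x) * / sin (PI * x))))) by bound.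
      rewrite Rabs_Ropp, !Rabs_mult. rewrite (Rabs_right PI), (Rabs_right (/ 2)), (Rabs_right (/ Hr)) by lra.
      pose proof (Rabs_pos (/ sin (PI * x))) as Hp0. pose proof (Rabs_pos (cos (PI * x))) as Hp1.
      apply Rle_trans with (4 * / 2 * / Hr * (1 * (2 * U * (2 * U) * (2 * U)))). 2: right; field; lra.
      apply Rmult_le_compat. bound. bound.
      bound.
      apply Rmult_le_compat; auto. bound.
      apply Rmult_le_compat; auto. bound. apply Rmult_le_compat; auto.
     - bound. }
    assert (EA : RInt Avg p q = RInt (fun x => A x * Ps y0 al (INR n1 + INR len + INR H - 1) (phi - PI) x) p q - RInt (fun x => A x * Ps y0 al (INR n1 + INR len - 1) (phi - PI) x) p q
      - (RInt (fun x => A x * Ps y0 al (INR n1 + INR H - 1) (phi - PI) x) p q - RInt (fun x => A x * Ps y0 al (INR n1 - 1) (phi - PI) x) p q)).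
    { assert (forall x, p <= x <= q -> continuous A x) by (intros x Hxx; specialize (Hs0 x Hxx); unfold A; cont; repeat apply Rmult_integral_contrapositive_currified; auto; lra).
     assert (forall m, ex_RInt (fun x => A x * Ps y0 al m (phi - PI) x) p q) by (intros m; apply ex_RInt_cont; auto; intros; apply continuous_mulR; auto).
     rewrite <- (RInt_subR (fun x => A x * Ps y0 al (INR n1 + INR len + INR H - 1) (phi - PI) x) (fun x => A x * Ps y0 al (INR n1 + INR len - 1) (phi - PI) x)) by auto.
     rewrite <- (RInt_subR (fun x => A x * Ps y0 al (INR n1 + INR H - 1) (phi - PI) x) (fun x => A x * Ps y0 al (INR n1 - 1) (phi - PI) x)) by auto.
     rewrite <- (RInt_subR (fun x => A x * Ps y0 al (INR n1 + INR len + INR H - 1) (phi - PI) x - A x * Ps y0 al (INR n1 + INR len - 1) (phi - PI) x) (fun x => A x * Ps y0 al (INR n1 + INR H - 1) (phi - PI) x - A x * Ps y0 al (INR n1 - 1) (phi - PI) x)) by (apply ex_RInt_subR; auto).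
     apply RInt_ext. intros x Hxx. rewrite Rmin_left, Rmax_right in Hxx by lra. specialize (Hs0 x ltac:(lra)).
     match goal with |- ?a = ?b => change (@eq R a b) end.
     transitivity (A x * (4 * sin (PI * x) ^ 2 * rsum (fun h => rsum (fun i => cp (2 * PI * (INR n1 + INR h + INR i) * x + phi) (Z x)) len) H)).
     - unfold Avg, A. rewrite (rsum_ext _ (fun h => rsum (fun i => cp (2 * PI * (INR n1 + INR h + INR i) * x + phi) (Z x)) len)) by (intros; apply rsum_ext; intros; apply HZ). field. split; [auto|lra].
     - rewrite kernel2, <- !HZ. ring. }
    pose proof (Am (INR n1 + INR len + INR H - 1) (phi - PI) ltac:(unfold Hr in *; lra)) as Q1. pose proof (Am (INR n1 + INR len - 1) (phi - PI) ltac:(unfold Hr in *; lra)) as Q2.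
    pose proof (Am (INR n1 + INR H - 1) (phi - PI) ltac:(unfold Hr in *; lra)) as Q3. pose proof (Am (INR n1 - 1) (phi - PI) ltac:(unfold Hr in *; lra)) as Q4.
    apply Rle_trans with (4 * (E U * (17 * (U * U / Hr)))).
    * apply Rabs_le_between in Q1. apply Rabs_le_between in Q2. apply Rabs_le_between in Q3. apply Rabs_le_between in Q4. apply Rabs_le. lra.
    * assert ((U * E U) * (U / Hr) <= (Ck * W) * 1) by bound.
     trans_l (68 * Ck * W). apply Rmult_le_compat_r; lra.
   + (* [U > H]: the Dirichlet kernel [1 / (2 sin)] *)
    set (A := fun x => / (2 * sin (PI * x))). set (A' := fun x => - PI * cos (PI * x) / (2 * sin (PI * x) ^ 2)).
    assert (Am : forall m ph, M <= m <= 4 * M -> Rabs (RInt (fun x => A x * Ps y0 al m ph x) p q) <= E U * (9 * U)).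
    { intros m ph Hm. eapply Rle_trans. apply (Amp A A' U (8 * (U * U))); auto.
     - intros x Hxx. specialize (Hs0 x Hxx). unfold A, A'. auto_derive. bound. field. auto.
     - intros x Hxx. unfold A'. cont. repeat apply Rmult_integral_contrapositive_currified; auto; lra.
     - intros x Hxx. specialize (Hs0 x Hxx). specialize (Hinv1 x Hxx). unfold A. replace (/ (2 * sin (PI * x))) with (/ sin (PI * x) * / 2) by bound.
      rewrite !Rabs_mult. rewrite (Rabs_right (/ 2)) by lra. lra.
     - intros x Hxx. specialize (Hs0 x Hxx). unfold A'. replace (- PI * cos (PI * x) / (2 * sin (PI * x) ^ 2)) with (- (PI * / 2 * (cos (PI * x) * (/ sin (PI * x) * / sin (PI * x))))) by bound.
      rewrite Rabs_Ropp, !Rabs_mult. rewrite (Rabs_right PI), (Rabs_right (/ 2)) by lra.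
      pose proof (Rabs_pos (/ sin (PI * x))) as Hp0. pose proof (Rabs_pos (cos (PI * x))) as Hp1.
      apply Rle_trans with (4 * / 2 * (1 * (2 * U * (2 * U)))). 2: right; field; lra.
      apply Rmult_le_compat. bound. bound. lra.
      apply Rmult_le_compat; auto. bound. apply Rmult_le_compat; auto.
     - bound. }
    assert (forall x, p <= x <= q -> continuous A x) by (intros x Hxx; specialize (Hs0 x Hxx); unfold A; cont; repeat apply Rmult_integral_contrapositive_currified; auto; lra).
    assert (forall m ph, ex_RInt (fun x => A x * Ps y0 al m ph x) p q) by (intros m ph; apply ex_RInt_cont; auto; intros; apply continuous_mulR; auto).
    assert (EA : RInt Avg p q = / Hr * rsum (fun h => RInt (fun x => A x * Ps y0 al (INR n1 + INR h + INR len - 1 / 2) (phi - PI / 2) x) p q - RInt (fun x => A x * Ps y0 al (INR n1 + INR h - 1 / 2) (phi - PI / 2) x) p q) H).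
    { destruct (rsum_RInt (fun h x => A x * Ps y0 al (INR n1 + INR h + INR len - 1 / 2) (phi - PI / 2) x - A x * Ps y0 al (INR n1 + INR h - 1 / 2) (phi - PI / 2) x) H p q) as [E2 ex2].
     { intros h _. apply (ex_RInt_subR (fun x => A x * Ps y0 al (INR n1 + INR h + INR len - 1 / 2) (phi - PI / 2) x) (fun x => A x * Ps y0 al (INR n1 + INR h - 1 / 2) (phi - PI / 2) x)); auto. }
     rewrite (rsum_ext _ (fun h => RInt (fun x => A x * Ps y0 al (INR n1 + INR h + INR len - 1 / 2) (phi - PI / 2) x - A x * Ps y0 al (INR n1 + INR h - 1 / 2) (phi - PI / 2) x) p q)).
     2: { intros h _. symmetry. apply (RInt_subR (fun x => A x * Ps y0 al (INR n1 + INR h + INR len - 1 / 2) (phi - PI / 2) x) (fun x => A x * Ps y0 al (INR n1 + INR h - 1 / 2) (phi - PI / 2) x)); auto. }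
     rewrite <- E2, <- (RInt_mulR (/ Hr) (fun x => rsum (fun h => A x * Ps y0 al (INR n1 + INR h + INR len - 1 / 2) (phi - PI / 2) x - A x * Ps y0 al (INR n1 + INR h - 1 / 2) (phi - PI / 2) x) H)) by auto.
     apply RInt_ext. intros x Hxx. rewrite Rmin_left, Rmax_right in Hxx by lra. specialize (Hs0 x ltac:(lra)). unfold Avg. f_equal. apply rsum_ext. intros h _.
     transitivity (A x * (2 * sin (PI * x) * rsum (fun i => cp (2 * PI * (INR n1 + INR h + INR i) * x + phi) (Z x)) len)).
     - rewrite (rsum_ext _ (fun i => cp (2 * PI * (INR n1 + INR h + INR i) * x + phi) (Z x))) by (intros; apply HZ). unfold A. field. auto.
     - rewrite kernel1, <- !HZ. ring. }
    rewrite EA, Rabs_mult, (Rabs_right (/ Hr)) by lra.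
    apply Rle_trans with (/ Hr * (Hr * (2 * (E U * (9 * U))))).
    * mul_l. le_by rsum_abs. unfold Hr at 1. rewrite <- rsum_const. apply rsum_le. intros h Hh.
     assert (0 <= INR h /\ INR h + 1 <= Hr). { split. bound. rewrite <- S_INR. bound. }
     pose proof (Am (INR n1 + INR h + INR len - 1 / 2) (phi - PI / 2) ltac:(lra)) as Q1. pose proof (Am (INR n1 + INR h - 1 / 2) (phi - PI / 2) ltac:(lra)) as Q2.
     apply Rabs_le_between in Q1. apply Rabs_le_between in Q2. apply Rabs_le. lra.
    * rewrite <- Rmult_assoc, Rinv_l, Rmult_1_l by lra.
     nra. }
 destruct (dyadic_ex 1 (De / 2) ltac:(lra) ltac:(lra)) as [J0 [HJ1 [HJ2 HJ3]]].
 destruct J0 as [|J]. bound.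
 assert (HJL : INR (S J) <= 3 * Lg). { assert (ln (De / 2) <= ln M) by bound. bound. } rewrite S_INR in HJL.
 rewrite (dyadic_split Avg J cAvg). le_by Rabs_triang.
 set (Uc := 2 ^ S J) in *.
 (* Around [0] no kernel is used: each of the at most [2 De <= 4 Uc] terms is bounded by [2 E Uc],
    one key bound for each side. *)
 assert (Rabs (RInt Avg (- / Uc) (/ Uc)) <= Cd * W).
 { assert (HUr : Hr / sR <= Uc <= De). { split; [|lra]. trans_r Hr. bound. }
  assert (0 < / Uc) by bound.
  rewrite EqI, Rabs_mult, (Rabs_right (/ Hr)) by lra.
  apply Rle_trans with (/ Hr * (Hr * (4 * Uc * (2 * E Uc)))).
  - mul_l. le_by rsum_abs. unfold Hr at 1. rewrite <- rsum_const. apply rsum_le. intros h Hh.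
   assert (0 <= INR h /\ INR h + 1 <= Hr). { split. bound. rewrite <- S_INR. bound. }
   le_by rsum_abs. apply Rle_trans with (INR len * (2 * E Uc)).
   + rewrite <- rsum_const. apply rsum_le. intros i Hi. assert (0 <= INR i /\ INR i + 1 <= INR len). { split. bound. rewrite <- S_INR. bound. }
    rewrite (RInt_split _ (- / Uc) 0 (/ Uc)) by (try lra; intros; apply cPs).
    pose proof (KeyU Uc (INR n1 + INR h + INR i) phi (- / Uc) 0 HUr ltac:(lra) ltac:(lra) ltac:(lra)) as Q1. pose proof (KeyU Uc (INR n1 + INR h + INR i) phi 0 (/ Uc) HUr ltac:(lra) ltac:(lra) ltac:(lra)) as Q2.
    le_by Rabs_triang. lra.
   + apply Rmult_le_compat_r; [|lra]. unfold E. apply Rmult_le_pos. lra. apply Rmult_le_pos. bound. apply Rplus_le_le_0_compat; [left; apply Rinv_0_lt_compat, Rmult_lt_0_compat; lra|lra].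
  - rewrite <- Rmult_assoc, Rinv_l, Rmult_1_l by lra.
   assert (Uc * E Uc <= Ck * W). { lhs (Ck * (L3 * (/ sR + Uc * T3))).
    bound. }
   nra. }
 assert (Rabs (rsum (fun j => RInt Avg (- / 2 ^ S j) (- / 2 ^ S (S j)) + RInt Avg (/ 2 ^ S (S j)) (/ 2 ^ S j)) J) <= INR J * (2 * (Cd * W))).
 { le_by rsum_abs. rewrite <- rsum_const. apply rsum_le. intros j Hj.
  set (U := 2 ^ S j). assert (HU2 : 2 <= U). { unfold U. simpl. bound. }
  assert (HUD : U <= De). { trans_r Uc. apply Rle_pow. lra. lia. }
  assert (E2 : / 2 ^ S (S j) = / (2 * U)) by (unfold U; simpl; reflexivity). rewrite E2.
  assert (/ (2 * U) = / 2 * / U) by bound. assert (0 < / U) by bound.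
  assert (/ U <= 1 / 2). { rhs (/ 2). bound. }
  le_by Rabs_triang.
  assert (Q1 : Rabs (RInt Avg (- / U) (- / (2 * U))) <= Cd * W). { apply (Dy U); auto; try lra. intros x Hxx. rewrite Rabs_left by lra. lra. }
  assert (Q2 : Rabs (RInt Avg (/ (2 * U)) (/ U)) <= Cd * W). { apply (Dy U); auto; try lra. intros x Hxx. rewrite Rabs_right by lra. lra. }
  lra. }
 trans_l ((1 + 2 * INR J) * (Cd * W)).
 trans_l (7 * Lg * (Cd * W)).
 right. unfold W, L3, T3, sR, Lg, Rdiv. ring.
Qed.

Lemma rsum_shift (b : nat -> R) m len : rsum (fun i => b (m + i)%nat) len - rsum (fun i => b (S m + i)%nat) len = b m - b (m + len)%nat.
Proof.
 induction len as [|l IH]; cbn [rsum]. replace (m + 0)%nat with m by lia. ring.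
 replace (S m + l)%nat with (m + S l)%nat by lia. lra.
Qed.

(** Each unit shift drops one term and gains another, so [h] shifts change the sum by at most
    [2 h beta]. *)
Lemma edges (b : nat -> R) n1 len H beta : (1 <= H)%nat -> 0 <= beta ->
  (forall k, (n1 <= k)%nat -> (k < n1 + len + H)%nat -> Rabs (b k) <= beta) ->
  Rabs (rsum (fun i => b (n1 + i)%nat) len) <= Rabs (/ INR H * rsum (fun h => rsum (fun i => b (n1 + h + i)%nat) len) H) + 2 * INR H * beta.
Proof.
 intros HH Hbe Hb. assert (0 < INR H) by (apply lt_0_INR; lia). set (S0 := rsum (fun i => b (n1 + i)%nat) len).
 assert (D : forall h, (h < H)%nat -> Rabs (S0 - rsum (fun i => b (n1 + h + i)%nat) len) <= 2 * INR h * beta).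
 { induction h as [|h IH]; intros Hh.
  - replace (n1 + 0)%nat with n1 by lia. rewrite Rminus_diag, Rabs_R0. simpl. lra.
  - specialize (IH ltac:(lia)). pose proof (rsum_shift b (n1 + h) len) as E. replace (S (n1 + h)) with (n1 + S h)%nat in E by lia.
   pose proof (Hb (n1 + h)%nat ltac:(lia) ltac:(lia)). pose proof (Hb (n1 + h + len)%nat ltac:(lia) ltac:(lia)).
   replace (S0 - rsum (fun i => b (n1 + S h + i)%nat) len) with ((S0 - rsum (fun i => b (n1 + h + i)%nat) len) + (b (n1 + h)%nat - b (n1 + h + len)%nat)) by bound.
   le_by Rabs_triang. rewrite S_INR. assert (Rabs (b (n1 + h)%nat - b (n1 + h + len)%nat) <= 2 * beta). { le_by Rabs_triang. rewrite Rabs_Ropp. lra. } lra. }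
 replace S0 with (/ INR H * rsum (fun h => rsum (fun i => b (n1 + h + i)%nat) len) H + / INR H * rsum (fun h => S0 - rsum (fun i => b (n1 + h + i)%nat) len) H).
 2: { rewrite <- Rmult_plus_distr_l, <- rsum_add. rewrite (rsum_ext _ (fun _ => S0)) by (intros; ring). rewrite rsum_const. bound. }
 le_by Rabs_triang. apply Rplus_le_compat_l.
 rewrite Rabs_mult, (Rabs_right (/ INR H)) by (left; apply Rinv_0_lt_compat; auto).
 apply Rle_trans with (/ INR H * (INR H * (2 * INR H * beta))). 2: right; field; lra.
 mul_l. rewrite <- rsum_const. le_by rsum_abs. apply rsum_le. intros h Hh.
 eapply Rle_trans. apply D; auto. bound.
Qed.

(** Partial summation with the reciprocals of weights that are bounded below and vary slowly; it
    leads from [gbar * T] to [T]. *)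
Lemma abel_weights (a g : nat -> R) N E g0 de : 0 < g0 -> 0 <= E -> (forall i, (i <= N)%nat -> g0 <= g i) -> (forall i, (i < N)%nat -> Rabs (g i - g (S i)) <= de) ->
  (forall n, (n <= N)%nat -> Rabs (rsum (fun i => g i * a i) n) <= E) -> Rabs (rsum a N) <= E * (/ g0 + INR N * (de / g0 ^ 2)).
Proof.
 intros Hg0 HE Hg Hde HP. set (P := fun n => rsum (fun i => g i * a i) n).
 assert (Eq : forall n, (n <= N)%nat -> rsum a n = P n * / g n + rsum (fun i => P (S i) * (/ g i - / g (S i))) n).
 { induction n as [|n IH]; intros Hn. unfold P. simpl. ring.
  cbn [rsum]. rewrite IH by lia. unfold P. cbn [rsum]. pose proof (Hg n ltac:(lia)). pose proof (Hg (S n) ltac:(lia)). bound. }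
 rewrite Eq by lia. le_by Rabs_triang. rewrite Rmult_plus_distr_l.
 assert (Hig : forall i, (i <= N)%nat -> 0 < / g i <= / g0). { intros i Hi. specialize (Hg i Hi). bound. }
 apply Rplus_le_compat.
 - rewrite Rabs_mult. destruct (Hig N ltac:(lia)). rewrite (Rabs_right (/ g N)) by lra. apply Rmult_le_compat; try lra. bound. apply HP; lia.
 - le_by rsum_abs. rewrite (Rmult_comm E), Rmult_assoc. rewrite <- rsum_const. apply rsum_le. intros i Hi.
  rewrite Rabs_mult, Rmult_comm. pose proof (Hg i ltac:(lia)). pose proof (Hg (S i) ltac:(lia)).
  apply Rmult_le_compat; try apply Rabs_pos. 2: apply HP; lia.
  replace (/ g i - / g (S i)) with (- (g i - g (S i)) * (/ g i * / g (S i))) by bound.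
  destruct (Hig i ltac:(lia)). destruct (Hig (S i) ltac:(lia)).
  rewrite !Rabs_mult, Rabs_Ropp, (Rabs_right (/ g i)), (Rabs_right (/ g (S i))) by lra. unfold Rdiv. replace (/ g0 ^ 2) with (/ g0 * / g0) by bound.
  apply Rmult_le_compat. bound. bound. auto. bound.
Qed.

(** The classical estimate: boundedness of [psi] and the Dirichlet kernel alone give a logarithm
    here, hence [sqrt M] up to a logarithm for the sums of [t n]. *)
Lemma core0 c0 : 0 < c0 -> exists C, 1 <= C /\ forall M (len n1 : nat) al phi, 4 <= M -> M + 1 <= INR n1 -> INR n1 + INR len <= 4 * M ->
  Rabs (rsum (fun i => bn (c0 / M) al phi (n1 + i)) len) <= C * (1 + ln M).
Proof.
 intros Hc0. destruct (Ps_bound) as [B [HB HPB]]. exists (1 + 84 * B). split. lra.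
 intros M len n1 al phi HM Hn1 Hn2. assert (0 <= ln M) by bound.
 set (y0 := c0 / M). assert (Hy0 : 0 < y0) by bound.
 set (Blk := fun x => rsum (fun i => Ps y0 al (INR n1 + INR i) phi x) len).
 assert (cPs : forall m ph x, continuous (Ps y0 al m ph) x) by (intros; apply (Ps_cont); auto).
 assert (cB : forall x, continuous Blk x) by (intros x; unfold Blk; apply rsum_cont; intros i _; apply cPs).
 assert (forall m ph a b, ex_RInt (Ps y0 al m ph) a b) by (intros; apply (ex_RInt_continuous (V := RV)); intros; apply cPs).
 assert (EqI : forall a b, RInt Blk a b = rsum (fun i => RInt (Ps y0 al (INR n1 + INR i) phi) a b) len).
 { intros a b. apply (rsum_RInt (fun i => Ps y0 al (INR n1 + INR i) phi)). auto. }
 assert (Eb : forall n, (1 <= n)%nat -> bn y0 al phi n = RInt (Ps y0 al (INR n) phi) (- (1 / 2)) (1 / 2)).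
 { intros n Hn. destruct n as [|k]. lia. unfold bn. rewrite !INR_IZR_INZ. rewrite <- (extract y0 k phi al Hy0). reflexivity. }
 assert ((1 <= n1)%nat). { apply INR_le. change (INR 1) with 1. lra. }
 replace (rsum (fun i => bn y0 al phi (n1 + i)) len) with (RInt Blk (- (1 / 2)) (1 / 2)).
 2: { rewrite EqI. apply rsum_ext. intros i _. rewrite Eb by lia. rewrite !plus_INR. bound. }
 destruct (Ps_cp y0 al Hy0) as [Z HZ].
 assert (Dy : forall U p q, 2 <= U -> p <= q -> q - p <= / U -> (forall x, p <= x <= q -> / (2 * U) <= Rabs x <= 1 / 2) -> Rabs (RInt Blk p q) <= 2 * B).
 { intros U p q HU2 Hpq Hqp Hx.
  assert (0 < / (2 * U)) by bound.
  apply Rle_trans with ((q - p) * (2 * B * U)).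
  - apply abs_RInt_le_const; auto. apply ex_RInt_cont; auto. intros x Hxx. destruct (Hx x Hxx) as [Hx1 Hx2]. pose proof (sin_abs_lower x Hx2) as Hsin.
   assert (sin (PI * x) <> 0). { intros E0. rewrite E0, Rabs_R0 in Hsin. lra. }
   assert (Rabs (/ sin (PI * x)) <= 2 * U). { rewrite Rabs_inv. rewrite <- (Rinv_inv (2 * U)). bound. }
   assert (E4 : Blk x = / sin (PI * x) * / 2 * (2 * sin (PI * x) * rsum (fun i => cp (2 * PI * (INR n1 + INR i) * x + phi) (Z x)) len)).
   { unfold Blk. rewrite (rsum_ext _ (fun i => cp (2 * PI * (INR n1 + INR i) * x + phi) (Z x))) by (intros; apply HZ). bound. }
   rewrite E4, kernel1, <- !HZ, !Rabs_mult, (Rabs_right (/ 2)) by lra.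
   assert (Rabs (Ps y0 al (INR n1 + INR len - 1 / 2) (phi - PI / 2) x - Ps y0 al (INR n1 - 1 / 2) (phi - PI / 2) x) <= 2 * B).
   { le_by Rabs_triang. rewrite Rabs_Ropp. pose proof (HPB y0 al (INR n1 + INR len - 1 / 2) (phi - PI / 2) x Hy0). pose proof (HPB y0 al (INR n1 - 1 / 2) (phi - PI / 2) x Hy0). lra. }
   apply Rle_trans with (2 * U * / 2 * (2 * B)). 2: right; field.
   apply Rmult_le_compat; auto; try apply Rabs_pos. bound. apply Rmult_le_compat_r; lra.
  - trans_l (/ U * (2 * B * U)). bound. }
 destruct (dyadic_ex 1 (M / 2) ltac:(lra) ltac:(lra)) as [J0 [HJ1 [HJ2 HJ3]]].
 destruct J0 as [|J]. bound.
 assert (HJL : INR (S J) <= 3 * (1 + ln M)). { assert (ln (M / 2) <= ln M) by bound. lra. } rewrite S_INR in HJL.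
 rewrite (dyadic_split Blk J cB). le_by Rabs_triang.
 set (Uc := 2 ^ S J) in *. assert (0 < / Uc) by bound.
 assert (Rabs (RInt Blk (- / Uc) (/ Uc)) <= 12 * B).
 { rewrite EqI. le_by rsum_abs. apply Rle_trans with (INR len * (2 * / Uc * B)).
  - rewrite <- rsum_const. apply rsum_le. intros i _. eapply Rle_trans. apply (abs_RInt_le_const _ (- / Uc) (/ Uc) B); auto. lra. right. ring.
  - apply Rle_trans with (3 * M * (2 * / (M / 2) * B)). 2: right; field; lra.
   bound. }
 assert (Rabs (rsum (fun j => RInt Blk (- / 2 ^ S j) (- / 2 ^ S (S j)) + RInt Blk (/ 2 ^ S (S j)) (/ 2 ^ S j)) J) <= INR J * (4 * B)).
 { le_by rsum_abs. rewrite <- rsum_const. apply rsum_le. intros j Hj.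
  set (U := 2 ^ S j). assert (HU2 : 2 <= U). { unfold U. simpl. bound. }
  assert (E2 : / 2 ^ S (S j) = / (2 * U)) by (unfold U; simpl; reflexivity). rewrite E2.
  assert (/ (2 * U) = / 2 * / U) by bound. assert (0 < / U) by bound.
  assert (/ U <= 1 / 2). { rhs (/ 2). bound. }
  le_by Rabs_triang.
  assert (Rabs (RInt Blk (- / U) (- / (2 * U))) <= 2 * B). { apply (Dy U); auto; try lra. intros x Hxx. rewrite Rabs_left by lra. lra. }
  assert (Rabs (RInt Blk (/ (2 * U)) (/ U)) <= 2 * B). { apply (Dy U); auto; try lra. intros x Hxx. rewrite Rabs_right by lra. lra. }
  lra. }
 nra.
Qed.

Definition an (al phi : R) (n : nat) : R := T (Z.of_nat n) (2 * PI * (INR n * al) - phi).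

Lemma remove_gbar : exists c0 Cg, 0 < c0 /\ 1 <= Cg /\
  (forall M n, 1 <= M -> M <= INR n <= 4 * M -> Rabs (gbar (c0 / M) (Z.of_nat n)) <= Cg / sqrt M) /\
  (forall M (len n1 : nat) al phi E, 1 <= M -> 0 <= E -> M <= INR n1 -> INR n1 + INR len <= 4 * M ->
    (forall n, (n <= len)%nat -> Rabs (rsum (fun i => bn (c0 / M) al phi (n1 + i)) n) <= E) ->
    Rabs (rsum (fun i => an al phi (n1 + i)) len) <= Cg * E * sqrt M).
Proof.
 destruct (gbar_facts) as [c0 [Cg [Hc0 [HCg H]]]].
 exists c0, (Cg + 3 * Cg ^ 3). assert (1 <= Cg ^ 3) by bound. split; auto. split. lra. split.
 - intros M n HM Hn. destruct (H M HM) as [H1 _]. specialize (H1 (Z.of_nat n) ltac:(rewrite <- INR_IZR_INZ; auto)).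
  assert (0 < / (Cg * sqrt M)) by bound.
  rewrite Rabs_right by lra. le_by H1. mul_r. lra.
 - intros M len n1 al phi E HM HE Hn1 Hn2 HP. destruct (H M HM) as [H1 H2].
  assert (0 < sqrt M) by bound.
  assert (Hn : forall i, (i <= len)%nat -> M <= IZR (Z.of_nat (n1 + i)) <= 4 * M).
  { intros i Hi. rewrite <- INR_IZR_INZ, plus_INR. apply le_INR in Hi. pose proof (pos_INR i). lra. }
  eapply Rle_trans. apply (abel_weights (fun i => an al phi (n1 + i)) (fun i => gbar (c0 / M) (Z.of_nat (n1 + i))) len E (/ (Cg * sqrt M)) (Cg / (M * sqrt M))); auto.
  + apply Rinv_0_lt_compat, Rmult_lt_0_compat; lra.
  + intros i Hi. apply H1. apply Hn; auto.
  + intros i Hi. replace (Z.of_nat (n1 + S i)) with (Z.of_nat (n1 + i) + 1)%Z by lia. apply H2. apply Hn; lia. specialize (Hn (S i) ltac:(lia)). replace (Z.of_nat (n1 + S i)) with (Z.of_nat (n1 + i) + 1)%Z in Hn by lia. rewrite plus_IZR in Hn. lra.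
  + rewrite Rinv_inv. assert (INR len <= 3 * M) by lra.
   apply Rle_trans with (E * (Cg * sqrt M + 3 * M * (Cg / (M * sqrt M) / (/ (Cg * sqrt M)) ^ 2))).
   * mul_l. apply Rplus_le_compat_l. apply Rmult_le_compat_r; auto. apply Rdiv_le_0_compat. bound. apply pow_lt. apply Rinv_0_lt_compat, Rmult_lt_0_compat; lra.
   * bound.
Qed.

(** The first bound is the classical one. In the second, [H * tau] is the price of the overlapping
    ends, and [De / M^(1/4)] comes from the isolated stationary frequencies. *)
Lemma block_sums : exists C, 1 <= C /\
  (forall M (len n1 : nat) al phi, 4 <= M -> M + 1 <= INR n1 -> INR n1 + INR len <= 4 * M ->
    Rabs (rsum (fun i => an al phi (n1 + i)) len) <= C * (1 + ln M) * sqrt M) /\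
  (forall M R0 A1 De (H len n1 : nat) Th tau al phi,
  1 <= M -> 1 <= R0 -> 0 <= A1 -> (1 <= H)%nat -> C * R0 * sqrt R0 <= INR H -> 2 * INR H <= De -> De <= M -> 4 <= De -> INR len <= 2 * De ->
  M + 1 <= INR n1 -> INR n1 + INR len + INR H <= 4 * M ->
  (forall U, INR H / sqrt R0 <= U <= De -> 1 <= Th U /\ C * U * R0 ^ 4 * Th U ^ 4 <= M /\ forall n, (1 <= n)%Z -> IZR n <= C * R0 * M / U -> Cmod (t n) <= Th U) ->
  (forall n, (1 <= n)%Z -> Cmod (t n) <= A1 * sqrt (sqrt (IZR n))) -> 0 <= tau ->
  (forall n : nat, (n1 <= n)%nat -> INR n <= 4 * M -> Cmod (t (Z.of_nat n)) <= tau) ->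
  Rabs (rsum (fun i => an al phi (n1 + i)) len) <= C * ((1 + A1) * (1 + ln M) ^ 4 * (sqrt M / sqrt R0 + De / sqrt (sqrt M)) + INR H * tau)).
Proof.
 destruct remove_gbar as [c0 [Cg [Hc0 [HCg [HG HR]]]]].
 destruct (core0 c0 Hc0) as [C0 [HC0 H0]]. destruct (core c0 Hc0) as [C1 [HC1 H1]].
 set (CC := C1 + Cg * C0 + Cg * C1 + 2 * Cg * Cg).
 assert (HCC : C1 <= CC /\ Cg * C0 <= CC /\ Cg * C1 <= CC /\ 2 * Cg * Cg <= CC).
 { assert (0 <= Cg * C0) by bound. assert (0 <= Cg * C1) by bound. assert (0 <= Cg * Cg) by bound. bound. }
 exists CC. split. lra. split.
 - intros M len n1 al phi HM Hn1 Hn2. assert (Hl0 : 0 <= ln M) by bound.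
  eapply Rle_trans. apply (HR M len n1 al phi (C0 * (1 + ln M))); try lra. bound.
  intros n Hn. apply H0; try lra. apply le_INR in Hn. lra.
  rewrite <- !Rmult_assoc. mul_r. apply Rmult_le_compat_r; lra.
 - intros M R0 A1 De H len n1 Th tau al phi HM HR0 HA1 HH HHR HHD HDM HD4 Hlen Hn1 Hn2 HTh H4 Htau Ht2.
  assert (1 <= sqrt R0) by bound.
  set (G := (1 + A1) * (1 + ln M) ^ 4).
  set (E := C1 * (1 + A1) * (1 + ln M) ^ 4 * (/ sqrt R0 + De / (sqrt M * sqrt (sqrt M))) + 2 * INR H * (Cg / sqrt M * tau)).
  assert (0 <= Cg / sqrt M * tau) by bound.
  assert (0 <= INR H) by bound.
  assert (0 <= E) by bound.
  eapply Rle_trans. apply (HR M len n1 al phi E); try lra.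
  + intros n Hn. apply le_INR in Hn. eapply Rle_trans. apply (edges (bn (c0 / M) al phi) n1 n H (Cg / sqrt M * tau)); auto.
   * intros k Hk1 Hk2. apply le_INR in Hk1 as Hk1'. apply lt_INR in Hk2. rewrite !plus_INR in Hk2.
    unfold bn. rewrite Rabs_mult. apply Rmult_le_compat; try apply Rabs_pos. apply HG; lra. le_by T_le. apply Ht2; auto; lra.
   * unfold E. apply Rplus_le_compat_r. apply (H1 M R0 A1 De H n n1 Th al phi); auto; try lra.
    -- eapply Rle_trans; [|apply HHR]. mul_r. apply Rmult_le_compat_r; lra.
    -- intros U HU. destruct (HTh U HU) as [T1 [T2 T3]]. assert (0 < U). { destruct HU as [HU _]. eapply Rlt_le_trans; [|apply HU]. apply Rdiv_lt_0_compat. apply lt_0_INR; lia. lra. }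
      split; auto. split.
      ++ eapply Rle_trans; [|apply T2]. rewrite !Rmult_assoc. apply Rmult_le_compat_r. 2: lra. apply Rmult_le_pos. lra. apply Rmult_le_pos; apply pow_le; lra.
      ++ intros m Hm Hm'. apply T3; auto. eapply Rle_trans. apply Hm'. mul_r. mul_r. apply Rmult_le_compat_r; lra.
  + unfold E. replace (Cg * (C1 * (1 + A1) * (1 + ln M) ^ 4 * (/ sqrt R0 + De / (sqrt M * sqrt (sqrt M))) + 2 * INR H * (Cg / sqrt M * tau)) * sqrt M)
    with (Cg * C1 * (G * (sqrt M / sqrt R0 + De / sqrt (sqrt M))) + 2 * Cg * Cg * (INR H * tau)).
   2: { bound. }
   rewrite (Rmult_plus_distr_l CC). bound.
Qed.

(** * Choice of the parameters *)

Lemma Rpower_large delta x : 0 < delta -> exists M0, 1 <= M0 /\ forall M, M0 <= M -> x <= Rpower M delta.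
Proof.
 intros Hd. exists (exp (Rmax 0 (x / delta))). assert (1 <= exp (Rmax 0 (x / delta))). { rewrite <- exp_0 at 1. apply exp_le. bound. }
 split; auto. intros M HM. assert (Hl : Rmax 0 (x / delta) <= ln M). { rewrite <- (ln_exp (Rmax 0 (x / delta))). bound. }
 apply Rle_trans with (1 + delta * ln M); [|apply exp_ineq1_le].
 assert (x <= delta * ln M). { lhs (delta * (x / delta)). mul_l. eapply Rle_trans; [apply Rmax_r|apply Hl]. } lra.
Qed.

Lemma log_pow_le eps M : 0 < eps -> 1 <= M -> (1 + ln M) ^ 4 <= (1 + 4 / eps) ^ 4 * Rpower M eps.
Proof.
 intros He HM. assert (0 <= ln M) by bound.
 replace (Rpower M eps) with (Rpower M (eps / 4) ^ 4). 2: { rewrite <- Rpower_pow by apply exp_pos. rewrite Rpower_mult. f_equal. simpl. field. }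
 rewrite <- Rpow_mult_distr. apply pow_incr. split. lra.
 assert (1 <= Rpower M (eps / 4)). { rewrite <- (Rpower_O M) by lra. apply Rle_Rpower; lra. }
 assert (ln M <= 4 / eps * Rpower M (eps / 4)).
 { replace (ln M) with (4 / eps * (eps / 4 * ln M)) at 1 by bound. mul_l. unfold Rpower. pose proof (exp_ineq1_le (eps / 4 * ln M)). lra. }
 lra.
Qed.

(* The admissibility of the parameters reduces to [31 + 35 th - 12 th^2 + 44 e - 12 th e <= (79 / 80) (32 + 48 th)]. *)
Lemma exponent_check th e la de r u : 0 <= th -> th < 1 / 6 -> 0 < e -> e <= 1 / 100 -> 0 <= la ->
  r <= 2 * ((1 - 6 * th) / (32 + 48 * th)) * la -> r <= (3 / 2 - 2 * (3 * th / (32 + 48 * th))) * la - 2 * de -> u <= de ->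
  u + 4 * r + 4 * (th + e) * (r + la - u) <= 79 / 80 * la.
Proof.
 intros H0 H1 He He2 Hla Hr1 Hr2 Hu. set (D := 32 + 48 * th) in *. assert (32 <= D) by bound.
 (* Weights for the two upper bounds on [r]: [l2] is such that the term in [u <= de] cancels against
    [- 2 de], and [l1 + l2] is the total coefficient of [r]. *)
 set (l2 := (1 - 4 * (th + e)) / 2). set (l1 := 4 + 4 * (th + e) - l2).
 assert (0 <= l1) by (unfold l1, l2; lra).
 assert (l2 * r <= l2 * ((3 / 2 - 2 * (3 * th / D)) * la - 2 * de)) by bound.
 assert (2 * l2 * u <= 2 * l2 * de) by bound.
 assert (u + 4 * r + 4 * (th + e) * (r + la - u) = 2 * l2 * u + l1 * r + l2 * r + 4 * (th + e) * la) by (unfold l1, l2; field).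
 apply Rle_trans with ((l1 * (2 * ((1 - 6 * th) / D)) + l2 * (3 / 2 - 2 * (3 * th / D)) + 4 * (th + e)) * la). nra.
 mul_r. apply Rmult_le_reg_r with D. lra.
 lhs (l1 * (2 * (1 - 6 * th)) + l2 * (3 / 2 * D - 6 * th) + 4 * (th + e) * D).
 unfold l1, l2, D. nra.
Qed.

Lemma cp_plus phi (z w : C) : cp phi (z + w)%C = cp phi z + cp phi w.
Proof. destruct z, w. unfold cp. simpl. ring. Qed.

(** Rounds the real interval to integer indices, both ends included. The indices are chosen before
    [phi], since the modulus is recovered from all components of one and the same sum. *)
Lemma sum_between_le M De al X : 1 <= M -> 1 <= De -> exists n1 len : nat, M <= INR n1 < M + 1 /\ INR len <= De + 1 /\ INR n1 + INR len <= M + De + 1 /\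
  ((forall phi, Rabs (rsum (fun i => an al phi (n1 + i)) len) <= X) -> Cmod (sum_between M (M + De) (fun n => (t n * e (IZR n * al))%C)) <= 2 * X).
Proof.
 intros HM HD. destruct (Zceil_bound M) as [C1 C2]. destruct (Zfloor_bound (M + De)) as [F1 F2].
 set (z1 := Zceil M) in *. set (z2 := Zfloor (M + De)) in *.
 assert ((1 <= z1)%Z) by (apply le_IZR; lra). assert ((z1 <= z2)%Z). { assert (z1 < z2 + 1)%Z; [|lia]. apply lt_IZR. rewrite plus_IZR. lra. }
 exists (Z.to_nat z1), (S (Z.to_nat (z2 - z1))).
 assert (INR (Z.to_nat z1) = IZR z1) by (rewrite INR_IZR_INZ, Z2Nat.id by lia; auto).
 assert (INR (S (Z.to_nat (z2 - z1))) = IZR z2 - IZR z1 + 1) by (rewrite S_INR, INR_IZR_INZ, Z2Nat.id, minus_IZR by lia; ring).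
 split. lra. split. lra. split. lra.
 intros HX. apply cp_Cmod. intros phi. unfold sum_between. fold z1 z2.
 replace (Z.to_nat z2) with (Z.to_nat z1 + Z.to_nat (z2 - z1))%nat by lia.
 assert (Hs : forall n l, cp phi (sum_n_m (G := C_AbelianMonoid) (fun n => (t (Z.of_nat n) * e (IZR (Z.of_nat n) * al))%C) n (n + l)) = rsum (fun i => an al phi (n + i)) (S l)).
 { assert (Tm : forall n, cp phi (t (Z.of_nat n) * e (IZR (Z.of_nat n) * al))%C = an al phi n).
  { intros n. unfold an, T, cp, e. rewrite INR_IZR_INZ, cos_minus, sin_minus. destruct (t (Z.of_nat n)) as [a b]. simpl. ring. }
  intros n l. induction l as [|l IH].
  - rewrite Nat.add_0_r, sum_n_n, Tm. cbn [rsum]. rewrite Nat.add_0_r. ring.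
  - rewrite Nat.add_succ_r, sum_n_Sm by lia.
   rewrite cp_plus, IH, Tm. change (rsum (fun i => an al phi (n + i)) (S (S l))) with (rsum (fun i => an al phi (n + i)) (S l) + an al phi (n + S l)). rewrite Nat.add_succ_r. bound. }
 rewrite Hs. apply HX.
Qed.

Lemma trivial_bound : exists C, 1 <= C /\ forall M De al, 1 <= M -> 1 <= De <= M ->
  Cmod (sum_between M (M + De) (fun n => (t n * e (IZR n * al))%C)) <= C * (sqrt M * (1 + ln M)).
Proof.
 destruct (block_sums) as [Cb [HCb [Hb _]]].
 destruct (finite_max (fun n => Cmod (t (Z.of_nat n))) 20) as [D [HD0 HD]].
 exists (2 * Cb + 40 * D). split. lra. intros M De al HM HDe.
 assert (0 <= ln M) by bound.
 assert (1 <= sqrt M * (1 + ln M)) by bound.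
 destruct (sum_between_le M De al ((Cb + 20 * D) * (sqrt M * (1 + ln M))) HM ltac:(lra)) as [n1 [len [H1 [H2 [H3 H4]]]]].
 rhs (2 * ((Cb + 20 * D) * (sqrt M * (1 + ln M)))). apply H4. intros phi.
 destruct (Rle_dec 6 M) as [H6|H6].
 (* The block parameter [2/3 M] leaves room for a start above [2/3 M + 1] and for indices up to
    [2 M + 1]. *)
 - eapply Rle_trans. apply (Hb (2 / 3 * M) len n1 al phi); lra.
  apply Rle_trans with (Cb * (sqrt M * (1 + ln M))). rewrite Rmult_assoc. mul_l. rewrite (Rmult_comm (sqrt M)). bound.
  apply Rmult_le_compat_r; lra.
 - le_by rsum_abs. apply Rle_trans with (INR len * D).
  + rewrite <- rsum_const. apply rsum_le. intros i Hi. le_by T_le. apply (HD (n1 + i)%nat).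
   apply INR_lt. rewrite plus_INR. apply lt_INR in Hi. change (INR 20) with (IZR (Z.of_nat 20)) || rewrite (INR_IZR_INZ 20). simpl IZR. lra.
  + nra.
Qed.

(** Three costs are balanced: [sqrt (M / R0)] from the key bound, [De M^(-1/4)] from isolated
    stationary frequencies and [H M^theta] from the ends. With [T] for the first exponent of the
    claim and [s = 1/2 - T], the first cost calls for [R0] up to [M^(2 s)], the last one for [H]
    about [M^(T - theta)]. *)
Lemma main_bound theta : 0 <= theta -> admissible_exponent t theta -> forall eps c1 c2 : R, 0 < eps -> 0 < c1 -> 0 < c2 ->
   exists A : R, forall M Delta alpha : R,
     1 <= M -> 1 <= Delta <= M ->
     c1 * Rpower M (2 / 3) <= Delta <= c2 * Rpower M (3 / 4) ->
     Cmod (sum_between M (M + Delta) (fun n => (t n * e (IZR n * alpha))%C))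
     <= A * (Rpower M (3 / 8 + (3 + 12 * theta) / (32 + 48 * theta) + eps)
             + Delta * Rpower M (- (1 / 4) + 3 * theta / (32 + 48 * theta) + eps)).
Proof.
 intros Hth Hadm eps c1 c2 Heps Hc1 Hc2.
 set (D := 32 + 48 * theta). assert (HD : 32 <= D) by bound.
 set (s := (1 - 6 * theta) / D). set (cc := 3 * theta / D). set (T := 3 / 8 + (3 + 12 * theta) / D).
 assert (HTs : T = 1 / 2 - s) by (unfold T, s, D; field; lra).
 assert (Hcc : 0 <= cc) by bound.
 destruct trivial_bound as [Ct [HCt Htriv]].
 set (Ce := (1 + 4 / eps) ^ 4).
 assert (Hlog1 : forall M, 1 <= M -> 1 + ln M <= Ce * Rpower M eps).
 { intros M HM. eapply Rle_trans; [|apply (log_pow_le eps M Heps HM)]. assert (0 <= ln M) by bound.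
  nra. }
 assert (Rp1 : forall M a, 1 <= M -> 0 <= a -> 1 <= Rpower M a). { intros M a HM Ha. rewrite <- (Rpower_O M) by lra. apply Rle_Rpower; lra. }
 assert (RpP : forall M a, 0 < Rpower M a) by bound.
 assert (Rsq : forall M, 1 <= M -> sqrt M = Rpower M (1 / 2)). { intros M HM. rewrite <- Rpower_sqrt by lra. f_equal. field. }
 set (F := fun M De => Rpower M (T + eps) + De * Rpower M (- (1 / 4) + cc + eps)).
 assert (HFe : forall M De, F M De = Rpower M eps * (Rpower M T + De * Rpower M (cc - 1 / 4))).
 { intros M De. unfold F. rewrite (Rpower_plus T eps), (Rpower_plus (- (1 / 4) + cc) eps). replace (- (1 / 4) + cc) with (cc - 1 / 4) by ring. ring. }
 (* the classical bound suffices when sqrt M is admissible *)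
 assert (CaseI : forall M De al, 1 <= M -> 1 <= De <= M -> sqrt M <= Rpower M T + De * Rpower M (cc - 1 / 4) ->
  Cmod (sum_between M (M + De) (fun n => (t n * e (IZR n * al))%C)) <= Ct * Ce * F M De).
 { intros M De al HM HDe Hs. eapply Rle_trans. apply Htriv; auto. rewrite HFe. rewrite Rmult_assoc. mul_l.
  rhs ((Rpower M T + De * Rpower M (cc - 1 / 4)) * (Ce * Rpower M eps)).
  assert (0 <= ln M) by bound.
  apply Rmult_le_compat; try lra. bound. apply Hlog1; auto. }
 (* For [theta >= 1/6] the exponent [T] is at least [1/2] and the classical bound is enough;
    otherwise [s > 0]. *)
 destruct (Rlt_dec theta (1 / 6)) as [H6|H6].
 2: { exists (Ct * Ce). intros M De al HM HDe _. apply CaseI; auto. rewrite Rsq by auto. apply Rle_trans with (Rpower M T).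
  apply Rle_Rpower; auto. assert (s <= 0) by bound. lra.
  assert (0 <= De * Rpower M (cc - 1 / 4)) by bound. lra. }
 assert (Hs0 : 0 < s) by bound.
 assert (Hs32 : s <= 1 / 32) by bound.
 destruct (block_sums) as [C [HC [_ Hb]]].
 set (e := Rmin (1 / 100) eps). assert (He : 0 < e <= 1 / 100 /\ e <= eps). { unfold e. split. split. bound. apply Rmin_l. apply Rmin_r. }
 destruct He as [He Hee]. set (th := theta + e).
 destruct (Hadm e ltac:(lra)) as [At0 HAt0]. set (At := 1 + Rabs At0). assert (HAt : 1 <= At) by (unfold At; pose proof (Rabs_pos At0); lra).
 assert (Htn : forall n, (1 <= n)%Z -> Cmod (t n) <= At * Rpower (IZR n) th).
 { intros n Hn. eapply Rle_trans. apply HAt0; auto. mul_r. unfold At. pose proof (Rle_abs At0). lra. }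
 assert (Hth14 : 0 <= th <= 1 / 4) by bound.
 set (P := T - theta). assert (HP : 1 / 5 <= P - 3 * s /\ P <= 1 / 2) by bound.
 destruct (Rpower_large (P - 3 * s) C ltac:(lra)) as [M1 [HM1 L1]].
 destruct (Rpower_large (1 / 6) (4 / c1) ltac:(lra)) as [M2 [HM2 L2]].
 destruct (Rpower_large (1 / 4) (4 * c2) ltac:(lra)) as [M3 [HM3 L3]].
 destruct (Rpower_large (1 / 80) (3 / 2 * (C ^ 2 * At ^ 4)) ltac:(lra)) as [M4 [HM4 L4]].
 (* Beyond [M0] small powers of [M] absorb the constants; smaller [M] fall to the classical
    bound. *)
 set (M0 := M1 + M2 + M3 + M4 + 10).
 set (A := Ct * Ce + Ct * (sqrt M0 * (1 + ln M0)) + 2 * C * (3 * (1 + At) * Ce + 6 * At)).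
 assert (PA1 : 0 <= Ct * Ce) by bound.
 assert (PA2 : 0 <= Ct * (sqrt M0 * (1 + ln M0))) by bound.
 assert (PA3 : 0 <= 2 * C * (3 * (1 + At) * Ce + 6 * At)) by bound.
 exists A. intros M De al HM HDe HcD. change (Cmod (sum_between M (M + De) (fun n => (t n * Defs.e (IZR n * al))%C)) <= A * F M De).
 assert (HF1 : 1 <= F M De).
 { unfold F. pose proof (Rp1 M (T + eps) HM ltac:(rewrite HTs; lra)). assert (0 <= De * Rpower M (- (1 / 4) + cc + eps)) by bound. lra. }
 destruct (Rle_dec (sqrt M) (Rpower M T + De * Rpower M (cc - 1 / 4))) as [HI|HI].
 { eapply Rle_trans. apply CaseI; auto. bound. }
 destruct (Rle_dec M M0) as [HMM|HMM].
 { eapply Rle_trans. apply Htriv; auto. apply Rle_trans with (A * 1). 2: apply Rmult_le_compat_l; [unfold A; lra|auto].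
  apply Rle_trans with (Ct * (sqrt M0 * (1 + ln M0))); [|unfold A; lra]. bound. }
 apply Rnot_le_lt in HI. apply Rnot_le_lt in HMM. unfold M0 in HMM.
 specialize (L1 M ltac:(lra)). specialize (L2 M ltac:(lra)). specialize (L3 M ltac:(lra)). specialize (L4 M ltac:(lra)).
 set (la := ln M) in *. assert (Hla : 0 <= la) by bound.
 set (de := ln De).
 (* Insufficiency of the classical bound limits [De], and this makes the second candidate for [R0]
    at least [1]. *)
 assert (HDc : De < Rpower M (3 / 4 - cc)).
 { apply Rmult_lt_reg_r with (Rpower M (cc - 1 / 4)). bound. rewrite <- Rpower_plus. replace (3 / 4 - cc + (cc - 1 / 4)) with (1 / 2) by field. rewrite <- Rsq by auto. pose proof (RpP M T). lra. }
 (* For either candidate [sqrt (M / R0)] equals one of the two terms of the claim, so no larger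
    saving is worth having. *)
 set (R0 := Rmin (Rpower M (2 * s)) (Rpower M (3 / 2 - 2 * cc) / De ^ 2)).
 assert (HD2 : 0 < De ^ 2) by bound.
 assert (HR01 : 1 <= R0).
 { apply Rmin_glb. apply Rp1; lra. apply Rmult_le_reg_r with (De ^ 2); auto.
  assert (Esq : Rpower M (3 / 2 - 2 * cc) = Rpower M (3 / 4 - cc) ^ 2). { replace (3 / 2 - 2 * cc) with ((3 / 4 - cc) + (3 / 4 - cc)) by field. rewrite Rpower_plus. ring. }
  rewrite Esq. rhs (Rpower M (3 / 4 - cc) ^ 2). nra. }
 assert (HR0a : R0 <= Rpower M (2 * s)) by apply Rmin_l. assert (HR0b : R0 <= Rpower M (3 / 2 - 2 * cc) / De ^ 2) by apply Rmin_r.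
 set (r := ln R0). assert (Er : R0 = exp r) by (unfold r; rewrite exp_ln; lra).
 assert (Hr1 : r <= 2 * s * la). { unfold r. replace (2 * s * la) with (ln (Rpower M (2 * s))) by (unfold Rpower; rewrite ln_exp; reflexivity). bound. }
 assert (Hr2 : r <= (3 / 2 - 2 * cc) * la - 2 * de).
 { unfold r. replace ((3 / 2 - 2 * cc) * la - 2 * de) with (ln (Rpower M (3 / 2 - 2 * cc) / De ^ 2)). bound.
  rewrite ln_div by (auto; apply RpP). unfold Rpower. rewrite ln_exp, ln_pow by lra. unfold de, la. simpl. ring. }
 destruct (nfloor_ex (Rpower M P)) as [H0 [HH1 HH2]]. bound.
 assert (HP1 : 1 <= Rpower M P) by (apply Rp1; lra).
 set (H := S H0). assert (HHa : Rpower M P <= INR H) by (unfold H; rewrite S_INR; lra). assert (INR H <= 2 * Rpower M P) by (unfold H; rewrite S_INR; lra).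
 assert (4 * Rpower M P <= De).
 { trans_r (c1 * Rpower M (2 / 3)). apply Rle_trans with (c1 * (Rpower M (1 / 2) * Rpower M (1 / 6))). 2: rewrite <- Rpower_plus; right; f_equal; f_equal; field.
  lhs (c1 * (Rpower M P * (4 / c1))). mul_l. apply Rmult_le_compat; auto. bound. bound. apply Rle_Rpower; lra. }
 assert (De <= M / 4).
 { trans_l (c2 * Rpower M (3 / 4)). replace M with (Rpower M (3 / 4) * Rpower M (1 / 4)) at 2. 2: { rewrite <- Rpower_plus. replace (3 / 4 + 1 / 4) with 1 by field. apply Rpower_1. lra. }
  rhs (Rpower M (1 / 4) / 4 * Rpower M (3 / 4)). bound. }
 set (Mk := 2 / 3 * M).
 destruct (sum_between_le M De al (C * (3 * (1 + At) * Ce + 6 * At) * F M De) HM ltac:(lra)) as [n1 [len [N1 [N2 [N3 N4]]]]].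
 apply Rle_trans with (2 * (C * (3 * (1 + At) * Ce + 6 * At) * F M De)).
 2: { lhs (2 * C * (3 * (1 + At) * Ce + 6 * At) * F M De). bound. }
 apply N4. intros phi.
 assert (1 <= sqrt R0) by bound.
 set (tau := 3 * At * Rpower M th).
 assert (0 <= tau) by bound.
 (* [Th U] is the assumed bound for [t n] at the end of the range of dual frequencies, a range that
    shrinks as [U] grows. *)
 eapply Rle_trans. apply (Hb Mk R0 At De H len n1 (fun U => At * Rpower (C * R0 * Mk / U) th) tau al phi); unfold Mk; auto; try lra.
 - unfold H; lia.
 - apply Rle_trans with (C * Rpower M (3 * s)).
  + rewrite Rmult_assoc. mul_l. replace (3 * s) with (2 * s + s) by ring. rewrite Rpower_plus. apply Rmult_le_compat; try lra.
   rhs (sqrt (Rpower M s * Rpower M s)). apply sqrt_le_1_alt. rewrite <- Rpower_plus. replace (s + s) with (2 * s) by ring. auto.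
  + eapply Rle_trans; [|apply HHa]. replace P with ((P - 3 * s) + 3 * s) by ring. rewrite Rpower_plus. apply Rmult_le_compat_r; auto. left; apply RpP.
 - intros U [HU1 HU2]. fold Mk.
  assert (0 < U). { eapply Rlt_le_trans; [|apply HU1]. bound. }
  set (x := R0 * M / U). set (b := C * R0 * Mk / U).
  assert (1 <= b).
  { unfold b. bound. }
  assert (Hx0 : 0 < x) by bound.
  assert (b <= C * x). { lhs (C * R0 / U * Mk). rhs (C * R0 / U * M). bound. }
  assert (1 <= Rpower b th) by (apply Rp1; lra).
  split; [|split].
  + rewrite <- (Rmult_1_r 1). apply Rmult_le_compat; lra.
  + assert (Rpower b th ^ 4 <= C * Rpower x (4 * th)).
   { rewrite <- Rpower_pow by apply RpP. rewrite Rpower_mult. replace (th * INR 4) with (4 * th) by (simpl; ring).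
    apply Rle_trans with (Rpower (C * x) (4 * th)). apply Rle_Rpower_l; lra. rewrite <- (Rpower_mult_distr C x); [|lra|exact Hx0].
    mul_r. rewrite <- (Rpower_1 C) at 2 by lra. apply Rle_Rpower; lra. }
   assert (U * R0 ^ 4 * Rpower x (4 * th) <= Rpower M (79 / 80)).
   { set (u := ln U). assert (Eu : U = exp u) by (unfold u; rewrite exp_ln; lra).
    assert (Elx : ln x = r + la - u). { unfold x. rewrite ln_div, ln_mult by (try lra; apply Rmult_lt_0_compat; lra). reflexivity. }
    replace (U * R0 ^ 4 * Rpower x (4 * th)) with (exp (u + 4 * r + 4 * th * (r + la - u))).
    - apply exp_le. fold la. apply (exponent_check theta e la de r u); auto; try lra. apply ln_le; lra.
    - rewrite !exp_plus. unfold Rpower at 1. rewrite Elx. rewrite <- Eu. f_equal. f_equal. rewrite Er. rewrite <- exp_pow_nat. f_equal. simpl; ring. }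
   lhs (C * At ^ 4 * (U * R0 ^ 4) * Rpower b th ^ 4).
   trans_l (C * At ^ 4 * (U * R0 ^ 4) * (C * Rpower x (4 * th))).
   lhs (C ^ 2 * At ^ 4 * (U * R0 ^ 4 * Rpower x (4 * th))).
   trans_l (C ^ 2 * At ^ 4 * Rpower M (79 / 80)).
   unfold Mk. replace M with (Rpower M (79 / 80) * Rpower M (1 / 80)) at 2. 2: { rewrite <- Rpower_plus. replace (79 / 80 + 1 / 80) with 1 by field. apply Rpower_1. lra. }
   pose proof (RpP M (79 / 80)). rhs (2 / 3 * Rpower M (1 / 80) * Rpower M (79 / 80)). apply Rmult_le_compat_r; lra.
  + intros n Hn Hnb. eapply Rle_trans. apply Htn; auto. mul_l. apply Rle_Rpower_l. lra. split; auto. apply IZR_lt; lia.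
 - intros n Hn. eapply Rle_trans. apply Htn; auto. mul_l. assert (1 <= IZR n) by bound.
  rewrite <- (Rpower_sqrt (IZR n)) by lra. rewrite <- (Rpower_sqrt (Rpower (IZR n) (/ 2))) by apply RpP. rewrite Rpower_mult. apply Rle_Rpower; lra.
 - intros n Hn Hn4. le_by Htn. { apply le_INR in Hn. apply le_IZR. rewrite <- INR_IZR_INZ. lra. }
  apply le_INR in Hn. rewrite <- INR_IZR_INZ. unfold tau. rewrite (Rmult_comm 3), Rmult_assoc. mul_l.
  apply Rle_trans with (Rpower (3 * M) th). apply Rle_Rpower_l; lra. rewrite <- Rpower_mult_distr by lra. mul_r. rewrite <- (Rpower_1 3) at 2 by lra. apply Rle_Rpower; lra.
 - fold Mk. assert (1 <= Mk <= M) by bound.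
  set (Y := Rpower M T + De * Rpower M (cc - 1 / 4)).
  assert (sqrt Mk / sqrt R0 <= Y).
  { trans_l (sqrt M / sqrt R0).
   rewrite Rsq by auto. unfold Y. pose proof (RpP M T). assert (0 < De * Rpower M (cc - 1 / 4)) by bound.
   unfold R0, Rmin. destruct Rle_dec as [Hle|Hle].
   - replace (sqrt (Rpower M (2 * s))) with (Rpower M s). 2: { replace (2 * s) with (s + s) by ring. rewrite Rpower_plus. bound. }
    replace (Rpower M (1 / 2)) with (Rpower M T * Rpower M s). 2: { rewrite <- Rpower_plus. f_equal. bound. }
    pose proof (RpP M s). unfold Rdiv. rewrite Rmult_assoc, Rinv_r by lra. lra.
   - replace (sqrt (Rpower M (3 / 2 - 2 * cc) / De ^ 2)) with (Rpower M (3 / 4 - cc) / De).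
    2: { replace (Rpower M (3 / 2 - 2 * cc) / De ^ 2) with ((Rpower M (3 / 4 - cc) / De) * (Rpower M (3 / 4 - cc) / De)). bound.
     replace (3 / 2 - 2 * cc) with ((3 / 4 - cc) + (3 / 4 - cc)) by field. rewrite Rpower_plus. bound. }
    replace (Rpower M (1 / 2)) with (Rpower M (cc - 1 / 4) * Rpower M (3 / 4 - cc)). 2: { rewrite <- Rpower_plus. f_equal. field. }
    lhs (De * Rpower M (cc - 1 / 4)). lra. }
  assert (De / sqrt (sqrt Mk) <= 2 * Y).
  { assert (Rpower M (1 / 4) / 2 <= sqrt (sqrt Mk)).
   { apply Rle_trans with (sqrt (sqrt (M / 16))). 2: apply sqrt_le_1_alt, sqrt_le_1_alt; unfold Mk; lra.
    right. rewrite sqrt_div by lra. replace 16 with (4 * 4) by ring. rewrite sqrt_square by lra. rewrite sqrt_div by (try lra; apply sqrt_pos). replace 4 with (2 * 2) at 2 by ring. rewrite sqrt_square by lra.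
    f_equal. rewrite <- (Rpower_sqrt M) by lra. rewrite <- (Rpower_sqrt (Rpower M (/ 2))) by apply RpP. rewrite Rpower_mult. f_equal. field. }
   trans_l (De / (Rpower M (1 / 4) / 2)).
   lhs (2 * (De * / Rpower M (1 / 4))). mul_l.
   rewrite <- Rpower_Ropp. unfold Y. pose proof (RpP M T). trans_r (De * Rpower M (cc - 1 / 4)). mul_l. apply Rle_Rpower; lra. }
  assert ((1 + ln Mk) ^ 4 <= Ce * Rpower M eps).
  { eapply Rle_trans; [|apply log_pow_le; auto]. bound. }
  assert (INR H * tau <= 6 * At * F M De).
  { trans_l (2 * Rpower M P * tau). lhs (6 * At * (Rpower M P * Rpower M th)). mul_l.
   rewrite <- Rpower_plus. apply Rle_trans with (Rpower M (T + eps)). apply Rle_Rpower; auto. unfold P, th. lra.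
   unfold F. assert (0 <= De * Rpower M (- (1 / 4) + cc + eps)) by bound. lra. }
  rewrite (Rmult_assoc C (3 * (1 + At) * Ce + 6 * At)). mul_l. rewrite (Rmult_plus_distr_r (3 * (1 + At) * Ce)). apply Rplus_le_compat; auto.
  rewrite HFe. fold Y. rhs ((1 + At) * (Ce * Rpower M eps) * (3 * Y)).
  bound.
Qed.

End MaassForm.

Theorem theorem8 (psi : C -> C) (kappa : R) (t : Z -> C)
  (Hpsi : maass_cusp_form psi kappa)
  (Hparity : even_form psi \/ odd_form psi)
  (Ht : has_fourier_expansion psi kappa t) :
  (forall theta : R, 0 <= theta -> admissible_exponent t theta ->
   forall eps c1 c2 : R, 0 < eps -> 0 < c1 -> 0 < c2 ->
   exists A : R, forall M Delta alpha : R,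
     1 <= M -> 1 <= Delta <= M ->
     c1 * Rpower M (2 / 3) <= Delta <= c2 * Rpower M (3 / 4) ->
     Cmod (sum_between M (M + Delta) (fun n => (t n * e (IZR n * alpha))%C))
     <= A * (Rpower M (3 / 8 + (3 + 12 * theta) / (32 + 48 * theta) + eps)
             + Delta * Rpower M (- (1 / 4) + 3 * theta / (32 + 48 * theta) + eps)))
  /\
  (admissible_exponent t (7 / 64) ->
   forall eps c1 c2 : R, 0 < eps -> 0 < c1 -> 0 < c2 ->
   exists A : R, forall M Delta alpha : R,
     1 <= M -> 1 <= Delta <= M ->
     c1 * Rpower M (2 / 3) <= Delta <= c2 * Rpower M (3 / 4) ->
     Cmod (sum_between M (M + Delta) (fun n => (t n * e (IZR n * alpha))%C))
     <= A * (Rpower M (585 / 1192 + eps)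
             + Delta * Rpower M (- (575 / 2384) + eps)))
  /\
  (admissible_exponent t 0 ->
   forall eps c1 c2 : R, 0 < eps -> 0 < c1 -> 0 < c2 ->
   exists A : R, forall M Delta alpha : R,
     1 <= M -> 1 <= Delta <= M ->
     c1 * Rpower M (2 / 3) <= Delta <= c2 * Rpower M (3 / 4) ->
     Cmod (sum_between M (M + Delta) (fun n => (t n * e (IZR n * alpha))%C))
     <= A * (Rpower M (15 / 32 + eps)
             + Delta * Rpower M (eps - 1 / 4))).
Proof.
 assert (Hcont : forall z : C, upper_half z -> continuous psi z) by (intros z Hz; apply (mcf_smooth _ _ Hpsi 0%nat); auto).
 pose proof (main_bound kappa psi t (mcf_invariant _ _ Hpsi) Ht Hcont) as Main.
 split; [|split].
 - intros theta Hth Hadm. apply Main; auto.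
 - intros Hadm eps c1 c2 He H1 H2. destruct (Main (7 / 64) ltac:(lra) Hadm eps c1 c2 He H1 H2) as [A HA]. exists A. intros M De al HM HD Hc.
  eapply Rle_trans. apply HA; auto. right. f_equal. f_equal; [|f_equal]; f_equal; field.
 - intros Hadm eps c1 c2 He H1 H2. destruct (Main 0 ltac:(lra) Hadm eps c1 c2 He H1 H2) as [A HA]. exists A. intros M De al HM HD Hc.
  eapply Rle_trans. apply HA; auto. right. f_equal. f_equal; [|f_equal]; f_equal; field.
Qed.
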